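(* Let $(f_m)_{m\in\mathbb{N}}$ be a sequence of functions $f_m\in S$ with Taylor expansions $f_m(z)=\sum_{n=1}^{\infty}a_n^{(m)}z^n$, and suppose that (i) $(f_m)$ converges locally uniformly in $\mathbb{D}$ to a function $f\in S$ of maximal growth (i.e. with Hayman index $\alpha(f)>0$) as $m\to\infty$, such that the function $z\mapsto f(z^{-1})^{-1}$, $z\in\Delta$, is a full mapping; (ii) $\alpha_m\to\alpha$ as $m\to\infty$, where $\alpha_m$ and $\alpha$ denote the Hayman indexes of $f_m$ and $f$ respectively. Then for every $\epsilon>0$ there exists a constant $N(\epsilon)$, depending only on $\epsilon$ (for the given sequence), such that \[ \left|\frac{|a_n^{(m)}|}{n}-\alpha_m\right|<\epsilon \] whenever $m,n>N(\epsilon)$.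
   Context: $\mathbb{D}$ is the open unit disk, $\Delta=\{z\in\mathbb{C}:|z|>1\}$, and $S$ is the class of schlicht functions $f(z)=z+\sum_{n\ge2}a_nz^n$ analytic and univalent in $\mathbb{D}$. For $f\in S$ let $M_\infty(r,f)=\max\{|f(z)|:|z|=r\}$; the Hayman index of $f$ is $\alpha(f)=\lim_{r\to1^-}(1-r)^2M_\infty(r,f)\in[0,1]$. A function $g:\Delta\to\mathbb{C}$ of the form $g(z)=z+\sum_{n=0}^\infty b_nz^{-n}$, analytic and univalent in $\Delta$, is called a full mapping if the complement $\mathbb{C}\setminus g(\Delta)$ has two-dimensional Lebesgue measure zero. *)

(* Defs.v *)
From mathcomp Require Import all_boot all_algebra.
From mathcomp Require Import all_classical all_reals all_analysis.
From mathcomp Require Export complex.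
Export Num.Theory GRing.Theory.
Import numFieldTopology.Exports numFieldNormedType.Exports.

Set Implicit Arguments.
Unset Strict Implicit.
Unset Printing Implicit Defensive.

Local Open Scope ring_scope.
Local Open Scope classical_set_scope.

Section Defs.
Variable R : realType.

Definition cabs (z : R[i]) : R := Normc.normc z.

Definition series_to (u : nat -> R[i]) (l : R[i]) : Prop :=
  forall e : R, 0 < e -> exists N : nat, forall n : nat, (N <= n)%N ->
    cabs (\sum_(k < n) u k - l) < e.

Definition schlicht_coeffs (f : R[i] -> R[i]) (a : nat -> R[i]) : Prop :=
  [/\ a 0%N = 0, a 1%N = 1,
      (forall z, cabs z < 1 -> series_to (fun n => a n * z ^+ n) (f z)) &
      (forall z w, cabs z < 1 -> cabs w < 1 -> f z = f w -> z = w)].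

Definition in_S (f : R[i] -> R[i]) : Prop := exists a, schlicht_coeffs f a.

Definition maxmod (f : R[i] -> R[i]) (r : R) : R :=
  sup [set cabs (f z) | z in [set z : R[i] | cabs z = r]].

Definition hayman_index (f : R[i] -> R[i]) (alpha : R) : Prop :=
  (fun r : R => (1 - r) ^+ 2 * maxmod f r) x @[x --> 1^'-] --> alpha.

Definition loc_unif_cvg (fm : nat -> R[i] -> R[i]) (f : R[i] -> R[i]) : Prop :=
  forall r : R, 0 < r < 1 -> forall e : R, 0 < e ->
    exists N : nat, forall m : nat, (N <= m)%N ->
      forall z : R[i], cabs z <= r -> cabs (fm m z - f z) < e.

Definition full_mapping (g : R[i] -> R[i]) : Prop :=
  [/\ (exists b : nat -> R[i], forall z, 1 < cabs z ->
          series_to (fun n => b n * z ^- n) (g z - z)),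
      (forall z w, 1 < cabs z -> 1 < cabs w -> g z = g w -> z = w) &
      ((lebesgue_measure \x lebesgue_measure)%E).-negligible
        [set p : R * R | ~ (exists z, 1 < cabs z /\ g z = Complex p.1 p.2)]].

End Defs.

(* Main.v *)
(** Put [y z = 1 / f z] and let [F_k] be its Faber polynomials. The area theorem for [P \o y], with [P]
    a polynomial, gives the Grunsky inequalities, and these are equalities when the complement of the
    range of [y] is null. Let [s] be a direction of maximal growth. Letting [z = r s] tend to the circle
    yields [sum k |c_k|^2 <= 2 ln (1 / alpha)] for [c_k = (F_k(0) - 2 conj(s)^k) / k], with equality for
    full mappings. If the coefficients of [f_m] misbehaved along a sequence, then a subsequence of the
    directions would converge; equality in the limit together with [alpha_m --> alpha] prevents energy
    from escaping to high indices, so the tails of [sum k |c_k|^2] are uniformly small for the [f_m].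
    Since [n a_{n+1}] is a convolution involving the [k c_k + 2], a Tauberian argument then makes
    [a_n / n] (rotated by [s]) close to its Abel mean, that is, to [(1 - r)^2 |f_m(r s)|] at
    [r = 1 - 1 / n], which lies near [alpha_m]. *)

From HB Require Import structures.
Require Import Defs.
From mathcomp Require Import all_boot all_order all_algebra.
From mathcomp Require Import all_classical all_reals all_analysis.
From mathcomp Require Import measurable_realfun complex ring lra zify.
Import Order.TTheory Num.Theory GRing.Theory.
Import numFieldTopology.Exports numFieldNormedType.Exports.

Set Implicit Arguments.
Unset Strict Implicit.
Unset Printing Implicit Defensive.

Local Open Scope ring_scope.
Local Open Scope classical_set_scope.
Local Notation re := complex.Re.
Local Notation im := complex.Im.

(** The numbers [c_k] are the coefficients of log (f z / z) minus those of the Koebe factor (1 -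
    conj(s) z)^(-2), so the energy bound is Bazilevich's inequality: [sum k |c_k|^2] measures the
    distance of [f] from a rotated Koebe function. Equality in the limit is the delicate part. At
    radius [r] the energy is spread over all indices, and a termwise limit could lose what sits at
    high ones. Polarisation repairs this: the cross term between a fixed point [r0 s] and a moving
    point [r s] sees only low indices, because the vector of the fixed point has a small tail. For
    the area theorem, [P \o y] is not injective and the area of its image is infinite. Hence |P'|^2
    is integrated in the plane of [y], where [y] is injective, with a cutoff making the integrand
    the divergence of a field of bounded support; its total integral vanishes, so the image
    contributes the opposite of the omitted set. The Tauberian step needs |a_n| <= C n with C
    depending only on the energy bound; this comes from a Lebedev-Milin inequality, whose linear
    term is controlled by (1 - r)^2 |f (r s)| <= r. *)

Section ComplexModulus.
Variable R : realType.
Implicit Types (z w : R[i]) (x y r e : R).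

Lemma normrc z : `|z| = (cabs z)%:C%C.
Proof. by case: z. Qed.

Lemma cabs_ge0 z : 0 <= cabs z.
Proof. by case: z => a b; exact: sqrtr_ge0. Qed.
Hint Resolve cabs_ge0 : core.

Lemma cabs0 : cabs (0 : R[i]) = 0. Proof. exact: Normc.normc0. Qed.
Lemma cabs1 : cabs (1 : R[i]) = 1. Proof. exact: Normc.normc1. Qed.

Lemma cabs_eq0 z : (cabs z == 0) = (z == 0).
Proof. by apply/eqP/eqP => [/Normc.eq0_normc|->]; rewrite ?cabs0. Qed.

Lemma cabs_gt0 z : (0 < cabs z) = (z != 0).
Proof. by rewrite lt_def cabs_ge0 andbT cabs_eq0. Qed.

Lemma cabsM z w : cabs (z * w) = cabs z * cabs w.
Proof. exact: Normc.normcM. Qed.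

Lemma cabsV z : cabs z^-1 = (cabs z)^-1.
Proof. exact: Normc.normcV. Qed.

Lemma cabsN z : cabs (- z) = cabs z.
Proof. exact: (@normcN R). Qed.

Lemma cabsB z w : cabs (z - w) = cabs (w - z).
Proof. by rewrite -cabsN opprB. Qed.

Lemma cabsD z w : cabs (z + w) <= cabs z + cabs w.
Proof. exact: (@le_normcD R). Qed.

Lemma cabsX z n : cabs (z ^+ n) = cabs z ^+ n.
Proof. by elim: n => [|n IH]; rewrite ?cabs1 // !exprS cabsM IH. Qed.

Lemma cabs_real x : cabs x%:C%C = `|x|.
Proof. by rewrite /cabs /= expr0n addr0 sqrtr_sqr. Qed.

Lemma cabs_nat n : cabs (n%:R : R[i]) = n%:R.
Proof.
have -> : (n%:R : R[i]) = (n%:R : R)%:C%C by rewrite rmorph_nat.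
by rewrite cabs_real ger0_norm.
Qed.

Lemma cabs_sum (I : Type) (s : seq I) (P : pred I) (F : I -> R[i]) :
  cabs (\sum_(i <- s | P i) F i) <= \sum_(i <- s | P i) cabs (F i).
Proof.
elim/big_ind2 : _ => [||//]; first by rewrite cabs0.
by move=> x1 x2 y1 y2 h1 h2; apply: le_trans (cabsD _ _) (lerD _ _).
Qed.

Lemma sqr_cabs z : cabs z ^+ 2 = re z ^+ 2 + im z ^+ 2.
Proof. by case: z => a b; rewrite /cabs /= sqr_sqrtr // addr_ge0 ?sqr_ge0. Qed.

Lemma re_le_cabs z : `|re z| <= cabs z.
Proof.
rewrite -(@ler_pXn2r _ 2) ?nnegrE // ?normr_ge0// sqr_cabs real_normK ?num_real//.
by rewrite lerDl sqr_ge0.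
Qed.

Lemma im_le_cabs z : `|im z| <= cabs z.
Proof.
rewrite -(@ler_pXn2r _ 2) ?nnegrE // ?normr_ge0// sqr_cabs real_normK ?num_real//.
by rewrite lerDr sqr_ge0.
Qed.

Lemma re_ler_cabs z : re z <= cabs z.
Proof. exact: le_trans (ler_norm _) (re_le_cabs z). Qed.

Lemma cabs_le_reim z : cabs z <= `|re z| + `|im z|.
Proof.
rewrite {1}(complexE z); apply: le_trans (cabsD _ _) _.
by rewrite cabsM !cabs_real lerD2l {1}/cabs /= expr0n expr1n add0r sqrtr1 mul1r.
Qed.

Lemma cabs_conj z : cabs z^*%C = cabs z.
Proof. by case: z => a b; rewrite /cabs /= sqrrN. Qed.

Lemma mulcJ z : z * z^*%C = (cabs z ^+ 2)%:C%C.
Proof. by rewrite sqr_cabs; case: z => a b; simpc; congr Complex; ring. Qed.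

Lemma reD z w : re (z + w) = re z + re w. Proof. by case: z; case: w. Qed.
Lemma reN z : re (- z) = - re z. Proof. by case: z. Qed.
Lemma reB z w : re (z - w) = re z - re w. Proof. by rewrite reD reN. Qed.
Lemma imD z w : im (z + w) = im z + im w. Proof. by case: z; case: w. Qed.
Lemma imN z : im (- z) = - im z. Proof. by case: z. Qed.
Lemma imB z w : im (z - w) = im z - im w. Proof. by rewrite imD imN. Qed.
Lemma reM z w : re (z * w) = re z * re w - im z * im w.
Proof. by case: z; case: w. Qed.
Lemma imM z w : im (z * w) = re z * im w + im z * re w.
Proof. by case: z; case: w. Qed.
Lemma re_conj z : re z^*%C = re z. Proof. by case: z. Qed.
Lemma im_conj z : im z^*%C = - im z. Proof. by case: z. Qed.
Lemma reZ x z : re (x%:C%C * z) = x * re z.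
Proof. by rewrite reM /= mul0r subr0. Qed.
Lemma imZ x z : im (x%:C%C * z) = x * im z.
Proof. by rewrite imM /= mul0r addr0. Qed.

Lemma re_sum (I : Type) (s : seq I) (P : pred I) (F : I -> R[i]) :
  re (\sum_(i <- s | P i) F i) = \sum_(i <- s | P i) re (F i).
Proof. by elim/big_rec2 : _ => // i x y _ <-; rewrite reD. Qed.

Lemma im_sum (I : Type) (s : seq I) (P : pred I) (F : I -> R[i]) :
  im (\sum_(i <- s | P i) F i) = \sum_(i <- s | P i) im (F i).
Proof. by elim/big_rec2 : _ => // i x y _ <-; rewrite imD. Qed.

Lemma sqr_cabsD z w :
  cabs (z + w) ^+ 2 = cabs z ^+ 2 + cabs w ^+ 2 + 2 * re (z * w^*%C).
Proof. rewrite !sqr_cabs reD imD reM re_conj im_conj; ring. Qed.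

Lemma conjX z n : ((z ^+ n)^*)%C = (z^*)%C ^+ n.
Proof. exact: rmorphXn. Qed.

Lemma conjM z w : ((z * w)^*)%C = (z^*)%C * (w^*)%C.
Proof. exact: rmorphM. Qed.

Lemma conjB z w : ((z - w)^*)%C = (z^*)%C - (w^*)%C.
Proof. exact: rmorphB. Qed.

Lemma real_complexX x n : ((x ^+ n)%:C)%C = (x%:C)%C ^+ n.
Proof. exact: rmorphXn. Qed.

Lemma cabs_geB z w : cabs z - cabs w <= cabs (z - w).
Proof. by rewrite lerBlDr; have := cabsD (z - w) w; rewrite subrK. Qed.

Lemma cabs_distB z w : `|cabs z - cabs w| <= cabs (z - w).
Proof.
by rewrite ler_norml cabs_geB andbT lerNl opprB cabsB cabs_geB.
Qed.

Lemma cabs_distD u z w : cabs (z - w) <= cabs (z - u) + cabs (u - w).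
Proof. by have := cabsD (z - u) (u - w); rewrite addrA subrK. Qed.

Lemma real_complexM x y : (x * y)%:C%C = x%:C%C * y%:C%C.
Proof. exact: rmorphM. Qed.

End ComplexModulus.
Arguments cabs {R} z : simpl never.
#[global] Hint Extern 0 (is_true (_ <= cabs _)) => solve [apply: cabs_ge0] : core.

HB.instance Definition _ (R : realType) :=
  NormedModule.copy R[i] ((R[i] : numFieldType)^o).

Lemma cvg_ext (T : topologicalType) (u v : nat -> T) (l : T) :
  u @ \oo --> l -> u =1 v -> v @ \oo --> l.
Proof. by move=> h /funext <-. Qed.

(** * Limits of real and complex sequences *)

Section RealLimits.
Variable R : realType.
Implicit Types (u v : nat -> R) (l m c : R).

Lemma rcvgD u v l m : u @ \oo --> l -> v @ \oo --> m ->
  (fun n => u n + v n) @ \oo --> l + m.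
Proof. exact: cvgD. Qed.

Lemma rcvgB u v l m : u @ \oo --> l -> v @ \oo --> m ->
  (fun n => u n - v n) @ \oo --> l - m.
Proof. exact: cvgB. Qed.

Lemma rcvgM u v l m : u @ \oo --> l -> v @ \oo --> m ->
  (fun n => u n * v n) @ \oo --> l * m.
Proof. exact: cvgM. Qed.

Lemma rcvgMl c u l : u @ \oo --> l -> (fun n => c * u n) @ \oo --> c * l.
Proof. by move=> h; exact: (rcvgM (cvg_cst c) h). Qed.

End RealLimits.
Arguments rcvgMl {R} c [u l] _.

Section ComplexLimits.
Variable R : realType.
Implicit Types (u v : nat -> R[i]) (l m c z : R[i]) (e : R).

(** The norm of [R[i]] takes its values in [R[i]] itself; this trades it for the real modulus used
    in all later estimates. *)
Lemma ccvgP u l : u @ \oo --> l <->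
  forall e : R, 0 < e -> exists N : nat, forall n, (N <= n)%N -> cabs (u n - l) < e.
Proof.
split.
- move=> /cvgrPdist_lt h e e0.
  have e0' : 0 < e%:C%C by rewrite ltcR.
  have [N _ hN] := h _ e0'.
  by exists N => n Nn; have := hN n Nn; rewrite /= distrC normrc ltcR.
- move=> h; apply/cvgrPdist_lt => e; rewrite ltcE /= => /andP[/eqP i0 e0].
  have [N hN] := h _ e0; exists N => // n /= Nn.
  by rewrite distrC normrc ltcE /= i0 eqxx hN.
Qed.

Lemma series_toP (a : nat -> R[i]) l :
  series_to a l <-> (fun n => \sum_(k < n) a k) @ \oo --> l.
Proof. by rewrite ccvgP. Qed.

Lemma rcvgP (u : nat -> R) (l : R) : u @ \oo --> l <->
  forall e : R, 0 < e -> exists N : nat, forall n, (N <= n)%N -> `|u n - l| < e.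
Proof.
split => [/cvgrPdist_lt h e e0|h].
  by have [N _ hN] := h _ e0; exists N => n Nn; have := hN n Nn; rewrite /= distrC.
apply/cvgrPdist_lt => e e0; have [N hN] := h _ e0; exists N => // n /= Nn.
by rewrite distrC hN.
Qed.

Lemma ccvg_cabs u l : u @ \oo --> l -> (@cabs R \o u) @ \oo --> cabs l.
Proof.
move=> /ccvgP h; apply/rcvgP => e e0; have [N hN] := h _ e0; exists N => n Nn.
exact: le_lt_trans (cabs_distB _ _) (hN n Nn).
Qed.

Lemma ccvg_re u l : u @ \oo --> l -> ((@complex.Re R) \o u) @ \oo --> re l.
Proof.
move=> /ccvgP h; apply/rcvgP => e e0; have [N hN] := h _ e0; exists N => n Nn /=.
by rewrite -reB; exact: le_lt_trans (re_le_cabs _) (hN n Nn).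
Qed.

Lemma ccvg_reim u l : ((@complex.Re R) \o u) @ \oo --> re l ->
  ((@complex.Im R) \o u) @ \oo --> im l -> u @ \oo --> l.
Proof.
move=> /rcvgP h1 /rcvgP h2; apply/ccvgP => e e0.
have e2 : 0 < e / 2 by rewrite divr_gt0.
have [N1 hN1] := h1 _ e2; have [N2 hN2] := h2 _ e2.
exists (maxn N1 N2) => n; rewrite geq_max => /andP[n1 n2].
apply: le_lt_trans (cabs_le_reim _) _; rewrite reB imB (splitr e).
by apply: ltrD; [exact: hN1|exact: hN2].
Qed.

Lemma ccvgD u v l m : u @ \oo --> l -> v @ \oo --> m ->
  (fun n => u n + v n) @ \oo --> l + m.
Proof. exact: cvgD. Qed.

Lemma ccvgB u v l m : u @ \oo --> l -> v @ \oo --> m ->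
  (fun n => u n - v n) @ \oo --> l - m.
Proof. exact: cvgB. Qed.

Lemma ccvgM u v l m : u @ \oo --> l -> v @ \oo --> m ->
  (fun n => u n * v n) @ \oo --> l * m.
Proof. exact: cvgM. Qed.

Lemma ccvgMl c u l : u @ \oo --> l -> (fun n => c * u n) @ \oo --> c * l.
Proof. by move=> h; exact: (ccvgM (cvg_cst c) h). Qed.

Lemma ccvg_bound u l (b : nat -> R) : (forall n, cabs (u n - l) <= b n) ->
  b @ \oo --> (0 : R) -> u @ \oo --> l.
Proof.
move=> h /rcvgP hb; apply/ccvgP => e /hb[N hN]; exists N => n Nn.
apply: le_lt_trans (h n) _; apply: le_lt_trans (ler_norm _) _.
by have := hN n Nn; rewrite subr0.
Qed.

Lemma ccvg_le u l (M : R) : u @ \oo --> l -> (exists N, forall n, (N <= n)%N -> cabs (u n) <= M) ->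
  cabs l <= M.
Proof.
move=> /ccvgP h [N1 hM]; apply/ler_addgt0Pl => e /h[N hN].
have := hM _ (leq_maxr N N1); have := hN _ (leq_maxl N N1).
set n := maxn N N1 => h1 h2.
have := cabs_geB l (u n); rewrite cabsB; lra.
Qed.

Lemma rcvg_le (u : nat -> R) (l M : R) : u @ \oo --> l -> (exists N, forall n, (N <= n)%N -> u n <= M) ->
  l <= M.
Proof.
move=> /rcvgP h [N1 hM]; apply/ler_addgt0Pl => e /h[N hN].
have := hM _ (leq_maxr N N1); have := hN _ (leq_maxl N N1).
set n := maxn N N1 => h1 h2.
by have := ler_norm (l - u n); rewrite distrC; lra.
Qed.

Lemma rcvg_ge (u : nat -> R) (l M : R) : u @ \oo --> l -> (exists N, forall n, (N <= n)%N -> M <= u n) ->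
  M <= l.
Proof.
move=> /rcvgP h [N1 hM]; apply/ler_addgt0Pl => e /h[N hN].
have := hM _ (leq_maxr N N1); have := hN _ (leq_maxl N N1).
set n := maxn N N1 => h1 h2.
by have := ler_norm (u n - l); lra.
Qed.

(** Real and imaginary parts are dominated separately, which reduces the claim to absolute
    convergence of real series. *)
Lemma ccvg_series_dom (a : nat -> R[i]) (b : nat -> R) :
  (forall n, cabs (a n) <= b n) -> cvgn (series b) ->
  cvgn (fun n => \sum_(k < n) a k).
Proof.
move=> hab cb.
have main (f : R[i] -> R) : (forall z, `|f z| <= cabs z) ->
    cvgn (series (f \o a)).
  move=> hf; apply: normed_cvg.
  apply: (series_le_cvg _ _ _ cb) => n /=; first exact: normr_ge0.
    exact: le_trans (cabs_ge0 _) (hab n).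
  exact: le_trans (hf _) (hab n).
have /cvg_ex[/= l1 h1] := main _ (@re_le_cabs R).
have /cvg_ex[/= l2 h2] := main _ (@im_le_cabs R).
apply/cvg_ex; exists (Complex l1 l2); apply: ccvg_reim.
- by apply: (cvg_ext h1) => n; rewrite /series /= re_sum big_mkord.
- by apply: (cvg_ext h2) => n; rewrite /series /= im_sum big_mkord.
Qed.

End ComplexLimits.
Arguments ccvgMl {R} c [u l] _.

(** * Polynomial growth against geometric decay *)

Section GeometricDecay.
Variable R : realType.
Implicit Types q r : R.

Lemma linear_geo_bounded q : 0 <= q < 1 -> exists M, forall n, n.+1%:R * q ^+ n <= M.
Proof.
move=> /andP[q0 q1]; have [->|qn0] := eqVneq q 0.
  by exists 1 => -[|n]; rewrite ?expr0 ?mulr1 // exprS mul0r mulr0.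
have qp : 0 < q by rewrite lt_def qn0.
(* Bernoulli's inequality for q^-1 = 1 + x beats the linear factor. *)
pose x := q^-1 - 1; have x0 : 0 < x by rewrite subr_gt0 invf_gt1.
have bern n : 1 + n%:R * x <= (1 + x) ^+ n.
  elim: n => [|n IH]; first by rewrite mul0r addr0.
  rewrite exprSr; apply: le_trans (ler_wpM2r _ IH); last by lra.
  rewrite -natr1; have := mulr_ge0 (ler0n R n) (ltW x0) => h.
  have := mulr_ge0 h (ltW x0); nra.
exists (x^-1 + 1) => n.
have -> : q = (1 + x)^-1 by rewrite /x addrC subrK invrK.
rewrite exprVn ler_pdivrMr ?exprn_gt0 //; last lra.
have := bern n; set P := (1 + x) ^+ n => h.
have h2 : n%:R <= x^-1 * P.
  by rewrite -(ler_pM2l x0) mulrA divff ?gt_eqF // mul1r; lra.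
rewrite -natr1 mulrDl mul1r lerD //.
by apply: le_trans h; rewrite lerDl mulr_ge0 // ltW.
Qed.

(** Induction on [k]: writing q = p^2, one factor p^n absorbs one linear factor and the other is
    left to the induction hypothesis. *)
Lemma poly_geo_bounded q (k : nat) : 0 <= q < 1 ->
  exists M, 0 <= M /\ forall n, n.+1%:R ^+ k * q ^+ n <= M.
Proof.
elim: k q => [|k IH] q q01.
  exists 1; split => // n; rewrite expr0 mul1r; have /andP[q0 q1] := q01.
  by apply: exprn_ile1 => //; exact: ltW.
pose p := Num.sqrt q.
have pq : q = p ^+ 2 by rewrite sqr_sqrtr //; case/andP: q01.
have p01 : 0 <= p < 1.
  rewrite sqrtr_ge0 /= -(@ltr_pXn2r _ 2) ?nnegrE ?sqrtr_ge0 // -pq expr1n.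
  by case/andP: q01.
have [M [M0 hM]] := IH p p01; have [M' hM'] := linear_geo_bounded p01.
have p0 : 0 <= p by case/andP: p01.
exists (M' * M); split.
  by apply: mulr_ge0 => //; apply: le_trans (hM' 0%N); rewrite expr0 mulr1.
move=> n; have -> : n.+1%:R ^+ k.+1 * q ^+ n = (n.+1%:R * p ^+ n) * (n.+1%:R ^+ k * p ^+ n).
  by rewrite pq -exprM mulnC exprM exprS; ring.
by apply: ler_pM => //; rewrite mulr_ge0 ?exprn_ge0 // exprn_ge0.
Qed.

Lemma geo_sum_le q n : 0 <= q < 1 -> \sum_(k < n) q ^+ k <= (1 - q)^-1.
Proof.
move=> /andP[q0 q1]; have d : 0 < 1 - q by lra.
rewrite -(ler_pM2l d) divff ?gt_eqF //.
have -> : (1 - q) * \sum_(k < n) q ^+ k = 1 - q ^+ n.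
  by rewrite -opprB mulNr -subrX1 opprB.
by rewrite gerBl exprn_ge0.
Qed.

Lemma cvg_geo q : 0 <= q < 1 -> (fun n => q ^+ n) @ \oo --> (0 : R).
Proof. by move=> /andP[q0 q1]; apply: cvg_expr; rewrite ger0_norm. Qed.

Lemma cvg_geoM q M : 0 <= q < 1 -> (fun n => M * q ^+ n) @ \oo --> (0 : R).
Proof.
by move=> h; rewrite -(mulr0 M); exact: (cvgM (cvg_cst M) (cvg_geo h)).
Qed.

End GeometricDecay.

Lemma sum_triangle (V : nmodType) (F : nat -> nat -> V) n :
  \sum_(k < n) \sum_(i < k.+1) F i (k - i)%N = \sum_(i < n) \sum_(j < n - i) F i j.
Proof.
elim: n => [|n IH]; first by rewrite !big_ord0.
rewrite big_ord_recr /= IH [RHS]big_ord_recr /= subSn // subnn big_ord1.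
rewrite [X in _ + X]big_ord_recr /= subnn addrA; congr (_ + _).
rewrite -big_split /=; apply: eq_bigr => i _.
by rewrite subSn 1?ltnW // big_ord_recr.
Qed.

(** * Power series with radius of convergence at least one *)

Section PowerSeries.
Variable R : realType.
Implicit Types (a b : nat -> R[i]) (c z w : R[i]) (r : R).

(** Radius of convergence at least one, encoded by boundedness of the terms, so that it can be
    established before any series is summed. *)
Definition unit_radius a := forall r : R, 0 <= r < 1 ->
  exists M : R, forall n, cabs (a n) * r ^+ n <= M.

Definition psum a z : R[i] := limn (fun n => \sum_(k < n) a k * z ^+ k).

Definition conv a b n : R[i] := \sum_(k < n.+1) a k * b (n - k)%N.

(** Boundedness at the intermediate radius s = (r + 1) / 2 gives geometric decay with ratio r / s at
    [r]. *)
Lemma unit_radius_decay a r : unit_radius a -> 0 <= r < 1 ->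
  exists M q : R, [/\ 0 <= M, 0 <= q < 1 & forall n, cabs (a n) * r ^+ n <= M * q ^+ n].
Proof.
move=> ha /andP[r0 r1]; pose s := (r + 1) / 2.
have s01 : 0 <= s < 1 by rewrite /s; lra.
have sp : 0 < s by rewrite /s; lra.
have [M hM] := ha s s01; exists M, (r / s); split.
- exact: le_trans (mulr_ge0 (cabs_ge0 _) (exprn_ge0 _ (ltW sp))) (hM 0%N).
- by rewrite divr_ge0 ?(ltW sp) //= ltr_pdivrMr // mul1r /s; lra.
- move=> n; rewrite exprMn exprVn.
  by rewrite mulrCA [leLHS]mulrC ler_wpM2l ?exprn_ge0 // ler_pdivlMr ?exprn_gt0.
Qed.

Lemma unit_radius_nat a (k : nat) : unit_radius a ->
  unit_radius (fun n => n.+1%:R ^+ k * a n).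
Proof.
move=> ha r r01; have [M [q [M0 q01 hM]]] := unit_radius_decay ha r01.
have [M' [M'0 hM']] := poly_geo_bounded k q01.
exists (M' * M) => n; rewrite cabsM cabsX cabs_nat.
apply: le_trans (_ : n.+1%:R ^+ k * (M * q ^+ n) <= _).
  by rewrite -mulrA ler_wpM2l // exprn_ge0.
by rewrite mulrCA [leRHS]mulrC ler_wpM2l.
Qed.

Lemma unit_radius_le a b : unit_radius b -> (forall n, cabs (a n) <= cabs (b n)) ->
  unit_radius a.
Proof.
move=> hb hab r r01; have [M hM] := hb r r01; exists M => n.
by apply: le_trans (hM n); rewrite ler_wpM2r // exprn_ge0 //; case/andP: r01.
Qed.

Lemma unit_radiusD a b : unit_radius a -> unit_radius b -> unit_radius (fun n => a n + b n).
Proof.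
move=> ha hb r r01; have [M hM] := ha r r01; have [M' hM'] := hb r r01.
exists (M + M') => n; apply: le_trans (lerD (hM n) (hM' n)).
by rewrite -mulrDl ler_wpM2r ?cabsD // exprn_ge0 //; case/andP: r01.
Qed.

Lemma unit_radiusZ c a : unit_radius a -> unit_radius (fun n => c * a n).
Proof.
move=> ha r r01; have [M hM] := ha r r01; exists (cabs c * M) => n.
by rewrite cabsM -mulrA ler_wpM2l.
Qed.

Lemma unit_radius_shift a : unit_radius a -> unit_radius (fun n => a n.+1).
Proof.
move=> ha r /andP[r0 r1]; pose s := (r + 1) / 2.
have s01 : 0 <= s < 1 by rewrite /s; lra.
have sp : 0 < s by rewrite /s; lra.
have [M hM] := ha s s01; exists (M / s) => n.
rewrite ler_pdivlMr //; apply: le_trans (hM n.+1).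
rewrite exprSr mulrA ler_wpM2r ?(ltW sp) // ler_wpM2l //.
by rewrite lerXn2r ?nnegrE // /s; lra.
Qed.

Lemma unit_radius_delay a : unit_radius a -> unit_radius (fun n => if n is m.+1 then a m else 0).
Proof.
move=> ha r r01; have [M hM] := ha r r01; exists M => -[|n].
  by rewrite cabs0 mul0r; apply: le_trans (hM 0%N); rewrite mulr_ge0 // exprn_ge0.
apply: le_trans (hM n); rewrite ler_wpM2l // exprS ler_piMl ?exprn_ge0 //; case/andP: r01 => //.
by move=> _ /ltW.
Qed.

Lemma unit_radius_bounded a (M : R) : (forall n, cabs (a n) <= M) -> unit_radius a.
Proof.
move=> h r /andP[r0 r1]; exists M => n; apply: le_trans (h n).
by rewrite ler_piMr // exprn_ile1 // ltW.
Qed.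

Lemma unit_radius_conv a b : unit_radius a -> unit_radius b -> unit_radius (conv a b).
Proof.
move=> ha hb r r01; have [M [q [M0 q01 hM]]] := unit_radius_decay ha r01.
have [M' hM'] := hb r r01.
have /andP[r0 r1] := r01.
have M'0 : 0 <= M' by apply: le_trans (hM' 0%N); rewrite mulr_ge0 // exprn_ge0.
exists (M * M' * (1 - q)^-1) => n.
apply: le_trans (ler_wpM2r (exprn_ge0 n r0) (cabs_sum _ _ _)) _.
rewrite mulr_suml; apply: le_trans (_ : \sum_(k < n.+1) M * M' * q ^+ k <= _); last first.
  by rewrite -mulr_sumr ler_wpM2l ?mulr_ge0 // geo_sum_le.
apply: ler_sum => k _; rewrite cabsM.
have -> : r ^+ n = r ^+ k * r ^+ (n - k) by rewrite -exprD subnKC // -ltnS.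
rewrite mulrACA [leRHS]mulrAC.
by apply: (ler_pM _ _ (hM k) (hM' (n - k)%N)); rewrite mulr_ge0 ?exprn_ge0.
Qed.

Lemma psum_cvg a z : unit_radius a -> cabs z < 1 ->
  (fun n => \sum_(k < n) a k * z ^+ k) @ \oo --> psum a z.
Proof.
move=> ha z1; have [|M [q [M0 /andP[q0 q1] hM]]] := unit_radius_decay ha (_ : 0 <= cabs z < 1).
  by rewrite cabs_ge0.
apply: (@ccvg_series_dom _ (fun k => a k * z ^+ k) (geometric M q)) => [n|].
  by rewrite cabsM cabsX; exact: hM.
by apply: is_cvg_geometric_series; rewrite ger0_norm.
Qed.

Lemma psum_eq a z l : unit_radius a -> cabs z < 1 ->
  (fun n => \sum_(k < n) a k * z ^+ k) @ \oo --> l -> psum a z = l.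
Proof. by move=> ha z1 h; apply: cvg_lim => //; exact: norm_hausdorff. Qed.

Lemma psumD a b z : unit_radius a -> unit_radius b -> cabs z < 1 ->
  psum (fun n => a n + b n) z = psum a z + psum b z.
Proof.
move=> ha hb z1; apply: psum_eq => //; first exact: unit_radiusD.
apply: (cvg_ext (ccvgD (psum_cvg ha z1) (psum_cvg hb z1))) => n /=.
by rewrite -big_split /=; apply: eq_bigr => k _; rewrite mulrDl.
Qed.

Lemma psumZ c a z : unit_radius a -> cabs z < 1 ->
  psum (fun n => c * a n) z = c * psum a z.
Proof.
move=> ha z1; apply: psum_eq => //; first exact: unit_radiusZ.
apply: (cvg_ext (ccvgMl c (psum_cvg ha z1))) => n /=.
by rewrite mulr_sumr; apply: eq_bigr => k _; rewrite mulrA.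
Qed.

Lemma psumB a b z : unit_radius a -> unit_radius b -> cabs z < 1 ->
  psum (fun n => a n - b n) z = psum a z - psum b z.
Proof.
move=> ha hb z1; have hb' : unit_radius (fun n => -1 * b n) by exact: unit_radiusZ.
rewrite -[- psum b z]mulN1r -psumZ // -psumD //.
by congr (psum _ z); apply/funext => n; rewrite mulN1r.
Qed.

Lemma eq_psum a b z : a =1 b -> psum a z = psum b z.
Proof. by move=> /funext ->. Qed.

Lemma psum_shift a z : unit_radius a -> cabs z < 1 ->
  psum a z = a 0%N + z * psum (fun n => a n.+1) z.
Proof.
move=> ha z1; apply: psum_eq => //; rewrite -cvg_shiftS /=.
have ha1 := unit_radius_shift ha.
apply: (cvg_ext (ccvgD (cvg_cst (a 0%N)) (ccvgMl z (psum_cvg ha1 z1)))) => n /=.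
rewrite big_ord_recl expr0 mulr1; congr (_ + _).
by rewrite mulr_sumr; apply: eq_bigr => k _; rewrite exprS mulrCA.
Qed.

Lemma psum0 a : unit_radius a -> psum a 0 = a 0%N.
Proof. by move=> ha; rewrite psum_shift ?cabs0 // mul0r addr0. Qed.

Lemma psum_tail a r : unit_radius a -> 0 <= r < 1 ->
  exists M q : R, [/\ 0 <= M, 0 <= q < 1 & forall n z, cabs z <= r ->
    cabs (psum a z - \sum_(k < n) a k * z ^+ k) <= M * q ^+ n].
Proof.
move=> ha r01; have [M [q [M0 q01 hM]]] := unit_radius_decay ha r01.
have /andP[r0 r1] := r01; have /andP[q0 q1] := q01.
exists (M / (1 - q)), q; split => //; first by rewrite divr_ge0 // subr_ge0 ltW.
move=> n z zr; have z1 : cabs z < 1 by exact: le_lt_trans zr r1.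
apply: (@ccvg_le _ (fun m => \sum_(k < m) a k * z ^+ k - \sum_(k < n) a k * z ^+ k)).
  by apply: ccvgB; [exact: psum_cvg|exact: cvg_cst].
exists n => m nm; rewrite -!(big_mkord xpredT (fun k => a k * z ^+ k)) (big_cat_nat (leq0n n) nm) /=.
rewrite addrAC subrr add0r; apply: le_trans (cabs_sum _ _ _) _.
apply: le_trans (_ : \sum_(n <= k < m) M * q ^+ k <= _).
  apply: ler_sum => k _; rewrite cabsM cabsX; apply: le_trans (hM k).
  by rewrite ler_wpM2l // lerXn2r ?nnegrE.
rewrite -mulr_sumr -mulrA ler_wpM2l // mulrC.
rewrite -{1}[n]add0n big_addn big_mkord.
under eq_bigr do rewrite exprD.
by rewrite -mulr_suml [leLHS]mulrC ler_wpM2l ?exprn_ge0 // geo_sum_le.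
Qed.

Lemma psumM a b z : unit_radius a -> unit_radius b -> cabs z < 1 ->
  psum (conv a b) z = psum a z * psum b z.
Proof.
move=> ha hb z1; apply: psum_eq => //; first exact: unit_radius_conv.
have z01 : 0 <= cabs z < 1 by rewrite cabs_ge0.
have [M [q [M0 q01 hM]]] := unit_radius_decay ha z01.
have [M' [q' [M'0 q'01 hM']]] := unit_radius_decay hb z01.
pose t := Num.max q q'.
have t01 : 0 <= t < 1 by rewrite /t; case: (leP q q').
have t0 : 0 <= t by case/andP: t01.
have ht (N : R) (c : nat -> R[i]) s : 0 <= s -> s <= t -> 0 <= N ->
   (forall n, cabs (c n) * cabs z ^+ n <= N * s ^+ n) ->
   forall n, cabs (c n * z ^+ n) <= N * t ^+ n.
  move=> s0 st N0 h n; rewrite cabsM cabsX; apply: le_trans (h n) _.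
  by rewrite ler_wpM2l // lerXn2r ?nnegrE.
have {}hM := ht _ _ _ (andP q01).1 (_ : q <= t) M0 hM.
have {}hM' := ht _ _ _ (andP q'01).1 (_ : q' <= t) M'0 hM'.
have {}hM n : cabs (a n * z ^+ n) <= M * t ^+ n by apply: hM; rewrite /t le_max lexx.
have {}hM' n : cabs (b n * z ^+ n) <= M' * t ^+ n by apply: hM'; rewrite /t le_max lexx orbT.
have prod := ccvgM (psum_cvg ha z1) (psum_cvg hb z1).
(* Up to sign, [D n] collects the pairs (i, j) of the square with i + j >= n. There are at most n^2
   of them, each of size O(t^n), and half of that decay absorbs n^2. *)
pose D n := (\sum_(k < n) conv a b k * z ^+ k) -
  (\sum_(k < n) a k * z ^+ k) * (\sum_(k < n) b k * z ^+ k).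
have D0 : D @ \oo --> (0 : R[i]).
  have s01 : 0 <= Num.sqrt t < 1.
    rewrite sqrtr_ge0 /= -(@ltr_pXn2r _ 2) ?nnegrE ?sqrtr_ge0 // sqr_sqrtr // expr1n.
    by case/andP: t01.
  have [K' [K'0 hK']] := poly_geo_bounded 2 s01.
  apply: (@ccvg_bound _ _ _ (fun n => M * M' * K' * Num.sqrt t ^+ n)); last first.
    exact: cvg_geoM.
  move=> n; rewrite subr0.
  pose F i j := a i * z ^+ i * (b j * z ^+ j).
  have -> : D n = - \sum_(i < n) \sum_(n - i <= j < n) F i j.
    rewrite /D mulr_suml; under [X in _ - X]eq_bigr do rewrite mulr_sumr.
    have -> : \sum_(k < n) conv a b k * z ^+ k = \sum_(i < n) \sum_(j < n - i) F i j.
      rewrite -sum_triangle; apply: eq_bigr => k _; rewrite /conv mulr_suml.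
      by apply: eq_bigr => i _; rewrite /F mulrACA -exprD subnKC // -ltnS.
    rewrite -sumrB -sumrN; apply: eq_bigr => i _.
    rewrite -!(big_mkord xpredT (F i)) [X in _ - X](big_cat_nat (leq0n (n - i)) (leq_subr i n)) /=.
    by rewrite opprD addrA subrr add0r.
  rewrite cabsN; apply: le_trans (cabs_sum _ _ _) _.
  apply: le_trans (_ : \sum_(i < n) \sum_(j < n) M * M' * t ^+ n <= _).
    apply: ler_sum => i _; apply: le_trans (cabs_sum _ _ _) _.
    apply: le_trans (_ : \sum_(n - i <= j < n) M * M' * t ^+ n <= _).
      rewrite big_nat_cond [leRHS]big_nat_cond; apply: ler_sum => j /andP[/andP[ij _] _].
      rewrite /F cabsM; apply: le_trans (ler_pM _ _ (hM i) (hM' j)) _ => //.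
      rewrite mulrACA ler_wpM2l ?mulr_ge0 // -exprD ler_wiXn2l ?leq_subLR //.
        by case/andP: t01 => _ /ltW.
      by rewrite -leq_subLR.
    rewrite -(big_mkord xpredT (fun=> M * M' * t ^+ n)).
    rewrite [leRHS](big_cat_nat (leq0n (n - i)) (leq_subr i n)) /= lerDr.
    by apply: sumr_ge0 => j _; rewrite !mulr_ge0 ?exprn_ge0.
  rewrite !sumr_const card_ord -mulrnA -[leLHS]mulr_natr -!mulrA.
  rewrite ler_wpM2l // ler_wpM2l //.
  apply: le_trans (_ : n.+1%:R ^+ 2 * Num.sqrt t ^+ n * Num.sqrt t ^+ n <= _); last first.
    by rewrite ler_wpM2r ?exprn_ge0 ?sqrtr_ge0.
  rewrite -[leRHS]mulrA -exprD addnn -mul2n exprM sqr_sqrtr // mulrC ler_wpM2r ?exprn_ge0 //.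
  by rewrite natrM -expr2 lerXn2r ?nnegrE // ler_nat.
have := ccvgD D0 prod; rewrite add0r => /cvg_ext; apply => n.
by rewrite /D /= subrK.
Qed.

End PowerSeries.

#[global] Opaque psum.

(** * The complex exponential *)

Section ComplexExponential.
Variable R : realType.
Implicit Types (x y t : R) (z w : R[i]) (n : nat).

Definition cis t : R[i] := Complex (cos t) (sin t).

Lemma cisD x y : cis (x + y) = cis x * cis y.
Proof. by rewrite /cis cosD sinD; simpc; congr Complex; rewrite ?[cos x * _ + _]addrC. Qed.

Lemma cis0 : cis 0 = 1. Proof. by rewrite /cis cos0 sin0. Qed.

Lemma cabs_cis t : cabs (cis t) = 1.
Proof.
apply/eqP; rewrite -(@eqrXn2 _ 2) // sqr_cabs /= expr1n.
by rewrite cos2Dsin2.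
Qed.

Lemma cis_nat t n : cis (n%:R * t) = cis t ^+ n.
Proof.
elim: n => [|n IH]; first by rewrite mul0r cis0.
by rewrite -natr1 mulrDl mul1r cisD IH exprSr.
Qed.

Lemma cis2pi : cis (pi *+ 2) = 1.
Proof. by rewrite /cis cos2pi sin_mulr2n sinpi mulr0 mul0rn. Qed.

Lemma cis_conj t : (cis t)^*%C = cis (- t).
Proof. by rewrite /cis /= cosN sinN. Qed.

Lemma cis_neq1 t : 0 < t < pi *+ 2 -> cis t != 1.
Proof.
move=> /andP[t0 t1]; apply/negP => /eqP [c1 _].
have : 0 < sin (t / 2) by apply: sin_gt0_pi; rewrite -mulr_natr in t1; lra.
have h : t = (t / 2) *+ 2 by rewrite -mulr_natr divfK.
move: c1; rewrite {1}h cos_mulr2n => c1 s0.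
have := cos2Dsin2 (t / 2); rewrite -mulr_natr in c1.
have : 0 < sin (t / 2) ^+ 2 by rewrite exprn_gt0.
lra.
Qed.

Lemma sin_dist x y : `|sin x - sin y| <= `|x - y|.
Proof.
wlog xy : x y / y <= x.
  by move=> h; case: (leP y x) => [/h//|/ltW/h]; rewrite distrC [leRHS]distrC.
have [] := @MVT_segment R sin cos y x xy.
  by apply: continuous_subspaceT; exact: continuous_sin.
by move=> c _ ->; rewrite normrM ler_piMl // cos_max.
Qed.

Lemma sin_le_norm x : `|sin x| <= `|x|.
Proof. by have := sin_dist x 0; rewrite sin0 !subr0. Qed.

Lemma cos_dist1 x : `|cos x - 1| <= x ^+ 2 / 2.
Proof.
have h : x = (x / 2) *+ 2 by rewrite -mulr_natr divfK.
rewrite {1}h cos_mulr2n; have := cos2Dsin2 (x / 2) => e.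
have -> : cos (x / 2) ^+ 2 *+ 2 - 1 - 1 = - (sin (x / 2) ^+ 2 *+ 2).
  by lra.
rewrite normrN ger0_norm ?mulrn_wge0 ?sqr_ge0 //.
have := sin_le_norm (x / 2); rewrite -(@ler_pXn2r _ 2) ?nnegrE ?normr_ge0 //.
by rewrite !real_normK ?num_real // exprMn; lra.
Qed.

Lemma sin_dist_id x : `|sin x - x| <= x ^+ 2.
Proof.
wlog x0 : x / 0 <= x.
  move=> h; case: (leP 0 x) => [/h//|x0]; have /h : 0 <= - x by lra.
  by rewrite sinN -opprD normrN sqrrN.
have [] := @MVT_segment R (fun t => sin t - t) (fun t => cos t - 1) 0 x x0.
  apply: continuous_subspaceT => t; apply: continuousB; first exact: continuous_sin.
  exact: cvg_id.
move=> c; rewrite in_itv /= => /andP[c0 cx].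
rewrite sin0 !subr0 => ->; rewrite normrM [`|x|]ger0_norm // expr2 ler_wpM2r //.
case: (lerP x 2) => x2; last first.
  by apply: le_trans (ler_normB _ _) _; rewrite normr1; have := cos_max c; lra.
by have := cos_dist1 c; nra.
Qed.

Definition cexp z : R[i] := (expR (re z))%:C%C * cis (im z).

Lemma cexpD z w : cexp (z + w) = cexp z * cexp w.
Proof. by rewrite /cexp reD imD expRD cisD rmorphM mulrACA. Qed.

Lemma cexp0 : cexp 0 = 1. Proof. by rewrite /cexp /= expR0 cis0 mulr1. Qed.

Lemma cabs_cexp z : cabs (cexp z) = expR (re z).
Proof. by rewrite /cexp cabsM cabs_real cabs_cis mulr1 ger0_norm // expR_ge0. Qed.

Lemma cexpN z : cexp z * cexp (- z) = 1.
Proof. by rewrite -cexpD subrr cexp0. Qed.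

Lemma expR_taylor x : `|expR x - 1| <= `|x| * expR `|x| /\
  `|expR x - 1 - x| <= `|x| ^+ 2 * expR `|x|.
Proof.
have h1 := expR_ge1Dx x; have h2 := expR_ge1Dx (- x).
have e0 := expR_gt0 x.
have h3 : expR x - 1 <= x * expR x.
  by have := expRxMexpNx_1 x; nra.
have hn : 1 <= expR `|x| by have := expR_ge1Dx `|x|; have := normr_ge0 x; lra.
case: (lerP 0 x) => x0.
  rewrite !ger0_norm; try lra.
  split; first by lra.
  have : x * (expR x - 1) <= x * (x * expR x) by rewrite ler_wpM2l.
  by rewrite expr2 -mulrA; lra.
have n1 : x * expR x < 0 by rewrite nmulr_rlt0.
rewrite (ltr0_norm x0) in hn *; rewrite (@ler0_norm _ (expR x - 1)); last by lra.
rewrite ger0_norm; last by lra.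
have n2 : - x <= - x * expR (- x) by rewrite ler_peMr //; lra.
split; first by lra.
have n3 : - x * (- x) <= - x * (- x) * expR (- x) by rewrite ler_peMr // mulr_ge0; lra.
have n4 : - x * (1 - expR x) <= - x * (- x) by rewrite ler_wpM2l; lra.
rewrite expr2; lra.
Qed.
End ComplexExponential.

Lemma div_nat_small (R : realType) (c e : R) : 0 < e ->
  exists N : nat, forall n, (N <= n)%N -> c / n.+1%:R < e.
Proof.
move=> e0; exists (Num.trunc (`|c| / e)) => n hn.
rewrite ltr_pdivrMr ?ltr0n // mulrC -ltr_pdivrMr //.
apply: le_lt_trans (_ : `|c| / e < _); first by rewrite ler_pM2r ?invr_gt0 // ler_norm.
have := @Num.Theory.trunc_itv R (`|c| / e) (divr_ge0 (normr_ge0 _) (ltW e0)).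
by move=> /andP[_ /lt_le_trans]; apply; rewrite ler_nat.
Qed.

(** * Uniform second-order Taylor bounds in place of holomorphy *)

Section Taylor.
Variable R : realType.

(* [P x y d] reads: [d] is an admissible increment from [x] to [y]; this covers
   both complex differentiation and differentiation in a fixed direction. *)
Definition tay (T : Type) (P : T -> T -> R[i] -> Prop) (f f' : T -> R[i]) :=
  exists2 M : R, 0 <= M & forall x y d, P x y d ->
    [/\ cabs (f x) <= M, cabs (f y) <= M, cabs (f' x) <= M &
        cabs (f y - f x - f' x * d) <= M * cabs d ^+ 2].

(** Neither openness nor convexity is asked of [A], so closed discs, annuli and rectangles are
    treated alike. *)
Definition hol (A : set R[i]) (x y d : R[i]) := [/\ A x, A y & d = y - x].

Section Rules.
Variables (T : Type) (P : T -> T -> R[i] -> Prop).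
Implicit Types f g : T -> R[i].

(** Short increments are controlled by the Taylor bound; for |d| > 1 the bound on the values already
    suffices. *)
Lemma tay_lip f f' : tay P f f' -> exists2 L : R, 0 <= L &
  forall x y d, P x y d -> cabs (f y - f x) <= L * cabs d.
Proof.
move=> [M M0 h]; exists (2 * M); first by lra.
move=> x y d /h[h1 h2 h3 h4]; have d0 := cabs_ge0 d.
case: (lerP (cabs d) 1) => d1.
  have := cabsD (f y - f x - f' x * d) (f' x * d); rewrite subrK cabsM => h5.
  have : cabs (f' x) * cabs d <= M * cabs d by rewrite ler_wpM2r.
  have : M * cabs d ^+ 2 <= M * cabs d by rewrite ler_wpM2l // expr2 ler_piMl.
  lra.
have := cabsD (f y) (- f x); rewrite cabsN => h5.
have : M * 1 <= M * cabs d by rewrite ler_wpM2l // ltW.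
lra.
Qed.

Lemma tay_cst (c : R[i]) : tay P (fun=> c) (fun=> 0).
Proof.
exists (cabs c) => // x y d _; rewrite subrr mul0r subrr cabs0; split => //.
by rewrite mulr_ge0 // exprn_ge0.
Qed.

Lemma tayD f f' g g' : tay P f f' -> tay P g g' ->
  tay P (fun x => f x + g x) (fun x => f' x + g' x).
Proof.
move=> [M M0 h] [N N0 k]; exists (M + N); first exact: addr_ge0.
move=> x y d p; have [h1 h2 h3 h4] := h _ _ _ p; have [k1 k2 k3 k4] := k _ _ _ p.
split; try by apply: le_trans (cabsD _ _) (lerD _ _).
rewrite [X in cabs X](_ : _ = (f y - f x - f' x * d) + (g y - g x - g' x * d)); last by ring.
by rewrite mulrDl; apply: le_trans (cabsD _ _) (lerD _ _).
Qed.

Lemma tayM f f' g g' : tay P f f' -> tay P g g' ->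
  tay P (fun x => f x * g x) (fun x => f' x * g x + f x * g' x).
Proof.
move=> tf tg; have [L L0 hL] := tay_lip tg; case: tf tg => [M M0 h] [N N0 k].
exists (2 * M * N + M * L).
  by rewrite addr_ge0 // ?mulr_ge0 // mulr_ge0.
have MN0 : 0 <= M * N by exact: mulr_ge0.
have ML0 : 0 <= M * L by exact: mulr_ge0.
move=> x y d p; have [h1 h2 h3 h4] := h _ _ _ p; have [k1 k2 k3 k4] := k _ _ _ p.
have l1 := hL _ _ _ p.
have b1 : cabs (f x) * cabs (g x) <= M * N by apply: ler_pM.
have b2 : cabs (f y) * cabs (g y) <= M * N by apply: ler_pM.
have b3 : cabs (f' x) * cabs (g x) <= M * N by apply: ler_pM.
have b4 : cabs (f x) * cabs (g' x) <= M * N by apply: ler_pM.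
rewrite !cabsM; split; try lra.
  by apply: le_trans (cabsD _ _) _; rewrite !cabsM; lra.
rewrite [X in cabs X](_ : _ = (f y - f x - f' x * d) * g y
   + f x * (g y - g x - g' x * d) + f' x * d * (g y - g x)); last by ring.
apply: le_trans (cabsD _ _) _; rewrite [leRHS]mulrDl; apply: lerD.
  apply: le_trans (cabsD _ _) _; rewrite !cabsM.
  have : cabs (f y - f x - f' x * d) * cabs (g y) <= M * cabs d ^+ 2 * N by apply: ler_pM.
  have : cabs (f x) * cabs (g y - g x - g' x * d) <= M * (N * cabs d ^+ 2) by apply: ler_pM.
  by lra.
rewrite !cabsM; have : cabs (f' x) * cabs d * cabs (g y - g x) <= (M * cabs d) * (L * cabs d).
  by apply: ler_pM => //; rewrite ?mulr_ge0 // ler_wpM2r.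
by lra.
Qed.

Lemma tayZ (c : R[i]) f f' : tay P f f' -> tay P (fun x => c * f x) (fun x => c * f' x).
Proof.
move=> tf; have [M M0 h] := tayM (tay_cst c) tf; exists M => // x y d /h[h1 h2 h3 h4].
by split => //; [move: h3|move: h4]; rewrite mul0r add0r.
Qed.

Lemma tay_eq f f' g' : f' =1 g' -> tay P f f' -> tay P f g'.
Proof. by move=> /funext <-. Qed.

(** Conjugation is only real-differentiable, hence the restriction to real increments; it serves for
    derivatives in a fixed direction. *)
Lemma tay_conj f f' : (forall x y d, P x y d -> d^*%C = d) -> tay P f f' ->
  tay P (fun x => (f x)^*%C) (fun x => (f' x)^*%C).
Proof.
move=> hd [M M0 h]; exists M => // x y d p; have [h1 h2 h3 h4] := h _ _ _ p.
rewrite !cabs_conj; split => //; rewrite -[X in _ * X](hd _ _ _ p).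
by rewrite -rmorphM -!rmorphB cabs_conj.
Qed.

Lemma tay_comp f f' (B : set R[i]) (g g' : R[i] -> R[i]) : tay P f f' ->
  (forall x y d, P x y d -> B (f x) /\ B (f y)) -> tay (hol B) g g' ->
  tay P (fun x => g (f x)) (fun x => g' (f x) * f' x).
Proof.
move=> tf hB [N N0 k]; have [L L0 hL] := tay_lip tf; case: tf => [M M0 h].
have MN0 : 0 <= N * M by exact: mulr_ge0.
have LL0 : 0 <= N * L ^+ 2 by rewrite mulr_ge0 // exprn_ge0.
exists (N + N * M + N * L ^+ 2); first by rewrite !addr_ge0.
move=> x y d p; have [h1 h2 h3 h4] := h _ _ _ p; have [Bx By] := hB _ _ _ p.
have [k1 k2 k3 k4] := k (f x) (f y) _ (And3 Bx By erefl).
rewrite !cabsM; split; try lra.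
  by have : cabs (g' (f x)) * cabs (f' x) <= N * M by [apply: ler_pM]; lra.
rewrite [X in cabs X](_ : _ = (g (f y) - g (f x) - g' (f x) * (f y - f x))
   + g' (f x) * (f y - f x - f' x * d)); last by ring.
apply: le_trans (cabsD _ _) _; rewrite cabsM.
have l1 := hL _ _ _ p.
have : cabs (f y - f x) ^+ 2 <= (L * cabs d) ^+ 2.
  by rewrite lerXn2r ?nnegrE // mulr_ge0.
move=> /(ler_wpM2l N0); rewrite exprMn => l2.
have : cabs (g' (f x)) * cabs (f y - f x - f' x * d) <= N * (M * cabs d ^+ 2) by apply: ler_pM.
have : 0 <= N * cabs d ^+ 2 by rewrite mulr_ge0 // exprn_ge0.
lra.
Qed.

Lemma tay_sub (Q : T -> T -> R[i] -> Prop) f f' :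
  (forall x y d, Q x y d -> P x y d) -> tay P f f' -> tay Q f f'.
Proof. by move=> s [M M0 h]; exists M => // x y d /s; exact: h. Qed.

End Rules.

Lemma tay_id (r : R) : 0 <= r -> tay (hol [set z | cabs z <= r]) id (fun=> 1).
Proof.
move=> r0; exists (r + 1) => [|x y d [/= hx hy ->]]; first by lra.
rewrite mul1r subrr cabs0 cabs1; split; try lra.
by rewrite mulr_ge0 ?exprn_ge0 // addr_ge0.
Qed.

Lemma tay_inv (m : R) : 0 < m -> tay (hol [set z | m <= cabs z])
  (fun z => z^-1) (fun z => - (z^-1 ^+ 2)).
Proof.
move=> m0; have mi : 0 <= m^-1 by rewrite invr_ge0 ltW.
have m3 : 0 <= m^-1 ^+ 3 by rewrite exprn_ge0.
have m2 : 0 <= m^-1 ^+ 2 by rewrite exprn_ge0.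
exists (m^-1 + m^-1 ^+ 2 + m^-1 ^+ 3); first by lra.
move=> x y d [/= hx hy ->].
have [x0 y0] : x != 0 /\ y != 0 by split; rewrite -cabs_gt0; exact: lt_le_trans m0 _.
have hv z : m <= cabs z -> cabs z^-1 <= m^-1.
  move=> hz; rewrite cabsV lef_pV2 // ?posrE //; exact: lt_le_trans m0 _.
have [vx vy] := (hv _ hx, hv _ hy).
split; try lra.
  rewrite cabsN cabsX; have : cabs x^-1 ^+ 2 <= m^-1 ^+ 2 by rewrite lerXn2r ?nnegrE.
  by lra.
rewrite [X in cabs X](_ : _ = x^-1 ^+ 2 * y^-1 * (y - x) ^+ 2); last by field; rewrite x0 y0.
rewrite cabsM [cabs (_ / y)]cabsM !cabsX ler_wpM2r ?exprn_ge0 //.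
have : cabs x^-1 ^+ 2 * cabs y^-1 <= m^-1 ^+ 2 * m^-1.
  by apply: ler_pM; rewrite ?exprn_ge0 // lerXn2r ?nnegrE.
by rewrite -exprSr; lra.
Qed.

Lemma tay_horner (p : {poly R[i]}) (r : R) : 0 <= r ->
  tay (hol [set z | cabs z <= r]) (horner p) (horner p^`()).
Proof.
move=> r0; elim/poly_ind: p => [|p c IH].
  have := tay_cst (hol [set z | cabs z <= r]) 0.
  have -> : horner (0 : {poly R[i]}) = (fun=> 0) by apply/funext => x; rewrite horner0.
  by apply: tay_eq => x; rewrite deriv0 horner0.
have := tayD (tayM IH (tay_id r0)) (tay_cst (hol [set z | cabs z <= r]) c).
have <- : horner (p * 'X + c%:P) = (fun z => p.[z] * z + c).
  by apply/funext => x; rewrite !hornerE.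
by apply: tay_eq => x; rewrite derivD derivM derivX derivC mulr1 addr0 !hornerE.
Qed.

Lemma tay_cexp (r : R) : 0 <= r -> tay (hol [set z | cabs z <= r]) (@cexp R) (@cexp R).
Proof.
move=> r0; have e0 : 0 <= expR r by exact: expR_ge0.
have e1 : 1 <= expR r by have := expR_ge1Dx r; lra.
have hexp z : cabs z <= r -> cabs (cexp z) <= expR r.
  by move=> hz; rewrite cabs_cexp ler_expR; exact: le_trans (re_ler_cabs z) hz.
have E0 : 0 <= expR (2 * r) by exact: expR_ge0.
exists (expR r + expR r * (4 * expR (2 * r))); first by rewrite addr_ge0 // mulr_ge0 // mulr_ge0.
move=> x y d [/= hx hy ->]; have ex := hexp _ hx; have ey := hexp _ hy.
have p0 : 0 <= expR r * (4 * expR (2 * r)) by rewrite mulr_ge0 // mulr_ge0.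
split; try lra.
set w := y - x.
have -> : cexp y - cexp x - cexp x * w = cexp x * (cexp w - 1 - w).
  have -> : y = x + w by rewrite /w addrC subrK.
  by rewrite cexpD; ring.
rewrite cabsM mulrDl.
have wr : cabs w <= 2 * r by have := cabsD y (- x); rewrite cabsN -/w; lra.
clearbody w.
set s := re w; set t := im w.
have [hs1 hs2] := expR_taylor s.
have sm : `|s| <= cabs w by exact: re_le_cabs.
have tm : `|t| <= cabs w by exact: im_le_cabs.
have es : expR `|s| <= expR (2 * r) by rewrite ler_expR; lra.
have es' : expR s <= expR (2 * r) by rewrite ler_expR; have := ler_norm s; lra.
(* The error of exp is split into those of [cis] and of [expR] and a cross term, each quadratic in
   |w|. *)
have -> : cexp w - 1 - w = (expR s)%:C%C * (cis t - 1 - Complex 0 t) + (expR s - 1 - s)%:C%C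
   + Complex 0 t * (expR s - 1)%:C%C.
  rewrite /cexp -/s -/t [X in _ - _ - X = _](_ : w = s%:C%C + Complex 0 t); last first.
    by rewrite /s /t; case: (w) => u v; simpc.
  by rewrite !rmorphB; ring.
have sq (u : R) : `|u| <= cabs w -> u ^+ 2 <= cabs w ^+ 2.
  by move=> h; rewrite -real_normK ?num_real // lerXn2r ?nnegrE.
have b1 : cabs (cis t - 1 - Complex 0 t) <= 2 * cabs w ^+ 2.
  apply: le_trans (cabs_le_reim _) _; rewrite !reB !imB /= !subr0.
  have := cos_dist1 t; have := sin_dist_id t; have := sq _ tm; have := sqr_ge0 t; lra.
have E1 : 1 <= expR (2 * r) by have := expR_ge1Dx (2 * r); lra.
have w0 := cabs_ge0 w.
have b2 : `|expR s - 1 - s| <= cabs w ^+ 2 * expR (2 * r).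
  apply: le_trans hs2 _; apply: ler_pM; rewrite ?exprn_ge0 ?normr_ge0 ?expR_ge0 //.
  by rewrite lerXn2r ?nnegrE.
have b3 : cabs (Complex 0 t * (expR s - 1)%:C%C) <= cabs w * (cabs w * expR (2 * r)).
  rewrite cabsM cabs_real; apply: ler_pM => //.
    by apply: le_trans (cabs_le_reim _) _; rewrite /= normr0 add0r.
  by apply: le_trans hs1 _; apply: ler_pM; rewrite ?expR_ge0.
have tot : cabs ((expR s)%:C%C * (cis t - 1 - Complex 0 t) + (expR s - 1 - s)%:C%C
   + Complex 0 t * (expR s - 1)%:C%C) <= 4 * expR (2 * r) * cabs w ^+ 2.
  apply: le_trans (cabsD _ _) _; apply: le_trans (lerD (cabsD _ _) b3) _.
  rewrite cabsM !cabs_real [`|expR s|]ger0_norm ?expR_ge0 //.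
  have : expR s * cabs (cis t - 1 - Complex 0 t) <= expR (2 * r) * (2 * cabs w ^+ 2).
    by apply: ler_pM; rewrite ?expR_ge0.
  by rewrite expr2 in b2 *; lra.
have : cabs (cexp x) * cabs ((expR s)%:C%C * (cis t - 1 - Complex 0 t) + (expR s - 1 - s)%:C%C
   + Complex 0 t * (expR s - 1)%:C%C) <= expR r * (4 * expR (2 * r) * cabs w ^+ 2).
  by apply: ler_pM.
have : 0 <= expR r * cabs w ^+ 2 by rewrite mulr_ge0 // exprn_ge0.
lra.
Qed.

(** Cutting the segment from 0 to [z] into n + 1 steps costs at most M (|z| / (n + 1))^2 per step,
    so the total increment is O(1 / n). *)
Lemma tay_const (r : R) (f : R[i] -> R[i]) :
  tay (hol [set z | cabs z <= r]) f (fun=> 0) -> forall z, cabs z <= r -> f z = f 0.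
Proof.
move=> [M M0 h] z zr; apply/eqP; rewrite -subr_eq0 -cabs_eq0 eq_le cabs_ge0 andbT.
apply/ler_addgt0Pl => e e0; rewrite addr0.
pose pt n j : R[i] := (j%:R / n.+1%:R : R)%:C%C * z.
have hstep n j : (j < n.+1)%N -> cabs (f (pt n j.+1) - f (pt n j)) <=
    M * (cabs z / n.+1%:R) ^+ 2.
  move=> jn; have hpt k : (k <= n.+1)%N -> cabs (pt n k) <= r.
    move=> kn; rewrite cabsM cabs_real ger0_norm ?divr_ge0 //; apply: le_trans zr.
    by rewrite ler_piMl // ler_pdivrMr ?ltr0n // mul1r ler_nat.
  have [|_ _ _] := h (pt n j) (pt n j.+1) (pt n j.+1 - pt n j).
    by split => //; apply: hpt => //; exact: ltnW.
  rewrite mul0r subr0; congr (_ <= M * _ ^+ 2).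
  rewrite /pt -mulrBl -rmorphB -mulrBl -natrB // subSnn mul1r cabsM cabs_real mulrC.
  by rewrite ger0_norm // invr_ge0.
have htot n : cabs (f z - f 0) <= M * cabs z ^+ 2 / n.+1%:R.
  have -> : f z - f 0 = \sum_(j < n.+1) (f (pt n j.+1) - f (pt n j)).
    rewrite -(big_mkord xpredT (fun j => f (pt n j.+1) - f (pt n j))) telescope_sumr //.
    by rewrite /pt mul0r mul0r divff ?pnatr_eq0 // mul1r.
  apply: le_trans (cabs_sum _ _ _) _.
  apply: le_trans (_ : \sum_(j < n.+1) M * (cabs z / n.+1%:R) ^+ 2 <= _).
    by apply: ler_sum => j _; exact: hstep.
  rewrite sumr_const card_ord -mulr_natr expr2 le_eqVlt; apply/orP; left; apply/eqP.
  by field; rewrite addrC natr1 pnatr_eq0.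
have [N hN] := div_nat_small (M * cabs z ^+ 2) e0.
by apply/ltW/(le_lt_trans (htot N)); exact: hN.
Qed.
End Taylor.

(** * Course-of-values recursion *)

Section Recursion.
Variables (T : Type) (x0 : T) (F : (nat -> T) -> nat -> T).

(** The sequence is built as a growing list because [F] at index n may consult all earlier values;
    [x0] only answers requests beyond the list. *)
Fixpoint rec_prefix n : seq T :=
  if n is m.+1 then rcons (rec_prefix m) (F (nth x0 (rec_prefix m)) m) else [::].

Definition course_rec n := nth x0 (rec_prefix n.+1) n.

Lemma size_rec_prefix n : size (rec_prefix n) = n.
Proof. by elim: n => //= n IH; rewrite size_rcons IH. Qed.

Lemma nth_rec_prefix n k : (k < n)%N -> nth x0 (rec_prefix n) k = course_rec k.
Proof.
elim: n => // n IH; rewrite ltnS leq_eqVlt => /orP[/eqP -> //|kn].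
by rewrite /= nth_rcons size_rec_prefix kn IH.
Qed.

Lemma course_recE (Fext : forall g h n, (forall k, (k < n)%N -> g k = h k) -> F g n = F h n) n :
  course_rec n = F course_rec n.
Proof.
rewrite {1}/course_rec /= nth_rcons size_rec_prefix ltnn eqxx.
by apply: Fext => k; exact: nth_rec_prefix.
Qed.
End Recursion.

(** * Differentiation of power series and the exponential recursion *)

Section PowerSeriesCalculus.
Variable R : realType.
Implicit Types (a b l e u v : nat -> R[i]) (c z w : R[i]) (r : R).

Definition dcoef a n : R[i] := n.+1%:R * a n.+1.

Lemma unit_radius_dcoef a : unit_radius a -> unit_radius (dcoef a).
Proof.
move=> ha; apply: (unit_radius_le (unit_radius_shift (unit_radius_nat 1 ha))) => n.
by rewrite !cabsM cabsX !cabs_nat expr1 ler_wpM2r // ler_nat.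
Qed.

Lemma psum_abs_bounded a r : unit_radius a -> 0 <= r < 1 ->
  exists2 M : R, 0 <= M & forall n, \sum_(k < n) cabs (a k) * r ^+ k <= M.
Proof.
move=> ha r01; have [M [q [M0 q01 hM]]] := unit_radius_decay ha r01.
exists (M / (1 - q)) => [|n].
  by rewrite divr_ge0 // subr_ge0 ltW //; case/andP: q01.
apply: le_trans (_ : \sum_(k < n) M * q ^+ k <= _); first by apply: ler_sum.
by rewrite -mulr_sumr ler_wpM2l // geo_sum_le.
Qed.

Lemma psum_bounded a r : unit_radius a -> 0 <= r < 1 ->
  exists2 M : R, 0 <= M & forall z, cabs z <= r -> cabs (psum a z) <= M.
Proof.
move=> ha r01; have [M M0 hM] := psum_abs_bounded ha r01; exists M => // z zr.
apply: (ccvg_le (psum_cvg ha _)); first by case/andP: r01 => _; exact: le_lt_trans.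
exists 0%N => n _; apply: le_trans (cabs_sum _ _ _) (le_trans _ (hM n)).
by apply: ler_sum => k _; rewrite cabsM cabsX ler_wpM2l // lerXn2r ?nnegrE //; case/andP: r01.
Qed.

(** Multiplying through by s^2 avoids the exponent n - 2. The induction writes the error at n + 1 as
    w times the error at n plus n z^(n-1) (w - z)^2. *)
Lemma exprn_taylor (s : R) z w n : 0 < s -> cabs z <= s -> cabs w <= s ->
  cabs (w ^+ n - z ^+ n - n%:R * z ^+ n.-1 * (w - z)) * s ^+ 2 <=
    n%:R ^+ 2 * s ^+ n * cabs (w - z) ^+ 2.
Proof.
move=> s0 hz hw; have s0' := ltW s0.
elim: n => [|n IH]; first by rewrite !mulr0n !expr0 subrr !mul0r subrr cabs0 expr0n !mul0r.
pose D := w ^+ n - z ^+ n - n%:R * z ^+ n.-1 * (w - z).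
have -> : w ^+ n.+1 - z ^+ n.+1 - n.+1%:R * z ^+ n.+1.-1 * (w - z) =
    w * D + n%:R * z ^+ n.-1 * (w - z) ^+ 2.
  rewrite /D; case: n {IH D} => [|n]; first by rewrite !expr0 !expr1; ring.
  by rewrite /= !exprS -!natr1; ring.
have d2 : 0 <= cabs (w - z) ^+ 2 by rewrite exprn_ge0.
apply: le_trans (_ : (s * cabs D + n%:R * s ^+ n.-1 * cabs (w - z) ^+ 2) * s ^+ 2 <= _).
  rewrite ler_wpM2r ?exprn_ge0 //; apply: le_trans (cabsD _ _) _.
  rewrite [cabs (w * D)]cabsM lerD ?ler_wpM2r //.
  rewrite cabsM [cabs (_ * z ^+ _)]cabsM !cabsX cabs_nat ler_wpM2r // ler_wpM2l //.
  by rewrite lerXn2r ?nnegrE.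
have h1 : s * cabs D * s ^+ 2 <= s * (n%:R ^+ 2 * s ^+ n * cabs (w - z) ^+ 2).
  by rewrite -mulrA ler_wpM2l.
have h2 : n%:R * s ^+ n.-1 * s ^+ 2 = n%:R * s ^+ n.+1 :> R.
  by case: n {IH D h1} => [|n]; rewrite ?mul0r // -mulrA -exprD addn2.
have -> : (s * cabs D + n%:R * s ^+ n.-1 * cabs (w - z) ^+ 2) * s ^+ 2 =
   s * cabs D * s ^+ 2 + n%:R * s ^+ n.+1 * cabs (w - z) ^+ 2 by rewrite -h2; ring.
apply: le_trans (lerD h1 (lexx _)) _.
have -> : s * (n%:R ^+ 2 * s ^+ n * cabs (w - z) ^+ 2) + n%:R * s ^+ n.+1 * cabs (w - z) ^+ 2 =
  (n%:R ^+ 2 + n%:R) * s ^+ n.+1 * cabs (w - z) ^+ 2 by rewrite [s ^+ n.+1]exprS; ring.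
rewrite ler_wpM2r // ler_wpM2r ?exprn_ge0 // -natr1.
have := ler0n R n; lra.
Qed.

(** The termwise Taylor errors are summed at an intermediate radius [s] > r, where the series with
    terms k^2 |a_k| s^k still converges. *)
Lemma tay_psum a r : unit_radius a -> 0 <= r < 1 ->
  tay (hol [set z | cabs z <= r]) (psum a) (psum (dcoef a)).
Proof.
move=> ha /andP[r0 r1]; pose s := (r + 1) / 2.
have s01 : 0 <= s < 1 by rewrite /s; lra.
have sp : 0 < s by rewrite /s; lra.
have rs : r <= s by rewrite /s; lra.
have r01 : 0 <= r < 1 by rewrite r0.
have [M1 M10 h1] := psum_bounded ha r01.
have [M2 M20 h2] := psum_bounded (unit_radius_dcoef ha) r01.
have [M3 M30 h3] := psum_abs_bounded (unit_radius_nat 2 ha) s01.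
have s2 : 0 <= s ^- 2 by rewrite invr_ge0 exprn_ge0 // ltW.
have M3s : 0 <= M3 * s ^- 2 by exact: mulr_ge0.
exists (M1 + M2 + M3 * s ^- 2); first by rewrite !addr_ge0.
move=> x y d [/= hx hy ->]; have H1 := h1 _ hx; have H2 := h1 _ hy; have H3 := h2 _ hx.
have b1 : M1 <= M1 + M2 + M3 * s ^- 2 by rewrite -addrA lerDl addr_ge0.
have b2 : M2 <= M1 + M2 + M3 * s ^- 2 by rewrite addrAC lerDr addr_ge0.
split; [exact: le_trans H1 b1|exact: le_trans H2 b1|exact: le_trans H3 b2|].
have x1 := le_lt_trans hx r1; have y1 := le_lt_trans hy r1.
apply: le_trans (_ : M3 * s ^- 2 * cabs (y - x) ^+ 2 <= _); last first.
  by rewrite ler_wpM2r ?exprn_ge0 // lerDr addr_ge0.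
have L1 := psum_cvg ha y1; have L2 := psum_cvg ha x1.
have L3 := psum_cvg (unit_radius_dcoef ha) x1.
rewrite -cvg_shiftS /= in L1; rewrite -cvg_shiftS /= in L2.
apply: (ccvg_le (ccvgB (ccvgB L1 L2) (ccvgM L3 (cvg_cst (y - x))))); exists 0%N => n _.
have -> : \sum_(k < n.+1) a k * y ^+ k - \sum_(k < n.+1) a k * x ^+ k -
   (\sum_(k < n) dcoef a k * x ^+ k) * (y - x) =
   \sum_(k < n.+1) a k * (y ^+ k - x ^+ k - k%:R * x ^+ k.-1 * (y - x)).
  rewrite -sumrB [X in X - _ = _]big_ord_recl [RHS]big_ord_recl /= !expr0 subrr mul0r.
  rewrite subrr !mul0r subr0 mulr0 !add0r mulr_suml -sumrB; apply: eq_bigr => k _ /=.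
  by rewrite /dcoef /bump /=; ring.
apply: le_trans (cabs_sum _ _ _) _.
apply: le_trans (_ : \sum_(k < n.+1) cabs (k.+1%:R ^+ 2 * a k) * s ^+ k * (s ^- 2 * cabs (y - x) ^+ 2) <= _).
  apply: ler_sum => k _; rewrite cabsM.
  have := exprn_taylor k sp (le_trans hx rs) (le_trans hy rs) => h.
  rewrite [cabs (_ ^+ 2 * _)]cabsM [_ * cabs (a k)]mulrC -!mulrA ler_wpM2l //.
  apply: le_trans (_ : k%:R ^+ 2 * s ^+ k * cabs (y - x) ^+ 2 / s ^+ 2 <= _).
    by rewrite ler_pdivlMr ?exprn_gt0 // [k%:R * _]mulrA.
  have -> : k%:R ^+ 2 * s ^+ k * cabs (y - x) ^+ 2 / s ^+ 2 =
    k%:R ^+ 2 * (s ^+ k * (s ^- 2 * cabs (y - x) ^+ 2)) by ring.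
  rewrite cabsX cabs_nat ler_wpM2r //; last by rewrite lerXn2r ?nnegrE // ler_nat.
  by rewrite mulr_ge0 ?exprn_ge0 ?(ltW sp) // mulr_ge0 // exprn_ge0.
by rewrite -mulr_suml -mulrA ler_wpM2r // mulr_ge0 // exprn_ge0.
Qed.

(** The recursion on coefficients says e' = l' e, so e exp(-l) has derivative 0 and keeps its value
    1 at the origin. *)
Lemma psum_exp l e z : unit_radius l -> unit_radius e -> l 0%N = 0 -> e 0%N = 1 ->
  (forall n, n.+1%:R * e n.+1 = conv (dcoef l) e n) -> cabs z < 1 ->
  psum e z = cexp (psum l z).
Proof.
move=> hl he l0 e0 rec z1; have r01 : 0 <= cabs z < 1 by rewrite cabs_ge0.
have te := tay_psum he r01; have tl := tay_psum hl r01.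
have [B B0 hB] := psum_bounded hl r01.
have tn := tayZ (-1) tl.
have hBn x y d : hol [set w | cabs w <= cabs z] x y d ->
    [set w | cabs w <= B] (-1 * psum l x) /\ [set w | cabs w <= B] (-1 * psum l y).
  by move=> [hx hy _]; split; rewrite /= mulN1r cabsN; exact: hB.
have tx := tay_comp tn hBn (tay_cexp B0).
have prod := tayM te tx.
have : tay (hol [set w | cabs w <= cabs z]) (fun x => psum e x * cexp (-1 * psum l x)) (fun=> 0).
  case: prod => M M0 hM; exists M => // x y d h; have [h1 h2 h3 h4] := hM _ _ _ h.
  have x1 : cabs x < 1 by case: h => /= /le_lt_trans hx _ _; exact: hx.
  have dE : psum (dcoef e) x = psum (dcoef l) x * psum e x.
    rewrite -psumM //; last exact: unit_radius_dcoef.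
    by apply: eq_psum => n; rewrite -rec.
  rewrite dE in h4; split; [exact: h1|exact: h2|by rewrite cabs0|].
  by move: h4; rewrite [X in cabs (_ - X * _)](_ : _ = 0) //; ring.
move=> /tay_const/(_ z (lexx _)).
rewrite !psum0 // l0 e0 mulr0 cexp0 mulr1 mulN1r => h.
by rewrite -[LHS]mulr1 -(cexpN (psum l z)) mulrCA h mulr1.
Qed.

End PowerSeriesCalculus.

(** * Circle means as averages over roots of unity *)

Section RootsOfUnity.
Variable R : realType.
Implicit Types (a b : nat -> R[i]) (r : R) (N n j k : nat).

Definition runity N j : R[i] := cis (j%:R * (pi *+ 2 / N%:R)).

Lemma cabs_runity N j : cabs (runity N j) = 1. Proof. exact: cabs_cis. Qed.

(** For k <> n this is a geometric sum with ratio [x], where x^N = 1 and x <> 1 because |k - n| <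
    N. *)
Lemma runity_ortho N k n : (k < N)%N -> (n < N)%N ->
  \sum_(j < N) ((runity N j ^+ k)^*)%C * runity N j ^+ n = if k == n then N%:R else 0.
Proof.
move=> kN nN; have N0 : (0 < N)%N by exact: leq_ltn_trans kN.
have N0' : (N%:R : R) != 0 by rewrite pnatr_eq0 -lt0n.
pose th : R := pi *+ 2 / N%:R; pose x := cis (th * (n%:R - k%:R)).
have E j : ((runity N j ^+ k)^*)%C * runity N j ^+ n = x ^+ j.
  rewrite /x /runity -!cis_nat cis_conj -cisD -/th; congr cis; ring.
under eq_bigr do rewrite E.
have [kn|kn] := eqVneq k n.
  have -> : x = 1 by rewrite /x kn subrr mulr0 cis0.
  by under eq_bigr do rewrite expr1n; rewrite sumr_const card_ord.
have xN : x ^+ N = 1.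
  rewrite /x -cis_nat; have -> : N%:R * (th * (n%:R - k%:R)) = n%:R * (pi *+ 2) + - (k%:R * (pi *+ 2)).
    by rewrite /th; field.
  by rewrite cisD -cis_conj !cis_nat cis2pi !expr1n mul1r conjc1.
have thp m : (0 < m < N)%N -> cis (th * m%:R) != 1.
  move=> /andP[m0 mN]; apply: cis_neq1; rewrite /th mulrAC.
  have p0 := pi_gt0 R; have p2 : 0 < pi *+ 2 :> R by rewrite pmulrn_lgt0.
  rewrite divr_gt0 ?mulr_gt0 ?ltr0n //= ltr_pdivrMr ?ltr0n // ltr_pM2l // ltr_nat //.
have x1 : x != 1.
  case: (ltngtP k n) kn => // h _.
    by rewrite /x -natrB 1?ltnW // thp // subn_gt0 h /=; apply: leq_ltn_trans nN; exact: leq_subr.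
  have -> : x = (cis (th * (k - n)%:R))^*%C.
    by rewrite cis_conj natrB 1?ltnW // /x; congr cis; ring.
  apply/negP => /eqP /(congr1 conjc); rewrite conjcK conjc1 => /eqP; apply/negP.
  by rewrite thp // subn_gt0 h /=; apply: leq_ltn_trans kN; exact: leq_subr.
apply/eqP; rewrite -(mulrI_eq0 _ (mulfI (_ : x - 1 != 0))) ?subr_eq0 //.
by rewrite -subrX1 xN subrr.
Qed.

(* The limit of these averages is the mean over the circle of radius [r]. *)
Lemma psum_parseval a b r : unit_radius a -> unit_radius b -> 0 <= r < 1 ->
  (fun N => N.+1%:R^-1 * \sum_(j < N.+1) ((psum a (r%:C%C * runity N.+1 j))^*)%C
     * psum b (r%:C%C * runity N.+1 j)) @ \oo -->
  psum (fun k => ((a k)^*)%C * b k) ((r ^+ 2)%:C%C).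
Proof.
move=> ha hb r01; have /andP[r0 r1] := r01.
have [Ma [qa [Ma0 qa01 ta]]] := psum_tail ha r01.
have [Mb [qb [Mb0 qb01 tb]]] := psum_tail hb r01.
have [Ba Ba0 hBa] := psum_bounded ha r01.
have [Bb Bb0 hBb] := psum_bounded hb r01.
pose pt N j : R[i] := r%:C%C * runity N.+1 j.
have ptr N j : cabs (pt N j) <= r by rewrite cabsM cabs_runity cabs_real mulr1 ger0_norm.
pose A N z := \sum_(k < N.+1) a k * z ^+ k; pose B N z := \sum_(k < N.+1) b k * z ^+ k.
have hab : unit_radius (fun k => ((a k)^*)%C * b k).
  move=> s s01; pose p := Num.sqrt s.
  have ps : s = p ^+ 2 by rewrite sqr_sqrtr //; case/andP: s01.
  have p01 : 0 <= p < 1.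
    rewrite sqrtr_ge0 /= -(@ltr_pXn2r _ 2) ?nnegrE ?sqrtr_ge0 // -ps expr1n.
    by case/andP: s01.
  have [M hM] := ha p p01; have [M' hM'] := hb p p01; exists (M * M') => n.
  have p0 : 0 <= p by case/andP: p01.
  rewrite cabsM cabs_conj ps -exprM mulnC exprM expr2 mulrACA.
  by apply: ler_pM; rewrite ?mulr_ge0 ?exprn_ge0.
(* For the truncations at degree N the average over N + 1 roots is exact by orthogonality; the tails
   only add geometrically small errors. *)
have main N : N.+1%:R^-1 * (\sum_(j < N.+1) ((A N (pt N j))^*)%C * B N (pt N j)) =
   \sum_(k < N.+1) ((a k)^*)%C * b k * (r ^+ 2)%:C%C ^+ k.
  under eq_bigr => j _.
    rewrite /A /B rmorph_sum mulr_suml; under eq_bigr do rewrite mulr_sumr; over.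
  rewrite exchange_big /= mulr_sumr; apply: eq_bigr => k _.
  rewrite exchange_big /= (bigD1 k) //= [X in _ * (_ + X)]big1 => [|n kn].
    have E j : ((a k * pt N j ^+ k)^*)%C * (b k * pt N j ^+ k) =
        ((a k)^*)%C * b k * (r ^+ 2)%:C%C ^+ k * (((runity N.+1 j ^+ k)^*)%C * runity N.+1 j ^+ k).
      by rewrite conjM !conjX /pt conjM conjc_real real_complexX !exprMn; ring.
    under eq_bigr do rewrite E.
    rewrite -mulr_sumr runity_ortho // eqxx addr0 mulrCA mulVf ?mulr1 // pnatr_eq0.
  have E j : ((a k * pt N j ^+ k)^*)%C * (b n * pt N j ^+ n) =
        ((a k)^*)%C * b n * (r%:C%C ^+ k * r%:C%C ^+ n) * (((runity N.+1 j ^+ k)^*)%C * runity N.+1 j ^+ n).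
    by rewrite conjM !conjX /pt conjM conjc_real !exprMn; ring.
  under eq_bigr do rewrite E.
  by rewrite -mulr_sumr runity_ortho // ifN ?mulr0 // eq_sym.
have r21 : cabs ((r ^+ 2)%:C%C : R[i]) < 1.
  by rewrite cabs_real ger0_norm ?exprn_ge0 // expr_lt1.
have L := psum_cvg hab r21; rewrite -cvg_shiftS /= in L.
have D0 : (fun N => N.+1%:R^-1 * \sum_(j < N.+1) ((psum a (pt N j))^*)%C * psum b (pt N j)
   - \sum_(k < N.+1) ((a k)^*)%C * b k * (r ^+ 2)%:C%C ^+ k) @ \oo --> (0 : R[i]).
  have L1 := cvg_geoM (Ma * Bb) qa01; have L2 := cvg_geoM ((Ba + Ma) * Mb) qb01.
  apply: (@ccvg_bound _ _ _ (fun N => Ma * Bb * qa ^+ N + (Ba + Ma) * Mb * qb ^+ N));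
    last by rewrite -[X in _ --> X]addr0; exact: cvgD L1 L2.
  move=> N; rewrite subr0 -main.
  rewrite -mulrBr -sumrB cabsM cabsV cabs_nat mulrC ler_pdivrMr ?ltr0n //.
  apply: le_trans (cabs_sum _ _ _) _.
  apply: le_trans (_ : \sum_(j < N.+1) (Ma * Bb * qa ^+ N + (Ba + Ma) * Mb * qb ^+ N) <= _);
    last by rewrite sumr_const card_ord mulr_natr.
  apply: ler_sum => j _; set z := pt N j; have zr := ptr N j.
  rewrite [X in cabs X](_ : _ = ((psum a z - A N z)^*)%C * psum b z
     + ((A N z)^*)%C * (psum b z - B N z)); last by rewrite conjB; ring.
  have qle (q : R) : 0 <= q < 1 -> q ^+ N.+1 <= q ^+ N.
    by move=> /andP[q0 q1]; rewrite exprS ler_piMl ?exprn_ge0 // ltW.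
  have ta1 : cabs (psum a z - A N z) <= Ma * qa ^+ N.
    by apply: le_trans (ta N.+1 z zr) _; rewrite ler_wpM2l // qle.
  have tb1 : cabs (psum b z - B N z) <= Mb * qb ^+ N.
    by apply: le_trans (tb N.+1 z zr) _; rewrite ler_wpM2l // qle.
  have A1 : cabs (A N z) <= Ba + Ma.
    rewrite -[A N z](subKr (psum a z)); apply: le_trans (cabsD _ _) _; rewrite cabsN lerD ?hBa //.
    apply: le_trans ta1 _; rewrite ler_piMr // exprn_ile1 //; case/andP: qa01 => // _ /ltW //.
  apply: le_trans (cabsD _ _) _; rewrite !cabsM !cabs_conj; apply: lerD.
    by rewrite mulrAC; apply: ler_pM => //; exact: hBb.
  by rewrite -mulrA; apply: ler_pM.
have := ccvgD D0 L; rewrite add0r => /cvg_ext; apply => N; exact: subrK.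
Qed.
End RootsOfUnity.

(** * Radii tending to one *)

Section RadiiToOne.
Variable R : realType.
Implicit Types (k n : nat).

(** The radius attached to the index n in the Tauberian step. Since [rho 0] is 0, arguments that
    need a positive radius use [rho n.+1]. *)
Definition rho n : R := 1 - n.+1%:R^-1.

Lemma rho01 n : 0 <= rho n < 1.
Proof.
have h : (0 : R) < n.+1%:R^-1 by rewrite invr_gt0 ltr0n.
have h1 : n.+1%:R^-1 <= (1 : R) by rewrite invf_le1 ?ltr0n // ler1n.
by move: h h1; rewrite /rho; move: _^-1 => x; lra.
Qed.

Lemma cvg_rho : rho @ \oo --> (1 : R).
Proof.
rewrite -[X in _ --> X]subr0; apply: (cvgB (cvg_cst _)); exact: cvg_harmonic.
Qed.

Lemma cvg_rhoX k : (fun n => rho n ^+ k) @ \oo --> (1 : R).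
Proof.
elim: k => [|k IH]; first by under eq_fun do rewrite expr0; exact: cvg_cst.
have h := rcvgM cvg_rho IH; rewrite mulr1 in h.
by apply: (cvg_ext h) => n; rewrite exprS.
Qed.

Lemma le_limit_radius (x M : R) k : (forall r : R, 0 <= r < 1 -> x * r ^+ k <= M) -> x <= M.
Proof.
move=> h; have L : (fun n => x * rho n ^+ k) @ \oo --> x.
  by have := rcvgMl x (cvg_rhoX k); rewrite mulr1.
by apply: (rcvg_le L); exists 0%N => n _; apply: h; exact: rho01.
Qed.
End RadiiToOne.

(** * Cauchy estimates and reciprocals of polynomials *)

Section CoefficientEstimates.
Variable R : realType.
Implicit Types (a b u v q : nat -> R[i]) (c z w : R[i]) (r : R) (p : {poly R[i]}).

Lemma unit_radius_poly p : unit_radius (fun k => p`_k).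
Proof.
apply: (unit_radius_bounded (M := \sum_(k < size p) cabs p`_k)) => n.
case: (ltnP n (size p)) => h.
  rewrite (bigD1 (Ordinal h)) //= lerDl; exact: sumr_ge0.
by rewrite nth_default // cabs0; exact: sumr_ge0.
Qed.

Lemma psum_poly p z : cabs z < 1 -> psum (fun k => p`_k) z = p.[z].
Proof.
move=> z1; apply: (psum_eq (unit_radius_poly p) z1); apply/ccvgP => e e0.
exists (size p) => n hn; rewrite horner_coef (big_ord_widen n (fun i => p`_i * z ^+ i) hn).
rewrite [X in X - _](bigID (fun i : 'I_n => (i < size p)%N)) /= [X in _ + X - _]big1.
  by rewrite addr0 subrr cabs0.
by move=> i; rewrite -leqNgt => h; rewrite nth_default // mul0r.
Qed.

Lemma psum_monomial n c z : cabs z < 1 -> psum (fun k => if k == n then c else 0) z = c * z ^+ n.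
Proof.
move=> z1; have := psum_poly (c *: 'X^n) z1; rewrite hornerZ hornerXn => <-.
by apply: eq_psum => k; rewrite coefZ coefXn; case: eqP; rewrite ?mulr1 ?mulr0.
Qed.

Lemma psum_one z : cabs z < 1 -> psum (fun n => if n is 0 then 1 else 0) z = 1.
Proof.
move=> z1; have := @psum_monomial 0%N 1 z z1; rewrite expr0 mulr1 => {2}<-.
by apply: eq_psum => -[|k].
Qed.

Lemma psum_delay a z : unit_radius a -> cabs z < 1 ->
  psum (fun n => if n is m.+1 then a m else 0) z = z * psum a z.
Proof.
move=> ha z1; rewrite psum_shift ?add0r //; exact: unit_radius_delay.
Qed.

(** Cauchy's estimate, obtained by pairing [a] with the single monomial z^n in the circle mean. *)
Lemma coef_bound a r (M : R) n : unit_radius a -> 0 < r < 1 ->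
  (forall z, cabs z = r -> cabs (psum a z) <= M) -> cabs (a n) * r ^+ n <= M.
Proof.
move=> ha /andP[r0 r1] hM; have r01 : 0 <= r < 1 by rewrite ltW.
have hd : unit_radius (fun k => if k == n then 1 else 0 : R[i]).
  by apply: (unit_radius_bounded (M := 1)) => k; case: eqP => _; rewrite ?cabs1 ?cabs0.
have L := psum_parseval hd ha r01.
have r21 : cabs ((r ^+ 2)%:C%C : R[i]) < 1.
  by rewrite cabs_real ger0_norm ?exprn_ge0 ?expr_lt1 // ltW.
have E : psum (fun k => ((if k == n then 1 else 0 : R[i])^*)%C * a k) ((r ^+ 2)%:C%C) =
   a n * (r ^+ 2)%:C%C ^+ n.
  rewrite -psum_monomial //; apply: eq_psum => k.
  by case: eqP => [->|_]; rewrite ?conjc1 ?conjc0 ?mul1r ?mul0r.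
rewrite E in L; have : cabs (a n * (r ^+ 2)%:C%C ^+ n) <= r ^+ n * M.
  apply: (ccvg_le L); exists 0%N => N _.
  rewrite cabsM cabsV cabs_nat mulrC ler_pdivrMr ?ltr0n //.
  apply: le_trans (cabs_sum _ _ _) _.
  apply: le_trans (_ : \sum_(j < N.+1) r ^+ n * M <= _);
    last by rewrite sumr_const card_ord mulr_natr.
  apply: ler_sum => j _; set z := _%:C%C * _.
  have zr : cabs z = r by rewrite cabsM cabs_runity cabs_real mulr1 gtr0_norm.
  by rewrite cabsM cabs_conj psum_monomial ?zr // mul1r cabsX zr ler_wpM2l ?exprn_ge0 ?hM // ltW.
have -> : cabs (a n * (r ^+ 2)%:C%C ^+ n) = r ^+ n * (cabs (a n) * r ^+ n).
  by rewrite cabsM cabsX cabs_real ger0_norm ?exprn_ge0 ?(ltW r0) // -exprM mulnC exprM; ring.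
by rewrite ler_pM2l // exprn_gt0.
Qed.

Lemma psum_inj a b : unit_radius a -> unit_radius b ->
  (forall z, cabs z < 1 -> psum a z = psum b z) -> a =1 b.
Proof.
move=> ha hb h n; have r01 : 0 < (2^-1 : R) < 1 by rewrite invr_gt0 ltr0n invf_lt1 ?ltr1n ?ltr0n.
have hab : unit_radius (fun k => a k - b k).
  have := unit_radiusD ha (unit_radiusZ (-1) hb); congr (unit_radius _).
  by apply/funext => k; rewrite mulN1r.
have := coef_bound (M := 0) n hab r01 _.
have hz z : cabs z = 2^-1 -> cabs (psum (fun k => a k - b k) z) <= 0.
  move=> zr; have z1 : cabs z < 1 by rewrite zr; case/andP: r01.
  by rewrite psumB // h // subrr cabs0.
move=> /(_ hz) h1; apply/eqP; rewrite -subr_eq0 -cabs_eq0 eq_le cabs_ge0 andbT.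
by move: h1; rewrite pmulr_lle0 // exprn_gt0 // invr_gt0.
Qed.

Lemma unit_radius_geo c : cabs c <= 1 -> unit_radius (fun n => c ^+ n).
Proof.
by move=> c1; apply: (unit_radius_bounded (M := 1)) => n; rewrite cabsX exprn_ile1.
Qed.

Lemma psum_geo c z : cabs c <= 1 -> cabs z < 1 -> psum (fun n => c ^+ n) z * (1 - c * z) = 1.
Proof.
move=> c1 z1; have hc := unit_radius_geo c1.
have h : psum (fun n => c ^+ n) z = 1 + z * (c * psum (fun n => c ^+ n) z).
  rewrite {1}(psum_shift hc z1) expr0 -(psumZ c hc z1); congr (_ + _ * _).
  by apply: eq_psum => n; rewrite exprS.
by rewrite mulrBr mulr1 {1}h; ring.
Qed.

(** Every root c satisfies |c| >= 1, so each factor z - c is inverted by a geometric series in z /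
    c. This is the seed for inverting general zero-free power series. *)
Lemma poly_inverse p : (forall z, cabs z < 1 -> p.[z] != 0) ->
  exists2 q, unit_radius q & forall z, cabs z < 1 -> psum q z * p.[z] = 1.
Proof.
have [s ps] := closed_field_poly_normal p => hp.
have hs : all (fun c => 1 <= cabs c) s.
  apply/allP => c cs; rewrite leNgt; apply/negP => /hp; rewrite ps hornerZ horner_prod.
  by rewrite (big_rem c) //= hornerXsubC subrr mul0r mulr0 eqxx.
have l0 : lead_coef p != 0.
  by rewrite lead_coef_eq0; apply/eqP => p0; have := hp 0; rewrite p0 horner0 eqxx cabs0 ltr01 => /(_ isT).
have [q hq q1] : exists2 q, unit_radius q & forall z, cabs z < 1 ->
    psum q z * (\prod_(c <- s) ('X - c%:P)).[z] = 1.
  elim: s hs {ps} => [_|c s IH /= /andP[c1 /IH [q hq q1]]].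
    exists (fun n => 0 ^+ n) => [|z z1]; first by apply: unit_radius_geo; rewrite cabs0.
    have := @psum_geo 0 z; rewrite cabs0 mul0r subr0 mulr1 big_nil hornerC mulr1.
    by move=> ->.
  have ci : cabs c^-1 <= 1 by rewrite cabsV invf_le1 //; apply: lt_le_trans c1.
  have c0 : c != 0 by rewrite -cabs_gt0; apply: lt_le_trans c1.
  have hg := unit_radiusZ (- c^-1) (unit_radius_geo ci).
  exists (conv (fun n => - c^-1 * c^-1 ^+ n) q) => [|z z1]; first exact: unit_radius_conv.
  rewrite psumM // psumZ ?big_cons ?hornerM ?hornerXsubC //; last exact: unit_radius_geo.
  have -> : z - c = - c * (1 - c^-1 * z) by field.
  have := psum_geo ci z1; have := q1 z z1.
  move: (psum _ z) (psum _ z) (horner _ z) => Q G B h1 h2.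
  transitivity ((Q * (1 - c^-1 * z)) * (G * B)); first by field.
  by rewrite h1 h2 mulr1.
exists (fun n => (lead_coef p)^-1 * q n) => [|z z1]; first exact: unit_radiusZ.
rewrite psumZ // {2}ps hornerZ mulrACA mulVf // mul1r; exact: q1.
Qed.

End CoefficientEstimates.

(** * Compactness in the plane *)

Section Compactness.
Variable R : realType.
Implicit Types (z w : R[i]) (r : R).

Definition toC (p : R * R) : R[i] := Complex p.1 p.2.

Lemma cabs_toC (p q : R * R) : cabs (toC p - toC q) <= `|p.1 - q.1| + `|p.2 - q.2|.
Proof. by apply: le_trans (cabs_le_reim _) _. Qed.

Lemma lipschitz_within (V : normedModType R) (A : set (R * R)) (F : R * R -> V) (L : R) :
  (forall p q, A p -> A q -> `|F p - F q| <= L * cabs (toC p - toC q)) -> {within A, continuous F}.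
Proof.
move=> h; apply/subspace_continuousP => x Ax; apply/cvgrPdist_lt => e e0.
pose d := e / (2 * (`|L| + 1)).
have L1 : 0 < `|L| + 1 by have := normr_ge0 L; lra.
have d0 : 0 < d by rewrite divr_gt0 // mulr_gt0.
have : nbhs x (ball x d) by exact: nbhsx_ballx.
rewrite /within /=; apply: filterS => y [/= b1 b2] Ay.
apply: le_lt_trans (h _ _ Ax Ay) _.
have b : cabs (toC x - toC y) < 2 * d.
  by apply: le_lt_trans (cabs_toC _ _) _; move: b1 b2; rewrite /ball /=; lra.
apply: le_lt_trans (_ : (`|L| + 1) * cabs (toC x - toC y) < _).
  by rewrite ler_wpM2r // (le_trans (ler_norm L)) // lerDl.
have -> : e = (`|L| + 1) * (2 * d) by rewrite /d; field; rewrite gt_eqF.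
by rewrite ltr_pM2l.
Qed.

Lemma compact_rect (a b c d : R) : compact (`[a, b] `*` `[c, d]).
Proof. by apply: compact_setX; exact: segment_compact. Qed.

Lemma compact_disc r : compact [set p | cabs (toC p) <= r].
Proof.
apply: (subclosed_compact _ (@compact_rect (- r) r (- r) r)); last first.
  move=> [x y] /= h; have := le_trans (re_le_cabs _) h; have := le_trans (im_le_cabs _) h.
  by rewrite /= !in_itv /= !ler_norml.
have cF : continuous (fun p => cabs (toC p)).
  apply/continuous_subspace_setT; apply: (lipschitz_within (L := 1)) => p q _ _.
  by rewrite mul1r; exact: cabs_distB.
by apply: (@closed_comp _ _ _ [set x | x <= r] (fun p _ => cF p)); exact: closed_le.
Qed.

Lemma compact_min (K : set (R * R)) (F : R[i] -> R) (L : R) : compact K -> K !=set0 ->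
  (forall p q, K p -> K q -> `|F (toC p) - F (toC q)| <= L * cabs (toC p - toC q)) ->
  exists2 p, K p & forall q, K q -> F (toC p) <= F (toC q).
Proof.
move=> cK K0 hL; have [p pK hp] := compact_EVT_min K0 cK (lipschitz_within hL).
by exists p => [|q qK]; [exact: set_mem|apply: hp; exact: mem_set].
Qed.

Lemma disc_min (F : R[i] -> R) (L r : R) : 0 <= r ->
  (forall z w, cabs z <= r -> cabs w <= r -> `|F z - F w| <= L * cabs (z - w)) ->
  exists2 z, cabs z <= r & forall w, cabs w <= r -> F z <= F w.
Proof.
move=> r0 h; have [||p pK hp] := compact_min (F := F) (L := L) (@compact_disc r).
- by exists (0, 0); rewrite /= /toC /= cabs0.
- by move=> p q /= hp hq; exact: h.
exists (toC p) => // -[x y] wr; exact: (hp (x, y)).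
Qed.

(* Bolzano-Weierstrass on the unit circle, stated through an arbitrary directed
   property so that no subsequence needs to be named. *)
Lemma circle_cluster (Q : nat -> R[i] -> Prop) :
  (forall N, exists n s, [/\ (N <= n)%N, cabs s = 1 & Q n s]) ->
  exists s0, cabs s0 = 1 /\ forall e : R, 0 < e -> forall N,
    exists n s, [/\ (N <= n)%N, cabs s = 1, Q n s & cabs (s - s0) < e].
Proof.
move=> h; have {h} [n hn] := choice h; have {hn} [s hs] := choice hn.
pose F := (fun k => (re (s k), im (s k))) @ \oo.
have FF : ProperFilter F by exact: fmap_proper_filter.
have FD : F [set p | cabs (toC p) <= 1].
  exists 0%N => // k _ /=; have [_ h _] := hs k; rewrite /toC /=.
  by move: h; case: (s k) => x y /= ->.
have [p [_ clp]] := compact_disc FF FD.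
have key (e : R) (N : nat) : 0 < e -> exists k, (N <= k)%N /\ cabs (s k - toC p) < e.
  move=> e0; have e2 : 0 < e / 2 by lra.
  have FN : F [set q | exists2 k, (N <= k)%N & q = (re (s k), im (s k))].
    by exists N => // k /= Nk; exists k.
  have [q [[k Nk ->] /= [b1 b2]]] := clp _ _ FN (nbhsx_ballx p _ e2).
  exists k; split => //; apply: le_lt_trans (cabs_le_reim _) _.
  rewrite reB imB /=; move: b1 b2; rewrite /ball /= => b1 b2.
  by rewrite distrC [X in _ + X]distrC; lra.
exists (toC p); split.
  apply/eqP; rewrite eq_le; apply/andP; split; apply/ler_addgt0Pl => e e0.
    have [k [_ hk]] := key e 0%N e0; have [_ h1 _] := hs k.
    by have := cabs_geB (toC p) (s k); rewrite cabsB h1; lra.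
  have [k [_ hk]] := key e 0%N e0; have [_ h1 _] := hs k.
  by have := cabs_geB (s k) (toC p); rewrite h1; lra.
move=> e e0 N; have [k [Nk hk]] := key e N e0; have [h1 h2 h3] := hs k.
by exists (n k), (s k); split => //; exact: leq_trans h1.
Qed.

End Compactness.

(** * Reciprocals of zero-free power series *)

Section Inverse.
Variable R : realType.
Implicit Types (u v : nat -> R[i]) (z : R[i]).

Definition inv_step u (v : nat -> R[i]) n : R[i] :=
  if n is m.+1 then - \sum_(k < n) u k.+1 * v (m - k)%N else 1.

Definition inv_coef u := course_rec 0 (inv_step u).

Lemma inv_coefE u n : inv_coef u n = inv_step u (inv_coef u) n.
Proof.
apply: course_recE => g h [|m] //= gh; congr (- _); apply: eq_bigr => k _.
by rewrite gh // ltnS leq_subr.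
Qed.

Lemma conv_inv u n : u 0%N = 1 -> conv u (inv_coef u) n = if n is 0 then 1 else 0.
Proof.
move=> u0; case: n => [|n]; first by rewrite /conv big_ord1 u0 mul1r inv_coefE.
by rewrite /conv big_ord_recl subn0 u0 mul1r inv_coefE /= addrC subrr.
Qed.

(** On |z| <= r the modulus of the sum has a positive minimum [d]. A long truncation, rescaled by r,
    is then at least d / 2 on the closed unit disc, and the coefficients of its reciprocal are at
    most 2 / d by Cauchy. Up to the degree of truncation these are the coefficients of 1 / u times
    r^k. *)
Lemma unit_radius_inv u : unit_radius u -> u 0%N = 1 ->
  (forall z, cabs z < 1 -> psum u z != 0) -> unit_radius (inv_coef u).
Proof.
move=> hu u0 unz r r01; have /andP[r0 r1] := r01.
have tu := tay_psum hu r01; have [L L0 hL] := tay_lip tu.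
have [z0 z0r hz0] : exists2 z, cabs z <= r & forall w, cabs w <= r ->
    cabs (psum u z) <= cabs (psum u w).
  apply: (@disc_min _ (fun z => cabs (psum u z)) L) => // z w zr wr.
  by rewrite cabsB; apply: le_trans (cabs_distB _ _) _; rewrite cabsB; exact: hL (And3 zr wr erefl).
set d := cabs (psum u z0) in hz0.
have d0 : 0 < d by rewrite cabs_gt0 unz // (le_lt_trans z0r).
have [M [q [M0 q01 tl]]] := psum_tail hu r01.
have [N0 hN0] : exists N0, forall n, (N0 <= n)%N -> M * q ^+ n <= d / 2.
  have /rcvgP := cvg_geoM M q01; move=> /(_ (d / 2)) [|N hN]; first by lra.
  exists N => n Nn; have := hN n Nn; rewrite subr0 => h.
  by apply: le_trans (ler_norm _) (ltW h).
(* [N0] makes the truncation error at most d / 2; [n.+1] keeps every coefficient up to index n. *)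
exists (2 / d) => n; pose N := maxn N0 n.+1.
pose p := \poly_(k < N) (u k * r%:C%C ^+ k).
have pE z : p.[z] = \sum_(k < N) u k * (r%:C%C * z) ^+ k.
  by rewrite horner_poly; apply: eq_bigr => k _; rewrite exprMn mulrA.
have plow z : cabs z <= 1 -> d / 2 <= cabs p.[z].
  move=> z1; have zr : cabs (r%:C%C * z) <= r.
    by rewrite cabsM cabs_real ger0_norm // ler_piMr.
  have h1 := hz0 _ zr; have h2 := tl N _ zr; rewrite -pE in h2.
  have h3 := hN0 N (leq_maxl _ _).
  by have := cabs_geB (psum u (r%:C%C * z)) (psum u (r%:C%C * z) - p.[z]); rewrite subKr; lra.
have [|g hg g1] := @poly_inverse R p.
  by move=> z z1; rewrite -cabs_gt0; apply: lt_le_trans (plow _ (ltW z1)); lra.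
have gb k : cabs (g k) <= 2 / d.
  apply: (le_limit_radius (k := k)) => s /andP[s0 s1].
  have hz z : cabs z < 1 -> cabs (psum g z) <= 2 / d.
    move=> z1; have := congr1 (@cabs R) (g1 z z1); rewrite cabsM cabs1 => h.
    have h2 := plow _ (ltW z1); have p0 : 0 < cabs p.[z] by apply: lt_le_trans h2; lra.
    have -> : cabs (psum g z) = (cabs p.[z])^-1.
      by apply: (mulIf (lt0r_neq0 p0)); rewrite h mulVf // gt_eqF.
    by rewrite -[2 / d]invrK invf_div lef_pV2 // posrE //; lra.
  case: (ltgtP 0 s) s0 => // [sp _|<- _].
    by apply: coef_bound; rewrite ?sp // => z zs; apply: hz; rewrite zs.
  case: k => [|k]; last by rewrite exprS mul0r mulr0 divr_ge0 // ltW.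
  by rewrite expr0 mulr1 -psum0 //; apply: hz; rewrite cabs0.
have cpg : conv (fun k => p`_k) g =1 fun n => if n is 0 then 1 else 0.
  apply: psum_inj => [||z z1].
  - by apply: unit_radius_conv => //; exact: unit_radius_poly.
  - by apply: (unit_radius_bounded (M := 1)) => -[|k]; rewrite ?cabs1 ?cabs0.
  rewrite psumM //; last exact: unit_radius_poly.
  by rewrite psum_poly // mulrC g1 // psum_one.
(* The recursion for the reciprocal at k reads coefficients up to k only, which the truncation has
   not changed. *)
have gE k : (k <= n)%N -> g k = inv_coef u k * r%:C%C ^+ k.
  elim/ltn_ind: k => k IH kn.
  have kN : (k < N)%N by rewrite /N leq_max ltnS kn orbT.
  have N0' : (0 < N)%N by exact: leq_ltn_trans kN.
  have := cpg k; rewrite /conv big_ord_recl subn0 coef_poly N0' u0 expr0 mulr1 mul1r.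
  case: k IH kn kN => [|k] IH kn kN.
    by rewrite big_ord0 addr0 => ->; rewrite inv_coefE expr0 mulr1.
  move=> /eqP; rewrite addr_eq0 => /eqP ->; rewrite inv_coefE /= mulNr; congr (- _).
  rewrite mulr_suml; apply: eq_bigr => i _; rewrite /bump /= add1n subSS.
  have ik : (i <= k)%N by rewrite -ltnS.
  rewrite IH ?ltnS ?leq_subr //; last by apply: leq_trans (leq_subr _ _) (ltnW kn).
  rewrite coef_poly (leq_ltn_trans _ kN) // mulrACA -exprD addSn subnKC //.
have := gb n; rewrite gE // cabsM cabsX cabs_real ger0_norm //.
Qed.

Lemma psum_inv u z : unit_radius u -> u 0%N = 1 ->
  (forall z, cabs z < 1 -> psum u z != 0) -> cabs z < 1 ->
  psum u z * psum (inv_coef u) z = 1.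
Proof.
move=> hu u0 unz z1; rewrite -psumM //; last exact: unit_radius_inv.
rewrite -(psum_one z1).
by apply: eq_psum => n; rewrite conv_inv //; case: n.
Qed.
End Inverse.

(** * Plane Lebesgue measure under shears and rotations *)

Section PlaneMeasure.
Variable R : realType.

Definition mu2 : {measure set (measurableTypeR R * measurableTypeR R) -> \bar R} :=
  (lebesgue_measure \x lebesgue_measure)%E.

Lemma lebesgue_translate (c : R) (B : set (measurableTypeR R)) : measurable B ->
  lebesgue_measure [set x : R | B (x + c)] = lebesgue_measure B.
Proof.
have mf : measurable_fun [set: measurableTypeR R] (fun x : measurableTypeR R => x + c : measurableTypeR R).
  apply: measurable_funD => //; exact: measurable_cst.
pose m := measure_function_pushforward__canonical__measure_function_Measure
  (@lebesgue_measure R) mf.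
move=> mB; symmetry; apply: (@lebesgue_measure_unique R m) => // X [[a b] _ <-] /=.
rewrite /pushforward.
have -> : (fun x : R => x + c) @^-1` `]a, b] = `]a - c, b - c].
  by apply/seteqP; split => x /=; rewrite !in_itv /=; lra.
rewrite !lebesgue_measure_itv /= !lte_fin ltrD2r; case: ifP => // _.
by rewrite -!EFinB; congr EFin; ring.
Qed.

Lemma mu2X (A B : set (measurableTypeR R)) : measurable A -> measurable B ->
  mu2 (A `*` B) = (lebesgue_measure A * lebesgue_measure B)%E.
Proof. exact: product_measure1E. Qed.

Lemma mu2_unique (m : {measure set (measurableTypeR R * measurableTypeR R) -> \bar R}) X :
  (forall A B : set (measurableTypeR R), measurable A -> measurable B ->
    m (A `*` B) = (lebesgue_measure A * lebesgue_measure B)%E) -> measurable X -> mu2 X = m X.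
Proof. by move=> h mX; apply: product_measure_unique. Qed.

Lemma measurable_affine (a b c : R) : measurable_fun [set: measurableTypeR R * measurableTypeR R]
  (fun p : measurableTypeR R * measurableTypeR R => a * p.1 + b * p.2 + c : measurableTypeR R).
Proof.
apply: measurable_funD; last exact: measurable_cst.
by apply: measurable_funD; apply: measurable_funM => //; exact: measurable_cst.
Qed.

(** On each vertical section the shear is a translation, so it preserves the measure of rectangles,
    and the product measure is determined by those. *)
Lemma mu2_shear (c : R) (X : set (measurableTypeR R * measurableTypeR R)) : measurable X ->
  mu2 ((fun p => (p.1, p.2 + c * p.1)) @^-1` X) = mu2 X.
Proof.
have mf : measurable_fun [set: measurableTypeR R * measurableTypeR R]
  (fun p : measurableTypeR R * measurableTypeR R => (p.1, p.2 + c * p.1) : measurableTypeR R * measurableTypeR R).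
  apply: measurable_fun_pair; first exact: measurable_fst.
  have := measurable_affine c 1 0; congr (measurable_fun _ _).
  by apply/funext => p; rewrite mul1r addr0 addrC.
pose m := measure_function_pushforward__canonical__measure_function_Measure mu2 mf.
move=> mX; symmetry; apply: (@mu2_unique m) => // A B mA mB /=.
rewrite /pushforward /mu2 /= /product_measure1.
rewrite (eq_integral (fun x => ((\1_A x)%:E * lebesgue_measure B)%E)).
  rewrite ge0_integralZr //; last by apply/measurable_EFinP; exact: measurable_indic.
  by rewrite integral_indic // setIT.
move=> x _ /=; rewrite indicE; case: (boolP (x \in A)) => xA /=.
  rewrite mul1e -(lebesgue_translate (c * x) mB); congr (lebesgue_measure _).
  apply/seteqP; split => y; rewrite /xsection /= ?inE /=; first by case.
  by split => //; exact: set_mem.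
rewrite mul0e (_ : xsection _ x = set0) ?measure0 //.
apply/seteqP; split => y //; rewrite /xsection /= ?inE /= => -[/mem_set].
by rewrite (negbTE xA).
Qed.

Local Notation P2 := (measurableTypeR R * measurableTypeR R)%type.

Lemma measurable_pair_affine (a b c d : R) :
  measurable_fun [set: P2] (fun p : P2 => (a * p.1 + b * p.2, c * p.1 + d * p.2) : P2).
Proof.
apply: measurable_fun_pair.
- have := measurable_affine a b 0; congr (measurable_fun _ _).
  by apply/funext => p; rewrite addr0.
- have := measurable_affine c d 0; congr (measurable_fun _ _).
  by apply/funext => p; rewrite addr0.
Qed.

Lemma measurable_preimage (f : P2 -> P2) (X : set P2) : measurable_fun [set: P2] f ->
  measurable X -> measurable (f @^-1` X).
Proof. by move=> mf mX; rewrite -[X in measurable X]setTI; apply: mf. Qed.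

Lemma mu2_swap (X : set P2) : measurable X -> mu2 ((fun p => (p.2, p.1)) @^-1` X) = mu2 X.
Proof.
have mf : measurable_fun [set: P2] (fun p : P2 => (p.2, p.1) : P2).
  by apply: measurable_fun_pair; [exact: measurable_snd|exact: measurable_fst].
pose m := measure_function_pushforward__canonical__measure_function_Measure mu2 mf.
move=> mX; symmetry; apply: (@mu2_unique m) => // A B mA mB /=.
rewrite /pushforward (_ : _ @^-1` _ = B `*` A); first by rewrite mu2X // muleC.
by apply/seteqP; split => -[x y] /= [].
Qed.

Lemma mu2_shear2 (c : R) (X : set P2) : measurable X ->
  mu2 ((fun p => (p.1 + c * p.2, p.2)) @^-1` X) = mu2 X.
Proof.
have mf : measurable_fun [set: P2] (fun p : P2 => (p.2, p.1) : P2).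
  by apply: measurable_fun_pair; [exact: measurable_snd|exact: measurable_fst].
have ms : measurable_fun [set: P2] (fun p : P2 => (p.1, p.2 + c * p.1) : P2).
  have := measurable_pair_affine 1 0 c 1; congr (measurable_fun _ _).
  by apply/funext => p; congr pair; ring.
move=> mX; have m1 := measurable_preimage mf mX; have m2 := measurable_preimage ms m1.
by rewrite -(mu2_swap mX) -(mu2_shear c m1) -(mu2_swap m2).
Qed.

(** A rotation by an angle theta other than a half-turn is a product of three shears; the outer two
    have parameter a = - s / (1 + c) = - tan (theta / 2). *)
Lemma mu2_rot (c s : R) (X : set P2) : c ^+ 2 + s ^+ 2 = 1 -> c != -1 -> measurable X ->
  mu2 ((fun p => (c * p.1 - s * p.2, s * p.1 + c * p.2)) @^-1` X) = mu2 X.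
Proof.
move=> cs c1 mX; have c1' : 1 + c != 0 by rewrite addrC addr_eq0.
have m1 a : measurable_fun [set: P2] (fun p : P2 => (p.1 + a * p.2, p.2) : P2).
  have := measurable_pair_affine 1 a 0 1; congr (measurable_fun _ _).
  by apply/funext => p; congr pair; ring.
have m2 : measurable_fun [set: P2] (fun p : P2 => (p.1, p.2 + s * p.1) : P2).
  have := measurable_pair_affine 1 0 s 1; congr (measurable_fun _ _).
  by apply/funext => p; congr pair; ring.
pose a := - s / (1 + c).
have n1 := measurable_preimage (m1 a) mX; have n2 := measurable_preimage m2 n1.
rewrite -(mu2_shear2 a mX) -(mu2_shear s n1) -(mu2_shear2 a n2).
have as1 : a * s = c - 1.
  rewrite /a mulrAC; have -> : - s * s = (c - 1) * (1 + c) by rewrite -[1 + c]addr0; lra.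
  by rewrite mulfK.
have ac : a * c = - s - a by rewrite /a; field.
have E1 (x y : R) : x + a * y + a * (y + s * (x + a * y)) = c * x - s * y.
  transitivity (x + 2 * (a * y) + (a * s) * x + (a * s) * a * y); first by ring.
  by rewrite as1 -[c * x]addr0; transitivity (c * x + a * y + a * c * y); [ring|rewrite ac; ring].
have E2 (x y : R) : y + s * (x + a * y) = s * x + c * y.
  by transitivity (y + s * x + (a * s) * y); [ring|rewrite as1; ring].
by congr (mu2 _); apply/seteqP; split => -[x y] /=; rewrite E1 E2.
Qed.

Lemma measurable_rect (x1 x2 y1 y2 : R) : measurable (`[x1, x2] `*` `[y1, y2] : set P2).
Proof. by apply: measurableX; exact: measurable_itv. Qed.

Lemma mu2_rect (x1 x2 y1 y2 : R) : x1 <= x2 -> y1 <= y2 ->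
  mu2 (`[x1, x2] `*` `[y1, y2]) = ((x2 - x1) * (y2 - y1))%:E.
Proof.
move=> x12 y12; rewrite mu2X; [|exact: measurable_itv..].
rewrite !lebesgue_measure_itv /= !lte_fin EFinM !EFinB.
case: ltP => hx; last by rewrite (_ : x2 = x1) ?subee ?mul0e //; lra.
by case: ltP => hy; last by rewrite (_ : y2 = y1) ?subee ?mule0 //; lra.
Qed.

Definition rot_rect (a : R[i]) (x1 x2 y1 y2 : R) : set P2 :=
  [set p | x1 <= re (a * toC p) <= x2 /\ y1 <= im (a * toC p) <= y2].

Lemma rot_rectE a x1 x2 y1 y2 : rot_rect a x1 x2 y1 y2 =
  (fun p : P2 => (re a * p.1 + - im a * p.2, im a * p.1 + re a * p.2) : P2) @^-1`
    (`[x1, x2] `*` `[y1, y2]).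
Proof.
apply/seteqP; split => -[u v]; rewrite /rot_rect /= !in_itv /= reM imM /= mulNr.
  by rewrite [im a * u + _]addrC.
by rewrite [im a * u + _]addrC.
Qed.

Lemma measurable_rot_rect a x1 x2 y1 y2 : measurable (rot_rect a x1 x2 y1 y2).
Proof.
rewrite rot_rectE; apply: measurable_preimage; first exact: measurable_pair_affine.
exact: measurable_rect.
Qed.

Lemma mu2_rot_rect (a : R[i]) (x1 x2 y1 y2 : R) : cabs a = 1 -> x1 <= x2 -> y1 <= y2 ->
  mu2 (rot_rect a x1 x2 y1 y2) = ((x2 - x1) * (y2 - y1))%:E.
Proof.
move=> a1 x12 y12; have := sqr_cabs a; rewrite a1 expr1n => cs.
have [c1|c1] := eqVneq (re a) (-1); last first.
  rewrite -mu2_rect // -(mu2_rot (esym cs) c1 (measurable_rect x1 x2 y1 y2)).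
  rewrite rot_rectE; congr (mu2 _); apply/seteqP.
  by split => -[u v] /=; rewrite mulNr.
(* The half-turn is out of reach of the three shears, but it sends the rectangle to its point
   reflection. *)
have s0 : im a = 0 by apply/eqP; rewrite -sqrf_eq0; move: cs; rewrite c1; lra.
have -> : rot_rect a x1 x2 y1 y2 = `[- x2, - x1] `*` `[- y2, - y1].
  rewrite rot_rectE c1 s0; apply/seteqP; split => -[u v] /=; rewrite !in_itv /=; lra.
by rewrite mu2_rect ?lerN2 //; congr EFin; ring.
Qed.

(* An open set is a countable union of rectangles with rational corners. *)
Lemma open_measurable2 (U : set (R * R)) : open U -> measurable (U : set P2).
Proof.
move=> oU; pose rc (q : rat * rat * (rat * rat)) : set (R * R) :=
  `[ratr q.1.1 : R, ratr q.1.2] `*` `[ratr q.2.1 : R, ratr q.2.2].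
pose F q := if `[< rc q `<=` U >] then rc q else set0.
have -> : U = \bigcup_q F q.
  apply/seteqP; split => [p Up|p [q _]]; last by rewrite /F; case: asboolP => // h; exact: h.
  have : nbhs p U by apply: open_nbhs_nbhs.
  move=> /nbhs_ballP [e /= e0 he].
  have rq (x : R) : exists q : rat * rat, [/\ ratr q.1 <= x, x <= ratr q.2 &
      forall y : R, ratr q.1 <= y -> y <= ratr q.2 -> `|x - y| < e].
    have xe : x - e / 2 < x by lra.
    have xe' : x < x + e / 2 by lra.
    have [q1 /andP[h1 h2]] := rat_in_itvoo xe; have [q2 /andP[h3 h4]] := rat_in_itvoo xe'.
    exists (q1, q2); split => /=; [exact: ltW|exact: ltW|move=> y y1 y2].
    by rewrite !bnd_simp in h1 h2 h3 h4; rewrite ltr_norml; lra.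
  have [q [a1 a2 a3]] := rq p.1; have [q' [b1 b2 b3]] := rq p.2.
  exists (q, q') => //; rewrite /F; case: asboolP => [_|[]].
    by split; rewrite /= in_itv /= ?a1 ?b1.
  move=> y [/= ]; rewrite !in_itv /= => /andP[c1 c2] /andP[d1 d2].
  by apply: he; split; rewrite /ball /=; [exact: a3|exact: b3].
apply: countable_bigcupT_measurable; first exact: countableP.
move=> q; rewrite /F; case: asboolP => _; last exact: measurable0.
exact: measurable_rect.
Qed.

Lemma compact_measurable2 (K : set (R * R)) : compact K -> measurable (K : set P2).
Proof.
move=> /(compact_closed (@norm_hausdorff _ _)) /closed_openC/open_measurable2/measurableC.
by rewrite setCK.
Qed.

End PlaneMeasure.
Arguments mu2 {R}.

(** * Area of the image of a small cell *)

Section Cells.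
Variable R : realType.
Local Notation P2 := (measurableTypeR R * measurableTypeR R)%type.
Implicit Types (G : R[i] -> R[i]) (S : set R[i]) (z w : R[i]).

Definition fromC z : R * R := (re z, im z).

Lemma toCK (p : R * R) : fromC (toC p) = p. Proof. by case: p. Qed.
Lemma fromCK z : toC (fromC z) = z. Proof. by case: z. Qed.

Definition cimg G (Q : set (R * R)) : set (R * R) := (fun q => fromC (G (toC q))) @` Q.

Lemma cimgP G Q p : cimg G Q p <-> exists2 q, Q q & G (toC q) = toC p.
Proof.
split=> [[q Qq <-]|[q Qq e]]; first by exists q; rewrite ?fromCK.
by exists q; rewrite ?e ?toCK.
Qed.

Lemma norm_fromC z w : `|fromC z - fromC w| <= cabs (z - w).
Proof. by rewrite prod_normE /= ge_max -reB -imB re_le_cabs im_le_cabs. Qed.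

Lemma cimg_compact G (L : R) (Q : set (R * R)) : compact Q ->
  (forall p q, Q p -> Q q -> cabs (G (toC p) - G (toC q)) <= L * cabs (toC p - toC q)) ->
  compact (cimg G Q).
Proof.
move=> cQ hL; apply: continuous_compact => //; apply: (lipschitz_within (L := L)) => p q Qp Qq.
by apply: le_trans (norm_fromC _ _) _; exact: hL.
Qed.

(* A modulus |G - w| has no positive interior minimum where G' does not vanish. *)
Lemma min_modulus_zero G (g : R[i]) (M eps : R) z w : 0 < eps -> 0 <= M -> g != 0 ->
  (forall y, cabs (y - z) < eps -> cabs (G y - G z - g * (y - z)) <= M * cabs (y - z) ^+ 2 /\
     cabs (G z - w) <= cabs (G y - w)) -> G z = w.
Proof.
move=> e0 M0 gn0 h; apply/eqP; rewrite -subr_eq0; apply/negPn/negP => v0.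
set v := G z - w in v0; have vp : 0 < cabs v by rewrite cabs_gt0.
have gp : 0 < cabs g by rewrite cabs_gt0.
(* The step 1 / k along the Newton direction - v / g is small for three reasons, one per summand: it
   is at most 1, the quadratic error is less than the linear gain, and the new point stays within
   [eps]. *)
pose k := 1 + M * cabs v / cabs g ^+ 2 + cabs v / (cabs g * eps).
have k1 : 0 <= M * cabs v / cabs g ^+ 2 by rewrite divr_ge0 ?exprn_ge0 ?mulr_ge0.
have k2 : 0 < cabs v / (cabs g * eps) by rewrite divr_gt0 ?mulr_gt0.
have kp : 0 < k by rewrite /k; lra.
pose s := k^-1; have sp : 0 < s by rewrite invr_gt0.
have sk : s * k = 1 by rewrite mulVf // gt_eqF.
have s1 : s <= 1 by rewrite invf_le1 // /k; lra.
have sM : s * (M * cabs v / cabs g ^+ 2) < 1.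
  by rewrite -sk ltr_pM2l // /k; lra.
have se : s * (cabs v / (cabs g * eps)) < 1.
  by rewrite -sk ltr_pM2l // /k; lra.
pose y := z - s%:C%C * (v / g).
have yz : y - z = - (s%:C%C * (v / g)) by rewrite /y addrC addKr.
have cyz : cabs (y - z) = s * (cabs v / cabs g).
  by rewrite yz cabsN !cabsM cabsV cabs_real gtr0_norm.
have [|h1 h2] := h y.
  rewrite cyz; have -> : s * (cabs v / cabs g) = s * (cabs v / (cabs g * eps)) * eps.
    by field; rewrite !gt_eqF.
  by rewrite -[ltRHS]mul1r ltr_pM2r.
have h3 : cabs (G y - w) <= cabs v * (1 - s) + M * cabs (y - z) ^+ 2.
  have -> : G y - w = v * (1 - s)%:C%C + (G y - G z - g * (y - z)).
    by rewrite yz rmorphB /= /v; field.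
  by apply: le_trans (cabsD _ _) _; rewrite cabsM cabs_real ger0_norm ?subr_ge0 // lerD.
have : M * cabs (y - z) ^+ 2 < cabs v * s.
  rewrite cyz; have -> : M * (s * (cabs v / cabs g)) ^+ 2 = s * (M * cabs v / cabs g ^+ 2) * (cabs v * s).
    by field; rewrite gt_eqF.
  by rewrite -[ltRHS]mul1r ltr_pM2r // mulr_gt0.
by rewrite -/v in h2; lra.
Qed.

(** Half-open, so that adjacent cells are disjoint and tile a rectangle exactly. *)
Definition hrect (a b c d : R) : set (R * R) := `[a, b[ `*` `[c, d[.

Lemma rectP (a b c d : R) p : (`[a, b] `*` `[c, d]) p <-> (a <= p.1 <= b /\ c <= p.2 <= d).
Proof. by case: p => x y; split=> -[]; rewrite /= !in_itv. Qed.

Lemma hrectP (a b c d : R) p : hrect a b c d p <-> (a <= p.1 < b /\ c <= p.2 < d).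
Proof. by rewrite /hrect; case: p => x y; split=> -[]; rewrite /= !in_itv. Qed.

Section OneCell.
Variables (G G' : R[i] -> R[i]) (M t d1 s d2 : R).
Local Notation D := (d1 + d2).
Local Notation Q := (`[t, t + d1] `*` `[s, s + d2]).
Local Notation H := (hrect t (t + d1) s (s + d2)).
Local Notation q0 := (Complex t s).
Hypotheses (M0 : 0 < M) (d10 : 0 < d1) (d20 : 0 < d2) (D1 : D <= 1).
Hypothesis hG : forall p q, Q p -> Q q -> cabs (G' (toC p)) <= M /\
  cabs (G (toC q) - G (toC p) - G' (toC p) * (toC q - toC p)) <= M * cabs (toC q - toC p) ^+ 2.

Let a := G' q0.
(** Bound for the error of linearising [G] over the whole cell. *)
Let k := M * D ^+ 2.
Let D0 : 0 < D. Proof. by rewrite addr_gt0. Qed.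
Let k0 : 0 < k. Proof. by rewrite mulr_gt0 ?exprn_gt0. Qed.

Let Qq0 : Q (t, s).
Proof. by apply/rectP; rewrite /= !lexx !lerDl !ltW. Qed.

Let Qdist p q : Q p -> Q q -> cabs (toC p - toC q) <= D.
Proof.
move=> /rectP[p1 p2] /rectP[q1 q2].
by apply: le_trans (cabs_toC _ _) (lerD _ _); rewrite ler_norml; lra.
Qed.

Let aM : cabs a <= M. Proof. by have [] := hG Qq0 Qq0. Qed.

(** After rotating the image by [b], the linear part of [G] at the corner is a dilation by |a|, so
    the image of a cell is close to an axis-parallel rectangle. *)
Let unit_dir : exists2 b : R[i], cabs b = 1 & b * a = (cabs a)%:C%C.
Proof.
have [a0|a0] := eqVneq a 0; first by exists 1; rewrite ?cabs1 // a0 cabs0 mulr0.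
have ap : 0 < cabs a by rewrite cabs_gt0.
exists ((a^*)%C * ((cabs a)^-1)%:C%C).
  by rewrite cabsM cabs_conj cabs_real gtr0_norm ?invr_gt0 // divff // gt_eqF.
rewrite mulrAC [_ * a]mulrC mulcJ -real_complexM expr2 mulfK // gt_eqF //.
Qed.

Let linear_err p : Q p -> cabs (G (toC p) - G q0 - a * (toC p - q0)) <= k.
Proof.
move=> Qp; have [_ h] := hG Qq0 Qp; apply: le_trans h _.
by rewrite ler_wpM2l ?(ltW M0) // lerXn2r ?nnegrE ?(ltW D0) //; exact: Qdist.
Qed.

Let linear_part b p : b * a = (cabs a)%:C%C -> cabs b = 1 -> Q p ->
  `|re (b * G (toC p)) - (re (b * G q0) + cabs a * (p.1 - t))| <= k /\
  `|im (b * G (toC p)) - (im (b * G q0) + cabs a * (p.2 - s))| <= k.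
Proof.
move=> ba b1 Qp; set e := G (toC p) - G q0 - a * (toC p - q0).
have eb : cabs (b * e) <= k by rewrite cabsM b1 mul1r; exact: linear_err.
have E : b * G (toC p) = b * G q0 + (cabs a)%:C%C * (toC p - q0) + b * e.
  by rewrite -ba /e; ring.
rewrite E !reD !imD reZ imZ reB imB /=.
have h1 := le_trans (re_le_cabs _) eb; have h2 := le_trans (im_le_cabs _) eb.
by split; rewrite addrAC subrr add0r.
Qed.

Let kD : k <= M * D /\ k * k <= M ^+ 2 * D ^+ 3.
Proof.
have D0' := ltW D0; have k1 : k <= M * D.
  by rewrite /k expr2 mulrA ler_piMr // mulr_ge0 // ltW.
split=> //; have -> : M ^+ 2 * D ^+ 3 = (M * D) * k by rewrite /k; ring.
by rewrite ler_wpM2r // ltW.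
Qed.

(** The image stays within [k] of the linear image, so 2k is added to each side; as [k] is of second
    order in [D], the excess area is of third order. *)
Lemma cell_upper : exists b x1 x2 y1 y2,
  [/\ cimg G H `<=` rot_rect b x1 x2 y1 y2 & (mu2 (rot_rect b x1 x2 y1 y2) <=
    (cabs a ^+ 2 * (d1 * d2) + 12 * M ^+ 2 * D ^+ 3)%:E)%E].
Proof.
have [b b1 ba] := unit_dir.
set X := re (b * G q0); set Y := im (b * G q0); set m := cabs a.
have m0 : 0 <= m by exact: cabs_ge0.
have md1 : 0 <= m * d1 by rewrite mulr_ge0 // ltW.
have md2 : 0 <= m * d2 by rewrite mulr_ge0 // ltW.
exists b, (X - k), (X + m * d1 + k), (Y - k), (Y + m * d2 + k); split.
  move=> p /cimgP [q /hrectP [q1 q2] e].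
  have Qq : Q q by apply/rectP; lra.
  have [h1 h2] := linear_part ba b1 Qq.
  have n1 : 0 <= m * (q.1 - t) <= m * d1.
    by rewrite mulr_ge0 ?ler_wpM2l //; lra.
  have n2 : 0 <= m * (q.2 - s) <= m * d2.
    by rewrite mulr_ge0 ?ler_wpM2l //; lra.
  rewrite /rot_rect /= -e; move: h1 h2; rewrite -/X -/Y -/m !ler_norml => h1 h2; lra.
have k0' := ltW k0.
rewrite mu2_rot_rect //; [|lra..]; rewrite lee_fin.
have -> : (X + m * d1 + k - (X - k)) * (Y + m * d2 + k - (Y - k)) =
  m ^+ 2 * (d1 * d2) + 2 * (k * m * D) + 4 * (k * k) by ring.
have [kd1 kd2] := kD; have D0' := ltW D0.
have h1 : k * m * D <= M ^+ 2 * D ^+ 3.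
  have -> : M ^+ 2 * D ^+ 3 = (k * M) * D by rewrite /k; ring.
  by rewrite ler_wpM2r // ler_wpM2l.
have : 0 <= M ^+ 2 * D ^+ 3 by rewrite mulr_ge0 ?exprn_ge0 // ltW.
lra.
Qed.

(** To see that a point w well inside the linear image is attained, minimise |G - w| over the closed
    cell. The minimiser is interior and [G'] does not vanish there, so the minimum is 0. The first
    alternative covers the cells for which the claimed lower bound is not positive. *)
Lemma cell_lower : cabs a ^+ 2 * (d1 * d2) <= 12 * M ^+ 2 * D ^+ 3 \/
  exists b x1 x2 y1 y2, [/\ rot_rect b x1 x2 y1 y2 `<=` cimg G H &
    ((cabs a ^+ 2 * (d1 * d2) - 12 * M ^+ 2 * D ^+ 3)%:E <= mu2 (rot_rect b x1 x2 y1 y2))%E].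
Proof.
set m := cabs a; have m0 : 0 <= m by exact: cabs_ge0.
have kp : 0 < k := k0; have d1p : 0 < d1 := d10; have d2p : 0 < d2 := d20.
have D0' := ltW D0; have M0' := ltW M0; have k0' := ltW k0.
have MD3 : 0 <= M ^+ 2 * D ^+ 3 by rewrite mulr_ge0 ?exprn_ge0.
have d12 : d1 * d2 <= D ^+ 2.
  have := mulr_gt0 d10 d20; have := sqr_ge0 d1; have := sqr_ge0 d2; rewrite sqrrD; lra.
have mdle d d' : 0 < d -> 0 < d' -> d' <= D -> m * d <= 6 * k -> m ^+ 2 * (d * d') <= 6 * M ^+ 2 * D ^+ 3.
  move=> dp dp' dD h; have -> : m ^+ 2 * (d * d') = (m * d) * (m * d') by ring.
  have -> : 6 * M ^+ 2 * D ^+ 3 = (6 * k) * (M * D) by rewrite /k; ring.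
  by apply: ler_pM => //; rewrite ?mulr_ge0 ?(ltW dp) ?(ltW dp') //; apply: ler_pM => //; exact: ltW.
have dD2 : d2 <= D by rewrite lerDr ltW.
have dD1 : d1 <= D by rewrite lerDl ltW.
case: (lerP (m * d1) (6 * k)) => c1; first by left; have := mdle _ _ d10 d20 dD2 c1; lra.
case: (lerP (m * d2) (6 * k)) => c2.
  by left; have := mdle _ _ d20 d10 dD1 c2; rewrite [d2 * d1]mulrC; lra.
(* Beyond this case |a| > 2 M D; since [G'] varies by at most 2 M D over the cell, it then has no
   zero there. *)
case: (lerP m (2 * M * D)) => c3.
  left; have h : m ^+ 2 * (d1 * d2) <= (2 * M * D * M) * D ^+ 2.
    by apply: ler_pM; rewrite ?exprn_ge0 ?mulr_ge0 ?(ltW d10) ?(ltW d20) // expr2; apply: ler_pM.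
  apply: le_trans h _; have -> : 2 * M * D * M * D ^+ 2 = 2 * (M ^+ 2 * D ^+ 3) by ring.
  by rewrite -[12 * _ * _]mulrA ler_wpM2r // ler_nat.
right; have [b b1 ba] := unit_dir; have b0 : b != 0 by rewrite -cabs_gt0 b1.
have mp : 0 < m by apply: le_lt_trans c3; rewrite !mulr_ge0.
set X := re (b * G q0); set Y := im (b * G q0).
(* Margin 3k: a minimiser of |G - w| lies within 2k / m of the affine preimage of w, and another k /
   m leaves room for a neighbourhood of it inside the cell. *)
exists b, (X + 3 * k), (X + m * d1 - 3 * k), (Y + 3 * k), (Y + m * d2 - 3 * k); split; last first.
  rewrite mu2_rot_rect //; [|lra..]; rewrite lee_fin.
  have -> : (X + m * d1 - 3 * k - (X + 3 * k)) * (Y + m * d2 - 3 * k - (Y + 3 * k)) =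
    m ^+ 2 * (d1 * d2) - 6 * (k * m * D) + 36 * (k * k) by ring.
  have h1 : k * m * D <= M ^+ 2 * D ^+ 3.
    have -> : M ^+ 2 * D ^+ 3 = (k * M) * D by rewrite /k; ring.
    by rewrite ler_wpM2r // ler_wpM2l.
  have : 0 <= k * k by exact: mulr_ge0.
  lra.
move=> p [p1 p2]; set w := toC p.
pose x := re (b * w) - X; pose y := im (b * w) - Y.
have hx : 3 * k <= x <= m * d1 - 3 * k by rewrite /x /w; lra.
have hy : 3 * k <= y <= m * d2 - 3 * k by rewrite /y /w; lra.
pose c : R * R := (t + x / m, s + y / m).
have divm u v : (u <= v * m) = (u / m <= v) by rewrite ler_pdivrMr.
have xm : 0 < x / m /\ x / m < d1.
  by split; rewrite ?divr_gt0 ?ltr_pdivrMr //; lra.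
have ym : 0 < y / m /\ y / m < d2.
  by split; rewrite ?divr_gt0 ?ltr_pdivrMr //; lra.
have Qc : Q c by apply/rectP; rewrite /c /=; lra.
have mx u : m * (u / m) = u by rewrite mulrCA divff ?mulr1 // gt_eqF.
have val q : Q q -> cabs (G (toC q) - w) <= k + m * cabs (toC q - toC c) /\
    m * cabs (toC q - toC c) <= cabs (G (toC q) - w) + k.
  move=> Qq; set e := G (toC q) - G q0 - a * (toC q - q0).
  have ek : cabs e <= k by exact: linear_err.
  have wE : w = G q0 + a * (toC c - q0).
    apply: (mulfI b0); rewrite mulrDr mulrA ba.
    apply/eqP; rewrite eq_complex reD imD reZ imZ reB imB /c /=.
    by rewrite ![_ + _ / m]addrC !addrK -/m !mx /x /y; apply/andP; split; apply/eqP; rewrite /X /Y; ring.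
  have E : G (toC q) - w = a * (toC q - toC c) + e by rewrite wE /e; ring.
  split.
    by rewrite E; apply: le_trans (cabsD _ _) _; rewrite cabsM addrC lerD2r.
  have -> : m * cabs (toC q - toC c) = cabs (a * (toC q - toC c)) by rewrite cabsM.
  have -> : a * (toC q - toC c) = (G (toC q) - w) - e by rewrite E addrK.
  by apply: le_trans (cabsD _ _) _; rewrite cabsN lerD2l.
have [L0 hL] : exists L, forall p q, Q p -> Q q -> `|cabs (G (toC p) - w) - cabs (G (toC q) - w)| <=
    L * cabs (toC p - toC q).
  exists (2 * M) => p' q' Qp Qq; apply: le_trans (cabs_distB _ _) _.
  have -> : G (toC p') - w - (G (toC q') - w) = G (toC p') - G (toC q') by ring.
  have [h1 h2] := hG Qq Qp; set u := toC p' - toC q' in h2 *.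
  have := cabsD (G (toC p') - G (toC q') - G' (toC q') * u) (G' (toC q') * u).
  rewrite subrK cabsM => h3.
  have u1 : cabs u <= 1 by apply: le_trans D1; exact: Qdist.
  have : M * cabs u ^+ 2 <= M * cabs u by rewrite ler_wpM2l // expr2 ler_piMl.
  have : cabs (G' (toC q')) * cabs u <= M * cabs u by rewrite ler_wpM2r.
  lra.
have Qne : Q !=set0 by exists (t, s).
have [q Qq qmin] := compact_min (F := fun z => cabs (G z - w)) (L := L0)
  (@compact_rect R t (t + d1) s (s + d2)) Qne hL.
have [vc _] := val c Qc; rewrite subrr cabs0 mulr0 addr0 in vc.
have vq := le_trans (qmin c Qc) vc.
have [_ dq] := val q Qq.
have cq : m * cabs (toC q - toC c) <= 2 * k by lra.
have cq1 : m * `|q.1 - c.1| <= 2 * k.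
  by apply: le_trans cq; rewrite ler_wpM2l //; have := re_le_cabs (toC q - toC c); rewrite reB.
have cq2 : m * `|q.2 - c.2| <= 2 * k.
  by apply: le_trans cq; rewrite ler_wpM2l //; have := im_le_cabs (toC q - toC c); rewrite imB.
pose eps := k / m; have eps0 : 0 < eps by rewrite divr_gt0.
have inside (r0 r1 u v : R) : m * `|v - u| < 3 * k -> 3 * k <= m * (u - r0) -> 3 * k <= m * (r1 - u) ->
    r0 < v < r1.
  move=> h1 h2 h3; have := ler_norm (v - u); have := ler_norm (u - v); rewrite [`|u - v|]distrC.
  move=> n1 n2; have n1' := ler_wpM2l m0 n1; have n2' := ler_wpM2l m0 n2.
  by apply/andP; split; rewrite -(ltr_pM2l mp); lra.
have near y' : cabs (toC y' - toC q) < eps -> t < y'.1 < t + d1 /\ s < y'.2 < s + d2.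
  move=> h; have hm : m * cabs (toC y' - toC q) < k.
    by have := h; rewrite -(ltr_pM2l mp) /eps mx.
  have n1 : m * `|y'.1 - q.1| < k.
    by apply: le_lt_trans hm; rewrite ler_wpM2l //; have := re_le_cabs (toC y' - toC q); rewrite reB.
  have n2 : m * `|y'.2 - q.2| < k.
    by apply: le_lt_trans hm; rewrite ler_wpM2l //; have := im_le_cabs (toC y' - toC q); rewrite imB.
  have t1 : m * `|y'.1 - c.1| < 3 * k.
    have := ler_wpM2l m0 (ler_distD q.1 y'.1 c.1); lra.
  have t2 : m * `|y'.2 - c.2| < 3 * k.
    have := ler_wpM2l m0 (ler_distD q.2 y'.2 c.2); lra.
  split; [apply: inside t1 _ _|apply: inside t2 _ _]; rewrite /c /=.
  - by rewrite addrAC subrr add0r mx; lra.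
  - by rewrite opprD addrACA subrr add0r mulrBr mx; lra.
  - by rewrite addrAC subrr add0r mx; lra.
  - by rewrite opprD addrACA subrr add0r mulrBr mx; lra.
have Gq : G (toC q) = w.
  apply: (@min_modulus_zero G (G' (toC q)) M eps) => //.
    have [_ h2] := hG Qq0 Qq; have [_ h3] := hG Qq Qq0.
    have [/andP[qt _] _] : t < q.1 < t + d1 /\ s < q.2 < s + d2 by apply: near; rewrite subrr cabs0.
    set d := toC q - toC (t, s) in h2.
    have dp : 0 < cabs d.
      rewrite cabs_gt0; apply/eqP => /(congr1 (@complex.Re R)).
      by rewrite /d reB /= => h; lra.
    have dD : cabs d <= D by exact: Qdist.
    (* Adding the Taylor estimates taken from both end points compares the derivative at [q] with
       that at the corner. *)
    have h4 : cabs (G' (toC q) - a) * cabs d <= 2 * M * cabs d * cabs d.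
      rewrite -cabsM; have -> : (G' (toC q) - a) * d = (G (toC q) - G q0 - a * d)
        + (G q0 - G (toC q) - G' (toC q) * (toC (t, s) - toC q)) by rewrite /d; ring.
      apply: le_trans (cabsD _ _) _.
      by rewrite [cabs (toC (t, s) - _)]cabsB -/d in h3; rewrite expr2 in h2 h3; lra.
    rewrite ler_pM2r // in h4.
    have h5 : 2 * M * cabs d <= 2 * M * D by rewrite ler_wpM2l // mulr_ge0.
    rewrite -cabs_gt0; have := cabs_geB a (a - G' (toC q)); rewrite subKr -/m cabsB; lra.
  move=> z zq; rewrite -(fromCK z) in zq *.
  have [z1 z2] := near (fromC z) zq; have Qz : Q (fromC z) by apply/rectP; lra.
  by split; [have [] := hG Qq Qz|exact: qmin].
apply/cimgP; exists q => //; apply/hrectP.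
have [] := near q; first by rewrite subrr cabs0.
by lra.
Qed.
End OneCell.
End Cells.

(** * Green's formula on a periodic strip *)

Section Stokes.
Variable R : realType.
Local Notation P2 := (measurableTypeR R * measurableTypeR R)%type.
Variables (T0 T1 : R) (G G' U U1 Ui : R[i] -> R[i]) (u : R[i] -> R) (B L : R).
Hypothesis T01 : T0 < T1.
Let S : set R[i] := [set z | T0 <= re z <= T1 /\ 0 <= im z <= pi *+ 2].

(** The field to be integrated involves conjugates and is only real-differentiable, so increments
    are real multiples of one direction [e]. *)
Definition dir (S : set R[i]) (e x y d : R[i]) :=
  [/\ S x, S y & exists2 r : R, d = r%:C%C & y = x + r%:C%C * e].

Hypothesis tG : tay (hol S) G G'.
Hypothesis Ginj : forall z w, S z -> S w -> G z = G w ->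
  re z = re w /\ (im z = im w \/ `|im z - im w| = pi *+ 2).
Hypothesis tU1 : tay (dir S 1) U U1.
Hypothesis tUi : tay (dir S 'i%C) U Ui.
Hypothesis Uper : forall x, T0 <= x <= T1 -> U (Complex x (pi *+ 2)) = U (Complex x 0).
Hypothesis UE : forall z, S z -> re (U1 z) - im (Ui z) = 2 * u (G z) * cabs (G' z) ^+ 2.
Hypothesis uB : forall w, `|u w| <= B.
Hypothesis uL : forall z w, S z -> S w -> `|u (G z) - u (G w)| <= L * cabs (z - w).
Hypothesis mu : measurable_fun [set: P2] (fun p : P2 => u (toC p)).

Let pi2 : 0 < pi *+ 2 :> R. Proof. by rewrite pmulrn_lgt0 // pi_gt0. Qed.

Let inS (a b c d : R) p : T0 <= a -> b <= T1 -> 0 <= c -> d <= pi *+ 2 ->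
  (`[a, b] `*` `[c, d]) p -> S (toC p).
Proof. by move=> h1 h2 h3 h4 /rectP[k1 k2]; rewrite /S /=; lra. Qed.

Lemma cimg_closed_measurable (a b c d : R) : T0 <= a -> b <= T1 -> 0 <= c -> d <= pi *+ 2 ->
  measurable (cimg G (`[a, b] `*` `[c, d]) : set P2).
Proof.
move=> h1 h2 h3 h4; apply: compact_measurable2; have [K K0 hK] := tay_lip tG.
apply: (cimg_compact (L := K)); first exact: compact_rect.
by move=> p q hp hq; rewrite cabsB [cabs (toC p - _)]cabsB; apply: hK; split; [exact: inS hp|exact: inS hq|].
Qed.

(** Exhausting by compact cells makes the image of a half-open cell a countable union of compact
    sets, hence measurable. *)
Lemma hrect_bigcup (a b c d : R) :
  hrect a b c d = \bigcup_n (`[a, b - n.+1%:R^-1] `*` `[c, d - n.+1%:R^-1]).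
Proof.
apply/seteqP; split => [p /hrectP[/andP[p1 p2] /andP[p3 p4]]|p [n _ /rectP[p1 p2]]].
  have e1 : 0 < b - p.1 by lra. 
  have e2 : 0 < d - p.2 by lra.
  have [N1 h1] := div_nat_small 1 e1; have [N2 h2] := div_nat_small 1 e2.
  exists (maxn N1 N2) => //; apply/rectP.
  have := h1 _ (leq_maxl N1 N2); have := h2 _ (leq_maxr N1 N2); rewrite !mul1r.
  move: _^-1 => x; lra.
have : (0 : R) < n.+1%:R^-1 by rewrite invr_gt0 ltr0n.
by move: p1 p2; move: _^-1 => x p1 p2 x0; apply/hrectP; lra.
Qed.

Lemma cimg_measurable (a b c d : R) : T0 <= a -> b <= T1 -> 0 <= c -> d <= pi *+ 2 ->
  measurable (cimg G (hrect a b c d) : set P2).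
Proof.
move=> h1 h2 h3 h4; rewrite hrect_bigcup /cimg image_bigcup; apply: bigcupT_measurable => n.
have : (0 : R) < n.+1%:R^-1 by rewrite invr_gt0 ltr0n.
by move: _^-1 => x x0; apply: cimg_closed_measurable; lra.
Qed.

Lemma cimg_finite (a b c d : R) : T0 <= a -> b <= T1 -> 0 <= c -> d <= pi *+ 2 ->
  (mu2 (cimg G (hrect a b c d)) < +oo)%E.
Proof.
move=> h1 h2 h3 h4; have [M M0 hM] := tG.
apply: (@le_lt_trans _ _ (mu2 (`[- M, M] `*` `[- M, M]))).
  apply: le_measure; rewrite ?inE; [exact: cimg_measurable|exact: measurable_rect|].
  move=> p /cimgP [q /hrectP qH e]; have Sq : S (toC q) by rewrite /S /=; lra.
  have [hq _ _ _] := hM _ _ _ (And3 Sq Sq erefl).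
  apply/rectP; rewrite -!ler_norml; have -> : p = fromC (G (toC q)) by rewrite e toCK.
  by split; apply: le_trans hq; [exact: re_le_cabs|exact: im_le_cabs].
by rewrite mu2_rect ?ltry; lra.
Qed.

Lemma integrable_bounded (A : set P2) : measurable A -> (mu2 A < +oo)%E ->
  mu2.-integrable A (EFin \o (fun p : P2 => u (toC p))).
Proof.
move=> mA fA; apply: measurable_bounded_integrable => //.
  exact: measurable_funTS.
exists B; split; first exact: num_real.
by move=> x Bx p _ /=; apply: le_trans (uB _) (ltW Bx).
Qed.

Let I a b c d : R := \int[mu2]_(p in (cimg G (hrect a b c d) : set P2)) u (toC p).

Let I_split1 a m b c d : T0 <= a -> a <= m -> m <= b -> b <= T1 -> 0 <= c -> d <= pi *+ 2 ->
  I a b c d = I a m c d + I m b c d.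
Proof.
move=> h1 h2 h3 h4 h5 h6; have am := le_trans h1 h2; have mb := le_trans h3 h4.
have E : cimg G (hrect a b c d) = cimg G (hrect a m c d) `|` cimg G (hrect m b c d).
  rewrite /cimg -image_setU; congr (_ @` _); apply/seteqP; split => p.
    by move=> /hrectP p1; case: (ltP p.1 m) => pm; [left|right]; apply/hrectP; lra.
  by move=> [|] /hrectP p1; apply/hrectP; lra.
rewrite /I E; apply: Rintegral_setU; [exact: cimg_measurable|exact: cimg_measurable| |].
  by rewrite -E; apply: integrable_bounded; [apply: cimg_measurable|apply: cimg_finite].
apply/eqP; apply/seteqP; split => p //=.
move=> [/cimgP[q /hrectP hq e] /cimgP[q' /hrectP hq' e']].
have Sq : S (toC q) by rewrite /S /=; lra.
have Sq' : S (toC q') by rewrite /S /=; lra.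
by have [/= h _] := Ginj Sq Sq' (etrans e (esym e')); lra.
Qed.

Let I_split2 a b c m d : T0 <= a -> b <= T1 -> 0 <= c -> c <= m -> m <= d -> d <= pi *+ 2 ->
  I a b c d = I a b c m + I a b m d.
Proof.
move=> h1 h4 h5 h2 h3 h6; have am := le_trans h5 h2; have mb := le_trans h3 h6.
have E : cimg G (hrect a b c d) = cimg G (hrect a b c m) `|` cimg G (hrect a b m d).
  rewrite /cimg -image_setU; congr (_ @` _); apply/seteqP; split => p.
    by move=> /hrectP p1; case: (ltP p.2 m) => pm; [left|right]; apply/hrectP; lra.
  by move=> [|] /hrectP p1; apply/hrectP; lra.
rewrite /I E; apply: Rintegral_setU; [exact: cimg_measurable|exact: cimg_measurable| |].
  by rewrite -E; apply: integrable_bounded; [apply: cimg_measurable|apply: cimg_finite].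
apply/eqP; apply/seteqP; split => p //=.
move=> [/cimgP[q /hrectP hq e] /cimgP[q' /hrectP hq' e']].
have Sq : S (toC q) by rewrite /S /=; lra.
have Sq' : S (toC q') by rewrite /S /=; lra.
have [/= _ [h|h]] := Ginj Sq Sq' (etrans e (esym e')); first by lra.
have : `|q.2 - q'.2| < pi *+ 2 by rewrite ltr_norml; lra.
by rewrite h ltxx.
Qed.

Let sum1 (x : nat -> R) n c d : (forall i, x i <= x i.+1) -> (forall i, T0 <= x i) ->
  (forall i, (i <= n)%N -> x i <= T1) -> 0 <= c -> d <= pi *+ 2 ->
  I (x 0%N) (x n) c d = \sum_(i < n) I (x i) (x i.+1) c d.
Proof.
move=> xi x0 xT c0 d0; have mono : {homo x : i j / (i <= j)%N >-> i <= j}.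
  by apply: homo_leq => //; exact: le_trans.
elim: n xT => [|n IH] xT.
  rewrite big_ord0 /I (_ : cimg G _ = set0) ?Rintegral_set0 //.
  by apply/seteqP; split => p // /cimgP[q /hrectP hq _]; lra.
rewrite big_ord_recr /= -IH; first by apply: I_split1 => //; [exact: mono|exact: xT].
by move=> i hi; apply: xT; exact: leqW.
Qed.

Let sum2 (x : nat -> R) n a b : (forall i, x i <= x i.+1) -> (forall i, 0 <= x i) ->
  (forall i, (i <= n)%N -> x i <= pi *+ 2) -> T0 <= a -> b <= T1 ->
  I a b (x 0%N) (x n) = \sum_(i < n) I a b (x i) (x i.+1).
Proof.
move=> xi x0 xT c0 d0; have mono : {homo x : i j / (i <= j)%N >-> i <= j}.
  by apply: homo_leq => //; exact: le_trans.
elim: n xT => [|n IH] xT.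
  rewrite big_ord0 /I (_ : cimg G _ = set0) ?Rintegral_set0 //.
  by apply/seteqP; split => p // /cimgP[q /hrectP hq _]; lra.
rewrite big_ord_recr /= -IH; first by apply: I_split2 => //; [exact: mono|exact: xT].
by move=> i hi; apply: xT; exact: leqW.
Qed.

Let cell_sub t d1 s d2 : T0 <= t -> t + d1 <= T1 -> 0 <= s -> s + d2 <= pi *+ 2 ->
  forall p, (`[t, t + d1] `*` `[s, s + d2]) p -> S (toC p).
Proof. by move=> h1 h2 h3 h4 p hp; apply: inS hp. Qed.

Let le_mu2 (X Y : set P2) : measurable X -> measurable Y -> X `<=` Y -> (mu2 X <= mu2 Y)%E.
Proof. by move=> mX mY XY; apply: le_measure; rewrite ?inE. Qed.

(** Both quantities agree with 2 u |G'|^2 d1 d2, taken at the corner, up to third order in the size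
    of the cell; such an error survives summation over a grid of N^2 cells. *)
Lemma cell_estimate : exists2 E : R, 0 <= E & forall t d1 s d2,
  0 < d1 -> 0 < d2 -> d1 + d2 <= 1 -> T0 <= t -> t + d1 <= T1 -> 0 <= s -> s + d2 <= pi *+ 2 ->
  `|2 * I t (t + d1) s (s + d2) - (d2 * (re (U (Complex (t + d1) s)) - re (U (Complex t s)))
     - d1 * (im (U (Complex t (s + d2))) - im (U (Complex t s))))| <= E * (d1 + d2) ^+ 3.
Proof.
have [M0 M00 hM] := tG; pose M := M0 + 1; have Mp : 0 < M by rewrite /M; lra.
have [K1 K10 hK1] := tU1; have [K2 K20 hK2] := tUi.
have B0 : 0 <= B by apply: le_trans (normr_ge0 _) (uB 0).
(* First term: oscillation of [u] times the area of the image, at most 13 M^2 D^2. Second term: the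
   bound on [u] times the area error of the cell lemmas. *)
pose C1 := `|L| * (13 * M ^+ 2) + B * (12 * M ^+ 2).
have M2 : 0 <= M ^+ 2 by exact: exprn_ge0 (ltW Mp).
have C10 : 0 <= C1 by rewrite /C1 addr_ge0 // mulr_ge0 // mulr_ge0.
exists (2 * C1 + (K1 + K2)); first by lra.
move=> t d1 s d2 d1p d2p D1 ht1 ht2 hs1 hs2; set z := Complex t s.
pose Q := `[t, t + d1] `*` `[s, s + d2]; pose H := hrect t (t + d1) s (s + d2).
set D := d1 + d2 in D1 *; have D0 : 0 < D by rewrite addr_gt0.
have QS := @cell_sub t d1 s d2 ht1 ht2 hs1 hs2.
have hG p q : Q p -> Q q -> cabs (G' (toC p)) <= M /\
   cabs (G (toC q) - G (toC p) - G' (toC p) * (toC q - toC p)) <= M * cabs (toC q - toC p) ^+ 2.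
  move=> Qp Qq; have [_ _ h1 h2] := hM _ _ _ (And3 (QS _ Qp) (QS _ Qq) erefl).
  split; first by rewrite /M; lra.
  by apply: le_trans h2 _; rewrite ler_wpM2r ?exprn_ge0 // /M lerDl.
have Sz : S z by apply: (QS (t, s)); apply/rectP => /=; lra.
have z1 : Complex (t + d1) s = z + d1%:C%C * 1 by rewrite mulr1; simpc.
have z2 : Complex t (s + d2) = z + d2%:C%C * 'i%C by simpc.
have S1 : S (Complex (t + d1) s) by apply: (QS (t + d1, s)); apply/rectP => /=; lra.
have S2 : S (Complex t (s + d2)) by apply: (QS (t, s + d2)); apply/rectP => /=; lra.
have mH : measurable (cimg G H : set P2) by apply: cimg_measurable; lra.
have fH : (mu2 (cimg G H) < +oo)%E by apply: cimg_finite; lra.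
set m := fine (mu2 (cimg G H)).
have mE : mu2 (cimg G H) = m%:E by rewrite fineK // ge0_fin_numE.
set a2 := cabs (G' z) ^+ 2; have a20 : 0 <= a2 by exact: exprn_ge0.
have D3 : 0 <= M ^+ 2 * D ^+ 3 by rewrite mulr_ge0 // exprn_ge0 // ltW.
have m0 : 0 <= m by rewrite fine_ge0.
have d12 : 0 <= d1 * d2 by rewrite mulr_ge0 // ltW.
have up : m <= a2 * (d1 * d2) + 12 * M ^+ 2 * D ^+ 3.
  have [b [x1 [x2 [y1 [y2 [h1 h2]]]]]] := cell_upper Mp d1p d2p D1 hG.
  rewrite -lee_fin -mE; apply: le_trans h2; apply: le_mu2 => //; exact: measurable_rot_rect.
have lo : a2 * (d1 * d2) - 12 * M ^+ 2 * D ^+ 3 <= m.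
  have [h|[b [x1 [x2 [y1 [y2 [h1 h2]]]]]]] := cell_lower Mp d1p d2p D1 hG.
    by move: h; rewrite -/D -/z -/a2 => h; lra.
  rewrite -lee_fin -mE; apply: le_trans h2 _; apply: le_mu2 => //; exact: measurable_rot_rect.
have int_u : mu2.-integrable (cimg G H) (EFin \o (fun p : P2 => u (toC p))) by exact: integrable_bounded.
have int_c c : mu2.-integrable (cimg G H) (EFin \o (fun=> c)).
  apply: measurable_bounded_integrable => //.
  exists `|c|; split; first exact: num_real.
  by move=> x cx p _ /=; apply: ltW.
pose u0 := u (G z).
have udist p : cimg G H p -> `|u (toC p) - u0| <= `|L| * D.
  move=> /cimgP [q /hrectP hq <-]; have Sq : S (toC q) by apply: QS; apply/rectP; lra.
  apply: le_trans (uL Sq Sz) _; apply: le_trans (_ : `|L| * cabs (toC q - z) <= _).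
    by rewrite ler_wpM2r // ler_norm.
  rewrite ler_wpM2l //; apply: le_trans (cabs_toC q (t, s)) _.
  by rewrite lerD // ler_norml /=; lra.
have hI1 : I t (t + d1) s (s + d2) <= (u0 + `|L| * D) * m.
  rewrite -Rintegral_cst //; apply: le_Rintegral => // p /udist; rewrite ler_norml; lra.
have hI2 : (u0 - `|L| * D) * m <= I t (t + d1) s (s + d2).
  rewrite -Rintegral_cst //; apply: le_Rintegral => // p /udist; rewrite ler_norml; lra.
have Dd : d1 * d2 <= D ^+ 2.
  by have := sqr_ge0 d1; have := sqr_ge0 d2; rewrite /D sqrrD; lra.
have a2M : a2 <= M ^+ 2.
  have Qz : Q (t, s) by apply/rectP => /=; lra.
  by have [h _] := hG _ _ Qz Qz; rewrite lerXn2r ?nnegrE ?(ltW Mp).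
have mub : m <= 13 * M ^+ 2 * D ^+ 2.
  have h1 : a2 * (d1 * d2) <= M ^+ 2 * D ^+ 2 by apply: ler_pM.
  have h2 : M ^+ 2 * D ^+ 3 <= M ^+ 2 * D ^+ 2.
    by rewrite ler_wpM2l // exprSr ler_piMr // exprn_ge0 // ltW.
  lra.
have LD : `|L| * D * m <= `|L| * D * (13 * M ^+ 2 * D ^+ 2).
  by rewrite ler_wpM2l // mulr_ge0 // ltW.
have u0B : `|u0| <= B by exact: uB.
have u0m : `|u0 * (m - a2 * (d1 * d2))| <= B * (12 * M ^+ 2 * D ^+ 3).
  by rewrite normrM; apply: ler_pM => //; rewrite ler_norml; lra.
have step1 : `|I t (t + d1) s (s + d2) - u0 * a2 * (d1 * d2)| <= C1 * D ^+ 3.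
  have -> : C1 * D ^+ 3 = `|L| * D * (13 * M ^+ 2 * D ^+ 2) + B * (12 * M ^+ 2 * D ^+ 3).
    by rewrite /C1; ring.
  move: u0m; rewrite !ler_norml; move: hI1 hI2 LD; rewrite mulrDl mulrBl; lra.
have [_ _ _ e1] := hK1 z (Complex (t + d1) s) d1%:C%C
  (And3 Sz S1 (ex_intro2 _ _ d1 erefl z1)).
have [_ _ _ e2] := hK2 z (Complex t (s + d2)) d2%:C%C
  (And3 Sz S2 (ex_intro2 _ _ d2 erefl z2)).
rewrite cabs_real gtr0_norm // in e1; rewrite cabs_real gtr0_norm // in e2.
have r1 := le_trans (re_le_cabs _) e1; have r2 := le_trans (im_le_cabs _) e2.
rewrite !reB mulrC reZ in r1; rewrite !imB mulrC imZ in r2.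
have cube (a b : R) : 0 < a -> 0 < b -> a <= D -> b <= D -> a ^+ 2 * b <= D ^+ 3.
  move=> a0 b0 aD bD; rewrite [D ^+ 3]exprSr; apply: ler_pM; rewrite ?exprn_ge0 ?(ltW a0) ?(ltW b0) //.
  by rewrite lerXn2r ?nnegrE ?(ltW a0) ?(ltW D0).
have dD1 : d1 <= D by rewrite lerDl ltW.
have dD2 : d2 <= D by rewrite lerDr ltW.
have d1D := cube d1 d2 d1p d2p dD1 dD2; have d2D := cube d2 d1 d2p d1p dD2 dD1.
have s1 : `|d2 * (re (U (Complex (t + d1) s)) - re (U z) - d1 * re (U1 z))| <= K1 * D ^+ 3.
  rewrite normrM gtr0_norm //; apply: le_trans (ler_wpM2l (ltW d2p) r1) _.
  by rewrite mulrCA ler_wpM2l // mulrC.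
have s2 : `|d1 * (im (U (Complex t (s + d2))) - im (U z) - d2 * im (Ui z))| <= K2 * D ^+ 3.
  rewrite normrM gtr0_norm //; apply: le_trans (ler_wpM2l (ltW d1p) r2) _.
  by rewrite mulrCA ler_wpM2l // mulrC.
have key : d1 * d2 * re (U1 z) - d1 * d2 * im (Ui z) = 2 * (u0 * a2 * (d1 * d2)).
  by rewrite -mulrBr UE // /u0 /a2; ring.
set X := I _ _ _ _; rewrite -/X in step1.
set A1 := re (U (Complex (t + d1) s)) - _; rewrite -/A1 in s1.
set A2 := im (U (Complex t (s + d2))) - _; rewrite -/A2 in s2.
have -> : 2 * X - (d2 * A1 - d1 * A2) = 2 * (X - u0 * a2 * (d1 * d2))
    - d2 * (A1 - d1 * re (U1 z)) + d1 * (A2 - d2 * im (Ui z)).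
  have -> : 2 * (X - u0 * a2 * (d1 * d2)) = 2 * X - 2 * (u0 * a2 * (d1 * d2)) by ring.
  by rewrite -key; ring.
have -> : (2 * C1 + (K1 + K2)) * D ^+ 3 = 2 * (C1 * D ^+ 3) + K1 * D ^+ 3 + K2 * D ^+ 3 by ring.
apply: le_trans (ler_normD _ _) _; apply: lerD => //; apply: le_trans (ler_normB _ _) _.
by apply: lerD => //; rewrite normrM normr_nat ler_wpM2l.
Qed.

(** Over a grid of (N + 1)^2 cells the errors sum to O(1 / N) and the differences telescope.
    Periodicity cancels the horizontal edges, so a Riemann sum over the two vertical edges
    remains. *)
Lemma stokes : (fun N => pi / N.+1%:R * \sum_(j < N.+1)
    (re (U (Complex T1 (j%:R * (pi *+ 2 / N.+1%:R)))) -
     re (U (Complex T0 (j%:R * (pi *+ 2 / N.+1%:R)))))) @ \oo -->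
  (\int[mu2]_(p in (cimg G (hrect T0 T1 0 (pi *+ 2)) : set P2)) u (toC p) : R).
Proof.
have [E E0 hE] := cell_estimate.
pose C0 := T1 - T0 + pi *+ 2; have pip := pi2; have T01' := T01.
have C00 : 0 < C0 by rewrite /C0; lra.
apply/rcvgP => e e0.
have e1 : (0 : R) < 1 by [].
have [N1 hN1] := div_nat_small C0 e1; have [N2 hN2] := div_nat_small (E * C0 ^+ 3) e0.
exists (maxn N1 N2) => N hN; have {}hN1 := hN1 N (leq_trans (leq_maxl _ _) hN).
have {}hN2 := hN2 N (leq_trans (leq_maxr _ _) hN).
pose n := N.+1; have n0 : (0 : R) < n%:R by rewrite ltr0n.
pose d1 := (T1 - T0) / n%:R; pose d2 : R := pi *+ 2 / n%:R.
have d1p : 0 < d1 by rewrite divr_gt0 // subr_gt0.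
have d2p : 0 < d2 by rewrite divr_gt0.
pose x i : R := T0 + i%:R * d1; pose y j : R := j%:R * d2.
have nd1 : n%:R * d1 = T1 - T0 by rewrite /d1 mulrCA divff ?mulr1 // gt_eqF.
have nd2 : n%:R * d2 = pi *+ 2 by rewrite /d2 mulrCA divff ?mulr1 // gt_eqF.
have D1 : d1 + d2 = C0 / n%:R by rewrite /d1 /d2 -mulrDl.
have xS i : x i.+1 = x i + d1 by rewrite /x -natr1; ring.
have yS j : y j.+1 = y j + d2 by rewrite /y -natr1; ring.
have x0 : x 0%N = T0 by rewrite /x mul0r addr0.
have xn : x n = T1 by rewrite /x nd1; ring.
have y0 : y 0%N = 0 by rewrite /y mul0r.
have yn : y n = pi *+ 2 by rewrite /y nd2.
have xle i : x i <= x i.+1 by rewrite xS lerDl ltW.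
have yle i : y i <= y i.+1 by rewrite yS lerDl ltW.
have xge i : T0 <= x i by rewrite /x lerDl mulr_ge0 // ltW.
have yge i : 0 <= y i by rewrite /y mulr_ge0 // ltW.
have xT i : (i <= n)%N -> x i <= T1.
  by move=> hi; rewrite -xn /x lerD2l ler_pM2r // ler_nat.
have yT i : (i <= n)%N -> y i <= pi *+ 2.
  by move=> hi; rewrite -yn /y ler_pM2r // ler_nat.
have split : I T0 T1 0 (pi *+ 2) = \sum_(i < n) \sum_(j < n) I (x i) (x i.+1) (y j) (y j.+1).
  rewrite -x0 -xn -y0 -yn (@sum1 x n) ?y0 ?yn //; apply: eq_bigr => i _.
  by rewrite -[X in I _ _ X _]y0 -yn (@sum2 y n) //; apply: xT.
pose W i j := d2 * (re (U (Complex (x i.+1) (y j))) - re (U (Complex (x i) (y j))))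
     - d1 * (im (U (Complex (x i) (y j.+1))) - im (U (Complex (x i) (y j)))).
have tele : \sum_(i < n) \sum_(j < n) W i j =
   d2 * \sum_(j < n) (re (U (Complex T1 (y j))) - re (U (Complex T0 (y j)))).
  rewrite /W; under eq_bigr do rewrite sumrB; rewrite sumrB [X in _ - X]big1 ?subr0.
    rewrite exchange_big /= mulr_sumr; apply: eq_bigr => j _; rewrite -mulr_sumr; congr (_ * _).
    rewrite -(big_mkord xpredT (fun i => re (U (Complex (x i.+1) (y j))) - re (U (Complex (x i) (y j))))).
    by rewrite telescope_sumr // x0 xn.
  move=> i _; rewrite -mulr_sumr.
  rewrite -(big_mkord xpredT (fun j => im (U (Complex (x i) (y j.+1))) - im (U (Complex (x i) (y j))))).
  rewrite telescope_sumr // yn y0 Uper ?subrr ?mulr0 // xge xT //; exact: ltnW.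
have bound : `|2 * I T0 T1 0 (pi *+ 2) - \sum_(i < n) \sum_(j < n) W i j| <= E * C0 ^+ 3 / n%:R.
  rewrite split mulr_sumr -sumrB; apply: le_trans (ler_norm_sum _ _ _) _.
  apply: le_trans (_ : \sum_(i < n) \sum_(j < n) E * (d1 + d2) ^+ 3 <= _).
    apply: ler_sum => i _; rewrite mulr_sumr -sumrB; apply: le_trans (ler_norm_sum _ _ _) _.
    apply: ler_sum => j _; rewrite /W xS yS; apply: hE => //.
    - by rewrite D1 ltW.
    - by rewrite -xS; apply: xT.
    - by rewrite -yS; apply: yT.
  rewrite !sumr_const card_ord -mulrnA -[leLHS]mulr_natr natrM D1 le_eqVlt.
  by apply/orP; left; apply/eqP; field; rewrite gt_eqF.
rewrite tele in bound.
rewrite distrC; apply: le_lt_trans hN2.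
set Sm := \sum_(j < n) _ in bound *.
have -> : pi / N.+1%:R * Sm = d2 * Sm / 2 by rewrite /d2 -mulr_natr; field; rewrite addrC natr1 gt_eqF.
move: bound; rewrite -/I !ler_norml; set X := I _ _ _ _; set Y := E * C0 ^+ 3 / _.
have : 0 <= Y by rewrite divr_ge0 ?mulr_ge0 ?exprn_ge0 // ltW.
rewrite /n -/Y -/(I T0 T1 0 (pi *+ 2)) -/X; clearbody X Y; move: (d2 * Sm) => v; lra.
Qed.
End Stokes.

(** * The cutoff weight *)

Section Weight.
Variable R : realType.
Local Notation P2 := (measurableTypeR R * measurableTypeR R)%type.
Implicit Types (x y e : R) (z w : R[i]).

(** It is used through its square, which has a Lipschitz derivative and therefore admits a
    second-order Taylor bound. *)
Definition cut x : R := Num.max 0 (1 - x).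
(** The derivative of x * cut x ^ 2, which is what the divergence of the flux produces. *)
Definition tent x : R := cut x * (1 - 3 * x).

Lemma cutE x : cut x = if x <= 1 then 1 - x else 0.
Proof. by rewrite /cut maxEge subr_le0; case: (ltgtP x 1) => // ->; rewrite subrr. Qed.

Lemma cut01 x : 0 <= x -> 0 <= cut x <= 1.
Proof. by rewrite cutE; case: ifP => h; lra. Qed.

Lemma tentE x : tent x = cut x ^+ 2 - 2 * x * cut x.
Proof. by rewrite /tent cutE; case: ifP => _; ring. Qed.

Lemma tent_bound x : 0 <= x -> `|tent x| <= 1.
Proof.
move=> x0; rewrite /tent cutE ler_norml; case: ifP => h; last by rewrite mul0r; lra.
by apply/andP; split; nra.
Qed.

Lemma tent_lip x y : 0 <= x -> 0 <= y -> `|tent x - tent y| <= 4 * `|x - y|.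
Proof.
wlog xy : x y / x <= y.
  by move=> H x0 y0; case: (leP x y) => h; [exact: H|rewrite distrC [`|x - _|]distrC; apply: H => //; exact: ltW].
move=> x0 y0; rewrite [`|x - y|]distrC [`|y - x|]ger0_norm ?subr_ge0 // ler_norml /tent !cutE.
by case: ifP => h; case: ifP => k; apply/andP; split; nra.
Qed.

(** Posed on the nonnegative reals inside the complex plane, so that it composes with |P|^2 written
    as a product of [P] and its conjugate. *)
Lemma tay_cut e : 0 < e <= 1 -> tay (hol [set z | exists2 s, 0 <= s & z = s%:C%C])
  (fun z => (cut (e * re z) ^+ 2)%:C%C) (fun z => (- (2 * e * cut (e * re z)))%:C%C).
Proof.
move=> /andP[e0 e1]; exists 2 => // z w d [/= [a a0 ->] [b b0 ->] ->] /=.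
have ea : 0 <= e * a by rewrite mulr_ge0 // ltW.
have eb : 0 <= e * b by rewrite mulr_ge0 // ltW.
have /andP[ca0 ca1] := cut01 ea; have /andP[cb0 cb1] := cut01 eb.
rewrite -!rmorphB -real_complexM -rmorphB !cabs_real; split.
- by rewrite ger0_norm ?exprn_ge0 // (le_trans (exprn_ile1 _ _ _)) //; lra.
- by rewrite ger0_norm ?exprn_ge0 // (le_trans (exprn_ile1 _ _ _)) //; lra.
- by rewrite normrN ger0_norm ?mulr_ge0 ?(ltW e0) //; nra.
have -> : cut (e * b) ^+ 2 - cut (e * a) ^+ 2 - - (2 * e * cut (e * a)) * (b - a) =
  cut (e * b) ^+ 2 - cut (e * a) ^+ 2 + 2 * cut (e * a) * (e * b - e * a) by ring.
apply: (@le_trans _ _ ((e * b - e * a) ^+ 2)).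
  move: ea eb; move: (e * a) (e * b) => x y x0 y0; rewrite !cutE ler_norml.
  have := sqr_ge0 (y - x); have := sqr_ge0 (1 - y).
  by rewrite !expr2; case: (leP y 1) => h; case: (leP x 1) => k q1 q2; apply/andP; split; nra.
rewrite -mulrBr exprMn real_normK ?num_real //; apply: ler_wpM2r; first exact: sqr_ge0.
by rewrite expr2; nra.
Qed.

Lemma measurable_poly (P : {poly R[i]}) :
  measurable_fun [set: P2] (fun p : P2 => re P.[toC p] : measurableTypeR R) /\
  measurable_fun [set: P2] (fun p : P2 => im P.[toC p] : measurableTypeR R).
Proof.
elim/poly_ind: P => [|P c [h1 h2]].
  by split; under eq_fun do rewrite horner0; exact: measurable_cst.
have m1 : measurable_fun [set: P2] (fun p : P2 => p.1 : measurableTypeR R) := measurable_fst.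
have m2 : measurable_fun [set: P2] (fun p : P2 => p.2 : measurableTypeR R) := measurable_snd.
split.
  under eq_fun do rewrite !hornerE reD reM /=.
  by apply: measurable_funD => //; apply: measurable_funB; apply: measurable_funM.
under eq_fun do rewrite !hornerE imD imM /=.
by apply: measurable_funD => //; apply: measurable_funD; apply: measurable_funM.
Qed.

(** As [e] tends to 0 this tends to |P'|^2, the area density of [P]. For e > 0 it has bounded
    support and is a divergence, which makes its integral over the plane vanish. *)
Definition weight (P : {poly R[i]}) e w : R := cabs P^`().[w] ^+ 2 * tent (e * cabs P.[w] ^+ 2).

Lemma measurable_weight P e : measurable_fun [set: P2] (fun p : P2 => weight P e (toC p) : measurableTypeR R).
Proof.
have sq (Q : {poly R[i]}) : measurable_fun [set: P2] (fun p : P2 => cabs Q.[toC p] ^+ 2 : measurableTypeR R).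
  have [h1 h2] := measurable_poly Q; under eq_fun do rewrite sqr_cabs !expr2.
  by apply: measurable_funD; apply: measurable_funM.
apply: measurable_funM; first exact: sq.
have mP : measurable_fun [set: P2] (fun p : P2 => e * cabs P.[toC p] ^+ 2 : measurableTypeR R).
  by apply: measurable_funM; [exact: measurable_cst|exact: sq].
apply: measurable_funM.
  by apply: measurable_maxr; [exact: measurable_cst|apply: measurable_funB => //; exact: measurable_cst].
apply: measurable_funB; first exact: measurable_cst.
by apply: measurable_funM => //; exact: measurable_cst.
Qed.

Lemma poly_growth (P : {poly R[i]}) (A : R) : (1 < size P)%N ->
  exists2 K : R, 1 <= K & forall w, K <= cabs w -> A <= cabs P.[w].
Proof.
elim/poly_ind: P A => [|P c IH] A; first by rewrite size_poly0.
rewrite size_MXaddC; case: ifP => // _; rewrite ltnS => sP.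
suff [K K1 hK] : exists2 K : R, 1 <= K & forall w, K <= cabs w -> A + cabs c <= cabs (P.[w] * w).
  exists K => // w /hK; rewrite !hornerE => h.
  by have := cabs_geB (P.[w] * w) (- c); rewrite cabsN opprK; lra.
have [s1|s1] := ltnP 1 (size P).
  have [K K1 hK] := IH `|A + cabs c| s1; exists K => // w Kw; rewrite cabsM.
  have := hK _ Kw; have := ler_norm (A + cabs c); have w1 := le_trans K1 Kw.
  have : cabs P.[w] <= cabs P.[w] * cabs w by rewrite ler_peMr.
  lra.
have /size_poly1P [a a0 ->] : size P == 1%N by rewrite eqn_leq s1.
have ap : 0 < cabs a by rewrite cabs_gt0.
exists (1 + (`|A + cabs c| / cabs a)); first by rewrite lerDl divr_ge0.
move=> w hw; rewrite hornerC cabsM; apply: le_trans (ler_norm _) _.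
have : `|A + cabs c| / cabs a <= cabs w by lra.
by rewrite ler_pdivrMr // mulrC.
Qed.

Lemma weight_support P e : 0 < e -> exists2 K : R, 1 <= K & forall w, K <= cabs w ->
  weight P e w = 0 /\ cut (e * cabs P.[w] ^+ 2) * cabs P^`().[w] = 0.
Proof.
move=> e0; have [s1|s1] := ltnP 1 (size P); last first.
  exists 1 => // w _; rewrite /weight [P]size1_polyC // derivC horner0 cabs0 mulr0.
  by rewrite expr0n mul0r.
have [K K1 hK] := poly_growth (1 + e^-1) s1; exists K => // w /hK h.
suff c0 : cut (e * cabs P.[w] ^+ 2) = 0 by rewrite /weight /tent c0 !mul0r mulr0.
have ei : 0 < e^-1 by rewrite invr_gt0.
have h2 : e^-1 <= cabs P.[w] ^+ 2 by rewrite expr2; nra.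
have : 1 <= e * cabs P.[w] ^+ 2 by rewrite -(ler_pM2l ei) mulrA mulVf ?gt_eqF // mul1r mulr1.
by rewrite cutE; case: ifP => // k1 k2; lra.
Qed.

Lemma weight_bounded P e : 0 < e -> exists2 B : R, 0 <= B & forall w, `|weight P e w| <= B.
Proof.
move=> e0; have [K K1 hK] := weight_support P e0; have K0 : 0 <= K by lra.
have [M M0 hM] := tay_horner P^`() K0; exists (M ^+ 2) => [|w]; first exact: exprn_ge0.
have [w1|/ltW w1] := leP K (cabs w); first by have [-> _] := hK _ w1; rewrite normr0 exprn_ge0.
have [h1 _ _ _] := hM w w _ (And3 w1 w1 erefl).
rewrite /weight normrM -[leRHS]mulr1; apply: ler_pM => //.
  by rewrite ger0_norm ?exprn_ge0 // lerXn2r ?nnegrE.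
by apply: tent_bound; rewrite mulr_ge0 ?exprn_ge0 // ltW.
Qed.
End Weight.

(** * Boundary form of the weighted area *)

Section WeightedArea.
Variable R : realType.
Local Notation P2 := (measurableTypeR R * measurableTypeR R)%type.
Variables (T0 T1 e : R) (G G' G'' : R[i] -> R[i]) (P : {poly R[i]}).
Hypotheses (T01 : T0 < T1) (e01 : 0 < e <= 1).
Let S : set R[i] := [set z | T0 <= re z <= T1 /\ 0 <= im z <= pi *+ 2].
Hypothesis tG : tay (hol S) G G'.
Hypothesis tG' : tay (hol S) G' G''.
Hypothesis Ginj : forall z w, S z -> S w -> G z = G w ->
  re z = re w /\ (im z = im w \/ `|im z - im w| = pi *+ 2).
Hypothesis Gper : forall x, T0 <= x <= T1 -> G (Complex x (pi *+ 2)) = G (Complex x 0).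
Hypothesis Gper' : forall x, T0 <= x <= T1 -> G' (Complex x (pi *+ 2)) = G' (Complex x 0).

(** With H = P \o G, applying d/dx + i d/dy to conj(H) H' gives 2 |H'|^2, twice the area density of
    H; the cutoff factor turns this density into the weight. *)
Definition flux (P : {poly R[i]}) e (G G' : R[i] -> R[i]) z : R[i] :=
  (P.[G z])^*%C * (P^`().[G z] * G' z) * (cut (e * cabs P.[G z] ^+ 2) ^+ 2)%:C%C.

Lemma tay_dir (A : set R[i]) (c : R[i]) f f' : cabs c = 1 -> tay (hol A) f f' ->
  tay (dir A c) f (fun x => f' x * c).
Proof.
move=> c1 [M M0 h]; exists M => // x y d [Ax Ay [r dr yr]].
have yx : y - x = d * c by rewrite yr dr addrC addKr.
have [h1 h2 h3 h4] := h x y _ (And3 Ax Ay erefl).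
split => //; first by rewrite cabsM c1 mulr1.
by rewrite -mulrA [c * d]mulrC -yx; move: h4; rewrite {2}yx cabsM c1 mulr1.
Qed.

Let H z := P.[G z].
Let H1 z := P^`().[G z] * G' z.
Let H2 z := P^`()^`().[G z] * G' z * G' z + P^`().[G z] * G'' z.

Let tcomp (Q : {poly R[i]}) : tay (hol S) (fun z => Q.[G z]) (fun z => Q^`().[G z] * G' z).
Proof.
have [M M0 h] := tG; apply: (tay_comp tG _ (tay_horner Q M0)).
by move=> x y d /h[]. 
Qed.

Let tH1 : tay (hol S) H1 H2.
Proof. exact: tayM (tcomp P^`()) tG'. Qed.

Let dU c z := (((H1 z * c)^*%C * H1 z + (H z)^*%C * (H2 z * c)) * (cut (e * cabs (H z) ^+ 2) ^+ 2)%:C%C +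
   (H z)^*%C * H1 z * ((- (2 * e * cut (e * cabs (H z) ^+ 2)))%:C%C *
     (H1 z * c * (H z)^*%C + H z * (H1 z * c)^*%C))).

Let tU c : cabs c = 1 -> tay (dir S c) (flux P e G G') (dU c).
Proof.
move=> c1; have cj x y d : dir S c x y d -> d^*%C = d.
  by move=> [_ _ [r -> _]]; exact: conjc_real.
have t1 := tay_dir c1 (tcomp P); have t2 := tay_conj cj t1; have t3 := tay_dir c1 tH1.
have hB x y d : dir S c x y d -> [set z | exists2 s, 0 <= s & z = s%:C%C] (P.[G x] * (P.[G x])^*%C)
  /\ [set z | exists2 s, 0 <= s & z = s%:C%C] (P.[G y] * (P.[G y])^*%C).
  by move=> _; split; rewrite /= mulcJ; [exists (cabs P.[G x] ^+ 2)|exists (cabs P.[G y] ^+ 2)];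
    rewrite ?exprn_ge0.
have := tayM (tayM t2 t3) (tay_comp (tayM t1 t2) hB (tay_cut e01)).
congr (tay _ _ _); apply/funext => z; first by rewrite /flux mulcJ /=.
by rewrite /dU /H /H1 mulcJ /=.
Qed.

Let dU_E z : S z -> re (dU 1 z) - im (dU 'i%C z) = 2 * weight P e (G z) * cabs (G' z) ^+ 2.
Proof.
move=> _; have imE w : im w = - re ('i%C * w) by case: w => a b /=; ring.
rewrite imE opprK -reD; have i2 : 'i%C * 'i%C = -1 :> R[i] by simpc.
have ci : ('i%C)^*%C = - 'i%C :> R[i] by simpc.
(* This combination is twice the d-bar derivative: holomorphic factors drop out and only the
   conjugate and the cutoff are differentiated. *)
have -> : dU 1 z + 'i%C * dU 'i%C z = 2 * ((H1 z * (H1 z)^*%C) * ((cut (e * cabs (H z) ^+ 2) ^+ 2)%:C%C +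
   (H z * (H z)^*%C) * (- (2 * e * cut (e * cabs (H z) ^+ 2)))%:C%C)).
  rewrite /dU !conjM conjc1 ci; move: ('i%C) i2 => i i2; ring: i2.
have two : 2 = (2 : R)%:C%C :> R[i] by rewrite rmorph_nat.
rewrite !mulcJ two -[(_ * _%:C)%C]real_complexM -rmorphD -!real_complexM /=.
rewrite /H1 cabsM /weight tentE /H; ring.
Qed.

Lemma weighted_area : (fun N => pi / N.+1%:R * \sum_(j < N.+1)
    (re (flux P e G G' (Complex T1 (j%:R * (pi *+ 2 / N.+1%:R)))) -
     re (flux P e G G' (Complex T0 (j%:R * (pi *+ 2 / N.+1%:R)))))) @ \oo -->
  (\int[mu2]_(p in (cimg G (hrect T0 T1 0 (pi *+ 2)) : set P2)) weight P e (toC p) : R).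
Proof.
have /andP[e0 e1] := e01; have [B B0 hB] := weight_bounded P e0.
have [L1 L10 hL1] := tay_lip (tcomp P); have [L2 L20 hL2] := tay_lip (tcomp P^`()).
have [M1 M10 hM1] := tcomp P; have [M2 M20 hM2] := tcomp P^`().
have uL z w : S z -> S w -> `|weight P e (G z) - weight P e (G w)| <=
  (2 * M2 * L2 + M2 ^+ 2 * (4 * (2 * M1 * L1))) * cabs (z - w).
  move=> Sz Sw; set d := cabs (z - w); have d0 : 0 <= d by exact: cabs_ge0.
  have h := And3 Sw Sz (erefl (z - w)).
  have [a1 b1 _ _] := hM1 _ _ _ h; have [a2 b2 _ _] := hM2 _ _ _ h.
  have {}hL1 := hL1 _ _ _ h; have {}hL2 := hL2 _ _ _ h.
  have dsq (a b : R[i]) (M L : R) : cabs a <= M -> cabs b <= M -> cabs (b - a) <= L * d ->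
      `|cabs b ^+ 2 - cabs a ^+ 2| <= 2 * M * L * d.
    move=> aM bM ab; rewrite subr_sqr normrM mulrC -mulrA; apply: ler_pM => //.
      by rewrite ger0_norm ?addr_ge0 //; lra.
    exact: le_trans (cabs_distB _ _) ab.
  have q1 := dsq _ _ _ _ a1 b1 hL1; have q2 := dsq _ _ _ _ a2 b2 hL2.
  rewrite /weight; set x := cabs _ ^+ 2 in q2 *; set y := cabs _ ^+ 2 in q2 *.
  set s := cabs P.[G z] ^+ 2 in q1 *; set t := cabs P.[G w] ^+ 2 in q1 *.
  have -> : x * tent (e * s) - y * tent (e * t) = (x - y) * tent (e * s) + y * (tent (e * s) - tent (e * t)) by ring.
  have s0 : 0 <= e * s by rewrite mulr_ge0 ?exprn_ge0 // ltW.
  have t0 : 0 <= e * t by rewrite mulr_ge0 ?exprn_ge0 // ltW.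
  apply: le_trans (ler_normD _ _) _; rewrite [leRHS]mulrDl [`|(x - y) * _|]normrM [`|y * _|]normrM; apply: lerD.
    by rewrite -[leRHS]mulr1; apply: ler_pM => //; exact: tent_bound.
  rewrite -mulrA; apply: ler_pM => //.
    by rewrite ger0_norm ?exprn_ge0 // lerXn2r ?nnegrE.
  apply: le_trans (tent_lip s0 t0) _; rewrite -mulrA ler_wpM2l // -mulrBr normrM gtr0_norm //.
  by apply: le_trans q1; rewrite ler_piMl.
apply: (stokes T01 tG Ginj (tU (cabs1 _)) (tU _) _ dU_E hB uL (measurable_weight P e)).
  by rewrite /cabs /= expr0n expr1n add0r sqrtr1.
by move=> x hx; rewrite /flux Gper // Gper'.
Qed.
End WeightedArea.

(** * Polar coordinates and annuli *)

Section Polar.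
Variable R : realType.
Local Notation P2 := (measurableTypeR R * measurableTypeR R)%type.
Implicit Types (z w : R[i]) (r t : R).

Lemma cis_surj z : cabs z = 1 -> exists2 t, 0 <= t < pi *+ 2 & z = cis t.
Proof.
case: z => a b z1; have := sqr_cabs (Complex a b); rewrite z1 expr1n /= => ab.
have a1 : -1 <= a <= 1 by rewrite -ler_norml -(normr1 R) -ler_sqr ?nnegrE // ?real_normK ?num_real //; nra.
have pp := pi_gt0 R; have /andP[ac0 ac1] : 0 <= acos a <= pi by rewrite acos_ge0 // acos_lepi.
have sE : sin (acos a) = `|b|.
  by rewrite sin_acos // -sqrtr_sqr; congr Num.sqrt; lra.
have [b0|b0] := leP 0 b.
  exists (acos a); first by rewrite mulr2n; lra.
  by rewrite /cis acosK ?sE ?ger0_norm // in_itv.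
have ac2 : 0 < acos a.
  rewrite lt0r ac0 andbT; apply/negP => /eqP e0; move: sE; rewrite e0 sin0 => /esym/eqP.
  by rewrite normr_eq0 => /eqP e1; rewrite e1 ltxx in b0.
exists (pi *+ 2 - acos a); first by rewrite mulr2n; lra.
by rewrite cisD cis2pi mul1r -cis_conj /cis acosK ?in_itv // sE /= ltr0_norm // opprK.
Qed.

Lemma cexp_polar w : w != 0 -> exists z, [/\ re z = ln (cabs w), 0 <= im z < pi *+ 2 & cexp z = w].
Proof.
move=> w0; have c0 : 0 < cabs w by rewrite cabs_gt0.
have cC : (cabs w)%:C%C != 0 :> R[i] by rewrite -cabs_gt0 cabs_real gtr0_norm // normr_gt0 gt_eqF.
have [|t ht wt] := @cis_surj (w / (cabs w)%:C%C).
  by rewrite cabsM cabsV cabs_real ger0_norm // divff // gt_eqF.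
exists (Complex (ln (cabs w)) t); split => //.
by rewrite /cexp /= lnK ?posrE // -wt mulrC divfK.
Qed.

Lemma cexp_inj z w : 0 <= im z <= pi *+ 2 -> 0 <= im w <= pi *+ 2 -> cexp z = cexp w ->
  re z = re w /\ (im z = im w \/ `|im z - im w| = pi *+ 2).
Proof.
move=> hz hw e; have er : re z = re w by apply: expR_inj; rewrite -!cabs_cexp e.
split => //; have cE : cis (im z) = cis (im w).
  move: e; rewrite /cexp er => /mulfI; apply.
  by rewrite -cabs_gt0 cabs_real gtr0_norm ?expR_gt0 // normr_gt0 gt_eqF // expR_gt0.
wlog zw : z w hz hw {e er} cE / im w <= im z.
  move=> H; case: (leP (im w) (im z)) => h; first exact: H.
  by have := H w z hw hz (esym cE) (ltW h); rewrite distrC => -[->|->]; [left|right].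
have [->|ne] := eqVneq (im z) (im w); [by left|right].
have c1 : cis (im z - im w) = 1 by rewrite cisD cE -cisD subrr cis0.
rewrite ger0_norm ?subr_ge0 //; apply/eqP; rewrite eq_le; apply/andP; split; first by lra.
rewrite leNgt; apply/negP => h; have /negP[] : cis (im z - im w) != 1.
  by apply: cis_neq1; rewrite h subr_gt0 lt_neqAle eq_sym ne zw.
by rewrite c1.
Qed.

Definition annulus r0 r1 : set R[i] := [set z | r0 <= cabs z <= r1].
Definition annimg (f : R[i] -> R[i]) r0 r1 : set P2 :=
  [set p | exists2 z, r0 <= cabs z < r1 & f z = toC p].
(** This is [flux] in the coordinate log z, in which an annulus becomes a periodic strip and the
    derivative of [f] is multiplied by z. *)
Definition pflux (P : {poly R[i]}) e (f f' : R[i] -> R[i]) z : R[i] :=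
  (P.[f z])^*%C * (P^`().[f z] * (f' z * z)) * (cut (e * cabs P.[f z] ^+ 2) ^+ 2)%:C%C.

Section Annulus.
Variables (r0 r1 e : R) (f f' f'' : R[i] -> R[i]) (P : {poly R[i]}).
Hypotheses (r00 : 0 < r0) (r01 : r0 < r1) (e01 : 0 < e <= 1).
Hypothesis tf : tay (hol (annulus r0 r1)) f f'.
Hypothesis tf' : tay (hol (annulus r0 r1)) f' f''.
Hypothesis finj : forall z w, annulus r0 r1 z -> annulus r0 r1 w -> f z = f w -> z = w.

Let T0 := ln r0.
Let T1 := ln r1.
Let S : set R[i] := [set z | T0 <= re z <= T1 /\ 0 <= im z <= pi *+ 2].
Let G z := f (cexp z).
Let G' z := f' (cexp z) * cexp z.

Let r10 : 0 < r1. Proof. exact: lt_trans r01. Qed.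
Let T01 : T0 < T1. Proof. by rewrite ltr_ln ?posrE. Qed.

Let S_ann z : S z -> annulus r0 r1 (cexp z).
Proof.
have eT0 : expR T0 = r0 by rewrite lnK ?posrE.
have eT1 : expR T1 = r1 by rewrite lnK ?posrE.
by move=> [h _]; rewrite /annulus /= cabs_cexp -eT0 -eT1 !ler_expR.
Qed.

Let texp : tay (hol S) (@cexp R) (@cexp R).
Proof.
have pp := pi_gt0 R.
have r_ge0 : 0 <= `|T0| + `|T1| + pi *+ 2 by have := normr_ge0 T0; have := normr_ge0 T1; lra.
apply: tay_sub (tay_cexp r_ge0).
have hS z : S z -> cabs z <= `|T0| + `|T1| + pi *+ 2.
  move=> [/andP[h1 h2] /andP[h3 h4]]; apply: le_trans (cabs_le_reim _) _; apply: lerD.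
    by rewrite ler_norml; have := ler_norm T1; have := ler_norm (- T0); rewrite normrN;
      have := normr_ge0 T0; have := normr_ge0 T1; lra.
  by rewrite ger0_norm.
by move=> x y d [/hS hx /hS hy ->].
Qed.

Let tcomp g g' : tay (hol (annulus r0 r1)) g g' ->
  tay (hol S) (fun z => g (cexp z)) (fun z => g' (cexp z) * cexp z).
Proof.
by move=> tg; apply: (tay_comp texp _ tg) => x y d [Sx Sy _]; split; exact: S_ann.
Qed.

Let tG : tay (hol S) G G'. Proof. exact: tcomp. Qed.
Let tG' : tay (hol S) G' (fun z => f'' (cexp z) * cexp z * cexp z + f' (cexp z) * cexp z).
Proof. exact: tayM (tcomp tf') texp. Qed.

Let Ginj z w : S z -> S w -> G z = G w ->
  re z = re w /\ (im z = im w \/ `|im z - im w| = pi *+ 2).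
Proof.
move=> Sz Sw e1; apply: cexp_inj; [by case: Sz|by case: Sw|].
exact: finj (S_ann Sz) (S_ann Sw) e1.
Qed.

Let per x : cexp (Complex x (pi *+ 2)) = cexp (Complex x 0) :> R[i].
Proof. by rewrite /cexp /= cis2pi cis0. Qed.

Lemma annimgE : annimg f r0 r1 = cimg G (hrect T0 T1 0 (pi *+ 2)).
Proof.
have h0 := r00; have h1 := r10.
apply/seteqP; split => [p [z hz e1]|p /cimgP[q /hrectP[hq1 hq2] e1]].
  have z0 : z != 0 by rewrite -cabs_gt0; apply: lt_le_trans h0 _; case/andP: hz.
  have [w [w1 w2 w3]] := cexp_polar z0; apply/cimgP; exists (fromC w); last by rewrite fromCK /G w3.
  apply/hrectP => /=; split => //; rewrite w1 /T0 /T1 ler_ln ?posrE ?cabs_gt0 //.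
  by rewrite ltr_ln ?posrE ?cabs_gt0.
exists (cexp (toC q)) => //; have eT0 : expR T0 = r0 by rewrite lnK ?posrE.
have eT1 : expR T1 = r1 by rewrite lnK ?posrE.
by rewrite cabs_cexp -eT0 -eT1 ler_expR ltr_expR.
Qed.

Lemma annimg_measurable : measurable (annimg f r0 r1).
Proof. by rewrite annimgE; apply: (cimg_measurable tG). Qed.

Lemma polar_area : (fun N => pi / N.+1%:R * \sum_(j < N.+1)
    (re (pflux P e f f' (r1%:C%C * runity R N.+1 j)) -
     re (pflux P e f f' (r0%:C%C * runity R N.+1 j)))) @ \oo -->
  (\int[mu2]_(p in annimg f r0 r1) weight P e (toC p) : R).
Proof.
have h0 := r00; have h1 := r10; rewrite annimgE.
have G1 x : T0 <= x <= T1 -> G (Complex x (pi *+ 2)) = G (Complex x 0) by rewrite /G per.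
have G2 x : T0 <= x <= T1 -> G' (Complex x (pi *+ 2)) = G' (Complex x 0) by rewrite /G' per.
have h Q := weighted_area (P := Q) T01 e01 tG tG' Ginj G1 G2.
apply: (cvg_ext (h P)) => N.
by congr (_ * _); apply: eq_bigr => j _; rewrite /flux /pflux /G /G' /cexp /= !lnK ?posrE.
Qed.
End Annulus.
End Polar.

(** * Integrals of the weight over large discs *)

Section PlaneIntegrals.
Variable R : realType.
Local Notation P2 := (measurableTypeR R * measurableTypeR R)%type.
Implicit Types (z w : R[i]) (r t : R) (A C D : set P2).

Definition cdisc r : set P2 := [set p | cabs (toC p) <= r].

Lemma measurable_cdisc r : measurable (cdisc r).
Proof. by apply: compact_measurable2; exact: compact_disc. Qed.

Lemma mu2_cdisc r : 0 <= r -> (mu2 (cdisc r) <= (4 * r ^+ 2)%:E)%E.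
Proof.
move=> r0; apply: (@le_trans _ _ (mu2 (`[- r, r] `*` `[- r, r]))).
  apply: le_measure; rewrite ?inE; [exact: measurable_cdisc|exact: measurable_rect|].
  move=> p hp; apply/rectP; rewrite -!ler_norml.
  by split; apply: le_trans hp; [exact: (re_le_cabs (toC p))|exact: (im_le_cabs (toC p))].
by rewrite mu2_rect ?lee_fin; [rewrite expr2; lra|lra|lra].
Qed.

Section Bounded.
Variables (u : R[i] -> R) (B : R).
Hypothesis uB : forall w, `|u w| <= B.
Hypothesis mu : measurable_fun [set: P2] (fun p : P2 => u (toC p)).

Lemma Rint_le A C b : measurable A -> measurable C -> (mu2 A < +oo)%E -> 0 <= b ->
  (forall p, A p -> C p -> u (toC p) <= b) -> (forall p, A p -> ~ C p -> u (toC p) <= 0) ->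
  \int[mu2]_(p in A) u (toC p) <= b * fine (mu2 (A `&` C)).
Proof.
move=> mA mC fA b0 h1 h2; have mAC := measurableI _ _ mA mC; have mAnC := measurableD mA mC.
have fin X : measurable X -> X `<=` A -> (mu2 X < +oo)%E.
  by move=> mX XA; apply: le_lt_trans fA; apply: le_measure; rewrite ?inE.
have int_c X c : measurable X -> X `<=` A -> mu2.-integrable X (EFin \o (fun=> c)).
  move=> mX XA; apply: measurable_bounded_integrable => //; first exact: fin.
  exists `|c|; split; first exact: num_real.
  by move=> x cx p _ /=; apply: ltW.
have sI : A `&` C `<=` A by exact: subIsetl.
have sD : A `\` C `<=` A by exact: subDsetl.
have AE : (A `&` C) `|` (A `\` C) = A by exact: setUIDK.
rewrite -{1}AE Rintegral_setU //; last 2 first.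
- by rewrite AE; apply: (integrable_bounded uB mu).
- by apply/eqP; apply/seteqP; split => p // [[_ Cp] []].
rewrite -[leRHS]addr0; apply: lerD.
  rewrite -Rintegral_cst //; apply: le_Rintegral => //; last by move=> p [Ap Cp]; exact: h1.
    by apply: (integrable_bounded uB mu) => //; exact: fin.
  exact: int_c.
apply: (@le_trans _ _ (\int[mu2]_(p in A `\` C) 0)); last by rewrite Rintegral_cst // mul0r.
apply: le_Rintegral => //; last by move=> p [Ap Cp]; exact: h2.
  by apply: (integrable_bounded uB mu) => //; exact: fin.
exact: int_c.
Qed.

Lemma Rint_subset A D : measurable A -> measurable D -> (mu2 D < +oo)%E -> A `<=` D ->
  \int[mu2]_(p in D) u (toC p) = \int[mu2]_(p in A) u (toC p) + \int[mu2]_(p in D `\` A) u (toC p).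
Proof.
move=> mA mD fD AD; have AE : A `|` (D `\` A) = D by rewrite setDUK.
rewrite -{1}AE Rintegral_setU //; first exact: measurableD.
- by rewrite AE; apply: (integrable_bounded uB mu).
- by apply/eqP; apply/seteqP; split => p // [Ap [_ []]].
Qed.
End Bounded.

Lemma Rint_small (u : R[i] -> R) (B b : R) A C : (forall w, `|u w| <= B) ->
  measurable_fun [set: P2] (fun p : P2 => u (toC p)) ->
  measurable A -> measurable C -> (mu2 A < +oo)%E -> (mu2 C <= b%:E)%E ->
  (forall p, A p -> ~ C p -> u (toC p) = 0) -> `|\int[mu2]_(p in A) u (toC p)| <= B * b.
Proof.
move=> uB mu mA mC fA Cb h; have B0 : 0 <= B := le_trans (normr_ge0 _) (uB 0).
have mI : measurable (A `&` C) by exact: measurableI.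
have b1 : B * fine (mu2 (A `&` C)) <= B * b.
  apply: ler_wpM2l => //; have le1 : (mu2 (A `&` C) <= b%:E)%E.
    by apply: le_trans Cb; apply: le_measure; rewrite ?inE.
  rewrite -lee_fin fineK // ge0_fin_numE //; exact: le_lt_trans le1 (ltry _).
have up : \int[mu2]_(p in A) u (toC p) <= B * fine (mu2 (A `&` C)).
  apply: (Rint_le uB mu) => // [p _ _|p Ap Cp]; last by rewrite h.
  exact: le_trans (ler_norm _) (uB _).
pose v w := - u w; have vB w : `|v w| <= B by rewrite normrN.
have mv : measurable_fun [set: P2] (fun p : P2 => v (toC p)) by exact: measurable_funN.
have lo : \int[mu2]_(p in A) v (toC p) <= B * fine (mu2 (A `&` C)).
  apply: (Rint_le vB mv) => // [p _ _|p Ap Cp]; last by rewrite /v h ?oppr0.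
  exact: le_trans (ler_norm _) (vB _).
have vE : \int[mu2]_(p in A) v (toC p) = - \int[mu2]_(p in A) u (toC p).
  rewrite -mulN1r -RintegralZl //; last by apply: (integrable_bounded uB mu).
  by apply: eq_Rintegral => p _; rewrite mulN1r.
by rewrite vE in lo; rewrite ler_norml; lra.
Qed.

Lemma cut_sqr_dist (x : R) : 0 <= x -> 0 <= 1 - cut x ^+ 2 <= 2 * x.
Proof. by move=> x0; rewrite cutE; case: (leP x 1) => h; rewrite !expr2; apply/andP; split; nra. Qed.

(** Apply the polar formula to the identity on d <= |z| < r. The outer flux vanishes with the
    cutoff, the inner flux is O(d) because of the factor z, and the removed disc has area O(d^2);
    then let d tend to 0. *)
Lemma weight_total (P : {poly R[i]}) (e : R) : 0 < e <= 1 -> exists2 K : R, 1 <= K &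
  (forall w, K <= cabs w -> weight P e w = 0 /\ cut (e * cabs P.[w] ^+ 2) * cabs P^`().[w] = 0) /\
  forall r, K < r -> \int[mu2]_(p in cdisc r) weight P e (toC p) = 0.
Proof.
move=> e01; have /andP[e0 e1] := e01; have [K K1 hK] := weight_support P e0.
exists K => //; split => // r Kr; have r0 : 0 < r by lra.
have [B B0 hB] := weight_bounded P e0; have mw := @measurable_weight R P e.
have l01 : (0 : R) <= 1 by [].
have [M1 M10 hM1] := tay_horner P l01; have [M2 M20 hM2] := tay_horner P^`() l01.
set J := \int[mu2]_(p in cdisc r) _.
have pp := pi_gt0 R.
have est d : 0 < d < 1 -> `|J| <= (pi * (M1 * M2) + B * 4) * d.
  move=> /andP[d0 d1]; have dr : d < r by lra.
  have sub x y c : hol (annulus d r) x y c -> hol [set z | cabs z <= r] x y c.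
    by move=> [/andP[_ h1] /andP[_ h2] ->].
  have t1 := tay_sub sub (tay_id (ltW r0)).
  have t2 : tay (hol (annulus d r)) (fun=> 1 : R[i]) (fun=> 0) := tay_cst _ 1.
  have inj z w : annulus d r z -> annulus d r w -> id z = id w -> z = w by [].
  have mA : measurable (annimg id d r) := annimg_measurable d0 dr t1.
  have AD : annimg id d r `<=` cdisc r.
    by move=> p [z /andP[_ h] /= zp]; rewrite /cdisc /= -zp ltW.
  have fD : (mu2 (cdisc r) < +oo)%E := le_lt_trans (mu2_cdisc (ltW r0)) (ltry _).
  rewrite /J (Rint_subset hB mw mA (measurable_cdisc r) fD AD).
  apply: le_trans (ler_normD _ _) _; rewrite mulrDl; apply: lerD; last first.
    rewrite -mulrA; apply: (Rint_small (C := cdisc d) hB mw) => //.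
    - apply: measurableD => //; exact: measurable_cdisc.
    - exact: measurable_cdisc.
    - by apply: le_lt_trans fD; apply: le_measure; rewrite ?inE; [apply: measurableD => //|..]; 
        [exact: measurable_cdisc|exact: measurable_cdisc|exact: subDsetl].
    - by apply: le_trans (mu2_cdisc (ltW d0)) _; rewrite lee_fin ler_wpM2l // expr2 ler_piMl // ltW.
    - move=> p [/= pr np] /negP; rewrite -ltNge => pd.
      have [rp|rp] := leP r (cabs (toC p)); first by have [] := hK (toC p) (le_trans (ltW Kr) rp).
      by case: np; exists (toC p) => //; rewrite rp ltW.
  have lim := polar_area (P := P) d0 dr e01 t1 t2 inj.
  set I := Rintegral _ _ _ in lim *.
  have bnd N : `|pi / N.+1%:R * \sum_(j < N.+1) (re (pflux P e id (fun=> 1) (r%:C%C * runity R N.+1 j)) -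
     re (pflux P e id (fun=> 1) (d%:C%C * runity R N.+1 j)))| <= pi * (M1 * M2) * d.
    have n0 : 0 < N.+1%:R :> R by rewrite ltr0n.
    rewrite normrM ger0_norm; last by rewrite divr_ge0 // ltW.
    rewrite -!mulrA ler_wpM2l ?(ltW pp) // mulrC ler_pdivrMr // mulrC.
    apply: le_trans (ler_norm_sum _ _ _) _; rewrite mulr_natl -[X in _ *+ X]card_ord -sumr_const.
    apply: ler_sum => j _; set z1 := r%:C%C * _; set z0 := d%:C%C * _.
    have c1 : cabs z1 = r by rewrite cabsM cabs_runity cabs_real gtr0_norm // mulr1.
    have c0 : cabs z0 = d by rewrite cabsM cabs_runity cabs_real gtr0_norm // mulr1.
    have -> : pflux P e id (fun=> 1) z1 = 0.
      have [|_ k] := hK z1; first by rewrite c1 ltW.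
      move/eqP: k; rewrite mulf_eq0 cabs_eq0 => /orP[] /eqP k; rewrite /pflux k.
        by rewrite expr0n mulr0.
      by rewrite mul0r mulr0 mul0r.
    rewrite sub0r normrN; apply: le_trans (re_le_cabs _) _.
    have dle : cabs z0 <= 1 by rewrite c0 ltW.
    have [p1 _ _ _] := hM1 z0 z0 _ (And3 dle dle erefl); have [p2 _ _ _] := hM2 z0 z0 _ (And3 dle dle erefl).
    rewrite /pflux mul1r [cabs (_ * _%:C%C)]cabsM cabs_real [cabs (_ * (_ * _))]cabsM [cabs (_ * z0)]cabsM cabs_conj c0.
    have x0 : 0 <= e * cabs P.[z0] ^+ 2 := mulr_ge0 (ltW e0) (exprn_ge0 _ (cabs_ge0 _)).
    have /andP[k1 k2] := cut01 x0.
    have k3 : `|cut (e * cabs P.[z0] ^+ 2) ^+ 2| <= 1.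
      by rewrite ger0_norm ?exprn_ge0 // exprn_ile1.
    rewrite -[leRHS]mulr1; apply: ler_pM => //; first by rewrite !mulr_ge0 // ltW.
    by rewrite !mulrA ler_wpM2r ?(ltW d0) //; apply: ler_pM.
  rewrite ler_norml; apply/andP; split.
    by apply: (rcvg_ge lim); exists 0%N => n _; have := bnd n; rewrite ler_norml => /andP[].
  by apply: (rcvg_le lim); exists 0%N => n _; have := bnd n; rewrite ler_norml => /andP[].
apply/eqP; rewrite -normr_le0; apply/ler_addgt0Pr => x x0; rewrite add0r.
set C := pi * (M1 * M2) + B * 4 in est.
have C0 : 0 <= C by rewrite /C addr_ge0 // !mulr_ge0 // ltW.
have [N hN] := div_nat_small C x0; have {}hN := hN N.+1 (leqnSn N).
apply: le_trans (ltW hN); apply: est.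
by rewrite invr_gt0 ltr0n /= invf_lt1 ?ltr0n // ltr1n.
Qed.
End PlaneIntegrals.

Section TaylorUnique.
Variable R : realType.

(** Subtracting the two Taylor bounds and dividing by |w - z| leaves an error that vanishes as w
    approaches [z] inside [A]. *)
Lemma tay_unique (A : set R[i]) f f1 f2 z : tay (hol A) f f1 -> tay (hol A) f f2 -> A z ->
  (forall d : R, 0 < d -> exists w, [/\ A w, w != z & cabs (w - z) < d]) -> f1 z = f2 z.
Proof.
move=> [M1 M10 h1] [M2 M20 h2] Az hz; apply/eqP; rewrite -subr_eq0 -cabs_eq0 eq_le cabs_ge0 andbT.
apply/ler_addgt0Pr => x x0; rewrite add0r.
have d0 : 0 < x / (M1 + M2 + 1) by rewrite divr_gt0 //; lra.
have [w [Aw wz wd]] := hz _ d0.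
have [_ _ _ k1] := h1 z w _ (And3 Az Aw erefl); have [_ _ _ k2] := h2 z w _ (And3 Az Aw erefl).
have c0 : 0 < cabs (w - z) by rewrite cabs_gt0 subr_eq0.
have : cabs (f1 z - f2 z) * cabs (w - z) <= (M1 + M2) * cabs (w - z) * cabs (w - z).
  rewrite -cabsM (_ : _ * _ = (f w - f z - f2 z * (w - z)) - (f w - f z - f1 z * (w - z))); last by ring.
  apply: le_trans (cabsD _ _) _; rewrite cabsN -mulrA -expr2; lra.
rewrite ler_pM2r // => h; apply: le_trans h _.
move: wd; rewrite ltr_pdivlMr; last by lra.
by move=> h; nra.
Qed.

Lemma tent01 (x : R) : 0 <= x -> 3 * x <= 1 -> 0 <= tent x <= 1.
Proof.
move=> x0 x1; have := cut01 x0; rewrite /tent => /andP[c0 c1].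
by apply/andP; split; nra.
Qed.
End TaylorUnique.

(** For the Laurent series h with z^n h(z) = sum a_k z^k, these are the coefficients of z^n (z
    h'(z)). *)
Definition shifted_euler (R : realType) n (a : nat -> R[i]) k : R[i] := (k%:R - n%:R) * a k.

Lemma unit_radius_shifted (R : realType) n (a : nat -> R[i]) : unit_radius a -> unit_radius (shifted_euler n a).
Proof.
move=> ha; have h1 := unit_radius_delay (unit_radius_dcoef ha); have h2 := unit_radiusZ (- n%:R) ha.
have := unit_radiusD h1 h2; congr unit_radius; apply/funext => -[|k] /=; rewrite /shifted_euler /dcoef; ring.
Qed.

(** * The area theorem for polynomials in a univalent map with a pole *)

Section Exterior.
Variable R : realType.
Local Notation P2 := (measurableTypeR R * measurableTypeR R)%type.
Implicit Types (z w : R[i]) (r t s : R).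
Variable Y : nat -> R[i].
Hypothesis hY : unit_radius Y.
Hypothesis Y0 : Y 0%N = 1.

(** With Y the series of z / f this is 1 / f: the exterior map read inside the disc, with its simple
    pole at 0. *)
Definition laurent (Y : nat -> R[i]) z : R[i] := psum Y z * z^-1.
Definition dlaurent (Y : nat -> R[i]) z : R[i] := psum (dcoef Y) z * z^-1 + psum Y z * - (z^-1 ^+ 2).
Local Notation y := (laurent Y).
Local Notation y' := (dlaurent Y).
Hypothesis yinj : forall z w, 0 < cabs z < 1 -> 0 < cabs w < 1 -> y z = y w -> z = w.

Let tpsum a r0 r1 : unit_radius a -> 0 < r0 -> r1 < 1 -> tay (hol (annulus r0 r1)) (psum a) (psum (dcoef a)).
Proof.
move=> ha r00 r11; have [r10|r10] := leP 0 r1.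
  apply: (tay_sub _ (tay_psum ha (_ : 0 <= r1 < 1))); last by rewrite r10.
  by move=> x z d [/andP[_ h1] /andP[_ h2] ->].
by exists 0 => // x z d [/andP[h1 h2] _ _]; have := cabs_ge0 x; lra.
Qed.

Let tinv r0 r1 : 0 < r0 -> tay (hol (annulus r0 r1)) (fun z => z^-1) (fun z => - (z^-1 ^+ 2)).
Proof. by move=> r00; apply: tay_sub (tay_inv r00) => x z d [/andP[h1 _] /andP[h2 _] ->]. Qed.

Let ty r0 r1 : 0 < r0 -> r1 < 1 -> tay (hol (annulus r0 r1)) y y'.
Proof. by move=> r00 r11; exact: tayM (tpsum hY r00 r11) (tinv r1 r00). Qed.

Let ty' r0 r1 : 0 < r0 -> r1 < 1 -> exists y'', tay (hol (annulus r0 r1)) y' y''.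
Proof.
move=> r00 r11; have ti := tinv r1 r00; have t1 := tpsum hY r00 r11.
have t2 := tpsum (unit_radius_dcoef hY) r00 r11.
have t3 := tayD (tayM t2 ti) (tayM t1 (tayZ (-1) (tayM ti ti))).
eexists; move: t3; congr (tay _ _ _); apply/funext => z; rewrite /dlaurent expr2; ring.
Qed.

Lemma laurent_large (K : R) : exists2 r, 0 < r < 1 & forall z, 0 < cabs z <= r -> K <= cabs (y z).
Proof.
have h2 : 0 <= (2^-1 : R) < 1 by lra.
have [L L0 hL] := tay_lip (tay_psum hY h2).
pose D := `|K| + L + 2; have D0 : 0 < D by rewrite /D; have := normr_ge0 K; lra.
have D1 : D^-1 <= 2^-1 by rewrite lef_pV2 ?posrE // /D; have := normr_ge0 K; lra.
exists D^-1; first by rewrite invr_gt0 D0; lra.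
move=> z /andP[z0 zD]; have zh : cabs z <= 2^-1 by lra.
have h0 : cabs (0 : R[i]) <= 2^-1 by rewrite cabs0; lra.
have := hL 0 z _ (And3 h0 zh erefl); rewrite subr0 psum0 // Y0 => hz.
have h1 : 1 - L * cabs z <= cabs (psum Y z).
  by have := cabsD (psum Y z) (1 - psum Y z); rewrite addrC subrK cabs1 [cabs (1 - _)]cabsB; lra.
rewrite /laurent cabsM cabsV ler_pdivlMr //.
have zD2 : D * cabs z <= 1 by rewrite mulrC -ler_pdivlMr // div1r.
have k : K * cabs z <= `|K| * cabs z by rewrite ler_wpM2r // ler_norm.
by move: zD2; rewrite /D; nra.
Qed.

(** The equation becomes Y(z) = w z. For large |w| the modulus of the difference exceeds 1 on the
    circle |z| = s, while it is 1 at the origin; so its minimiser over the disc is interior, where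
    the derivative is nonzero because |w| dominates Y'. *)
Lemma laurent_covers t : 0 < t < 1 -> exists2 K : R, 1 <= K &
  forall w, K <= cabs w -> exists2 z, 0 < cabs z < t & y z = w.
Proof.
move=> /andP[t0 t1]; pose s := t / 2; have s0 : 0 < s by rewrite /s; lra.
have s1 : 0 <= s < 1 by rewrite /s; lra.
have tY := tay_psum hY s1; have [M M0 hM] := tY.
exists (1 + M + (M + 2) / s).
  by have : 0 < (M + 2) / s; [rewrite divr_gt0 //; lra|lra].
move=> w hw; have w1 : 1 + M <= cabs w by have : 0 < (M + 2) / s; [rewrite divr_gt0 //; lra|lra].
have w2 : M + 2 <= cabs w * s.
  by rewrite -ler_pdivrMr //; lra.
pose G z := psum Y z + - w * z; pose g z := psum (dcoef Y) z + - w * 1.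
have tG : tay (hol [set z | cabs z <= s]) G g by exact: tayD tY (tayZ (- w) (tay_id (ltW s0))).
have [L L0 hL] := tay_lip tG.
have [z0 z0s zmin] : exists2 z, cabs z <= s & forall v, cabs v <= s -> cabs (G z) <= cabs (G v).
  apply: (disc_min (F := fun z => cabs (G z)) (L := L)) => [|z v zs vs]; first exact: ltW.
  by apply: le_trans (cabs_distB _ _) _; apply: hL; split.
have G0 : cabs (G 0) = 1 by rewrite /G psum0 // Y0 mulr0 addr0 cabs1.
have h0 : cabs (0 : R[i]) <= s by rewrite cabs0 ltW.
have hY1 v : cabs v <= s -> cabs (psum Y v) <= M /\ cabs (psum (dcoef Y) v) <= M.
  by move=> vs; have [? _ ? _] := hM v v _ (And3 vs vs erefl).
have z0lt : cabs z0 < s.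
  rewrite lt_neqAle z0s andbT; apply/negP => /eqP e.
  have := zmin 0 h0; rewrite G0; have [k _] := hY1 _ z0s.
  by have := cabs_geB (w * z0) (psum Y z0); rewrite cabsB /G mulNr cabsM e; lra.
have gn0 : g z0 != 0.
  rewrite -cabs_gt0; have [_ k] := hY1 _ z0s.
  by have := cabs_geB w (psum (dcoef Y) z0); rewrite cabsB /g mulr1; lra.
have Gz0 : G z0 = 0.
  apply: (@min_modulus_zero _ G (g z0) M (s - cabs z0)) => //; first by rewrite subr_gt0.
  move=> v hv; have vs : cabs v <= s by have := cabsD (v - z0) z0; rewrite subrK; lra.
  split; last by rewrite !subr0; exact: zmin.
  rewrite (_ : G v - G z0 - _ = psum Y v - psum Y z0 - psum (dcoef Y) z0 * (v - z0)).
    by have [_ _ _] := hM z0 v _ (And3 z0s vs erefl).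
  by rewrite /G /g; move: (psum Y v) (psum Y z0) (psum _ z0) => a b c; ring.
have z00 : z0 != 0.
  by apply/eqP => e; move: G0; rewrite -e Gz0 cabs0 => /eqP; rewrite eq_sym oner_eq0.
have st : s <= t by rewrite /s ler_pdivrMr // ler_peMr ?ltW // ltr1n.
exists z0; first by rewrite cabs_gt0 z00 /= (lt_le_trans z0lt st).
by rewrite /laurent; move/eqP: Gz0; rewrite /G mulNr subr_eq0 => /eqP ->; rewrite mulfK.
Qed.

Definition omitted (Y : nat -> R[i]) t : set P2 :=
  [set p | ~ exists2 z, 0 < cabs z < t & laurent Y z = toC p].

Section Area.
Variables (P : {poly R[i]}) (q : nat -> R[i]) (N : nat).
Hypothesis hq : unit_radius q.
Hypothesis rel : forall z, 0 < cabs z < 1 -> P.[y z] * z ^+ N = psum q z.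

(** The sum of (k - N) |q_k|^2 t^(2k - 2N); times pi it is the signed area enclosed by the image of
    |z| = t under [P \o y]. *)
Definition laurent_area (q : nat -> R[i]) N t : R :=
  re (psum (fun k => (q k)^*%C * ((k%:R - N%:R) * q k)) (t ^+ 2)%:C%C) / t ^+ (2 * N).

Local Notation q' := (shifted_euler N q).

Let hq' : unit_radius q'.
Proof. exact: unit_radius_shifted. Qed.

(** Both sides of z^N P(y z) = q(z) are differentiated as functions on an annulus, and uniqueness of
    the Taylor derivative identifies the results. *)
Lemma psum_shifted_euler z : 0 < cabs z < 1 -> P^`().[y z] * (y' z * z) * z ^+ N = psum q' z.
Proof.
move=> /andP[z0 z1]; pose r0 := cabs z / 2.
have r00 : 0 < r0 by rewrite /r0; lra.
have [M M0 hM] := ty r00 z1.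
have t1 : tay (hol (annulus r0 (cabs z))) (fun x => P.[y x]) (fun x => P^`().[y x] * y' x).
  by apply: (tay_comp (ty r00 z1) _ (tay_horner P M0)) => x v d /hM[].
have tX : tay (hol (annulus r0 (cabs z))) (fun x => x ^+ N) (fun x => N%:R * x ^+ N.-1).
  have := tay_horner ('X^N) (ltW z0); rewrite derivXn => h.
  have h' : tay (hol [set x | cabs x <= cabs z]) (fun x => x ^+ N) (fun x => N%:R * x ^+ N.-1).
    move: h; congr (tay _ _ _); apply/funext => x; rewrite ?hornerMn ?hornerXn //.
    by rewrite mulr_natl.
  by apply: tay_sub h' => x v d [/andP[_ h1] /andP[_ h2] ->].
have t2 := tayM t1 tX.
have t3 := tpsum hq r00 z1.
have AE x : annulus r0 (cabs z) x -> P.[y x] * x ^+ N = psum q x.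
  by move=> /andP[h1 h2]; apply: rel; rewrite (lt_le_trans r00 h1) (le_lt_trans h2 z1).
have t4 : tay (hol (annulus r0 (cabs z))) (psum q) (fun x => P^`().[y x] * y' x * x ^+ N + P.[y x] * (N%:R * x ^+ N.-1)).
  have [M2 M20 h2] := t2; exists M2 => // x v d hxv; have [hx hv _] := hxv.
  by have := h2 _ _ _ hxv; rewrite !AE.
have zA : annulus r0 (cabs z) z by rewrite /annulus /= lexx andbT /r0; lra.
have e1 : psum (dcoef q) z = P^`().[y z] * y' z * z ^+ N + P.[y z] * (N%:R * z ^+ N.-1).
  apply: (tay_unique t3 t4 zA) => d d0; pose t := Num.min (d / 2) 2^-1.
  have t0 : 0 < t by rewrite lt_min; apply/andP; split; lra.
  have td : t <= d / 2 by rewrite ge_min lexx.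
  have th : t <= 2^-1 by rewrite ge_min lexx orbT.
  have wz : (1 - t)%:C%C * z - z = - (t%:C%C * z) by rewrite rmorphB rmorph1; ring.
  exists ((1 - t)%:C%C * z); split.
  - by rewrite /annulus /= cabsM cabs_real ger0_norm; [rewrite /r0; nra|lra].
  - by rewrite -subr_eq0 wz oppr_eq0 -cabs_gt0 cabsM cabs_real gtr0_norm // mulr_gt0.
  - by rewrite wz cabsN cabsM cabs_real gtr0_norm //; nra.
have zn0 : z != 0 by rewrite -cabs_gt0.
have -> : psum q' z = z * psum (dcoef q) z - N%:R * psum q z.
  have e2 := psum_delay (unit_radius_dcoef hq) z1; have e3 := psumZ N%:R hq z1.
  rewrite -e2 -e3 -psumB //; last 2 first.
  - exact/unit_radius_delay/unit_radius_dcoef.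
  - exact: unit_radiusZ.
  by apply: eq_psum => -[|k]; rewrite /shifted_euler /dcoef; ring.
rewrite e1 -rel ?z0 //; case: (N) => [|n]; first by ring.
by rewrite exprS /=; ring.
Qed.

(** The inner circle contributes nothing because the cutoff vanishes on it. On the outer circle,
    dropping the cutoff costs O(e), and the remaining mean is Parseval's sum. *)
Let flux_mean t : 0 < t < 1 -> exists2 C : R, 0 <= C & forall e r0 : R, 0 < e <= 1 -> 0 < r0 < t ->
  (forall z, cabs z = r0 -> cut (e * cabs P.[y z] ^+ 2) * cabs P^`().[y z] = 0) ->
  `|\int[mu2]_(p in annimg y r0 t) weight P e (toC p) - pi * laurent_area q N t| <= C * e.
Proof.
move=> /andP[t0 t1]; have t01 : 0 <= t < 1 by rewrite (ltW t0).
have [M1 M10 hM1] := psum_bounded hq t01; have [M2 M20 hM2] := psum_bounded hq' t01.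
have tN : 0 < t ^+ N by exact: exprn_gt0.
have t2N : 0 < t ^+ (2 * N) by exact: exprn_gt0.
pose M3 := M1 * M2 / t ^+ (2 * N); pose M4 := M1 / t ^+ N; have pp := pi_gt0 R.
have M30 : 0 <= M3 by rewrite divr_ge0 ?mulr_ge0 // ltW.
have M40 : 0 <= M4 by rewrite divr_ge0 // ltW.
exists (pi * (M3 * (2 * M4 ^+ 2))); first by rewrite mulr_ge0 ?(ltW pp) // mulr_ge0 // mulr_ge0 // exprn_ge0.
move=> e r0 e01 /andP[r00 r0t] hz; have /andP[e0 e1] := e01.
pose F z := re ((psum q z)^*%C * psum q' z) / t ^+ (2 * N).
have FE z : cabs z = t -> re (pflux P e y y' z) = F z * cut (e * cabs P.[y z] ^+ 2) ^+ 2.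
  move=> zt; have z01 : 0 < cabs z < 1 by rewrite zt t0.
  rewrite /pflux mulrC reZ mulrC; congr (_ * _).
  rewrite /F -psum_shifted_euler // -rel // conjM.
  have -> : (P.[y z])^*%C * (z ^+ N)^*%C * (P^`().[y z] * (y' z * z) * z ^+ N) =
     (z ^+ N * (z ^+ N)^*%C) * ((P.[y z])^*%C * (P^`().[y z] * (y' z * z))) by ring.
  by rewrite mulcJ cabsX zt -exprM mulnC reZ [_ * re _]mulrC mulfK // gt_eqF.
have Fb z : cabs z = t -> `|F z| <= M3.
  move=> zt; rewrite /F /M3 normrM [`|_^-1|]ger0_norm ?invr_ge0 ?(ltW t2N) //.
  apply: ler_wpM2r; first by rewrite invr_ge0 ltW.
  apply: le_trans (re_le_cabs _) _; rewrite cabsM cabs_conj.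
  by apply: ler_pM => //; [apply: hM1|apply: hM2]; rewrite zt.
have Pb z : cabs z = t -> cabs P.[y z] <= M4.
  move=> zt; have z01 : 0 < cabs z < 1 by rewrite zt t0.
  rewrite /M4 ler_pdivlMr // -zt -cabsX -cabsM rel //; apply: hM1; rewrite zt //.
have [y'' ty''] := ty' r00 t1.
have inj z w : annulus r0 t z -> annulus r0 t w -> y z = y w -> z = w.
  by move=> /andP[a1 a2] /andP[b1 b2]; apply: yinj; apply/andP; split; lra.
have lim := polar_area (P := P) r00 r0t e01 (ty r00 t1) ty'' inj.
have lim2 := rcvgMl (pi / t ^+ (2 * N)) (ccvg_re (psum_parseval hq hq' t01)).
have lim3 : (fun n => pi / n.+1%:R * \sum_(j < n.+1) F (t%:C%C * runity R n.+1 j)) @ \oo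
   --> pi * laurent_area q N t.
  have -> : pi * laurent_area q N t = pi / t ^+ (2 * N) * re (psum (fun k => (q k)^*%C * q' k) (t ^+ 2)%:C%C).
    by rewrite /laurent_area /shifted_euler; ring.
  apply: (cvg_ext lim2) => n /=; rewrite /F.
  have -> : (n.+1%:R^-1 : R[i]) = (n.+1%:R^-1)%:C%C by rewrite fmorphV rmorph_nat.
  by rewrite reZ re_sum -mulr_suml; ring.
have lim4 := rcvgB lim lim3; set I := Rintegral _ _ _ in lim lim4 *.
have bnd n : `|pi / n.+1%:R * \sum_(j < n.+1) (re (pflux P e y y' (t%:C%C * runity R n.+1 j)) -
     re (pflux P e y y' (r0%:C%C * runity R n.+1 j))) - pi / n.+1%:R * \sum_(j < n.+1) F (t%:C%C * runity R n.+1 j)|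
     <= pi * (M3 * (2 * M4 ^+ 2)) * e.
  have n0 : 0 < n.+1%:R :> R by rewrite ltr0n.
  rewrite -mulrBr normrM ger0_norm; last by rewrite divr_ge0 // ltW.
  rewrite -[leRHS]mulrA -[leLHS]mulrA; set D := M3 * (2 * M4 ^+ 2) * e.
  rewrite ler_wpM2l ?(ltW pp) // mulrC ler_pdivrMr // mulrC -sumrB.
  apply: le_trans (ler_norm_sum _ _ _) _; rewrite [_ * D]mulr_natl -[X in _ *+ X]card_ord -sumr_const.
  apply: ler_sum => j _; rewrite /D -mulrA; set z1 := t%:C%C * _; set z0 := r0%:C%C * _.
  have c1 : cabs z1 = t by rewrite cabsM cabs_runity cabs_real gtr0_norm // mulr1.
  have c0 : cabs z0 = r0 by rewrite cabsM cabs_runity cabs_real gtr0_norm // mulr1.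
  have -> : pflux P e y y' z0 = 0.
    have := hz z0 c0 => /eqP; rewrite mulf_eq0 cabs_eq0 => /orP[] /eqP k; rewrite /pflux k.
      by rewrite expr0n mulr0.
    by rewrite mul0r mulr0 mul0r.
  rewrite subr0 FE // -[X in _ - X]mulr1 -mulrBr normrM; apply: ler_pM => //; first exact: Fb.
  have x0 : 0 <= e * cabs P.[y z1] ^+ 2 := mulr_ge0 (ltW e0) (exprn_ge0 _ (cabs_ge0 _)).
  have /andP[k1 k2] := cut_sqr_dist x0; rewrite distrC ger0_norm //; apply: le_trans k2 _.
  rewrite -mulrA ler_wpM2l // mulrC ler_wpM2r ?(ltW e0) // lerXn2r ?nnegrE //; exact: Pb.
rewrite ler_norml; apply/andP; split.
  by apply: (rcvg_ge lim4); exists 0%N => n _; have := bnd n; rewrite ler_norml => /andP[].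
by apply: (rcvg_le lim4); exists 0%N => n _; have := bnd n; rewrite ler_norml => /andP[].
Qed.

(** The weight has total integral 0, so its integral over the image is the opposite of that over the
    omitted set, where it lies between 0 and M2^2 once [e] is small. Omitted sets for t >= 1/2 lie
    in one fixed disc, which makes [M] independent of [t]. *)
Lemma area_theorem : exists2 M : R, 0 <= M & forall t, 2^-1 <= t < 1 ->
  [/\ measurable (omitted Y t), (mu2 (omitted Y t) < +oo)%E, laurent_area q N t <= 0 &
      - pi * laurent_area q N t <= M * fine (mu2 (omitted Y t))].
Proof.
have h2 : 0 < (2^-1 : R) < 1 by lra.
have [K1 K11 hK1] := laurent_covers h2; have K10 : 0 <= K1 by lra.
have [M1 M10 hM1] := tay_horner P K10; have [M2 M20 hM2] := tay_horner P^`() K10.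
have [r3 /andP[r30 r31] hr3] := laurent_large (K1 + 1).
exists (M2 ^+ 2); first exact: exprn_ge0.
move=> t /andP[th t1]; have t0 : 0 < t by lra.
have cov w : K1 <= cabs w -> exists2 z, 0 < cabs z < t & y z = w.
  by move=> /hK1[z /andP[z0 z1] e]; exists z => //; rewrite z0 /=; lra.
pose r4 := Num.min r3 (t / 2); have r40 : 0 < r4 by rewrite lt_min r30 /=; lra.
have r4t : r4 < t by rewrite gt_min; apply/orP; right; lra.
have r43 : r4 <= r3 by rewrite ge_min lexx.
have mE : measurable (omitted Y t).
  have -> : omitted Y t = cdisc K1 `\` annimg y r4 t.
    apply/seteqP; split => p /=.
      move=> np; split; last by move=> [z /andP[z1 z2] e]; apply: np; exists z => //; rewrite z2 andbT; lra.
      by rewrite /cdisc /= leNgt; apply/negP => /ltW /cov.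
    move=> [hp np] [z /andP[z0 zt] e]; apply: np; exists z => //; rewrite zt andbT leNgt.
    apply/negP => zr; have := hr3 z; rewrite z0 e => /(_ _); rewrite /cdisc /= in hp; apply: contraPP => _.
    move/(_ (le_trans (ltW zr) r43)); lra.
  by apply: measurableD; [exact: measurable_cdisc|exact: annimg_measurable r40 r4t (ty r40 t1)].
have fE : (mu2 (omitted Y t) < +oo)%E.
  apply: le_lt_trans (ltry (4 * K1 ^+ 2)); apply: le_trans (mu2_cdisc K10).
  apply: le_measure; rewrite ?inE //; first exact: measurable_cdisc.
  by move=> p np; rewrite /cdisc /= leNgt; apply/negP => /ltW /cov.
have t01 : 0 < t < 1 by rewrite t0.
have [C C0 hC] := flux_mean t01.
set A := laurent_area q N t in hC *; set m := fine (mu2 (omitted Y t)).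
(* For e <= e0 one has 3 e |P|^2 <= 1 on the omitted set, the range in which [tent] is
   nonnegative. *)
pose e0 := (1 + 3 * M1 ^+ 2)^-1; have s1 : 0 <= M1 ^+ 2 by exact: exprn_ge0.
have e00 : 0 < e0 by rewrite invr_gt0; lra.
have e01 : e0 <= 1 by rewrite invf_le1; lra.
have key e : 0 < e <= e0 -> - (C * e) <= - pi * A <= M2 ^+ 2 * m + C * e.
  move=> /andP[ep ee]; have ep1 : 0 < e <= 1 by rewrite ep (le_trans ee).
  have eM : e * (3 * M1 ^+ 2) <= 1.
    have : e0 * (1 + 3 * M1 ^+ 2) = 1 by rewrite mulVf // gt_eqF //; lra.
    by have : e * (1 + 3 * M1 ^+ 2) <= e0 * (1 + 3 * M1 ^+ 2); [rewrite ler_wpM2r //; lra|lra].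
  have [K K1' [hK hK2]] := weight_total P ep1.
  have [r5 /andP[r50 r51] hr5] := laurent_large K.
  (* On |z| <= r0 the map has modulus at least [K], beyond the support of the weight, so the inner
     circle and the missing punctured disc are harmless. *)
  pose r0 := Num.min r5 (t / 2); have r00 : 0 < r0 by rewrite lt_min r50 /=; lra.
  have r0t : r0 < t by rewrite gt_min; apply/orP; right; lra.
  have r05 : r0 <= r5 by rewrite ge_min lexx.
  have big z : 0 < cabs z <= r0 -> K <= cabs (y z).
    by move=> /andP[z0 zr]; apply: hr5; rewrite z0 (le_trans zr).
  pose I := \int[mu2]_(p in annimg y r0 t) weight P e (toC p).
  have r0t2 : 0 < r0 < t by rewrite r00.
  have IA : `|I - pi * A| <= C * e.
    apply: hC => // z zr; have zr0 : 0 < cabs z <= r0 by rewrite zr r00 lexx.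
    by have [] := hK (y z) (big z zr0).
  move: IA; rewrite ler_norml => /andP[I_lo I_up].
  have [M M0 hM] := ty r00 t1; pose r := K + M + 1; have rK : K < r by rewrite /r; lra.
  have [B B0 hB] := weight_bounded P ep; have mw := @measurable_weight R P e.
  have mA : measurable (annimg y r0 t) := annimg_measurable r00 r0t (ty r00 t1).
  have AD : annimg y r0 t `<=` cdisc r.
    move=> p [z /andP[h1 h2'] zp]; rewrite /cdisc /= -zp.
    have hz : annulus r0 t z by rewrite /annulus /= h1 ltW.
    by have [k _ _ _] := hM z z _ (And3 hz hz erefl); rewrite /r; lra.
  have r0' : 0 <= r by rewrite /r; lra.
  have fD : (mu2 (cdisc r) < +oo)%E := le_lt_trans (mu2_cdisc r0') (ltry _).
  have mDA : measurable (cdisc r `\` annimg y r0 t) by apply: measurableD => //; exact: measurable_cdisc.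
  have fDA : (mu2 (cdisc r `\` annimg y r0 t) < +oo)%E.
    by apply: le_lt_trans fD; apply: le_measure; rewrite ?inE //; exact: measurable_cdisc.
  (* The integral over the large disc vanishes: image and remainder cancel. *)
  have tot := Rint_subset hB mw mA (measurable_cdisc r) fD AD; rewrite hK2 // -/I in tot.
  set J := Rintegral _ _ _ in tot.
  have off p : (cdisc r `\` annimg y r0 t) p -> ~ omitted Y t p -> weight P e (toC p) = 0.
    move=> [_ np] /contrapT [z /andP[z0 zt] zp]; have [|//] := hK (toC p).
    rewrite -zp; apply: big; rewrite z0 leNgt; apply/negP => zr; apply: np; exists z => //.
    by rewrite zt ltW.
  have on p : omitted Y t p -> 0 <= weight P e (toC p) <= M2 ^+ 2.
    move=> op; have pK : cabs (toC p) <= K1 by rewrite leNgt; apply/negP => /ltW /cov.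
    have [k1 _ _ _] := hM1 _ _ _ (And3 pK pK erefl); have [k2 _ _ _] := hM2 _ _ _ (And3 pK pK erefl).
    have x0 : 0 <= e * cabs P.[toC p] ^+ 2 := mulr_ge0 (ltW ep) (exprn_ge0 _ (cabs_ge0 _)).
    have x1 : 3 * (e * cabs P.[toC p] ^+ 2) <= 1.
      apply: le_trans eM; rewrite mulrCA ler_wpM2l ?(ltW ep) // ler_wpM2l //.
      by rewrite lerXn2r ?nnegrE.
    have k3 : cabs P^`().[toC p] ^+ 2 <= M2 ^+ 2 by rewrite lerXn2r ?nnegrE.
    have T0 := tent01 x0 x1; rewrite /weight.
    case/andP: T0 => T0 T1; rewrite mulr_ge0 ?exprn_ge0 //= -[leRHS]mulr1.
    by apply: ler_pM; rewrite ?exprn_ge0.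
  have J0 : 0 <= J.
    apply: Rintegral_ge0 => p Dp; have [op|np] := pselect (omitted Y t p); first by case/andP: (on p op).
    by rewrite off.
  have J1 : J <= M2 ^+ 2 * m.
    apply: (@le_trans _ _ (M2 ^+ 2 * fine (mu2 ((cdisc r `\` annimg y r0 t) `&` omitted Y t)))).
      apply: (Rint_le hB mw) => //; first exact: exprn_ge0.
        by move=> p _ /on /andP[].
      by move=> p Dp np; rewrite off.
    apply: ler_wpM2l; first exact: exprn_ge0.
    have le1 : (mu2 ((cdisc r `\` annimg y r0 t) `&` omitted Y t) <= mu2 (omitted Y t))%E.
      by apply: le_measure; rewrite ?inE //; exact: measurableI.
    have f2 : mu2 (omitted Y t) \is a fin_num by rewrite ge0_fin_numE; [exact: fE|exact: measure_ge0].
    have f1 : mu2 ((cdisc r `\` annimg y r0 t) `&` omitted Y t) \is a fin_num.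
      by rewrite ge0_fin_numE; [exact: le_lt_trans le1 fE|exact: measure_ge0].
    exact: fine_le f1 f2 le1.
  have {tot} IJ : I = - J by apply/eqP; rewrite -addr_eq0 -tot.
  rewrite IJ in I_lo I_up; rewrite mulNr; apply/andP; split.
    by apply: le_trans I_lo _; rewrite gerDr oppr_le0.
  by rewrite -(lerD2l (- J)); apply: le_trans I_up _; rewrite addrA lerDr addrC subr_ge0.
have lim : forall x : R, 0 < x -> - x <= - pi * A <= M2 ^+ 2 * m + x.
  move=> x x0; pose e := Num.min e0 (x / (C + 1)).
  have C1 : 0 < C + 1 by lra.
  have ep : 0 < e by rewrite lt_min e00 divr_gt0.
  have e1 : e <= e0 by rewrite ge_min lexx.
  have e2 : C * e <= x.
    have : e <= x / (C + 1) by rewrite ge_min lexx orbT.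
    rewrite ler_pdivlMr // => h; apply: le_trans h.
    by rewrite mulrC ler_wpM2l ?(ltW ep) // lerDl.
  have := key e; rewrite ep e1 => /(_ isT) /andP[k1 k2]; apply/andP; split.
    by apply: le_trans k1; rewrite lerN2.
  by apply: le_trans k2 _; rewrite lerD2l.
split => //.
  have pA : 0 <= - pi * A.
    by apply/ler_addgt0Pr => x x0; have /andP[k _] := lim x x0; rewrite -lerBlDr sub0r.
  by move: pA; rewrite mulNr oppr_ge0 pmulr_rle0 // pi_gt0.
by apply/ler_addgt0Pr => x x0; have /andP[] := lim x x0.
Qed.
End Area.
End Exterior.

(** * Algebra of Cauchy products and shifts *)

Section ConvAlgebra.
Variable R : realType.
Implicit Types (a b c : nat -> R[i]) (z : R[i]).

(** A Cauchy product coefficient only depends on truncations, so commutativity and associativity are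
    inherited from polynomials. *)
Lemma convE a b m n : (n <= m)%N ->
  conv a b n = ((\poly_(i < m.+1) a i) * (\poly_(i < m.+1) b i))`_n.
Proof.
move=> nm; rewrite coefM; apply: eq_bigr => i _; rewrite !coef_poly.
by rewrite ltnS (leq_trans (leq_ord i) nm) ltnS (leq_trans (leq_subr i n) nm).
Qed.

Lemma convC a b n : conv a b n = conv b a n.
Proof. by rewrite !(convE _ _ (leqnn n)) mulrC. Qed.

Lemma convA a b c n : conv a (conv b c) n = conv (conv a b) c n.
Proof.
set A := \poly_(i < n.+1) a i; set B := \poly_(i < n.+1) b i; set C := \poly_(i < n.+1) c i.
transitivity ((A * B * C)`_n).
  rewrite -mulrA [RHS]coefM; apply: eq_bigr => i _; rewrite -convE ?leq_subr // coef_poly.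
  by rewrite ltn_ord.
rewrite [LHS]coefM; apply: eq_bigr => i _; rewrite -convE; last by rewrite -ltnS.
by rewrite coef_poly ltnS leq_subr.
Qed.

Lemma eq_conv a a' b b' n : a =1 a' -> b =1 b' -> conv a b n = conv a' b' n.
Proof. by move=> /funext -> /funext ->. Qed.

Lemma convDl a b c n : conv (fun k => a k + b k) c n = conv a c n + conv b c n.
Proof. by rewrite /conv -big_split; apply: eq_bigr => i _; rewrite mulrDl. Qed.

Lemma convBl a b c n : conv (fun k => a k - b k) c n = conv a c n - conv b c n.
Proof. by rewrite /conv -sumrB; apply: eq_bigr => i _; rewrite mulrBl. Qed.

Lemma convBr a b c n : conv a (fun k => b k - c k) n = conv a b n - conv a c n.
Proof. by rewrite convC convBl ![conv _ a n]convC. Qed.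

Lemma unit_radiusB a b : unit_radius a -> unit_radius b -> unit_radius (fun k => a k - b k).
Proof.
move=> ha hb; have := unit_radiusD ha (unit_radiusZ (-1) hb); congr unit_radius.
by apply/funext => k; rewrite mulN1r.
Qed.

Definition euler a n : R[i] := n%:R * a n.

Lemma conv_euler a b n : n%:R * conv a b n = conv (euler a) b n + conv a (euler b) n.
Proof.
rewrite /conv mulr_sumr -big_split; apply: eq_bigr => i _ /=.
have -> : n%:R = i%:R + (n - i)%:R :> R[i] by rewrite -natrD subnKC // -ltnS.
by rewrite /euler; ring.
Qed.

Definition unitseq n : R[i] := (n == 0%N)%:R.

Lemma conv1 a n : conv unitseq a n = a n.
Proof.
rewrite /conv big_ord_recl /unitseq /= mul1r subn0 big1 ?addr0 // => i _.
by rewrite mul0r.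
Qed.

Lemma unit_radius_unitseq : unit_radius unitseq.
Proof. by apply: (unit_radius_bounded (M := 1)) => n; rewrite cabs_nat lern1 leq_b1. Qed.

Lemma psum_unitseq z : cabs z < 1 -> psum unitseq z = 1.
Proof. by move=> z1; rewrite -[RHS](psum_one z1); apply: eq_psum => -[]. Qed.

Definition delay m a n : R[i] := if (m <= n)%N then a (n - m)%N else 0.

Lemma delay0 a : delay 0 a =1 a.
Proof. by move=> n; rewrite /delay subn0. Qed.

Lemma delayS m a n : delay m.+1 a n = if n is k.+1 then delay m a k else 0.
Proof. by case: n. Qed.

Lemma unit_radius_delayn m a : unit_radius a -> unit_radius (delay m a).
Proof.
move=> ha; elim: m => [|m IH]; first by move: ha; congr unit_radius; apply/funext => n; rewrite delay0.
by move: (unit_radius_delay IH); congr unit_radius; apply/funext => n; rewrite delayS.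
Qed.

Lemma psum_delayn m a z : unit_radius a -> cabs z < 1 -> psum (delay m a) z = z ^+ m * psum a z.
Proof.
move=> ha z1; elim: m => [|m IH]; first by rewrite mul1r; apply: eq_psum; exact: delay0.
rewrite exprS -mulrA -IH -psum_delay //; last exact: unit_radius_delayn.
by apply: eq_psum => n; rewrite delayS.
Qed.

Lemma unit_radius_sum (I : Type) (s : seq I) (F : I -> nat -> R[i]) :
  (forall i, unit_radius (F i)) -> unit_radius (fun n => \sum_(i <- s) F i n).
Proof.
move=> hF; elim: s => [|i s IH].
  by apply: (unit_radius_bounded (M := 0)) => n; rewrite big_nil cabs0.
by move: (unit_radiusD (hF i) IH); congr unit_radius; apply/funext => n; rewrite big_cons.
Qed.

Lemma psum_sum (I : Type) (s : seq I) (F : I -> nat -> R[i]) z : (forall i, unit_radius (F i)) ->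
  cabs z < 1 -> psum (fun n => \sum_(i <- s) F i n) z = \sum_(i <- s) psum (F i) z.
Proof.
move=> hF z1; elim: s => [|i s IH].
  rewrite big_nil; transitivity (psum (fun n => 0 * unitseq n) z).
    by apply: eq_psum => n; rewrite big_nil mul0r.
  by rewrite psumZ ?mul0r //; exact: unit_radius_unitseq.
rewrite big_cons -IH -psumD //; last exact: unit_radius_sum.
by apply: eq_psum => n; rewrite big_cons.
Qed.

(** Equality at 0 is not given because of the pole; after multiplication by z the two sums agree on
    the whole disc. *)
Lemma psum_inj0 a b : unit_radius a -> unit_radius b ->
  (forall z, 0 < cabs z < 1 -> psum a z = psum b z) -> a =1 b.
Proof.
move=> ha hb h n.
have := psum_inj (unit_radius_delayn 1 ha) (unit_radius_delayn 1 hb) _ n.+1.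
rewrite !delayS !delay0; apply=> z z1; rewrite !psum_delayn // expr1.
by have [->|z0] := eqVneq z 0; [rewrite !mul0r|rewrite h // cabs_gt0 z0].
Qed.
End ConvAlgebra.
Arguments unitseq {R} n.

(** * Faber polynomials and Grunsky coefficients *)

Section LaurentCoefficients.
Variable R : realType.
Implicit Types (z w : R[i]) (P : {poly R[i]}) (n k m : nat).
Variable Y : nat -> R[i].
Hypothesis hY : unit_radius Y.
Hypothesis Y0 : Y 0%N = 1.
Local Notation y := (laurent Y).

Definition cpow n : nat -> R[i] := iter n (conv Y) (@unitseq R).

Lemma unit_radius_cpow n : unit_radius (cpow n).
Proof. by elim: n => [|n IH]; [exact: unit_radius_unitseq|exact: unit_radius_conv]. Qed.

Lemma psum_cpow n z : cabs z < 1 -> psum (cpow n) z = psum Y z ^+ n.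
Proof.
move=> z1; elim: n => [|n IH]; first by rewrite psum_unitseq.
by rewrite /cpow /= psumM // -/(cpow n) ?IH ?exprS //; exact: unit_radius_cpow.
Qed.

(** Coefficients of z^n P(y z): clearing the pole keeps every series an ordinary power series. *)
Definition lcoef P n k : R[i] := \sum_(i < n.+1) P`_i * delay (n - i) (cpow i) k.

Lemma unit_radius_lcoef P n : unit_radius (lcoef P n).
Proof. by apply: unit_radius_sum => i; apply: unit_radiusZ; apply: unit_radius_delayn; exact: unit_radius_cpow. Qed.

Lemma psum_lcoef P n z : (size P <= n.+1)%N -> 0 < cabs z < 1 -> psum (lcoef P n) z = P.[y z] * z ^+ n.
Proof.
move=> sP /andP[z0 z1]; have zn0 : z != 0 by rewrite -cabs_gt0.
rewrite psum_sum //; last first.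
  by move=> i; apply: unit_radiusZ; apply: unit_radius_delayn; exact: unit_radius_cpow.
rewrite (horner_coef_wide _ sP) mulr_suml; apply: eq_bigr => i _.
have hd := unit_radius_delayn (n - i) (unit_radius_cpow i).
rewrite psumZ // psum_delayn ?psum_cpow //; last exact: unit_radius_cpow.
have -> : z ^+ n = z ^+ (n - i) * z ^+ i by rewrite -exprD subnK // -ltnS.
rewrite /laurent exprMn exprVn; field; exact: expf_neq0.
Qed.

Lemma lcoef_unique P n a : (size P <= n.+1)%N -> unit_radius a ->
  (forall z, 0 < cabs z < 1 -> P.[y z] * z ^+ n = psum a z) -> lcoef P n =1 a.
Proof.
move=> sP ha h; apply: psum_inj0 => //; first exact: unit_radius_lcoef.
by move=> z z1; rewrite psum_lcoef // h.
Qed.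

Lemma poly_antideriv P n : (size P <= n)%N -> exists2 Q : {poly R[i]}, (size Q <= n.+1)%N & deriv Q = P.
Proof.
move=> sP; exists (\poly_(i < n.+1) (P`_i.-1 / i%:R)); first exact: size_poly.
apply/polyP => i; rewrite coef_deriv coef_poly ltnS.
have i0 : i.+1%:R != 0 :> R[i] by rewrite pnatr_eq0.
case: (ltnP i n) => h; first by rewrite -[LHS]mulr_natr /= divfK.
by rewrite mul0rn nth_default // (leq_trans sP).
Qed.

(* A composite [P1(y) d(P2(y))] is an exact differential, so its residue vanishes. *)
Lemma residue_zero P1 P2 n1 n2 : (size P1 <= n1.+1)%N -> (size P2 <= n2.+1)%N ->
  conv (lcoef P1 n1) (shifted_euler n2 (lcoef P2 n2)) (n1 + n2)%N = 0.
Proof.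
move=> s1 s2; have sD : (size (P1 * deriv P2)%R <= n1 + n2)%N.
  have [->|z2] := eqVneq (deriv P2) 0; first by rewrite mulr0 size_poly0.
  apply: leq_trans (size_polyMleq _ _) _.
  have : (size (deriv P2) <= n2)%N by rewrite -ltnS (leq_trans (lt_size_deriv _)) //; apply: contra_neq z2 => ->; rewrite deriv0.
  by move: s1; lia.
have [Q sQ dQ] := poly_antideriv sD.
have hq P n : unit_radius (lcoef P n) := @unit_radius_lcoef P n.
have rel P n : (size P <= n.+1)%N -> forall z, 0 < cabs z < 1 -> P.[y z] * z ^+ n = psum (lcoef P n) z.
  by move=> sP z z1; rewrite psum_lcoef.
have hs2 := unit_radius_shifted n2 (hq P2 n2).
have h : conv (lcoef P1 n1) (shifted_euler n2 (lcoef P2 n2)) =1 shifted_euler (n1 + n2) (lcoef Q (n1 + n2)).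
  apply: psum_inj0 => [| |z z01].
  - exact: unit_radius_conv.
  - exact: unit_radius_shifted.
  rewrite -(psum_shifted_euler hY (hq _ _) (rel _ _ sQ) z01) psumM //; last by case/andP: z01.
  rewrite -(psum_shifted_euler hY (hq _ _) (rel _ _ s2) z01) -rel // dQ hornerM exprD; ring.
by rewrite h /shifted_euler subrr mul0r.
Qed.

(** The recursion is forced by F_n(y z) = z^(-n) + O(z). Multiplying F_m(y) by y creates lower poles
    and a constant; the sum removes these up to a remaining constant m Y_(m+1), which the last term
    cancels. *)
Definition faber_step (F : nat -> {poly R[i]}) n : {poly R[i]} :=
  if n is m.+1 then 'X * F m - \sum_(i < m.+1) Y i.+1 *: F (m - i)%N - (m%:R * Y m.+1)%:P else 1.
Definition faber := course_rec 0 faber_step.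

Lemma faberE n : faber n = faber_step faber n.
Proof.
apply: course_recE => g h [|m] // e; rewrite /faber_step e //; congr (_ - _ - _).
by apply: eq_bigr => i _; rewrite e // ltnS leq_subr.
Qed.

Lemma faber0 : faber 0 = 1. Proof. by rewrite faberE. Qed.

Lemma size_faber n : (size (faber n) <= n.+1)%N.
Proof.
elim/ltn_ind: n => -[|m] IH; first by rewrite faber0 size_poly1.
rewrite faberE /=; apply: leq_trans (size_polyD _ _) _; rewrite geq_max size_polyN; apply/andP; split; last first.
  by apply: leq_trans (size_polyC_leq1 _) _.
apply: leq_trans (size_polyD _ _) _; rewrite geq_max size_polyN; apply/andP; split.
  by apply: leq_trans (size_polyMleq _ _) _; rewrite size_polyX /= ltnS; exact: IH.
apply: leq_trans (size_sum _ _ _) _; apply/bigmax_leqP => i _.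
apply: leq_trans (size_scale_leq _ _) _; apply: leq_trans (IH _ _) _; rewrite ?ltnS ?leq_subr //.
exact: leqW (leq_subr _ _).
Qed.

Definition fcoef n := lcoef (faber n) n.

Lemma psum_fcoef n z : 0 < cabs z < 1 -> psum (fcoef n) z = (faber n).[y z] * z ^+ n.
Proof. by move=> z1; rewrite psum_lcoef ?size_faber. Qed.

Lemma laurentK z : 0 < cabs z -> y z * z = psum Y z.
Proof. by rewrite cabs_gt0 /laurent => z0; rewrite divfK. Qed.

Lemma fcoefS m : fcoef m.+1 =1 fun k => conv Y (fcoef m) k
  - \sum_(i < m.+1) Y i.+1 * delay i.+1 (fcoef (m - i)) k - m%:R * Y m.+1 * delay m.+1 (@unitseq R) k.
Proof.
have hf n := unit_radius_lcoef (faber n) n.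
have h1 := unit_radius_conv hY (hf m).
have h2 (i : 'I_m.+1) := unit_radiusZ (Y i.+1) (unit_radius_delayn i.+1 (hf (m - i)%N)).
have h3 := unit_radiusZ (m%:R * Y m.+1) (unit_radius_delayn m.+1 (@unit_radius_unitseq R)).
have h2' := unit_radius_sum (index_enum _) h2.
have hB := unit_radiusB h1 h2'.
apply: lcoef_unique; [exact: size_faber|exact: unit_radiusB|].
move=> z /andP[z0 z1]; have zz : 0 < cabs z < 1 by rewrite z0.
have hd := unit_radius_delayn m.+1 (@unit_radius_unitseq R).
rewrite (psumB hB h3 z1) (psumB h1 h2' z1) (psumM hY (hf m) z1) (psum_sum _ h2 z1) (psumZ _ hd z1).
rewrite psum_delayn //; last exact: unit_radius_unitseq.
rewrite -/(fcoef m) psum_unitseq // psum_fcoef // -laurentK // faberE /faber_step !(hornerD, hornerN, hornerM, hornerX, hornerC) exprS.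
rewrite horner_sum !mulrBl; congr (_ - _ - _); [by ring| |by ring].
rewrite mulr_suml; apply: eq_bigr => i _; rewrite psumZ //; last exact: unit_radius_delayn.
rewrite psum_delayn // psum_fcoef // hornerZ.
have -> : z ^+ m = z ^+ i * z ^+ (m - i) by rewrite -exprD subnKC // -ltnS.
by rewrite exprS; ring.
Qed.

Lemma lcoefX : lcoef 'X 1 =1 Y.
Proof.
apply: lcoef_unique => //; first by rewrite size_polyX.
by move=> z /andP[z0 z1]; rewrite hornerX expr1 laurentK.
Qed.

(** The induction needs the coefficient of z in F_m(y z), equal to m Y_(m+1); it is read off the
    vanishing residue of F_m(y) dy. *)
Lemma fcoef_prefix n : fcoef n 0 = 1 /\ forall k, (0 < k <= n)%N -> fcoef n k = 0.
Proof.
have next m : fcoef m 0 = 1 -> (forall k, (0 < k <= m)%N -> fcoef m k = 0) -> fcoef m m.+1 = m%:R * Y m.+1.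
  move=> f0 f1; have := @residue_zero (faber m) 'X m 1 (size_faber m); rewrite size_polyX => /(_ isT).
  rewrite -/(fcoef m) addn1 /conv big_ord_recl big_ord_recr /= f0 big1 ?add0r; last first.
    by move=> i _; rewrite /bump /= f1 ?mul0r //; have := ltn_ord i; lia.
  rewrite /bump /= subnn subn0 /shifted_euler !lcoefX Y0 add1n -natr1 => /eqP.
  by rewrite sub0r mulr1 mulrN1 mul1r addrK subr_eq0 => /eqP <-.
elim/ltn_ind: n => -[|m] IH.
  split; last by case.
  rewrite /fcoef faber0 /lcoef big_ord1 coef1 mul1r /delay /= /unitseq //.
have [m0 m1] := IH m (leqnn _).
split=> [|k /andP[k0 km]]; rewrite fcoefS.
  rewrite /conv big_ord1 subn0 Y0 m0 mulr1 big1 ?subr0 /delay /= ?mulr0 ?subr0 //.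
  by move=> i _; rewrite mulr0.
case: k k0 km => // k _ km.
have -> : conv Y (fcoef m) k.+1 = fcoef m k.+1 + Y k.+1.
  rewrite /conv big_ord_recl big_ord_recr /= big1 ?add0r.
    by rewrite Y0 mul1r subn0 /bump /= add1n subnn m0 mulr1.
  by move=> i _; rewrite m1 ?mulr0 // /bump; have := ltn_ord i; lia.
rewrite (bigD1 (Ordinal km)) //= big1 ?addr0; last first.
  move=> i ik; have ik' : (i : nat) <> k by move=> e; case/eqP: ik; exact/val_inj.
  rewrite /delay; case: ifP => h; last by rewrite mulr0.
  have [_ ->] := IH (m - i)%N (leq_ltn_trans (leq_subr _ _) (ltnSn _)); first by rewrite mulr0.
  by clear ik; have := ltn_ord i; lia.
rewrite {1}/delay leqnn subnn (proj1 (IH _ (leq_ltn_trans (leq_subr _ _) (ltnSn _)))) mulr1.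
rewrite addrK /delay ltnS; move: km; rewrite ltnS leq_eqVlt => /orP[/eqP ->|km].
  by rewrite leqnn subnn /unitseq eqxx mulr1 next // subrr.
by rewrite leqNgt km mulr0 subr0 m1.
Qed.

(** Grunsky coefficients in the normalisation F_n(y z) = z^(-n) + n sum_k [grunsky n k] z^k, the one
    that makes them symmetric. *)
Definition grunsky n k : R[i] := fcoef n (n + k) / n%:R.

Lemma unit_radius_grunsky n : unit_radius (grunsky n).
Proof.
have sh j (a : nat -> R[i]) : unit_radius a -> unit_radius (fun k : nat => a (j + k)%N).
  elim: j a => [|j IH] a ha; first by [].
  by move: (IH _ (unit_radius_shift ha)); congr unit_radius; apply/funext => k; rewrite addSn.
have := unit_radiusZ n%:R^-1 (sh n _ (unit_radius_lcoef (faber n) n)).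
by congr unit_radius; apply/funext => k; rewrite /grunsky mulrC.
Qed.

Lemma grunskyn0 n : (0 < n)%N -> grunsky n 0 = 0.
Proof. by move=> n0; rewrite /grunsky addn0 (proj2 (fcoef_prefix n)) ?mul0r // n0 leqnn. Qed.

Lemma fcoef_grunsky n k : (0 < n)%N -> fcoef n k = unitseq k + n%:R * delay n (grunsky n) k.
Proof.
move=> n0; have nn : n%:R != 0 :> R[i] by rewrite pnatr_eq0 -lt0n.
rewrite /delay /unitseq; case: leqP => h; last first.
  rewrite mulr0 addr0; case: k h => [|k] h; first by rewrite (proj1 (fcoef_prefix n)).
  by rewrite (proj2 (fcoef_prefix n)) //= ltnW.
have -> : (k == 0%N) = false by apply/negbTE; rewrite -lt0n (leq_trans n0).
by rewrite /grunsky subnKC // mulrC divfK // add0r.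
Qed.

Lemma faber_grunsky n z : (0 < n)%N -> 0 < cabs z < 1 ->
  (faber n).[y z] = z ^- n + n%:R * psum (grunsky n) z.
Proof.
move=> n0 zz; have /andP[z0 z1] := zz; have zn : z ^+ n != 0 by rewrite expf_neq0 // -cabs_gt0.
have hg := unit_radius_grunsky n.
apply: (mulIf zn); rewrite -psum_fcoef // (eq_psum _ (fun k => fcoef_grunsky k n0)).
rewrite psumD //; [|exact: unit_radius_unitseq|exact/unit_radiusZ/unit_radius_delayn].
rewrite psum_unitseq // psumZ //; last exact: unit_radius_delayn.
by rewrite psum_delayn // mulrDl mulVf //; ring.
Qed.

(** In the vanishing residue of F_n(y) d F_k(y) the gap in both prefixes kills every product except
    the two that pair a pole with a Grunsky coefficient. *)
Lemma grunsky_sym n k : (0 < n)%N -> (0 < k)%N -> grunsky n k = grunsky k n.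
Proof.
move=> n0 k0; have nn : n%:R != 0 :> R[i] by rewrite pnatr_eq0 -lt0n.
have kk : k%:R != 0 :> R[i] by rewrite pnatr_eq0 -lt0n.
have := residue_zero (size_faber n) (size_faber k); rewrite -/(fcoef n) -/(fcoef k).
have [N nkE] : exists N, (n + k)%N = N.+1 by exists (n + k).-1; lia.
rewrite nkE /conv big_ord_recl big_ord_recr /= big1 ?add0r; last first.
  move=> i _; have := ltn_ord i; rewrite /bump /= add1n => iN.
  have [h|h] := leqP i.+1 n; first by rewrite (proj2 (fcoef_prefix n)) ?mul0r.
  by rewrite /shifted_euler (proj2 (fcoef_prefix k)) ?mulr0 //; lia.
rewrite /bump /= add1n subn0 subnn (proj1 (fcoef_prefix n)) mul1r /shifted_euler (proj1 (fcoef_prefix k)).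
rewrite -nkE natrD => h; rewrite /grunsky; apply: (mulIf nn); apply: (mulIf kk).
rewrite [(k + n)%N]addnC divfK // [RHS]mulrAC divfK //.
by move/eqP: h; rewrite addr_eq0 => /eqP h; rewrite mulrC [RHS]mulrC -[LHS]opprK -mulNr; rewrite addrK in h; rewrite h; ring.
Qed.
End LaurentCoefficients.

Section SumLimits.
Variable R : realType.

Lemma rcvg_sum n (u : nat -> nat -> R) (l : nat -> R) : (forall i, u i @ \oo --> l i) ->
  (fun k => \sum_(i < n) u i k) @ \oo --> \sum_(i < n) l i.
Proof.
move=> h; elim: n => [|n IH].
  by rewrite big_ord0; apply: (cvg_ext (cvg_cst (0 : R))) => k; rewrite big_ord0.
by rewrite big_ord_recr; apply: (cvg_ext (rcvgD IH (h n))) => k; rewrite big_ord_recr.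
Qed.

Lemma rcvg_sqr_cabs (u : nat -> R[i]) l : u @ \oo --> l -> (fun n => cabs (u n) ^+ 2) @ \oo --> cabs l ^+ 2.
Proof. by move=> /ccvg_cabs h; apply: (cvg_ext (rcvgM h h)). Qed.

Lemma sum_le_mono (a : nat -> R) m n : (forall i, (m <= i)%N -> 0 <= a i) -> (m <= n)%N ->
  \sum_(i < m) a i <= \sum_(i < n) a i.
Proof.
move=> h; elim: n => [|n IH]; first by rewrite leqn0 => /eqP ->.
rewrite leq_eqVlt => /orP[/eqP ->//|mn]; rewrite big_ord_recr /=.
by apply: le_trans (IH mn) _; rewrite lerDl h.
Qed.

Lemma sum_le_lim (a : nat -> R) m L : (forall i, (m <= i)%N -> 0 <= a i) ->
  (fun n => \sum_(i < n) a i) @ \oo --> L -> forall n, (m <= n)%N -> \sum_(i < n) a i <= L.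
Proof.
move=> h hL n mn; apply: (rcvg_ge hL); exists n => k nk; apply: sum_le_mono => // i ni.
by apply: h; exact: leq_trans ni.
Qed.
End SumLimits.

(** * Grunsky's inequality and its near-equality case *)

Section GrunskyInequality.
Variable R : realType.
Implicit Types (z w : R[i]) (n k m N K : nat) (x : nat -> R[i]).
Variable Y : nat -> R[i].
Hypothesis hY : unit_radius Y.
Hypothesis Y0 : Y 0%N = 1.
Local Notation y := (laurent Y).
Hypothesis yinj : forall z w, 0 < cabs z < 1 -> 0 < cabs w < 1 -> y z = y w -> z = w.

Definition g n k : R[i] := grunsky Y n.+1 k.+1.

Section Finite.
Variables (x : nat -> R[i]) (N : nat).
Let P : {poly R[i]} := \sum_(n < N) (x n / n.+1%:R) *: faber Y n.+1.
Let q k : R[i] := \sum_(n < N) (x n / n.+1%:R) * delay (N - n.+1) (fcoef Y n.+1) k.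
Let G k : R[i] := \sum_(n < N) x n * g n k.

Let hq : unit_radius q.
Proof. by apply: unit_radius_sum => n; apply/unit_radiusZ/unit_radius_delayn/unit_radius_lcoef. Qed.

Let rel z : 0 < cabs z < 1 -> P.[y z] * z ^+ N = psum q z.
Proof.
move=> zz; have /andP[z0 z1] := zz.
have hf n : unit_radius (fcoef Y n) by exact: unit_radius_lcoef.
have hd (n : 'I_N) := unit_radius_delayn (N - n.+1) (hf n.+1).
have hz (n : 'I_N) := unit_radiusZ (x n / n.+1%:R) (hd n).
rewrite (psum_sum _ hz z1) horner_sum mulr_suml; apply: eq_bigr => n _.
rewrite psumZ // psum_delayn // psum_fcoef // hornerZ.
have -> : z ^+ N = z ^+ (N - n.+1) * z ^+ n.+1 by rewrite -exprD subnK.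
by ring.
Qed.

Let nn n : n.+1%:R != 0 :> R[i]. Proof. by rewrite pnatr_eq0. Qed.

Let q_high k : q (N + k.+1)%N = G k.
Proof.
apply: eq_bigr => n _; have nN := ltn_ord n; rewrite /delay ifT; last by lia.
have -> : (N + k.+1 - (N - n.+1) = n.+1 + k.+1)%N by lia.
by rewrite /g /grunsky; field.
Qed.

Let q_low j : (j < N)%N -> q (N - j.+1)%N = x j / j.+1%:R.
Proof.
move=> jN; rewrite /q (bigD1 (Ordinal jN)) //= big1 ?addr0.
  by rewrite /delay leqnn subnn (proj1 (fcoef_prefix hY Y0 _)) mulr1.
move=> n nj; have nj' : (n : nat) <> j by move=> e; case/eqP: nj; exact/val_inj.
clear nj; have nN := ltn_ord n; rewrite /delay; case: ifP => h; last by rewrite mulr0.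
by rewrite (proj2 (fcoef_prefix hY Y0 n.+1)) ?mulr0 //; lia.
Qed.

Let a (t : R) m : R := (m%:R - N%:R) * cabs (q m) ^+ 2 * t ^+ (2 * m).

Let a_ge0 t m : 0 <= t -> (N <= m)%N -> 0 <= a t m.
Proof.
by move=> t0 Nm; rewrite /a !mulr_ge0 ?exprn_ge0 // subr_ge0 ler_nat.
Qed.

Let a_sum t K : \sum_(m < N + K.+1) a t m = t ^+ (2 * N) * (\sum_(k < K) k.+1%:R * cabs (G k) ^+ 2 * t ^+ (2 * k.+1))
   - \sum_(n < N) cabs (x n) ^+ 2 / n.+1%:R * t ^+ (2 * (N - n.+1)).
Proof.
rewrite big_split_ord /= addrC; congr (_ + _).
  (* Index m = N is the constant term of P(y z); the factor m - N removes it. *)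
  rewrite big_ord_recl /= addn0 /a subrr !mul0r add0r mulr_sumr; apply: eq_bigr => k _.
  rewrite /bump /= add1n q_high.
  have -> : (N + k.+1)%:R - N%:R = k.+1%:R :> R by rewrite natrD addrAC subrr add0r.
  by rewrite mulnDr exprD; ring.
rewrite -sumrN (reindex_inj rev_ord_inj) /=; apply: eq_bigr => n _; have nN := ltn_ord n.
have n0 : n.+1%:R != 0 :> R by rewrite pnatr_eq0.
by rewrite /a q_low // cabsM cabsV cabs_nat natrB //; field.
Qed.

Let L t : R := re (psum (fun k => (q k)^*%C * ((k%:R - N%:R) * q k)) (t ^+ 2)%:C%C).

Let a_lim t : 0 <= t < 1 -> (fun M => \sum_(m < M) a t m) @ \oo --> L t.
Proof.
move=> /andP[t0 t1].
have t21 : cabs (t ^+ 2)%:C%C < 1 :> R by rewrite cabs_real ger0_norm ?exprn_ge0 // exprn_ilt1.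
have hs : unit_radius (fun k => (q k)^*%C * ((k%:R - N%:R) * q k)).
  have hu := unit_radius_shifted N hq; move=> r r01.
  have [r2 r21 rr] : exists2 s : R, 0 <= s < 1 & r <= s ^+ 2.
    move: r01 => /andP[r0 r1]; exists (Num.sqrt r); last by rewrite sqr_sqrtr.
    by rewrite sqrtr_ge0 -sqrtr1 ltr_sqrt.
  have [M1 h1] := hq r21; have [M2 h2] := hu _ r21; exists (M1 * M2) => n.
  rewrite cabsM cabs_conj; have /andP[s0 _] := r21; have /andP[r0 _] := r01.
  apply: le_trans (_ : cabs (q n) * cabs (shifted_euler N q n) * (r2 ^+ 2) ^+ n <= _).
    by apply: ler_wpM2l; [exact: mulr_ge0|apply: lerXn2r; rewrite ?nnegrE // exprn_ge0].
  rewrite exprAC expr2 mulrACA; apply: ler_pM => //; by rewrite mulr_ge0 // exprn_ge0.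
apply: (cvg_ext (ccvg_re (psum_cvg hs t21))) => M /=; rewrite re_sum; apply: eq_bigr => m _.
have -> : (q m)^*%C * ((m%:R - N%:R) * q m) = (m%:R - N%:R) * (q m * (q m)^*%C) by ring.
have -> : (m%:R - N%:R : R[i]) = (m%:R - N%:R)%:C%C by rewrite rmorphB !rmorph_nat.
by rewrite mulcJ -real_complexX -!real_complexM /= /a exprM.
Qed.

Let a_le t M : 0 <= t < 1 -> (N <= M)%N -> \sum_(m < M) a t m <= L t.
Proof.
move=> t01; have /andP[t0 _] := t01; apply: sum_le_lim (a_lim t01) M => i; exact: a_ge0.
Qed.

(** [P] is chosen so that P(y z) has principal part sum x_n / (n + 1) z^(-n-1) and regular
    coefficients [G k]. The area theorem compares the two weighted sums at radius t < 1; terms of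
    index at least N are nonnegative, so the series may be cut before t tends to 1. *)
Lemma grunsky_ineq K : \sum_(k < K) k.+1%:R * cabs (\sum_(n < N) x n * g n k) ^+ 2 <=
  \sum_(n < N) cabs (x n) ^+ 2 / n.+1%:R.
Proof.
have [M M0 hM] := area_theorem hY Y0 yinj hq rel.
have neg n : (1 <= n)%N -> \sum_(m < N + K.+1) a (rho R n) m <= 0.
  move=> n1; have r01 := rho01 R n; have /andP[r0 r1] := r01.
  have rh : 2^-1 <= rho R n.
    have : n.+1%:R^-1 <= 2^-1 :> R by rewrite lef_pV2 ?posrE ?ltr0n // ler_nat ltnS.
    by rewrite /rho; move: _^-1 => u; lra.
  have /hM[_ _ h _] : 2^-1 <= rho R n < 1 by rewrite rh.
  apply: le_trans (a_le r01 (leq_addr _ _)) _.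
  have p0 : 0 < rho R n ^+ (2 * N) by rewrite exprn_gt0 //; lra.
  by move: h; rewrite /laurent_area -/(L _) pmulr_lle0 ?invr_gt0.
have lim := @rcvg_sum R (N + K.+1) (fun m n => a (rho R n) m) (a 1).
have : \sum_(m < N + K.+1) a 1 m <= 0.
  apply: (rcvg_le (lim _)); last by exists 1%N => n /neg.
  move=> m; have h := rcvgMl ((m%:R - N%:R) * cabs (q m) ^+ 2) (@cvg_rhoX R (2 * m)).
  rewrite /a expr1n; exact: h.
rewrite a_sum expr1n mul1r subr_le0; congr (_ <= _); apply: eq_bigr => k _; by rewrite expr1n mulr1.
Qed.

(** The area theorem is two-sided: at a radius where the omitted set is small, the deficit in
    Grunsky's inequality is at most a multiple of its measure. *)
Lemma grunsky_full e : (forall d : R, 0 < d -> exists2 t, 2^-1 <= t < 1 & fine (mu2 (omitted Y t)) < d) ->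
  0 < e -> exists K, \sum_(n < N) cabs (x n) ^+ 2 / n.+1%:R - e <=
    \sum_(k < K) k.+1%:R * cabs (\sum_(n < N) x n * g n k) ^+ 2.
Proof.
move=> full e0; have [M M0 hM] := area_theorem hY Y0 yinj hq rel; have pp := pi_gt0 R.
have d0 : 0 < pi * (e / 2) / (M + 1) by rewrite divr_gt0 ?mulr_gt0 ?divr_gt0 //; lra.
have [t th tm] := full _ d0; have [_ _ _ h] := hM _ th; have /andP[t1 t2] := th.
have t0 : 0 < t by lra.
have t01 : 0 <= t < 1 by rewrite t2 ltW.
have tN : 0 < t ^+ (2 * N) by exact: exprn_gt0.
have {h}hL : - (e / 2) * t ^+ (2 * N) <= L t.
  move: h; rewrite /laurent_area -/(L _) => h.
  have m1 : M * fine (mu2 (omitted Y t)) <= pi * (e / 2).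
    have := ltW tm; rewrite ler_pdivlMr; last by lra.
    apply: le_trans; rewrite mulrC ler_wpM2l ?fine_ge0 //; lra.
  have : - (pi * (L t / t ^+ (2 * N))) <= pi * (e / 2) by rewrite -mulNr (le_trans h).
  rewrite -mulrN ler_pM2l // => k; rewrite -ler_pdivlMr // lerNl //.
have e20 : 0 < e / 2 * t ^+ (2 * N) by rewrite mulr_gt0 // divr_gt0.
have [M1 hM1] := (rcvgP _ _).1 (a_lim t01) _ e20.
exists M1; have := hM1 (N + M1.+1)%N; rewrite (leq_trans (leqnSn M1) (leq_addl _ _)) => /(_ isT).
rewrite a_sum ltr_norml => /andP[h1 _].
set S1 := \sum_(k < M1) _ * _ * _ in h1; set S2 := \sum_(n < N) _ in h1.
have s1 : S1 <= \sum_(k < M1) k.+1%:R * cabs (\sum_(n < N) x n * g n k) ^+ 2.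
  apply: ler_sum => k _; rewrite -[leRHS]mulr1 ler_wpM2l ?mulr_ge0 ?exprn_ge0 //.
  by rewrite exprn_ile1 // ltW.
have s2 : t ^+ (2 * N) * (\sum_(n < N) cabs (x n) ^+ 2 / n.+1%:R) <= S2.
  rewrite mulr_sumr; apply: ler_sum => n _; rewrite mulrC ler_wpM2l ?divr_ge0 ?exprn_ge0 //.
  by apply: ler_wiXn2l; [exact: ltW|exact: ltW|rewrite leq_mul2l leq_subr orbT].
have : t ^+ (2 * N) * (\sum_(n < N) cabs (x n) ^+ 2 / n.+1%:R - e) <= t ^+ (2 * N) * S1.
  rewrite mulrBr; move: hL h1 s2; set T := t ^+ (2 * N); set V := T * _.
  have -> : - (e / 2) * T = - (e / 2 * T) by rewrite mulNr.
  have -> : T * e = e / 2 * T + e / 2 * T by field.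
  move: (e / 2 * T) (T * S1) (L t) => u v w; clearbody V S2; lra.
by rewrite ler_pM2l // => h; exact: le_trans s1.
Qed.
End Finite.
End GrunskyInequality.

Lemma wsum_mono (R : realType) (b : nat -> R[i]) m n : (m <= n)%N ->
  \sum_(k < m) k.+1%:R * cabs (b k) ^+ 2 <= \sum_(k < n) k.+1%:R * cabs (b k) ^+ 2.
Proof.
by apply: (@sum_le_mono R (fun k => k.+1%:R * cabs (b k) ^+ 2)) => i _; rewrite mulr_ge0 ?exprn_ge0.
Qed.

(** * Grunsky's inequality for infinite vectors, in polarised form *)

Section QuadraticForms.
Variable R : realType.
Implicit Types (z w : R[i]) (n k m N K : nat).
Variable Y : nat -> R[i].
Hypothesis hY : unit_radius Y.
Hypothesis Y0 : Y 0%N = 1.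
Local Notation y := (laurent Y).
Local Notation g := (g Y).
Hypothesis yinj : forall z w, 0 < cabs z < 1 -> 0 < cabs w < 1 -> y z = y w -> z = w.

Lemma grunsky_le (x X : nat -> R[i]) (V : R) K : (forall k, (fun N => \sum_(n < N) x n * g n k) @ \oo --> X k) ->
  (fun N => \sum_(n < N) cabs (x n) ^+ 2 / n.+1%:R) @ \oo --> V ->
  \sum_(k < K) k.+1%:R * cabs (X k) ^+ 2 <= V.
Proof.
move=> hX hV; have lim := @rcvg_sum R K (fun k N => k.+1%:R * cabs (\sum_(n < N) x n * g n k) ^+ 2)
   (fun k => k.+1%:R * cabs (X k) ^+ 2).
apply: (rcvg_le (lim _)) => [k|]; first exact: rcvgMl _ (rcvg_sqr_cabs (hX k)).
exists 0%N => N _; apply: le_trans (grunsky_ineq hY Y0 yinj x N K) _.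
have nn i : (0 <= i)%N -> 0 <= cabs (x i) ^+ 2 / i.+1%:R by move=> _; rewrite divr_ge0 ?exprn_ge0.
exact: (sum_le_lim nn hV (leq0n N)).
Qed.

Section Form.
Variables (x X : nat -> R[i]) (V W : R) (s : R).
Hypothesis s1 : s ^+ 2 = 1.
Hypothesis hX : forall k, (fun N => \sum_(n < N) x n * g n k) @ \oo --> X k.
Hypothesis hV : (fun N => \sum_(n < N) cabs (x n) ^+ 2 / n.+1%:R) @ \oo --> V.
Hypothesis hW : (fun N => \sum_(k < N) re (X k * x k)) @ \oo --> W.

(** Near-equality holds for the truncation of [x] at N, while the removed tail has small energy by
    the inequality itself. The bound (a + b)^2 <= (1 + th) a^2 + (1 + 1/th) b^2 transfers it to the
    full vector. *)
Lemma grunsky_ge (e : R) : (forall d : R, 0 < d -> exists2 t, 2^-1 <= t < 1 & fine (mu2 (omitted Y t)) < d) ->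
  0 < e -> exists K0, forall K, (K0 <= K)%N -> V - e <= \sum_(k < K) k.+1%:R * cabs (X k) ^+ 2.
Proof.
move=> full e0; have V0 : 0 <= V.
  by apply: (rcvg_ge hV); exists 0%N => n _; apply: sumr_ge0 => i _; rewrite divr_ge0 ?exprn_ge0.
(* Here th V <= e / 4, and [d] below satisfies (2 + 1/th) d = e / 4, so truncation, transfer and
   near-equality cost less than [e] together. *)
pose th := e / 4 / (V + 1); have th0 : 0 < th by rewrite divr_gt0 ?divr_gt0 //; lra.
pose d := e / 4 / (2 + th^-1); have ti : 0 < th^-1 by rewrite invr_gt0.
have d0 : 0 < d by rewrite divr_gt0 ?divr_gt0 //; lra.
have [N hN] := (rcvgP _ _).1 hV _ d0; have {hN} := hN N (leqnn N).
set VN := \sum_(n < N) _; rewrite ltr_norml => /andP[vN _].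
have e40 : 0 < e / 4 by rewrite divr_gt0.
have [K0 hK0] := grunsky_full hY Y0 yinj x N full e40; exists K0 => K KK.
apply: (@le_trans _ _ (\sum_(k < K0) k.+1%:R * cabs (X k) ^+ 2)); last first.
  exact: wsum_mono.
pose x' n := if (n < N)%N then 0 else x n.
pose S k := \sum_(n < N) x n * g n k.
have hX' k : (fun M => \sum_(n < M) x' n * g n k) @ \oo --> X k - S k.
  apply/ccvgP => u u0; have [M hM] := (ccvgP _ _).1 (@hX k) _ u0; exists (maxn M N) => n hn.
  have := hM n (leq_trans (leq_maxl _ _) hn); congr (cabs _ < _).
  have [j ->] : exists j, n = (N + j)%N by exists (n - N)%N; rewrite subnKC // (leq_trans (leq_maxr _ _) hn).
  rewrite !big_split_ord /= [X in X + _ - (_ - _)]big1.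
    rewrite [X in 0 + X - _](eq_bigr (fun i : 'I_j => x (N + i)%N * g (N + i) k)) ?/S; first by ring.
    by move=> i _; rewrite /x' ltnNge leq_addr.
  by move=> i _; rewrite /x' ltn_ord mul0r.
have hV' : (fun M => \sum_(n < M) cabs (x' n) ^+ 2 / n.+1%:R) @ \oo --> V - VN.
  apply/rcvgP => u u0; have [M hM] := (rcvgP _ _).1 hV _ u0; exists (maxn M N) => n hn.
  have := hM n (leq_trans (leq_maxl _ _) hn); congr (`|_| < _).
  have [j ->] : exists j, n = (N + j)%N by exists (n - N)%N; rewrite subnKC // (leq_trans (leq_maxr _ _) hn).
  rewrite !big_split_ord /= [X in X + _ - (_ - _)]big1.
    rewrite [X in 0 + X - _](eq_bigr (fun i : 'I_j => cabs (x (N + i)%N) ^+ 2 / (N + i).+1%:R)) ?/VN; first by ring.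
    by move=> i _; rewrite /x' ltnNge leq_addr.
  by move=> i _; rewrite /x' ltn_ord cabs0 expr0n mul0r.
have r1 := grunsky_le K0 hX' hV'; have r2 := grunsky_le K0 hX hV.
have r3 : \sum_(k < K0) k.+1%:R * cabs (S k) ^+ 2 <= (1 + th) * (\sum_(k < K0) k.+1%:R * cabs (X k) ^+ 2)
   + (1 + th^-1) * (\sum_(k < K0) k.+1%:R * cabs (X k - S k) ^+ 2).
  rewrite !mulr_sumr -big_split; apply: ler_sum => k _ /=.
  rewrite [_ * (_ * _)]mulrCA [(1 + th^-1) * _]mulrCA -mulrDr ler_wpM2l //.
  apply: (@le_trans _ _ ((cabs (X k) + cabs (X k - S k)) ^+ 2)).
    rewrite lerXn2r ?nnegrE ?addr_ge0 // -{1}[S k](subKr (X k)).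
    by apply: le_trans (cabsD _ _) _; rewrite cabsN.
  move: (cabs (X k)) (cabs (X k - S k)) => a b.
  have := sqr_ge0 (th * a - b); rewrite -(pmulr_rge0 _ ti).
  have -> : th^-1 * (th * a - b) ^+ 2 = th * a ^+ 2 - 2 * (a * b) + th^-1 * b ^+ 2 by field; rewrite gt_eqF.
  by rewrite sqrrD; lra.
set A := \sum_(k < K0) k.+1%:R * cabs (X k) ^+ 2 in r2 r3 *.
set B := \sum_(k < K0) _ in r1 r3; set C := \sum_(k < K0) _ in r3 hK0; rewrite -/VN in hK0.
have q1 : th * A <= e / 4.
  apply: (@le_trans _ _ (th * V)); first by rewrite ler_wpM2l // ltW.
  by rewrite /th mulrAC ler_pdivrMr; [rewrite ler_wpM2l ?(ltW e40) //|]; lra.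
have q2 : (2 + th^-1) * d = e / 4 by rewrite /d mulrCA divff ?mulr1 // gt_eqF //; lra.
have q3 : (1 + th^-1) * B <= (1 + th^-1) * d by rewrite ler_wpM2l //; lra.
have q4 : d + (1 + th^-1) * d = e / 4 by rewrite -q2; ring.
move: r3 hK0 vN q1 q3 q4; rewrite mulrDl mul1r.
move: (th * A) ((1 + th^-1) * B) ((1 + th^-1) * d) => a1 a2 a3; clearbody A C VN d; lra.
Qed.

Let c k := X k - s%:C%C * ((x k)^*%C / k.+1%:R).

Let sum_c K : \sum_(k < K) k.+1%:R * cabs (c k) ^+ 2 = \sum_(k < K) k.+1%:R * cabs (X k) ^+ 2
  + \sum_(k < K) cabs (x k) ^+ 2 / k.+1%:R - 2 * s * \sum_(k < K) re (X k * x k).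
Proof.
rewrite mulr_sumr -big_split -sumrB; apply: eq_bigr => k _ /=.
have k0 : k.+1%:R != 0 :> R by rewrite pnatr_eq0.
have iC : (k.+1%:R^-1 : R[i]) = (k.+1%:R^-1)%:C%C by rewrite fmorphV rmorph_nat.
rewrite /c iC sqr_cabsD cabsN !cabsM cabs_conj !cabs_real !exprMn real_normK ?num_real // s1 mul1r.
rewrite ger0_norm ?invr_ge0 // -mulNr -rmorphN !conjM !conjc_real conjcK.
have -> : X k * ((- s)%:C%C * (x k * (k.+1%:R^-1)%:C%C)) = (- s * k.+1%:R^-1)%:C%C * (X k * x k).
  by rewrite real_complexM; ring.
by rewrite reZ; field.
Qed.

(** Expand the square: the energies of [X] and of [x] are each at most V and the mixed term
    contributes - 2 s W. The sign s = 1 serves the energy bound, s = -1 the distortion theorem. *)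
Lemma quad_le K : \sum_(k < K) k.+1%:R * cabs (c k) ^+ 2 <= 2 * V - 2 * s * W.
Proof.
have lim : (fun M => V + \sum_(k < M) cabs (x k) ^+ 2 / k.+1%:R - 2 * s * \sum_(k < M) re (X k * x k)) @ \oo -->
   V + V - 2 * s * W by apply: rcvgB (rcvgMl _ hW); apply: rcvgD hV; exact: cvg_cst.
have -> : 2 * V - 2 * s * W = V + V - 2 * s * W by ring.
apply: (rcvg_ge lim); exists K => M KM.
apply: (@le_trans _ _ (\sum_(k < M) k.+1%:R * cabs (c k) ^+ 2)).
  exact: wsum_mono.
by rewrite sum_c !lerD2r; exact: grunsky_le hX hV.
Qed.

Lemma quad_ge (e : R) : (forall d : R, 0 < d -> exists2 t, 2^-1 <= t < 1 & fine (mu2 (omitted Y t)) < d) ->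
  0 < e -> exists K0, forall K, (K0 <= K)%N ->
    2 * V - 2 * s * W - e <= \sum_(k < K) k.+1%:R * cabs (c k) ^+ 2.
Proof.
move=> full e0; have e2 : 0 < e / 2 by rewrite divr_gt0.
have [K1 h1] := grunsky_ge full e2.
have lim := rcvgB hV (rcvgMl (2 * s) hW).
have [K2 h2] := (rcvgP _ _).1 lim _ e2; exists (maxn K1 K2) => K KK.
have := h1 K (leq_trans (leq_maxl _ _) KK); have := h2 K (leq_trans (leq_maxr _ _) KK).
rewrite sum_c ltr_norml; move: (\sum_(k < K) _) (\sum_(k < K) _) (2 * s * \sum_(k < K) _) (2 * s * W) => a1 a2 a3 a4; lra.
Qed.
End Form.
End QuadraticForms.

(** * The logarithm of |1 - u| *)

Section Logarithms.
Variable R : realType.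
Implicit Types (z w u : R[i]) (n k m N K : nat).

Lemma sub1_neq0 u : cabs u < 1 -> 0 < cabs (1 - u).
Proof. by move=> u1; have := cabs_geB 1 u; rewrite cabs1; lra. Qed.

(** The geometric series is the exponential of the series with coefficients 1 / n; taking moduli
    avoids any choice of a branch. *)
Lemma log1m u : cabs u < 1 ->
  (fun N => re (\sum_(n < N) u ^+ n.+1 / n.+1%:R)) @ \oo --> - ln (cabs (1 - u)).
Proof.
move=> u1; pose l n : R[i] := if n is m.+1 then m.+1%:R^-1 else 0; pose e (n : nat) : R[i] := 1.
have l1 : unit_radius l.
  apply: (unit_radius_bounded (M := 1)) => -[|n] /=; first by rewrite cabs0.
  by rewrite cabsV cabs_nat invf_le1 // ler1n.
have e1 : unit_radius e by apply: (unit_radius_bounded (M := 1)) => n; rewrite cabs1.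
have rec n : n.+1%:R * e n.+1 = conv (dcoef l) e n.
  rewrite /conv /e mulr1 (eq_bigr (fun=> 1)) ?sumr_const ?card_ord // => i _.
  by rewrite mulr1 /dcoef /= divff // pnatr_eq0.
have ex := psum_exp l1 e1 erefl erefl rec u1.
have c1 : cabs (1 : R[i]) <= 1 by rewrite cabs1.
have geo := psum_geo c1 u1; rewrite mul1r in geo.
have eE : psum e u = psum (fun n => 1 ^+ n) u by apply: eq_psum => n; rewrite expr1n.
have p0 := sub1_neq0 u1.
have -> : - ln (cabs (1 - u)) = re (psum l u).
  have : cabs (psum e u) * cabs (1 - u) = 1 by rewrite -cabsM eE geo cabs1.
  rewrite ex cabs_cexp => h.
  have -> : cabs (1 - u) = expR (- re (psum l u)).
    by rewrite expRN; apply: (mulfI (lt0r_neq0 (expR_gt0 (re (psum l u))))); rewrite h divff // gt_eqF // expR_gt0.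
  by rewrite expRK opprK.
have h := ccvg_re (psum_cvg l1 u1); rewrite -(cvg_shiftS _) in h.
apply: (cvg_ext h) => N /=; rewrite big_ord_recl /= mul0r add0r; congr re.
by apply: eq_bigr => i _; rewrite mulrC.
Qed.
End Logarithms.

Lemma conjD (R : realType) (z w : R[i]) : ((z + w)^*)%C = (z^*)%C + (w^*)%C.
Proof. exact: rmorphD. Qed.

Lemma tay_congr (R : realType) (A : set R[i]) (f g f' : R[i] -> R[i]) : (forall x, A x -> f x = g x) ->
  tay (hol A) f f' -> tay (hol A) g f'.
Proof.
move=> e [M M0 h]; exists M => // x v d hxv; have [Ax Av _] := hxv.
by rewrite -(e _ Ax) -(e _ Av); exact: h hxv.
Qed.

Lemma radial_near (R : realType) (z : R[i]) (d : R) : z != 0 -> 0 < d ->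
  exists w, [/\ cabs w <= cabs z, w != z & cabs (w - z) < d].
Proof.
rewrite -cabs_gt0 => z0 d0; pose t := Num.min (d / (2 * (cabs z))) 2^-1.
have t0 : 0 < t by rewrite lt_min divr_gt0 ?mulr_gt0 //=; lra.
have td : t * cabs z <= d / 2.
  have h : t <= d / (2 * cabs z) by rewrite ge_min lexx.
  apply: le_trans (ler_wpM2r (ltW z0) h) _; rewrite le_eqVlt; apply/orP; left; apply/eqP; field.
  by rewrite gt_eqF.
have th : t <= 2^-1 by rewrite ge_min lexx orbT.
have wz : (1 - t)%:C%C * z - z = - (t%:C%C * z) by rewrite rmorphB rmorph1; ring.
exists ((1 - t)%:C%C * z); split.
- by rewrite cabsM cabs_real ger0_norm; [nra|lra].
- by rewrite -subr_eq0 wz oppr_eq0 -cabs_gt0 cabsM cabs_real gtr0_norm // mulr_gt0.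
- by rewrite wz cabsN cabsM cabs_real gtr0_norm //; lra.
Qed.

(** * Two-point inequalities of Goluzin type *)

Section TwoPoints.
Variable R : realType.
Implicit Types (z w : R[i]) (n k m N K : nat).
Variable Y : nat -> R[i].
Hypothesis hY : unit_radius Y.
Hypothesis Y0 : Y 0%N = 1.
Local Notation y := (laurent Y).
Hypothesis yinj : forall z w, 0 < cabs z < 1 -> 0 < cabs w < 1 -> y z = y w -> z = w.

(** The regular part of F_(k+1)(y z), divided by k + 1. *)
Definition fabA k z : R[i] := psum (grunsky Y k.+1) z.

(** Symmetry of the Grunsky coefficients turns the sum over the first index into the regular part of
    a single Faber polynomial. *)
Lemma fabA_cvg k z : cabs z < 1 -> (fun N => \sum_(n < N) z ^+ n.+1 * g Y n k) @ \oo --> fabA k z.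
Proof.
move=> z1; have hg := unit_radius_grunsky hY k.+1.
rewrite /fabA psum_shift // grunskyn0 // add0r.
apply: (cvg_ext (ccvgMl z (psum_cvg (unit_radius_shift hg) z1))) => N.
rewrite mulr_sumr; apply: eq_bigr => n _; rewrite /g (grunsky_sym hY Y0) // exprS; ring.
Qed.

(** Grunsky's inequality for x_n = z^(n+1), whose energy is - ln (1 - |z|^2), bounds each entry. *)
Lemma fabA_bounded z : cabs z < 1 -> exists M : R, forall k, cabs (fabA k z) <= M.
Proof.
move=> z1; have zz1 : cabs (z * z^*%C) < 1 by rewrite cabsM cabs_conj -expr2 expr_lt1.
have hV : (fun N => \sum_(n < N) cabs (z ^+ n.+1) ^+ 2 / n.+1%:R) @ \oo --> - ln (cabs (1 - z * z^*%C)).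
  apply: (cvg_ext (log1m zz1)) => N; rewrite re_sum; apply: eq_bigr => n _.
  have iC : (n.+1%:R^-1 : R[i]) = (n.+1%:R^-1)%:C%C by rewrite fmorphV rmorph_nat.
  by rewrite iC exprMn -conjX mulcJ -real_complexM.
set V := - ln _ in hV; exists (V + 1) => k.
have := grunsky_le (x := fun n => z ^+ n.+1) hY Y0 yinj k.+1 (fun k => @fabA_cvg k z z1) hV.
rewrite big_ord_recr /= => h.
have s0 : 0 <= \sum_(i < k) i.+1%:R * cabs (fabA i z) ^+ 2.
  by apply: sumr_ge0 => i _; rewrite mulr_ge0 ?exprn_ge0.
have k1 : cabs (fabA k z) ^+ 2 <= k.+1%:R * cabs (fabA k z) ^+ 2.
  by rewrite ler_peMl ?exprn_ge0 // ler1n.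
have a0 := cabs_ge0 (fabA k z); have := sqr_ge0 (cabs (fabA k z) - 1).
by rewrite !expr2 in h k1 *; nra.
Qed.

(** Power series in s of (y s - y z) / (1/s - 1/z), that is, of (Y(s) - s y z) / (1 - s/z). *)
Definition kercoef z : nat -> R[i] :=
  conv (fun n => Y n - (if n == 1%N then y z else 0)) (fun n => z ^- n).

Section Kernel.
Variable z : R[i].
Hypothesis z01 : 0 < cabs z < 1.
Let z0 : 0 < cabs z. Proof. by case/andP: z01. Qed.
Let z1 : cabs z < 1. Proof. by case/andP: z01. Qed.
Let zn0 : z != 0. Proof. by rewrite -cabs_gt0. Qed.
Let p n : R[i] := Y n - (if n == 1%N then y z else 0).

Let F n : R[i] := (faber Y n).[y z].
Local Notation e := (kercoef z).

Let hp : unit_radius p.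
Proof.
apply: unit_radiusB => //; apply: (unit_radius_bounded (M := cabs (y z))) => n.
by case: eqP => _ //; rewrite cabs0.
Qed.

Let psum_p s : cabs s < 1 -> psum p s = psum Y s - s * y z.
Proof.
move=> s1; rewrite psumB //; last first.
  apply: (unit_radius_bounded (M := cabs (y z))) => n; by case: eqP => _ //; rewrite cabs0.
by rewrite psum_monomial // expr1 [s * _]mulrC.
Qed.

Let e_scaled n : e n * z ^+ n = \sum_(i < n.+1) p i * z ^+ i.
Proof.
rewrite /kercoef /conv mulr_suml; apply: eq_bigr => i _; rewrite -mulrA -/(p i); congr (_ * _).
have -> : z ^+ n = z ^+ (n - i) * z ^+ i by rewrite -exprD subnK // -ltnS.
by rewrite mulKf // expf_neq0.
Qed.

(** Division by 1 - s/z could reduce the radius to |z|. The numerator vanishes at s = z, so the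
    coefficients scaled by z^n are tails of a convergent series with sum 0 and decay
    geometrically. *)
Lemma unit_radius_kercoef : unit_radius e.
Proof.
have psz : psum p z = 0 by rewrite psum_p // mulrC laurentK // subrr.
suff key r : cabs z < r < 1 -> exists M : R, forall n, cabs (e n) * r ^+ n <= M.
  move=> r /andP[r0 r1]; pose r' := Num.max r ((1 + cabs z) / 2).
  have zr : cabs z < r' by rewrite lt_max; apply/orP; right; have h := z1; lra.
  have r'1 : r' < 1 by rewrite gt_max r1 /=; have h := z1; lra.
  have [|M hM] := key r'; first by rewrite zr.
  exists M => n; apply: le_trans (hM n); apply: ler_wpM2l => //.
  apply: lerXn2r; rewrite ?nnegrE //; [by rewrite (le_trans r0) // le_max lexx|by rewrite le_max lexx].
move=> /andP[zr r1]; have r0 : 0 < r := lt_trans z0 zr.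
have r01 : 0 <= r < 1 by rewrite ltW.
have [M hM] := hp r01; have M0 : 0 <= M.
  by have := hM 0%N; rewrite expr0 mulr1; apply: le_trans.
pose q := cabs z / r; have q01 : 0 <= q < 1 by rewrite divr_ge0 ?(ltW r0) //= ltr_pdivrMr // mul1r.
have pz i : cabs (p i * z ^+ i) <= M * q ^+ i.
  rewrite cabsM cabsX /q expr_div_n mulrA mulrAC.
  have ri : 0 < r ^+ i by exact: exprn_gt0.
  by rewrite ler_wpM2r ?exprn_ge0 // ler_pdivlMr.
exists (M / (1 - q)) => n.
have tail : cabs (\sum_(i < n.+1) p i * z ^+ i) <= M * q ^+ n.+1 / (1 - q).
  set T := \sum_(i < n.+1) _.
  have cT : (fun _ : nat => T) @ \oo --> T by exact: cvg_cst.
  have lim := ccvgB (psum_cvg hp z1) cT; rewrite psz sub0r in lim.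
  rewrite -cabsN; apply: (ccvg_le lim); exists n.+1 => m nm.
  have [j ->] : exists j, m = (n.+1 + j)%N by exists (m - n.+1)%N; rewrite subnKC.
  rewrite big_split_ord /= -/T addrAC subrr add0r; apply: le_trans (cabs_sum _ _ _) _.
  apply: (@le_trans _ _ (\sum_(i < j) M * q ^+ n.+1 * q ^+ i)).
    by apply: ler_sum => i _; apply: le_trans (pz _) _; rewrite exprD mulrA.
  rewrite -mulr_sumr ler_wpM2l ?geo_sum_le // mulr_ge0 // exprn_ge0 //; by case/andP: q01.
have zX : 0 < cabs z ^+ n by exact: exprn_gt0 z0.
rewrite -e_scaled cabsM cabsX in tail.
have q1 : 0 < 1 - q by case/andP: q01 => _; rewrite subr_gt0.
rewrite -(ler_pM2r zX) mulrAC; apply: le_trans (ler_wpM2r (exprn_ge0 n (ltW r0)) tail) _.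
have -> : M * q ^+ n.+1 / (1 - q) * r ^+ n = (M / (1 - q)) * (q ^+ n.+1 * r ^+ n) by ring.
apply: ler_wpM2l; first by rewrite divr_ge0 // ltW.
rewrite exprS /q expr_div_n -mulrA divfK ?expf_neq0 ?gt_eqF //.
by rewrite ler_piMl ?exprn_ge0 //; case/andP: q01 => _ /ltW.
Qed.

Let p_rec n : p n = e n - z^-1 * (if n is m.+1 then e m else 0).
Proof.
apply: (mulIf (expf_neq0 n zn0)); rewrite [RHS]mulrBl e_scaled.
case: n => [|n]; first by rewrite big_ord1 mulr0 mul0r subr0.
have -> : z^-1 * e n * z ^+ n.+1 = e n * z ^+ n by rewrite exprS mulrAC mulKf // mulrC.
by rewrite e_scaled big_ord_recr /= addrAC subrr add0r.
Qed.

Lemma psum_kercoef s : cabs s < 1 -> psum e s * (1 - s / z) = psum Y s - s * y z.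
Proof.
move=> s1; have he := unit_radius_kercoef; rewrite -psum_p //.
transitivity (psum e s - z^-1 * (s * psum e s)); first by ring.
rewrite -psum_delay // -psumZ //; last exact: unit_radius_delay.
rewrite -psumB //; last by apply/unit_radiusZ/unit_radius_delay.
by apply: eq_psum => n; rewrite p_rec.
Qed.

(** Differentiate the product formula at s = z, where the factor 1 - s/z vanishes and only its
    derivative counts. *)
Lemma psum_kercoef_diag : psum e z = psum Y z - z * psum (dcoef Y) z.
Proof.
have he := unit_radius_kercoef; pose r := (1 + cabs z) / 2.
have zr : cabs z < r by rewrite /r; have h := z1; lra.
have r01 : 0 <= r < 1 by rewrite /r; have h := z1; have h' := z0; lra.
have r0 : 0 <= r by case/andP: r01.
have t1 := tayM (tay_psum he r01) (tayD (tay_cst _ 1) (tayZ (- z^-1) (tay_id r0))).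
have t2 := tayD (tay_psum hY r01) (tayZ (- y z) (tay_id r0)).
have t3 : tay (hol [set x | cabs x <= r]) (fun s => psum Y s + - y z * s)
   (fun x => psum (dcoef e) x * (1 + - z^-1 * x) + psum e x * (0 + - z^-1 * 1)).
  apply: tay_congr t1 => u ur; have u1 : cabs u < 1 by case/andP: r01 => _; exact: le_lt_trans.
  have h1 := psum_kercoef u1; rewrite [u / z]mulrC in h1.
  by rewrite mulNr h1 mulNr [y z * u]mulrC.
have zA : [set x | cabs x <= r] z by exact: ltW.
have near d : 0 < d -> exists w, [/\ [set x | cabs x <= r] w, w != z & cabs (w - z) < d].
  by move=> /(radial_near zn0)[w [w1 w2 w3]]; exists w; split => //; apply: le_trans w1 (ltW zr).
have := tay_unique t3 t2 zA near; rewrite mulNr mulVf // subrr mulr0 !add0r mulr1 => h.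
have -> : psum e z = - z * (psum e z * - z^-1) by rewrite mulrCA mulrNN mulfV // mulr1.
have yz : y z * z = psum Y z := laurentK Y z0.
by rewrite h -yz; ring.
Qed.

Definition kerlog z n : R[i] := if n is k.+1 then - fabA k z else 0.

Let unit_radius_kerlog : unit_radius (kerlog z).
Proof.
have [M hM] := fabA_bounded z1; apply: (unit_radius_bounded (M := `|M|)) => -[|k] /=; first by rewrite cabs0.
by rewrite cabsN; apply: le_trans (hM k) (ler_norm _).
Qed.

(** The generating function of the Faber polynomials: sum F_n(y z) s^n = 1 - s p'(s) / p(s) with
    p(s) = Y(s) - s y z. *)
Let conv_p_F n : conv p F n = p n - euler p n.
Proof.
have p0 : p 0%N = 1 by rewrite /p Y0 subr0.
case: n => [|n]; first by rewrite /conv big_ord1 /euler p0 /F faber0 hornerC mul0r mulr1 subr0.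
have FS : F n.+1 = y z * F n - \sum_(i < n.+1) Y i.+1 * F (n - i)%N - n%:R * Y n.+1.
  rewrite /F faberE /= !(hornerD, hornerN, hornerM, hornerX, hornerC) horner_sum.
  by congr (_ - _ - _); apply: eq_bigr => i _; rewrite hornerZ.
rewrite /conv big_ord_recl subn0 p0 mul1r FS.
have -> : \sum_(i < n.+1) p (lift ord0 i) * F (n.+1 - lift ord0 i)%N =
    \sum_(i < n.+1) Y i.+1 * F (n - i)%N - y z * F n.
  rewrite !big_ord_recl /= /p /bump /= !subn0 subSS subn0 mulrBl addrAC; congr (_ + _ - _).
  by apply: eq_bigr => i _; rewrite /bump /= !add1n subSS subr0.
rewrite /euler /p; case: n {FS} => [|n] /=; last by rewrite subr0 -[n.+2%:R]natr1; ring.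
by ring.
Qed.

(** The logarithmic derivative of the kernel, times s, has coefficients z^(-k) - F_k(y z); the poles
    cancel and minus k times a regular part remains. *)
Let kercoef_rec n : n.+1%:R * e n.+1 = conv (dcoef (kerlog z)) e n.
Proof.
pose h m : R[i] := z ^- m.
have eE : e =1 conv p h by [].
have euler_h m : euler h m = conv h h m - h m.
  have -> : conv h h m = m.+1%:R * h m.
    rewrite /conv (eq_bigr (fun _ => h m)) => [|i _]; first by rewrite sumr_const card_ord mulr_natl.
    by rewrite /h -invfM -exprD subnKC // -ltnS.
  by rewrite /euler -natr1; ring.
have euler_p : euler p =1 fun m => p m - conv p F m by move=> m; rewrite conv_p_F; ring.
have step m : m%:R * e m = conv (fun k => h k - F k) e m.
  rewrite eE conv_euler (eq_conv _ euler_p (fun=> erefl)) (eq_conv _ (fun=> erefl) euler_h).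
  rewrite convBl convBr convBl.
  have -> : conv (conv p F) h m = conv F e m.
    by rewrite (eq_conv m (fun k => convC p F k) (fun=> erefl)) -convA.
  have -> : conv p (conv h h) m = conv h e m by rewrite convA convC.
  by ring.
rewrite step {1}/conv big_ord_recl /h /F faber0 hornerC expr0 invr1 subrr mul0r add0r.
apply: eq_bigr => i _; rewrite /dcoef /kerlog /= faber_grunsky // /fabA; congr (_ * _).
by rewrite opprD addNKr mulrN.
Qed.

Lemma kercoef_exp s : cabs s < 1 -> psum e s = cexp (psum (kerlog z) s).
Proof. by apply: psum_exp => //; [exact: unit_radius_kercoef|rewrite /kercoef /conv big_ord1 Y0 subr0 expr0 invr1 mulr1]. Qed.

Lemma kerlog_cvg s : cabs s < 1 ->
  (fun K => \sum_(k < K) re (fabA k z * s ^+ k.+1)) @ \oo --> - ln (cabs (psum e s)).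
Proof.
move=> s1; rewrite kercoef_exp // cabs_cexp expRK.
have h := rcvgMl (-1) (ccvg_re (psum_cvg unit_radius_kerlog s1)); rewrite mulN1r -(cvg_shiftS _) in h.
apply: (cvg_ext h) => N /=; rewrite big_ord_recl /= mul0r add0r re_sum mulN1r -sumrN.
by apply: eq_bigr => i _; rewrite mulNr reN opprK.
Qed.
End Kernel.

(** For x_n = z^(n+1), the deviation from the relation X_k = s conj(x_k) / (k + 1), which
    characterises equality in the quadratic inequality. *)
Definition cc s k z : R[i] := fabA k z - s%:C%C * ((z ^+ k.+1)^*%C / k.+1%:R).
Definition lE z w : R := ln (cabs (psum (kercoef z) w)).
Definition pairing s z w : R := - ln (cabs (1 - z * w^*%C)) + s * lE z w.

Section Pair.
Variables (t1 t2 s : R) (z1 z2 : R[i]).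
Hypotheses (s1 : s ^+ 2 = 1) (z10 : 0 < cabs z1 < 1) (z20 : 0 < cabs z2 < 1).
Let x n : R[i] := t1%:C%C * z1 ^+ n.+1 + t2%:C%C * z2 ^+ n.+1.
Let X k : R[i] := t1%:C%C * fabA k z1 + t2%:C%C * fabA k z2.
Let l z w : R := - ln (cabs (1 - z * w^*%C)).
Let V : R := t1 ^+ 2 * l z1 z1 + t2 ^+ 2 * l z2 z2 + 2 * t1 * t2 * l z1 z2.
Let W : R := - (t1 ^+ 2 * lE z1 z1 + t2 ^+ 2 * lE z2 z2 + t1 * t2 * (lE z1 z2 + lE z2 z1)).
Let z11 : cabs z1 < 1. Proof. by case/andP: z10. Qed.
Let z21 : cabs z2 < 1. Proof. by case/andP: z20. Qed.

Let hX k : (fun N => \sum_(n < N) x n * g Y n k) @ \oo --> X k.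
Proof.
have h := ccvgD (ccvgMl t1%:C%C (@fabA_cvg k z1 z11)) (ccvgMl t2%:C%C (@fabA_cvg k z2 z21)).
apply: (cvg_ext h) => N; rewrite !mulr_sumr -big_split; apply: eq_bigr => n _; rewrite /x /=; ring.
Qed.

Let cabs_pair z w : cabs z < 1 -> cabs w < 1 -> cabs (z * w^*%C) < 1.
Proof. by move=> a b; rewrite cabsM cabs_conj mulr_ilt1. Qed.

Let hV : (fun N => \sum_(n < N) cabs (x n) ^+ 2 / n.+1%:R) @ \oo --> V.
Proof.
have h := rcvgD (rcvgD (rcvgMl (t1 ^+ 2) (log1m (cabs_pair z11 z11))) (rcvgMl (t2 ^+ 2) (log1m (cabs_pair z21 z21))))
  (rcvgMl (2 * t1 * t2) (log1m (cabs_pair z11 z21))).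
apply: (cvg_ext h) => N; rewrite !re_sum !mulr_sumr -!big_split; apply: eq_bigr => n _ /=.
have iC : (n.+1%:R^-1 : R[i]) = (n.+1%:R^-1)%:C%C by rewrite fmorphV rmorph_nat.
rewrite /x sqr_cabsD !cabsM !cabs_real !exprMn !real_normK ?num_real // iC -!conjX !mulcJ.
rewrite -!real_complexM /= conjM conjc_real !(mulrC _ (_^-1)%:C%C) !reZ.
have -> : t1%:C%C * z1 ^+ n.+1 * (t2%:C%C * (z2 ^+ n.+1)^*%C) = (t1 * t2)%:C%C * (z1 ^+ n.+1 * (z2 ^+ n.+1)^*%C).
  by rewrite real_complexM; ring.
by rewrite reZ; ring.
Qed.

Let hW : (fun N => \sum_(k < N) re (X k * x k)) @ \oo --> W.
Proof.
have h := rcvgD (rcvgD (rcvgMl (t1 ^+ 2) (kerlog_cvg z10 z11)) (rcvgMl (t2 ^+ 2) (kerlog_cvg z20 z21)))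
  (rcvgMl (t1 * t2) (rcvgD (kerlog_cvg z10 z21) (kerlog_cvg z20 z11))).
have -> : W = t1 ^+ 2 * - lE z1 z1 + t2 ^+ 2 * - lE z2 z2 + t1 * t2 * (- lE z1 z2 + - lE z2 z1).
  by rewrite /W; move: (lE z1 z1) (lE z2 z2) (lE z1 z2) (lE z2 z1) => a b c d; ring.
apply: (cvg_ext h) => N; rewrite -big_split !mulr_sumr -!big_split; apply: eq_bigr => n _ /=.
have -> : X n * x n = (t1 ^+ 2)%:C%C * (fabA n z1 * z1 ^+ n.+1) + (t2 ^+ 2)%:C%C * (fabA n z2 * z2 ^+ n.+1)
   + (t1 * t2)%:C%C * (fabA n z1 * z2 ^+ n.+1 + fabA n z2 * z1 ^+ n.+1).
  rewrite /X /x !expr2 !real_complexM; move: (fabA n z1) (fabA n z2) (z1 ^+ _) (z2 ^+ _) => a b c d; ring.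
by rewrite !reD !reZ reD.
Qed.

Let QE : 2 * V - 2 * s * W = 2 * (t1 ^+ 2 * pairing s z1 z1 + t2 ^+ 2 * pairing s z2 z2
   + t1 * t2 * (2 * l z1 z2 + s * (lE z1 z2 + lE z2 z1))).
Proof.
rewrite /V /W /pairing -!/(l _ _); move: (l z1 z1) (l z2 z2) (l z1 z2) => a' b' c'.
by move: (lE z1 z1) (lE z2 z2) (lE z1 z2) (lE z2 z1) => a b c d; ring.
Qed.

Let cE K : \sum_(k < K) k.+1%:R * cabs (X k - s%:C%C * ((x k)^*%C / k.+1%:R)) ^+ 2 =
  \sum_(k < K) k.+1%:R * cabs (t1%:C%C * cc s k z1 + t2%:C%C * cc s k z2) ^+ 2.
Proof.
apply: eq_bigr => k _; congr (_ * cabs _ ^+ 2); rewrite /X /x /cc conjD !conjM !conjc_real.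
by move: (fabA k z1) (fabA k z2) (_ ^*)%C (_ ^*)%C => a b c d; ring.
Qed.

(** The choice x_n = t1 z1^(n+1) + t2 z2^(n+1) makes both the energy V and the mixed term W explicit
    logarithms. *)
Lemma two_point_le K : \sum_(k < K) k.+1%:R * cabs (t1%:C%C * cc s k z1 + t2%:C%C * cc s k z2) ^+ 2 <=
  2 * (t1 ^+ 2 * pairing s z1 z1 + t2 ^+ 2 * pairing s z2 z2
   + t1 * t2 * (- 2 * ln (cabs (1 - z1 * z2^*%C)) + s * (lE z1 z2 + lE z2 z1))).
Proof.
have -> : - 2 * ln (cabs (1 - z1 * z2^*%C)) = 2 * l z1 z2 by rewrite /l mulNr mulrN.
by rewrite -QE -cE; exact: (@quad_le R Y hY Y0 yinj x X V W s s1 hX hV hW K).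
Qed.

Lemma two_point_ge (d : R) : (forall d : R, 0 < d -> exists2 t, 2^-1 <= t < 1 & fine (mu2 (omitted Y t)) < d) ->
  0 < d -> exists K0, forall K, (K0 <= K)%N ->
  2 * (t1 ^+ 2 * pairing s z1 z1 + t2 ^+ 2 * pairing s z2 z2
   + t1 * t2 * (- 2 * ln (cabs (1 - z1 * z2^*%C)) + s * (lE z1 z2 + lE z2 z1))) - d <=
  \sum_(k < K) k.+1%:R * cabs (t1%:C%C * cc s k z1 + t2%:C%C * cc s k z2) ^+ 2.
Proof.
move=> full d0; have [K0 h] := @quad_ge R Y hY Y0 yinj x X V W s s1 hX hV hW d full d0; exists K0 => K /h.
have -> : - 2 * ln (cabs (1 - z1 * z2^*%C)) = 2 * l z1 z2 by rewrite /l mulNr mulrN.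
by rewrite cE QE.
Qed.
End Pair.
End TwoPoints.

(** * Exponentials and square roots of power series by recursion *)

Section ExponentialSequence.
Variable R : realType.
Implicit Types (d e a b : nat -> R[i]) (z : R[i]).

Definition exp_step d (e : nat -> R[i]) n : R[i] := if n is m.+1 then conv d e m / n%:R else 1.
Definition exp_seq d := course_rec 0 (exp_step d).

Lemma exp_seqE d n : exp_seq d n = exp_step d (exp_seq d) n.
Proof.
apply: course_recE => g h [|m] // e; rewrite /exp_step /conv; congr (_ / _).
by apply: eq_bigr => i _; rewrite e // ltnS leq_subr.
Qed.

Lemma exp_seq0 d : exp_seq d 0 = 1. Proof. by rewrite exp_seqE. Qed.

Lemma exp_seqS d n : n.+1%:R * exp_seq d n.+1 = conv d (exp_seq d) n.
Proof. by rewrite exp_seqE /= mulrCA divff ?mulr1 // pnatr_eq0. Qed.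

Lemma exp_rec_unique d a b : a 0%N = b 0%N -> (forall n, n.+1%:R * a n.+1 = conv d a n) ->
  (forall n, n.+1%:R * b n.+1 = conv d b n) -> a =1 b.
Proof.
move=> ab ha hb; elim/ltn_ind => -[|n] IH //.
have n0 : n.+1%:R != 0 :> R[i] by rewrite pnatr_eq0.
apply: (mulfI n0); rewrite ha hb; apply: eq_bigr => i _; rewrite IH // ltnS leq_subr //.
Qed.

(** Beyond index N >= M / (1 - q) the division by n in the recursion outweighs the convolution, so a
    bound for the first terms propagates. *)
Lemma unit_radius_exp d e : unit_radius d -> (forall n, n.+1%:R * e n.+1 = conv d e n) -> unit_radius e.
Proof.
move=> hd he r /andP[r0 r1]; pose s := (1 + r) / 2; pose q := r / s.
have s0 : 0 < s by rewrite /s; lra.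
have s1 : s < 1 by rewrite /s; lra.
have s01 : 0 <= s < 1 by rewrite s1 ltW.
have [M hM] := hd s s01; have M0 : 0 <= M.
  by have := hM 0%N; rewrite expr0 mulr1; apply: le_trans.
have rs : r < s by rewrite /s; lra.
have q0 : 0 <= q by rewrite divr_ge0 // ltW.
have q1 : q < 1 by rewrite ltr_pdivrMr // mul1r.
have [N hN] : exists N : nat, M / (1 - q) <= N%:R.
  have D0 : 0 <= M / (1 - q) by rewrite divr_ge0 // subr_ge0 ltW.
  by exists (Num.bound (M / (1 - q))); exact: ltW (archi_boundP D0).
pose K := \sum_(i < N.+1) cabs (e i) * r ^+ i; have K0 : 0 <= K.
  by apply: sumr_ge0 => i _; rewrite mulr_ge0 // exprn_ge0.
exists K; elim/ltn_ind => n IH; have [nN|nN] := leqP n N.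
  rewrite /K (bigD1 (Ordinal (nN : n < N.+1)%N)) //= lerDl; apply: sumr_ge0 => i _.
  by rewrite mulr_ge0 // exprn_ge0.
case: n IH nN => // n IH nN.
have n0 : 0 < n.+1%:R :> R by rewrite ltr0n.
rewrite -(ler_pM2l n0) mulrA -[X in X * cabs _](cabs_nat _ n.+1) -cabsM he.
apply: (@le_trans _ _ (\sum_(i < n.+1) M * q ^+ i * K)).
  rewrite /conv; apply: le_trans (ler_wpM2r (exprn_ge0 _ r0) (cabs_sum _ _ _)) _.
  rewrite mulr_suml; apply: ler_sum => i _; rewrite cabsM.
  have -> : r ^+ n.+1 = r * (r ^+ i * r ^+ (n - i)).
    by rewrite -exprD subnKC -?exprS // -ltnS.
  have -> : cabs (d i) * cabs (e (n - i)%N) * (r * (r ^+ i * r ^+ (n - i))) =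
    r * ((cabs (d i) * r ^+ i) * (cabs (e (n - i)%N) * r ^+ (n - i))) by ring.
  have h1 : cabs (d i) * r ^+ i <= M * q ^+ i.
    have sn : s ^+ i != 0 by rewrite expf_neq0 // gt_eqF.
    have -> : r ^+ i = s ^+ i * q ^+ i by rewrite -exprMn /q mulrCA divff ?mulr1 // gt_eqF.
    by rewrite mulrA ler_wpM2r ?exprn_ge0.
  have h2 : cabs (e (n - i)%N) * r ^+ (n - i) <= K by apply: IH; rewrite ltnS leq_subr.
  apply: (@le_trans _ _ ((cabs (d i) * r ^+ i) * (cabs (e (n - i)%N) * r ^+ (n - i)))).
    by rewrite ler_piMl ?(ltW r1) // !mulr_ge0 // exprn_ge0.
  by apply: ler_pM => //; rewrite mulr_ge0 // exprn_ge0.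
rewrite -mulr_suml -mulr_sumr; apply: ler_wpM2r => //.
apply: (@le_trans _ _ (M / (1 - q))).
  by rewrite ler_wpM2l // geo_sum_le // q0.
by apply: le_trans hN _; rewrite ler_nat ltnW.
Qed.

(** Half of the logarithmic derivative Y' u, with u = 1 / Y, exponentiates to a square root. *)
Lemma exp_seq_sqrt (u Y : nat -> R[i]) : unit_radius Y -> unit_radius u -> Y 0%N = 1 -> (forall n, conv u Y n = unitseq n) ->
  exists w, [/\ unit_radius w, w 0%N = 1 & conv w w =1 Y].
Proof.
move=> hY hu Y0 uY; pose dl := conv (dcoef Y) u; pose d n := 2^-1 * dl n.
have hdl : unit_radius dl by apply: unit_radius_conv => //; exact: unit_radius_dcoef.
exists (exp_seq d); split; [|exact: exp_seq0|].
  by apply: unit_radius_exp (exp_seqS d); exact: unit_radiusZ.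
apply: (@exp_rec_unique dl) => [|n|n].
- by rewrite /conv big_ord1 exp_seq0 mulr1 Y0.
- set e := exp_seq d; rewrite conv_euler.
  have eE : euler e =1 fun k => if k is m.+1 then conv d e m else 0.
    by case=> [|m]; rewrite /euler ?mul0r // exp_seqS.
  have h (b : nat -> R[i]) : conv (fun k => if k is m.+1 then conv d e m else 0) b n.+1 = conv (conv d e) b n.
    by rewrite /conv big_ord_recl mul0r add0r; apply: eq_bigr.
  rewrite [X in _ + X]convC (eq_conv _ eE (fun=> erefl)) h -convA.
  have -> : conv d (conv e e) n = 2^-1 * conv dl (conv e e) n.
    by rewrite /conv mulr_sumr; apply: eq_bigr => i _; rewrite /d mulrA.
  have two : 2 != 0 :> R[i] by rewrite pnatr_eq0.
  by field.
- rewrite -/(dcoef Y n) /dl -convA convC (eq_conv _ uY (fun=> erefl)) conv1 //.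
Qed.
End ExponentialSequence.

(** * The distortion theorem *)

Section Distortion.
Variable R : realType.
Implicit Types (z w : R[i]).
Variables (u Y : nat -> R[i]).
Hypothesis hY : unit_radius Y.
Hypothesis hu : unit_radius u.
Hypothesis Y0 : Y 0%N = 1.
Hypothesis uY : forall n, conv u Y n = unitseq n.
Hypothesis yinj : forall z w, 0 < cabs z < 1 -> 0 < cabs w < 1 -> laurent Y z = laurent Y w -> z = w.

Definition even_ext (w : nat -> R[i]) n : R[i] := if odd n then 0 else w n./2.

Lemma unit_radius_even (w : nat -> R[i]) : unit_radius w -> unit_radius (even_ext w).
Proof.
move=> hw r /andP[r0 r1]; have r2 : 0 <= r ^+ 2 < 1 by rewrite exprn_ge0 // expr_lt1.
have [M hM] := hw _ r2; have M0 : 0 <= M by have := hM 0%N; rewrite expr0 mulr1; apply: le_trans.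
exists M => n; rewrite /even_ext; case: ifP => [_|/negbT on]; first by rewrite cabs0 mul0r.
by have := hM n./2; rewrite -exprM mul2n even_halfK.
Qed.

Lemma psum_even (w : nat -> R[i]) z : unit_radius w -> cabs z < 1 -> psum (even_ext w) z = psum w (z ^+ 2).
Proof.
move=> hw z1; have z2 : cabs (z ^+ 2) < 1 by rewrite cabsX expr_lt1.
have he := unit_radius_even hw; apply/esym/psum_eq => //; apply/ccvgP => e e0.
have [N hN] := (ccvgP _ _).1 (psum_cvg he z1) e e0; exists N => n Nn.
have := hN (n.*2) (leq_trans Nn _); rewrite -addnn leq_addr => /(_ isT); congr (cabs (_ - _) < _).
elim: n {Nn} => [|n IH]; first by rewrite addn0 !big_ord0.
rewrite addnS addSn !big_ord_recr /= IH /even_ext /= oddD addbb /= mul0r addr0 addnn doubleK.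
by rewrite -exprM mul2n.
Qed.

Lemma psum_euler (a : nat -> R[i]) z : unit_radius a -> cabs z < 1 -> psum (euler a) z = z * psum (dcoef a) z.
Proof.
move=> ha z1; rewrite -psum_delay //; last exact: unit_radius_dcoef.
by apply: eq_psum => -[|n]; rewrite /euler ?mul0r.
Qed.

Lemma psum_even_deriv (w : nat -> R[i]) z : unit_radius w -> cabs z < 1 ->
  z * psum (dcoef (even_ext w)) z = 2 * (z ^+ 2 * psum (dcoef w) (z ^+ 2)).
Proof.
move=> hw z1; have z2 : cabs (z ^+ 2) < 1 by rewrite cabsX expr_lt1.
have he : unit_radius (euler w).
  move: (unit_radius_delay (unit_radius_dcoef hw)); congr unit_radius; apply/funext => -[|n] //.
  by rewrite /euler mul0r.
rewrite -psum_euler //; last exact: unit_radius_even.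
rewrite -psum_euler // -psumZ // -psum_even //; last exact: unit_radiusZ.
apply: eq_psum => n; rewrite /euler /even_ext; case: ifP => [_|/negbT on]; first by rewrite mulr0.
by rewrite mulrA -natrM mul2n even_halfK.
Qed.

(** For f = z / Y this is |z f' / f| <= (1 + |z|) / (1 - |z|). The square-root transform of y is odd
    and univalent; comparing it at x and - x, where x^2 = z, yields the bound. *)
Lemma distortion z : 0 < cabs z < 1 ->
  cabs (psum Y z - z * psum (dcoef Y) z) * (1 - cabs z) <= cabs (psum Y z) * (1 + cabs z).
Proof.
move=> /andP[z0 z1]; have [w [hw w0 wwE]] := exp_seq_sqrt hY hu Y0 uY.
pose x := sqrtc z; have xz : x ^+ 2 = z by exact: sqr_sqrtc.
have xx : cabs x ^+ 2 = cabs z by rewrite -cabsX xz.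
have x0 : 0 < cabs x by rewrite cabs_gt0; apply: contraTneq z0 => x0; rewrite -xz x0 expr0n cabs0 ltxx.
have x1 : cabs x < 1 by rewrite -(@expr_lt1 _ 2) // xx.
have w2 s : cabs s < 1 -> psum w s ^+ 2 = psum Y s.
  by move=> s1; rewrite expr2 -psumM // (eq_psum _ wwE).
have YN s : cabs s < 1 -> psum Y s != 0.
  move=> s1; have := psumM hu hY s1; rewrite (eq_psum _ uY) psum_unitseq // => /eqP.
  by apply: contraTneq => ->; rewrite mulr0 oner_eq0.
have wN s : cabs s < 1 -> psum w s != 0.
  by move=> s1; have := YN s s1; apply: contraNneq => e; rewrite -w2 // e expr0n.
pose Yh := even_ext w; have hYh : unit_radius Yh by exact: unit_radius_even.
have Yh0 : Yh 0%N = 1 by rewrite /Yh /even_ext.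
have YhE s : cabs s < 1 -> psum Yh s = psum w (s ^+ 2) by exact: psum_even.
have sq1 (s : R[i]) : cabs s < 1 -> cabs (s ^+ 2) < 1 by move=> s1; rewrite cabsX expr_lt1.
have yh2 s : 0 < cabs s < 1 -> laurent Yh s ^+ 2 = laurent Y (s ^+ 2).
  by move=> /andP[_ s1]; rewrite /laurent YhE // exprMn w2 ?sq1 // exprVn.
have yhinj a b : 0 < cabs a < 1 -> 0 < cabs b < 1 -> laurent Yh a = laurent Yh b -> a = b.
  move=> ha hb e; have /andP[a0 a1] := ha; have /andP[b0 b1] := hb.
  have /eqP : a ^+ 2 = b ^+ 2.
    by apply: yinj; rewrite ?cabsX ?exprn_gt0 ?expr_lt1 // -!yh2 // e.
  rewrite eqf_sqr => /orP[/eqP //|/eqP ab].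
  move: e; rewrite /laurent !YhE // ab sqrrN invrN mulrN => /eqP; rewrite eq_sym -subr_eq0 opprK -mulr2n.
  have bn0 : b != 0 by rewrite -cabs_gt0.
  rewrite -mulr_natr mulf_eq0 pnatr_eq0 orbF mulf_eq0 invr_eq0 (negbTE bn0) orbF.
  by rewrite (negbTE (wN _ (sq1 _ b1))).
have hx : 0 < cabs x < 1 by rewrite x0.
have hNx : 0 < cabs (- x) < 1 by rewrite cabsN.
have xN1 : cabs (- x) < 1 by rewrite cabsN.
have m11 : (-1 : R) ^+ 2 = 1 by rewrite sqrrN expr1n.
(* Weights 1 and -1, sign -1, and an empty sum on the left: only nonnegativity of the right-hand
   side is used. *)
have := two_point_le hYh Yh0 yhinj 1 (-1) m11 hx hNx 0; rewrite big_ord0 /pairing.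
set D := psum w z - 2 * (z * psum (dcoef w) z).
have Dx : psum (kercoef Yh x) x = D.
  by rewrite (psum_kercoef_diag hYh hx) (YhE x x1) (psum_even_deriv hw x1) xz.
have DNx : psum (kercoef Yh (- x)) (- x) = D.
  by rewrite (psum_kercoef_diag hYh hNx) (YhE _ xN1) (psum_even_deriv hw xN1) sqrrN xz.
have xn0 : x != 0 by rewrite -cabs_gt0.
have two : 2 != 0 :> R[i] by rewrite pnatr_eq0.
have kx : psum (kercoef Yh x) (- x) = psum w z.
  have := psum_kercoef hYh hx xN1.
  rewrite mulNr divff // opprK mulNr opprK [x * _]mulrC (laurentK Yh x0) (YhE _ xN1) (YhE x x1) sqrrN xz => h.
  apply: (mulIf two); rewrite [RHS]mulr_natr [RHS]mulr2n -h; exact: erefl.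
have kNx : psum (kercoef Yh (- x)) x = psum w z.
  have := psum_kercoef hYh hNx x1.
  rewrite invrN mulrN divff // opprK => h.
  have lN : x * laurent Yh (- x) = - psum Yh x.
    by rewrite /laurent (YhE _ xN1) (YhE x x1) sqrrN invrN mulrN mulrN mulrCA divff // mulr1.
  rewrite lN opprK (YhE x x1) xz in h.
  apply: (mulIf two); rewrite [RHS]mulr_natr [RHS]mulr2n -h; exact: erefl.
rewrite /lE Dx DNx kx kNx.
have c1 : 1 - x * x^*%C = (1 - cabs z)%:C%C by rewrite mulcJ xx rmorphB rmorph1.
have c2 : 1 - - x * (- x)^*%C = (1 - cabs z)%:C%C.
  by rewrite mulcJ cabsN xx rmorphB rmorph1.
have c3 : 1 - x * (- x)^*%C = (1 + cabs z)%:C%C.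
  by rewrite (_ : (- x)^*%C = - x^*%C); [rewrite mulrN opprK mulcJ xx rmorphD rmorph1|exact: rmorphN].
rewrite c1 c2 c3 !cabs_real; have p1 : 0 < 1 - cabs z by lra.
have p2 : 0 < 1 + cabs z by lra.
rewrite !gtr0_norm // => ineq.
have YD : psum Y z - z * psum (dcoef Y) z = psum w z * D.
  have eE : euler Y =1 (fun n => 2 * conv (euler w) w n).
    by move=> n; rewrite [LHS]/euler -wwE conv_euler [X in _ + X]convC mulr_natl mulr2n.
  rewrite -psum_euler // (eq_psum _ eE).
  have he : unit_radius (euler w).
    move: (unit_radius_delay (unit_radius_dcoef hw)); congr unit_radius; apply/funext => -[|n] //.
    by rewrite /euler mul0r.
  rewrite psumZ //; last exact: unit_radius_conv.
  rewrite psumM // psum_euler // -w2 // /D; move: (psum w z) (psum (dcoef w) z) => a b; ring.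
rewrite YD -w2 // cabsM cabsX expr2 -!mulrA; apply: ler_wpM2l => //.
have [D0|D0] := eqVneq D 0; first by rewrite D0 cabs0 mul0r mulr_ge0 // ltW.
have dp : 0 < cabs D by rewrite cabs_gt0.
have wp : 0 < cabs (psum w z) by rewrite cabs_gt0 wN.
rewrite -ler_ln ?posrE ?mulr_gt0 // !lnM ?posrE //; lra.
Qed.
End Distortion.

(** Over N + 1 equal steps the linear terms are nonnegative and the quadratic errors add up to O(1 /
    N). *)
Lemma nondecreasing_of_taylor (R : realType) (F F' : R -> R) (a b M : R) : a <= b ->
  (forall x, a <= x <= b -> 0 <= F' x) ->
  (forall x y, a <= x <= b -> a <= y <= b -> - (M * (y - x) ^+ 2) <= F y - F x - F' x * (y - x)) -> F a <= F b.
Proof.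
move=> ab F'0 hF; apply/ler_addgt0Pr => e e0; rewrite -lerBlDl.
have [N hN] := div_nat_small (M * (b - a) ^+ 2) e0; have {}hN := hN N (leqnn N).
have n0 : 0 < N.+1%:R :> R by rewrite ltr0n.
pose h := (b - a) / N.+1%:R; pose x i := a + i%:R * h.
have h0 : 0 <= h by rewrite divr_ge0 ?subr_ge0 // ltW.
have xN : x N.+1 = b by rewrite /x /h mulrCA divff ?mulr1 ?gt_eqF // addrC subrK.
have xi i : (i <= N.+1)%N -> a <= x i <= b.
  move=> iN; rewrite /x lerDl mulr_ge0 //= -xN /x lerD2l ler_wpM2r // ler_nat //.
have step i : (i < N.+1)%N -> - (M * h ^+ 2) <= F (x i.+1) - F (x i).
  move=> iN; have hx := xi i (ltnW iN); have := hF _ _ hx (xi _ iN).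
  have -> : x i.+1 - x i = h by rewrite /x -natr1; ring.
  have : 0 <= F' (x i) * h by rewrite mulr_ge0 ?F'0.
  by move: (F' (x i) * h) => u; lra.
have sum : F b - F a = \sum_(i < N.+1) (F (x i.+1) - F (x i)).
  rewrite -(big_mkord xpredT (fun i => F (x i.+1) - F (x i))) telescope_sumr // xN.
  by rewrite /x mul0r addr0.
have : - (M * (b - a) ^+ 2 / N.+1%:R) <= F b - F a.
  rewrite sum; apply: (@le_trans _ _ (\sum_(i < N.+1) - (M * h ^+ 2))).
    rewrite sumr_const card_ord -[X in _ <= X]mulr_natr /h le_eqVlt.
    by apply/orP; left; apply/eqP; field; rewrite addrC natr1 gt_eqF.
  by apply: ler_sum => i _; exact: step.
by move: hN; move: (M * (b - a) ^+ 2 / _) => v h1 h2; lra.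
Qed.

(** * Growth along a ray and the energy at radius r *)

Section Growth.
Variable R : realType.
Implicit Types (z w : R[i]) (r : R).
Variables (u Y : nat -> R[i]).
Hypothesis hY : unit_radius Y.
Hypothesis hu : unit_radius u.
Hypothesis Y0 : Y 0%N = 1.
Hypothesis uY : forall n, conv u Y n = unitseq n.
Hypothesis yinj : forall z w, 0 < cabs z < 1 -> 0 < cabs w < 1 -> laurent Y z = laurent Y w -> z = w.

Lemma Y_neq0 z : cabs z < 1 -> 0 < cabs (psum Y z).
Proof.
move=> z1; rewrite cabs_gt0; have := psumM hu hY z1; rewrite (eq_psum _ uY) psum_unitseq // => /eqP.
by apply: contraTneq => ->; rewrite mulr0 oner_eq0.
Qed.

Section Ray.
Variable s : R[i].
Hypothesis s1 : cabs s = 1.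

(** The inverse square of (1 - r)^2 |f (r s)| / r. Squaring makes it a product of power series and
    conjugates, to which the Taylor calculus applies. *)
Definition phi r : R := cabs (psum Y (r%:C%C * s)) ^+ 2 / (1 - r) ^+ 4.

Let cs r : 0 <= r -> cabs (r%:C%C * s) = r.
Proof. by move=> r0; rewrite cabsM s1 mulr1 cabs_real ger0_norm. Qed.

Definition seg (b : R) (x y d : R[i]) :=
  exists r t : R, [/\ 0 <= r <= b, 0 <= t <= b, x = r%:C%C, y = t%:C%C & d = (t - r)%:C%C].

(** Its logarithmic derivative, times r / 2, is (1 + r) / (1 - r) - Re (z f' / f), nonnegative by
    distortion. *)
Lemma phi_nondecreasing a b : 0 < a -> a <= b -> b < 1 -> phi a <= phi b.
Proof.
move=> a0 ab b1; have b0 : 0 <= b by lra.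
have b01 : 0 <= b < 1 by rewrite b0.
have tid : tay (seg b) id (fun=> 1).
  apply: tay_sub (tay_id b0) => x y d [r [t [/andP[r0 rb] /andP[t0 tb] -> -> ->]]].
  by split; rewrite /= ?cabs_real ?ger0_norm // rmorphB.
have tA : tay (seg b) (fun x => psum Y (s * x)) (fun x => psum (dcoef Y) (s * x) * (s * 1)).
  apply: (tay_comp (tayZ s tid) _ (tay_psum hY b01)) => x y d [r [t [/andP[r0 rb] /andP[t0 tb] -> -> _]]].
  by rewrite /= ![s * _]mulrC !cs.
have tAc := tay_conj _ tA.
have {}tAc : tay (seg b) (fun x => (psum Y (s * x))^*%C) (fun x => (psum (dcoef Y) (s * x) * (s * 1))^*%C).
  by apply: tAc => x y d [r [t [_ _ _ _ ->]]]; exact: conjc_real.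
have m0 : 0 < 1 - b by lra.
have tB : tay (seg b) (fun x => (1 + -1 * x)^-1) (fun x => - ((1 + -1 * x)^-1 ^+ 2) * (0 + -1 * 1)).
  apply: (tay_comp (tayD (tay_cst _ 1) (tayZ (-1) tid)) _ (tay_inv m0)) => x y d [r [t [/andP[r0 rb] /andP[t0 tb] -> -> _]]].
  have h v : 0 <= v -> v <= b -> 1 - b <= cabs (1 + -1 * v%:C%C).
    move=> v0 vb; rewrite mulN1r -(rmorph1 (real_complex R)) -rmorphB cabs_real ger0_norm; lra.
  by split; exact: h.
pose Phi x := psum Y (s * x) * (psum Y (s * x))^*%C *
   ((1 + -1 * x)^-1 * (1 + -1 * x)^-1 * ((1 + -1 * x)^-1 * (1 + -1 * x)^-1)).
have val r : a <= r <= b -> Phi r%:C%C = (phi r)%:C%C.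
  move=> /andP[ar rb]; rewrite /Phi mulcJ mulN1r -(rmorph1 (real_complex R)) -rmorphB -fmorphV -!real_complexM /=.
  congr (_%:C%C); rewrite /phi [s * _]mulrC; field; rewrite gt_eqF // subr_gt0; lra.
pose Y' z := psum (dcoef Y) z.
pose F' r : R := 2 * (re (Y' (r%:C%C * s) * s * (psum Y (r%:C%C * s))^*%C) + 2 * cabs (psum Y (r%:C%C * s)) ^+ 2 / (1 - r)) / (1 - r) ^+ 4.
have [Psi [M M0 hM] DE] : exists2 Psi, tay (seg b) Phi Psi & forall r, a <= r <= b -> Psi r%:C%C = (F' r)%:C%C.
  eexists; first exact: tayM (tayM tA tAc) (tayM (tayM tB tB) (tayM tB tB)).
  move=> r /andP[ar rb]; have p1 : 1 - r != 0 by rewrite gt_eqF // subr_gt0; lra.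
  have p2 : 1 + -1 * r%:C%C = (1 - r)%:C%C by rewrite mulN1r rmorphB rmorph1.
  have wconj (v : R[i]) : v + v^*%C = (2 * re v)%:C%C by case: v => v1 v2; simpc; rewrite mulrDl mul1r.
  rewrite p2 -fmorphV [s * r%:C%C]mulrC; set A := psum Y _; set A' := psum (dcoef Y) _ * (s * 1).
  have -> : A' * A^*%C + A * A'^*%C = A' * A^*%C + (A' * A^*%C)^*%C by rewrite conjM conjcK [A * _]mulrC.
  rewrite wconj mulcJ; have -> : A' = Y' (r%:C%C * s) * s by rewrite /A' mulr1.
  rewrite /F' -/A; move: (re _) (cabs A ^+ 2) => a1 a2.
  have e1 : - ((1 - r)^-1%:C%C ^+ 2) * (0 + -1 * 1) = ((1 - r)^-1 ^+ 2)%:C%C :> R[i].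
    by rewrite real_complexX; ring.
  rewrite e1 -!(rmorphM, rmorphD); congr (_%:C%C) => /=; field; exact: p1.
clearbody Phi.
apply: (@nondecreasing_of_taylor R phi F' a b M ab).
  move=> r /andP[ar rb]; have r0 : 0 < r by lra.
  have p1 : 0 < 1 - r by lra.
  rewrite /F' divr_ge0 ?exprn_ge0 ?(ltW p1) // mulr_ge0 //.
  set z := r%:C%C * s; have zr : cabs z = r by rewrite /z cs // ltW.
  have zz : 0 < cabs z < 1 by rewrite zr r0; lra.
  have dist := distortion hY hu Y0 uY yinj zz; rewrite zr in dist.
  rewrite -(pmulr_rge0 _ (mulr_gt0 r0 p1)).
  set L := psum Y z - z * Y' z in dist.
  have e1 : r * re (Y' z * s * (psum Y z)^*%C) = cabs (psum Y z) ^+ 2 - re (L * (psum Y z)^*%C).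
    have -> : L * (psum Y z)^*%C = (cabs (psum Y z) ^+ 2)%:C%C - r%:C%C * (Y' z * s * (psum Y z)^*%C).
      by rewrite /L mulrBl mulcJ /z; congr (_ - _); ring.
    by rewrite reB reZ /=; ring.
  have e2 : re (L * (psum Y z)^*%C) * (1 - r) <= cabs (psum Y z) ^+ 2 * (1 + r).
    apply: (@le_trans _ _ (cabs L * cabs (psum Y z) * (1 - r))).
      rewrite ler_wpM2r ?(ltW p1) //; apply: le_trans (re_ler_cabs _) _; by rewrite cabsM cabs_conj.
    have -> : cabs L * cabs (psum Y z) * (1 - r) = cabs (psum Y z) * (cabs L * (1 - r)) by ring.
    have -> : cabs (psum Y z) ^+ 2 * (1 + r) = cabs (psum Y z) * (cabs (psum Y z) * (1 + r)) by ring.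
    by rewrite ler_wpM2l.
  have -> : r * (1 - r) * (re (Y' z * s * (psum Y z)^*%C) + 2 * cabs (psum Y z) ^+ 2 / (1 - r)) =
     (1 - r) * (r * re (Y' z * s * (psum Y z)^*%C)) + 2 * r * cabs (psum Y z) ^+ 2 by field; rewrite gt_eqF.
  rewrite e1; move: e2; move: (re (L * _)) (cabs (psum Y z) ^+ 2) => p q; nra.
move=> r t hr ht; have /andP[ar rb] := hr; have /andP[at' tb] := ht.
have S : seg b r%:C%C t%:C%C (t - r)%:C%C by exists r, t; split => //; apply/andP; split; lra.
have [_ _ _] := hM _ _ _ S; rewrite (val r hr) (val t ht) (DE r hr).
rewrite -rmorphB -real_complexM -rmorphB !cabs_real => h.
by move: h; rewrite ler_norml real_normK ?num_real // => /andP[].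
Qed.

(** By monotonicity it suffices to look at small radii, where |Y| is close to Y(0) = 1. *)
Lemma phi_ge1 r : 0 < r < 1 -> 1 <= phi r.
Proof.
move=> /andP[r0 r1]; have r01 : 0 <= r < 1 by rewrite ltW.
have [L L0 hL] := tay_lip (tay_psum hY r01).
have near d : 0 < d <= r -> 1 - L * d <= cabs (psum Y (d%:C%C * s)).
  move=> /andP[d0 dr]; have h0 : cabs (0 : R[i]) <= r by rewrite cabs0 ltW.
  have hd : cabs (d%:C%C * s) <= r by rewrite cs // ltW.
  have := hL _ _ _ (And3 h0 hd erefl); rewrite subr0 psum0 // Y0 cs ?(ltW d0) // => h.
  by have := cabsD (psum Y (d%:C%C * s)) (1 - psum Y (d%:C%C * s)); rewrite addrC subrK cabs1 [cabs (1 - _)]cabsB; lra.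
apply/ler_addgt0Pr => e e0; pose d := Num.min r (Num.min (e / 2) 1 / (L + 1)).
have m0 : 0 < Num.min (e / 2) 1 by rewrite lt_min ltr01 andbT divr_gt0.
have L1 : 0 < L + 1 by lra.
have d0 : 0 < d by rewrite lt_min r0 divr_gt0.
have dr : d <= r by rewrite ge_min lexx.
have Ld : L * d <= Num.min (e / 2) 1.
  have : d <= Num.min (e / 2) 1 / (L + 1) by rewrite ge_min lexx orbT.
  by rewrite ler_pdivlMr // => h; nra.
have Ld1 : L * d <= e / 2 by apply: le_trans Ld _; rewrite ge_min lexx.
have Ld2 : L * d <= 1 by apply: le_trans Ld _; rewrite ge_min lexx orbT.
have hd : 0 < d <= r by rewrite d0.
have := near d hd => n1; have := phi_nondecreasing d0 dr r1; rewrite {1}/phi => h.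
have q0 : 0 < (1 - d) ^+ 4 by apply: exprn_gt0; lra.
have q1 : (1 - d) ^+ 4 <= 1 by apply: exprn_ile1; lra.
have k1 : cabs (psum Y (d%:C%C * s)) ^+ 2 <= cabs (psum Y (d%:C%C * s)) ^+ 2 / (1 - d) ^+ 4.
  by rewrite ler_pdivlMr // ler_piMr // exprn_ge0.
have k2 : (1 - L * d) ^+ 2 <= cabs (psum Y (d%:C%C * s)) ^+ 2 by rewrite lerXn2r ?nnegrE // subr_ge0.
have k3 : 1 - e <= (1 - L * d) ^+ 2 by have := sqr_ge0 (L * d); rewrite sqrrB; move: (L * d) Ld1 => v; lra.
by have := le_trans k3 (le_trans k2 (le_trans k1 h)); move: (phi r) => v; lra.
Qed.
Lemma phi_gt0 r : 0 < r < 1 -> 0 < phi r.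
Proof. by move=> /phi_ge1; exact: lt_le_trans. Qed.

Lemma ln_phi r : 0 < r < 1 -> ln (phi r) = 2 * (ln (cabs (psum Y (r%:C%C * s))) - 2 * ln (1 - r)).
Proof.
move=> /andP[r0 r1]; have y0 : 0 < cabs (psum Y (r%:C%C * s)) by apply: Y_neq0; rewrite cs // ltW.
have p1 : 0 < 1 - r by lra.
by rewrite /phi ln_div ?posrE ?exprn_gt0 // !lnXn //; ring.
Qed.

(** The one-point case of the two-point bound. Distortion bounds the diagonal kernel |Y - z Y'|, and
    the logarithms then combine to ln [phi]. *)
Lemma coef_energy r K : 0 < r < 1 ->
  \sum_(k < K) k.+1%:R * cabs (cc Y 1 k (r%:C%C * s)) ^+ 2 <= ln (phi r).
Proof.
move=> r01; have /andP[r0 r1] := r01; set z := r%:C%C * s.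
have zr : cabs z = r by rewrite /z cs // ltW.
have zz : 0 < cabs z < 1 by rewrite zr.
have := two_point_le hY Y0 yinj 1 0 (expr1n _ 2) zz zz K.
rewrite expr0n expr1n !mul0r !mulr0 !mul0r !addr0 !mul1r.
have -> : \sum_(k < K) k.+1%:R * cabs (1%:C%C * cc Y 1 k z + 0%:C%C * cc Y 1 k z) ^+ 2 =
   \sum_(k < K) k.+1%:R * cabs (cc Y 1 k z) ^+ 2.
  by apply: eq_bigr => k _; rewrite rmorph1 rmorph0 mul1r mul0r addr0.
move=> h; apply: le_trans h _; rewrite ln_phi // ler_pM2l // /pairing mul1r /lE.
have z1 : cabs z < 1 by case/andP: zz.
have L0 : 0 < cabs (psum (kercoef Y z) z).
  by rewrite (kercoef_exp hY Y0 yinj zz z1) cabs_cexp expR_gt0.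
have dist := distortion hY hu Y0 uY yinj zz; rewrite -(psum_kercoef_diag hY zz) zr in dist.
have -> : 1 - z * z^*%C = ((1 - r) * (1 + r))%:C%C by rewrite mulcJ zr -subr_sqr expr1n rmorphB rmorph1.
have p1 : 0 < 1 - r by lra.
have p2 : 0 < 1 + r by lra.
have y0 := Y_neq0 z1.
rewrite cabs_real gtr0_norm ?mulr_gt0 // lnM ?posrE //.
move: dist; rewrite -ler_ln ?posrE ?mulr_gt0 // !lnM ?posrE // -/z.
by move: (ln _) (ln _) (ln _) (ln _) => a b c d; lra.
Qed.
End Ray.
End Growth.

(** * Passage to the boundary: energy bound and its equality case *)

Section LimitCoefficients.
Variable R : realType.
Implicit Types (z w : R[i]) (r : R).

Lemma ccvg_horner (P : {poly R[i]}) (v : nat -> R[i]) (l : R[i]) : v @ \oo --> l -> (fun n => P.[v n]) @ \oo --> P.[l].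
Proof.
move=> hv; elim/poly_ind: P => [|P c IH].
  by rewrite horner0; apply: (cvg_ext (cvg_cst (0 : R[i]))) => n; rewrite horner0.
have hc : (fun _ : nat => c) @ \oo --> c by exact: cvg_cst.
rewrite !(hornerD, hornerM, hornerX, hornerC); apply: (cvg_ext (ccvgD (ccvgM IH hv) hc)) => n.
by rewrite !(hornerD, hornerM, hornerX, hornerC).
Qed.

Lemma ccvgX (v : nat -> R[i]) (l : R[i]) k : v @ \oo --> l -> (fun n => v n ^+ k) @ \oo --> l ^+ k.
Proof.
move=> hv; have := @ccvg_horner 'X^k v l hv; rewrite hornerXn => h.
by apply: (cvg_ext h) => n; rewrite hornerXn.
Qed.

Lemma ccvg_conj (v : nat -> R[i]) (l : R[i]) : v @ \oo --> l -> (fun n => (v n)^*%C) @ \oo --> l^*%C.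
Proof.
move=> /ccvgP h; apply/ccvgP => e /h[N hN]; exists N => n /hN.
by rewrite -conjB cabs_conj.
Qed.

Lemma ccvg_real (v : nat -> R) (l : R) : v @ \oo --> l -> (fun n => (v n)%:C%C) @ \oo --> l%:C%C.
Proof.
move=> /rcvgP h; apply/ccvgP => e /h[N hN]; exists N => n /hN.
by rewrite -rmorphB cabs_real.
Qed.

Lemma rcvg_eventually (v w : nat -> R) (l : R) N : v @ \oo --> l ->
  (forall n, (N <= n)%N -> v n = w n) -> w @ \oo --> l.
Proof.
move=> /rcvgP h e; apply/rcvgP => d /h[M hM]; exists (maxn M N) => n hn.
by rewrite -e ?hM // (leq_trans _ hn) // ?leq_maxl ?leq_maxr.
Qed.

Lemma rcvg_ln (v : nat -> R) (l : R) : 0 < l -> v @ \oo --> l -> (fun n => ln (v n)) @ \oo --> ln l.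
Proof. by move=> l0 hv; exact: cvg_comp hv (continuous_ln l0). Qed.

Variables (u Y : nat -> R[i]).
Hypothesis hY : unit_radius Y.
Hypothesis hu : unit_radius u.
Hypothesis Y0 : Y 0%N = 1.
Hypothesis uY : forall n, conv u Y n = unitseq n.
Hypothesis yinj : forall z w, 0 < cabs z < 1 -> 0 < cabs w < 1 -> laurent Y z = laurent Y w -> z = w.
Local Notation y := (laurent Y).

(** The coefficient of z^(k+1) in log (f z / z) minus that in log (1 - conj(s) z)^(-2). *)
Definition ck (s : R[i]) k : R[i] := ((faber Y k.+1).[0] - 2 * (s^*%C) ^+ k.+1) / k.+1%:R.

Variables (s : R[i]) (B : R).
Hypothesis s1 : cabs s = 1.
Hypothesis hB : forall r, 0 < r < 1 -> phi Y s r <= B.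

Let zeta n : R[i] := (rho R n.+1)%:C%C * s.
Let rhoS n : 0 < rho R n.+1 < 1.
Proof.
have /andP[_ ->] := rho01 R n.+1; rewrite andbT /rho subr_gt0 invf_lt1 ?ltr0n // ltr1n //.
Qed.

Let zeta_abs n : cabs (zeta n) = rho R n.+1.
Proof. by rewrite cabsM s1 mulr1 cabs_real ger0_norm //; have /andP[/ltW] := rhoS n. Qed.

Let zeta01 n : 0 < cabs (zeta n) < 1.
Proof. by rewrite zeta_abs. Qed.

Let rhoS_cvg : (fun n => rho R n.+1) @ \oo --> (1 : R).
Proof. by rewrite (cvg_shiftS (rho R)); exact: cvg_rho. Qed.

Let zeta_cvg : zeta @ \oo --> s.
Proof.
have hs : (fun _ : nat => s) @ \oo --> s by exact: cvg_cst.
by have := ccvgM (ccvg_real rhoS_cvg) hs; rewrite rmorph1 mul1r.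
Qed.

Let sV : s^-1 = s^*%C.
Proof.
have sn0 : s != 0 by rewrite -cabs_gt0 s1.
by apply: (mulfI sn0); rewrite mulfV // mulcJ s1 expr1n.
Qed.

Let zetaV_cvg : (fun n => (zeta n)^-1) @ \oo --> s^*%C.
Proof.
have h0 : (1 : R) != 0 := oner_neq0 R.
have hr : (fun n => (rho R n.+1)^-1) @ \oo --> (1 : R) by rewrite -[X in _ --> X]invr1; exact: cvgV.
have hs : (fun _ : nat => s^*%C) @ \oo --> s^*%C by exact: cvg_cst.
have := ccvgM (ccvg_real hr) hs; rewrite rmorph1 mul1r => h.
by apply: (cvg_ext h) => n; rewrite /zeta invfM fmorphV sV.
Qed.

(** A bounded [phi] makes |Y|^2 = O((1 - r)^4); hence y tends to 0 along the ray, and Faber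
    polynomials get evaluated at 0. *)
Let Yzeta_cvg : (fun n => psum Y (zeta n)) @ \oo --> (0 : R[i]).
Proof.
have B0 : 0 <= B by apply: le_trans (hB (rhoS 0)); rewrite divr_ge0 ?exprn_ge0 // subr_ge0 ltW //; case/andP: (rhoS 0).
apply: (@ccvg_bound _ _ _ (fun n => (B + 1) * (1 - rho R n.+1))) => [n|].
  have /andP[r0 r1] := rhoS n; have := hB (rhoS n); rewrite /phi -/(zeta n) ler_pdivrMr ?exprn_gt0 ?subr_gt0 //.
  rewrite subr0; set v := cabs _; set d := 1 - rho R n.+1 => h.
  have d0 : 0 < d by rewrite subr_gt0.
  have d1 : d <= 1 by rewrite /d; lra.
  have v0 : 0 <= v by exact: cabs_ge0.
  rewrite -(@ler_pXn2r _ 2) ?nnegrE ?mulr_ge0 ?(ltW d0) ?addr_ge0 // exprMn.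
  apply: le_trans h _; have d4 : d ^+ 4 <= d ^+ 2 by rewrite ler_wiXn2l // ltW.
  apply: ler_pM => //; first by rewrite exprn_ge0 // ltW.
  by rewrite sqrrD; have := sqr_ge0 B; lra.
have h1 : (fun _ : nat => (1 : R)) @ \oo --> (1 : R) by exact: cvg_cst.
by have := rcvgMl (B + 1) (rcvgB h1 rhoS_cvg); rewrite subrr mulr0.
Qed.

Let yzeta_cvg : (fun n => y (zeta n)) @ \oo --> (0 : R[i]).
Proof. by have := ccvgM Yzeta_cvg zetaV_cvg; rewrite mul0r. Qed.

(** The factor 2 in [ck] has two sources with the same limit on the unit circle: the pole z^(-k-1)
    subtracted from the Faber polynomial, and the conjugate power in [cc]. *)
Lemma cc_cvg k : (fun n => cc Y 1 k (zeta n)) @ \oo --> ck s k.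
Proof.
have h1 := @ccvgX _ _ k.+1 zetaV_cvg; have h2 := @ccvgX _ _ k.+1 (ccvg_conj zeta_cvg).
have h3 := @ccvg_horner (faber Y k.+1) _ _ yzeta_cvg.
have h4 := ccvgMl k.+1%:R^-1 (ccvgB h3 (ccvgD h1 h2)).
have k0 : k.+1%:R != 0 :> R[i] by rewrite pnatr_eq0.
have -> : ck s k = k.+1%:R^-1 * ((faber Y k.+1).[0] - ((s^*%C) ^+ k.+1 + (s^*%C) ^+ k.+1)) by rewrite /ck; ring.
apply: (cvg_ext h4) => n; rewrite /cc /fabA rmorph1 mul1r (faber_grunsky hY Y0 (ltn0Sn k) (zeta01 n)).
rewrite conjX exprVn; move: (psum _ _) ((zeta n ^+ k.+1)^-1) ((zeta n)^*%C ^+ k.+1) => v1 v2 v3; field; rewrite addrC natr1; exact: k0.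
Qed.

Lemma energy_limit K : \sum_(k < K) k.+1%:R * cabs (ck s k) ^+ 2 <= ln B.
Proof.
have lim := @rcvg_sum R K (fun k n => k.+1%:R * cabs (cc Y 1 k (zeta n)) ^+ 2) (fun k => k.+1%:R * cabs (ck s k) ^+ 2).
have {}lim := lim (fun k => rcvgMl k.+1%:R (rcvg_sqr_cabs (@cc_cvg k))).
apply: (rcvg_le lim).
exists 0%N => n _; apply: le_trans (coef_energy hY hu Y0 uY yinj s1 K (rhoS n)) _.
rewrite ler_ln ?posrE //; first exact: hB.
  exact: (phi_gt0 hY hu Y0 uY yinj s1 (rhoS n)).
by apply: lt_le_trans (hB (rhoS 0)); exact: (phi_gt0 hY hu Y0 uY yinj s1 (rhoS 0)).
Qed.

Section Full.
Hypothesis full : forall d : R, 0 < d -> exists2 t, 2^-1 <= t < 1 & fine (mu2 (omitted Y t)) < d.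
Variable r0 : R.
Hypothesis r01 : 0 < r0 < 1.
Let z : R[i] := r0%:C%C * s.
Let zr : cabs z = r0.
Proof. by rewrite cabsM s1 mulr1 cabs_real ger0_norm //; case/andP: r01 => /ltW. Qed.
Let z01 : 0 < cabs z < 1. Proof. by rewrite zr. Qed.
Let X n : R := - 2 * ln (cabs (1 - z * (zeta n)^*%C)) + 1 * (lE Y z (zeta n) + lE Y (zeta n) z).

(** When the moving point reaches the circle, both mixed kernels tend to |Y z| / (1 - r0) in
    modulus, since y vanishes there; with the term - 2 ln (1 - r0) this is exactly ln [phi] at
    r0. *)
Let X_cvg : X @ \oo --> ln (phi Y s r0).
Proof.
have /andP[r00 r1] := r01; have p1 : 0 < 1 - r0 by lra.
have z1 : cabs z < 1 by case/andP: z01.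
have y0 := Y_neq0 hY hu uY z1; set Yz := cabs (psum Y z) in y0.
have zn0 : z != 0 by rewrite -cabs_gt0 zr.
have sn0 : s != 0 by rewrite -cabs_gt0 s1.
have c1 : (fun _ : nat => (1 : R[i])) @ \oo --> (1 : R[i]) by exact: cvg_cst.
have zs : z * s^*%C = r0%:C%C by rewrite /z -mulrA mulcJ s1 expr1n rmorph1 mulr1.
have h1 : (fun n => cabs (1 - z * (zeta n)^*%C)) @ \oo --> 1 - r0.
  have := ccvg_cabs (ccvgB c1 (ccvgMl z (ccvg_conj zeta_cvg))).
  by rewrite zs -(rmorph1 (real_complex R)) -rmorphB cabs_real gtr0_norm.
have quot (E D N : nat -> R) (d n : R) : 0 < d -> (forall k, E k * D k = N k) -> D @ \oo --> d ->
    N @ \oo --> n -> E @ \oo --> n / d.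
  move=> d0 ED hD hN; have d20 : 0 < d / 2 by rewrite divr_gt0.
  have [M hM] := (rcvgP _ _).1 hD _ d20.
  have hV : (fun k => (D k)^-1) @ \oo --> d^-1 by apply: cvgV => //; rewrite gt_eqF.
  apply: (rcvg_eventually (N := M) (rcvgM hN hV)) => k /hM; rewrite ltr_norml => /andP[h _].
  have Dk : 0 < D k by lra.
  by rewrite -ED mulfK // gt_eqF.
have h2 : (fun n => cabs (psum (kercoef Y z) (zeta n))) @ \oo --> Yz / (1 - r0).
  have hs : (fun n => zeta n * y z) @ \oo --> s * y z by apply: ccvgM zeta_cvg _; exact: cvg_cst.
  have hN := ccvg_cabs (ccvgB Yzeta_cvg hs).
  have zV : (fun _ : nat => z^-1) @ \oo --> z^-1 by exact: cvg_cst.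
  have hD := ccvg_cabs (ccvgB c1 (ccvgM zeta_cvg zV)).
  have d0 : cabs (1 - s * z^-1) = (1 - r0) / r0.
    have -> : 1 - s * z^-1 = (1 - r0^-1)%:C%C.
      by rewrite /z invfM rmorphB rmorph1 fmorphV mulrCA mulfV // mulr1.
    rewrite cabs_real ler0_norm; first by field; rewrite gt_eqF.
    by rewrite subr_le0 invf_ge1 // ltW.
  have -> : Yz / (1 - r0) = cabs (0 - s * y z) / ((1 - r0) / r0).
    rewrite sub0r cabsN cabsM s1 mul1r /laurent cabsM cabsV zr -/Yz; field.
    by rewrite !gt_eqF.
  apply: (quot _ (fun n => cabs (1 - zeta n * z^-1)) (fun n => cabs (psum Y (zeta n) - zeta n * y z))) => //.
  - by rewrite divr_gt0.
  - move=> n; have /andP[_ zn1] := zeta01 n.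
    by rewrite -cabsM (psum_kercoef hY z01 zn1).
  - by move: hD; rewrite d0.
have h3 : (fun n => cabs (psum (kercoef Y (zeta n)) z)) @ \oo --> Yz / (1 - r0).
  have hY' : (fun _ : nat => psum Y z) @ \oo --> psum Y z by exact: cvg_cst.
  have hN := ccvg_cabs (ccvgB hY' (ccvgMl z yzeta_cvg)).
  have hD := ccvg_cabs (ccvgB c1 (ccvgMl z zetaV_cvg)).
  have dE : cabs (1 - z * s^*%C) = 1 - r0 by rewrite zs -(rmorph1 (real_complex R)) -rmorphB cabs_real gtr0_norm.
  have nE : cabs (psum Y z - z * 0) = Yz by rewrite [z * 0]mulr0 [_ - 0]subr0.
  rewrite dE in hD; rewrite nE in hN.
  apply: (quot _ _ _ _ _ _ _ hD hN) => // n.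
  by rewrite /comp -cabsM (psum_kercoef hY (zeta01 n) z1).
have l0 : 0 < Yz / (1 - r0) by rewrite divr_gt0.
have := rcvgD (rcvgMl (-2) (rcvg_ln p1 h1)) (rcvgMl 1 (rcvgD (rcvg_ln l0 h2) (rcvg_ln l0 h3))).
rewrite (ln_phi hY hu uY s1 r01) -/z -/Yz ln_div ?posrE //.
have -> : - 2 * ln (1 - r0) + 1 * (ln Yz - ln (1 - r0) + (ln Yz - ln (1 - r0))) = 2 * (ln Yz - 2 * ln (1 - r0)) by ring.
by [].
Qed.

(** The energy of the sum of the two vectors is nearly maximal, and each single energy is at most
    its own diagonal term, so the cross term is at least 2 X up to a small error. Since the fixed
    vector is concentrated below K0, this forces energy of the moving vector onto indices below K0,
    where the termwise limit is legitimate. *)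
Lemma full_energy e : 0 < e -> exists K, ln (phi Y s r0) - e <= \sum_(k < K) k.+1%:R * cabs (ck s k) ^+ 2.
Proof.
have arith (p1 p2 x q a b cs a0 c E t1 t2 th tL : R) : a <= 2 * p1 -> b <= 2 * p2 -> cs <= a0 + c + (t1 + t2) ->
    t1 <= th -> t2 <= tL -> th + tL = q -> a0 <= E -> 2 * (p1 + p2 + x) - q <= a + b + cs -> 2 * x - q - E - q <= c.
  by lra.
move=> e0; set E := ln (phi Y s r0); pose LB := ln B.
have ph0 := phi_gt0 hY hu Y0 uY yinj s1 r01; have ph1 := phi_ge1 hY hu Y0 uY yinj s1 r01.
have EB : E <= LB by rewrite ler_ln ?posrE //; [exact: hB|exact: lt_le_trans ph0 (hB r01)].
have LB0 : 0 <= LB by apply: le_trans EB; exact: ln_ge0.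
(* The tail of the cross term costs th^2 / th + th ln B = th (1 + ln B) = e / 4. *)
pose th := e / 4 / (1 + LB); have th0 : 0 < th by rewrite divr_gt0 ?divr_gt0 //; lra.
have thE : th * (1 + LB) = e / 4 by rewrite /th divfK // gt_eqF //; lra.
pose A K := \sum_(k < K) k.+1%:R * cabs (cc Y 1 k z) ^+ 2.
have Amono : {homo A : m n / (m <= n)%N >-> m <= n} by move=> m n mn; exact: (@wsum_mono R (fun k => cc Y 1 k z)) mn.
have AE K : A K <= E by exact: (coef_energy hY hu Y0 uY yinj s1 K r01).
have [K0 hK0] : exists K0, forall K, (K0 <= K)%N -> A K - A K0 <= th ^+ 2.
  have cv : cvgn A.
    apply: nondecreasing_is_cvgn; first exact: Amono.
    by exists E => _ [K _ <-]; exact: AE.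
  have t2 : 0 < th ^+ 2 / 2 by rewrite divr_gt0 ?exprn_gt0.
  have [N hN] := (rcvgP _ _).1 cv _ t2; exists N => K NK.
  have := hN N (leqnn N); have := hN K NK; rewrite !ltr_norml.
  by move: (A N) (A K) (limn A) => a b c; lra.
pose C n := \sum_(k < K0) k.+1%:R * cabs (cc Y 1 k (zeta n)) ^+ 2.
have key n : 2 * X n - e / 4 - E - e / 4 <= C n.
  have e4 : 0 < e / 4 by rewrite divr_gt0.
  have [K1 hK1] := two_point_ge hY Y0 yinj 1 1 (expr1n _ 2) z01 (zeta01 n) full e4.
  pose p1 := pairing Y 1 z z; pose p2 := pairing Y 1 (zeta n) (zeta n).
  have e1 (a b c d S : R) : 2 * (1 ^+ 2 * a + 1 ^+ 2 * b + 1 * 1 * c) - d <= S -> 2 * (a + b + c) - d <= S.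
    by rewrite expr1n !mul1r.
  have := e1 p1 p2 (X n) _ _ (hK1 (K0 + K1)%N (leq_addl _ _)).
  move: {hK1} K1 => j.
  have e2 (a b c S : R) : S <= 2 * (1 ^+ 2 * a + 0 ^+ 2 * b + 1 * 0 * c) -> S <= 2 * a.
    by rewrite expr1n expr0n mulr0 !mul0r !addr0 mul1r.
  have u1 : A (K0 + j)%N <= 2 * p1.
    have := e2 _ _ _ _ (two_point_le hY Y0 yinj 1 0 (expr1n _ 2) z01 z01 (K0 + j)); apply: le_trans.
    rewrite le_eqVlt; apply/orP; left; apply/eqP; apply: eq_bigr => k _.
    by rewrite rmorph1 rmorph0 [1 * _]mul1r [0 * _]mul0r [_ + 0]addr0.
  pose Bz K := \sum_(k < K) k.+1%:R * cabs (cc Y 1 k (zeta n)) ^+ 2.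
  have u2 : Bz (K0 + j)%N <= 2 * p2.
    have := e2 _ _ _ _ (two_point_le hY Y0 yinj 1 0 (expr1n _ 2) (zeta01 n) (zeta01 n) (K0 + j)); apply: le_trans.
    rewrite le_eqVlt; apply/orP; left; apply/eqP; apply: eq_bigr => k _.
    by rewrite rmorph1 rmorph0 [1 * _]mul1r [0 * _]mul0r [_ + 0]addr0.
  have u3 : Bz (K0 + j)%N <= LB.
    apply: le_trans (coef_energy hY hu Y0 uY yinj s1 _ (rhoS n)) _.
    by rewrite ler_ln ?posrE ?hB //; [exact: (phi_gt0 hY hu Y0 uY yinj s1 (rhoS n))|exact: lt_le_trans ph0 (hB r01)].
  pose cr k := k.+1%:R * (2 * re (cc Y 1 k z * (cc Y 1 k (zeta n))^*%C)).
  have sumE K : \sum_(k < K) k.+1%:R * cabs (1%:C%C * cc Y 1 k z + 1%:C%C * cc Y 1 k (zeta n)) ^+ 2 =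
     A K + Bz K + \sum_(k < K) cr k.
    rewrite /A /Bz -!big_split; apply: eq_bigr => k _ /=.
    by rewrite rmorph1 !mul1r sqr_cabsD !mulrDr.
  (* Below K0 the mixed products are split evenly; above K0 with weight [th], because there the
     fixed point has energy at most th^2. *)
  rewrite sumE; have crE : \sum_(k < K0 + j) cr k <= A K0 + C n + (th^-1 * (A (K0 + j)%N - A K0) + th * Bz (K0 + j)%N).
    have am (a b : R[i]) (c : R) : 0 < c -> 2 * re (a * b^*%C) <= c^-1 * cabs a ^+ 2 + c * cabs b ^+ 2.
      move=> c0; apply: (@le_trans _ _ (2 * (cabs a * cabs b))).
        by rewrite ler_pM2l // -[cabs b]cabs_conj -cabsM; exact: re_ler_cabs.
      move: (cabs a) (cabs b) => v w; have ci : 0 < c^-1 by rewrite invr_gt0.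
      have := sqr_ge0 (v - c * w); rewrite -(pmulr_rge0 _ ci).
      have -> : c^-1 * (v - c * w) ^+ 2 = c^-1 * v ^+ 2 - 2 * (v * w) + c * w ^+ 2 by field; rewrite gt_eqF.
      lra.
    rewrite big_split_ord /=; apply: lerD.
      rewrite /A /C -big_split; apply: ler_sum => k _ /=; rewrite /cr -mulrDr ler_wpM2l //.
      by have := am (cc Y 1 k z) (cc Y 1 k (zeta n)) 1 ltr01; rewrite invr1 !mul1r.
    have AD : A (K0 + j)%N - A K0 = \sum_(k < j) (K0 + k).+1%:R * cabs (cc Y 1 (K0 + k) z) ^+ 2.
      by rewrite /A big_split_ord /= addrAC subrr add0r.
    have BD : \sum_(k < j) (K0 + k).+1%:R * cabs (cc Y 1 (K0 + k) (zeta n)) ^+ 2 <= Bz (K0 + j)%N.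
      by rewrite /Bz big_split_ord /= lerDr; apply: sumr_ge0 => i _; rewrite mulr_ge0 ?exprn_ge0.
    rewrite AD; apply: le_trans (lerD (lexx _) (ler_wpM2l (ltW th0) BD)).
    rewrite !mulr_sumr -big_split; apply: ler_sum => k _ /=; rewrite /cr.
    have := am (cc Y 1 (K0 + k) z) (cc Y 1 (K0 + k) (zeta n)) th th0 => h.
    apply: le_trans (ler_wpM2l (ler0n _ _) h) _; rewrite le_eqVlt; apply/orP; left; apply/eqP; ring.
  have w1 : th^-1 * (A (K0 + j)%N - A K0) <= th.
    by rewrite mulrC ler_pdivrMr // -expr2; apply: hK0; exact: leq_addr.
  have w2 : th * Bz (K0 + j)%N <= th * LB by rewrite ler_wpM2l // ltW.
  have w3 : th + th * LB = e / 4 by rewrite -thE; ring.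
  have w4 := AE K0.
  exact: (arith _ _ _ _ _ _ _ _ _ _ _ _ _ _ u1 u2 crE w1 w2 w3 w4).
have limC : C @ \oo --> \sum_(k < K0) k.+1%:R * cabs (ck s k) ^+ 2.
  apply: (@rcvg_sum R K0 (fun k n => k.+1%:R * cabs (cc Y 1 k (zeta n)) ^+ 2) (fun k => k.+1%:R * cabs (ck s k) ^+ 2)).
  by move=> k; exact: rcvgMl _ (rcvg_sqr_cabs (@cc_cvg k)).
have lim := rcvgB limC (rcvgMl 2 X_cvg); exists K0.
have : - (e / 4 + E + e / 4) <= \sum_(k < K0) k.+1%:R * cabs (ck s k) ^+ 2 - 2 * E.
  by apply: (rcvg_ge lim); exists 0%N => n _; have := key n; move: (C n) (2 * X n) => a b; lra.
by move: (\sum_(k < K0) _) => S; lra.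
Qed.
End Full.
End LimitCoefficients.

Lemma sum_cauchy_schwarz (R : realType) (x y : nat -> R) n :
  (\sum_(i < n) x i * y i) ^+ 2 <= (\sum_(i < n) x i ^+ 2) * (\sum_(i < n) y i ^+ 2).
Proof.
elim: n => [|n ih]; first by rewrite !big_ord0 expr0n mul0r.
have B0 : 0 <= \sum_(i < n) x i ^+ 2 by apply: sumr_ge0 => i _; exact: sqr_ge0.
have C0 : 0 <= \sum_(i < n) y i ^+ 2 by apply: sumr_ge0 => i _; exact: sqr_ge0.
rewrite !big_ord_recr /=.
move: (\sum_(i < n) x i * y i) (\sum_(i < n) x i ^+ 2) (\sum_(i < n) y i ^+ 2) (x n) (y n) ih B0 C0 => A B C a b ih B0 C0.
have s0 : 0 <= B * b ^+ 2 + C * a ^+ 2 by rewrite addr_ge0 // mulr_ge0 ?sqr_ge0.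
have : 2 * A * (a * b) <= B * b ^+ 2 + C * a ^+ 2.
  apply: le_trans (ler_norm _) _; rewrite -(@ler_pXn2r _ 2) ?nnegrE // real_normK ?num_real //.
  apply: (@le_trans _ _ (4 * (B * C) * (a * b) ^+ 2)).
    have -> : (2 * A * (a * b)) ^+ 2 = 4 * A ^+ 2 * (a * b) ^+ 2 by ring.
    by rewrite ler_wpM2r ?sqr_ge0 // ler_wpM2l.
  have := sqr_ge0 (B * b ^+ 2 - C * a ^+ 2); rewrite -subr_ge0 => h; rewrite -subr_ge0.
  by move: h; rewrite subr0; congr (0 <= _); ring.
move=> h; rewrite -subr_ge0.
have -> : (B + a ^+ 2) * (C + b ^+ 2) - (A + a * b) ^+ 2 = (B * C - A ^+ 2) + (B * b ^+ 2 + C * a ^+ 2 - 2 * A * (a * b)) by ring.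
by rewrite addr_ge0 // subr_ge0.
Qed.

(** * Products of exponentials *)

Section ExponentialProducts.
Variable R : realType.

(** By Leibniz the product satisfies the first-order recursion whose data is the sum. *)
Lemma exp_seqD (d1 d2 : nat -> R[i]) : conv (exp_seq d1) (exp_seq d2) =1 exp_seq (fun k => d1 k + d2 k).
Proof.
apply: (@exp_rec_unique _ (fun k => d1 k + d2 k)) => [|n|n]; last exact: exp_seqS.
  by rewrite /conv big_ord_recl big_ord0 !exp_seq0 mulr1 addr0.
have E (d : nat -> R[i]) (k : nat) : euler (exp_seq d) k.+1 = conv d (exp_seq d) k by rewrite /euler exp_seqS.
have E0 (d : nat -> R[i]) : euler (exp_seq d) 0 = 0 by rewrite /euler mul0r.
have shift (a c : nat -> R[i]) : a 0%N = 0 -> conv a c n.+1 = conv (fun k => a k.+1) c n.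
  by move=> a0; rewrite /conv big_ord_recl a0 mul0r add0r; apply: eq_bigr => k _; rewrite /= subSS.
rewrite conv_euler shift // [X in _ + X]convC shift // convDl; congr (_ + _).
  by rewrite (@eq_conv _ _ (conv d1 (exp_seq d1)) _ (exp_seq d2)) ?convA.
rewrite (@eq_conv _ _ (conv d2 (exp_seq d2)) _ (exp_seq d1)) // -convA; apply: eq_conv => // k.
exact: convC.
Qed.

Lemma exp_seq_one : exp_seq (fun _ => 1) =1 (fun _ => 1 : R[i]).
Proof.
move=> n; apply: (@exp_rec_unique _ (fun _ => 1)) => [|k|k]; [exact: exp_seq0|exact: exp_seqS|].
by rewrite mulr1 /conv (eq_bigr (fun _ => 1)) ?sumr_const ?card_ord // => i _; rewrite mulr1.
Qed.

End ExponentialProducts.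

(** * A Lebedev-Milin inequality *)

Section LebedevMilin.
Variable R : realType.
Variables (b : nat -> R[i]) (D : R).
Hypothesis hD : forall K, \sum_(k < K) k.+1%:R * cabs (b k) ^+ 2 <= D.
Hypothesis hb : forall r, 0 < r < 1 -> re (psum b r%:C%C) <= 0.

Lemma energy_ge0 : 0 <= D.
Proof. by have := hD 0; rewrite big_ord0. Qed.

Lemma energy_coef_le k : cabs (b k) <= D + 1.
Proof.
have h : cabs (b k) ^+ 2 <= D.
  apply: le_trans (hD k.+1); rewrite big_ord_recr /= -[X in X <= _]add0r lerD //.
    by apply: sumr_ge0 => i _; rewrite mulr_ge0 ?exprn_ge0.
  by rewrite ler_peMl ?exprn_ge0 // ler1n.
have D0 := energy_ge0; have D1 : 0 <= D + 1 by apply: addr_ge0.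
rewrite -(@ler_pXn2r _ 2) ?nnegrE //; apply: le_trans h _.
by move: (D) D0 => x D0; rewrite sqrrD; have := sqr_ge0 x; lra.
Qed.

Lemma unit_radius_energy : unit_radius b.
Proof. exact: unit_radius_bounded energy_coef_le. Qed.

(** The logarithmic derivative of exp (sum b_k z^(k+1)) / (1 - z), the constant 1 coming from the
    denominator. *)
Let h k : R[i] := k.+1%:R * b k + 1.
Let e := exp_seq h.
Let S n := \sum_(j < n) cabs (e j) ^+ 2.
Let yk k : R := cabs (h k) ^+ 2 - 1.
Let E n := \sum_(k < n) yk k * (k.+1%:R^-1 - n.+1%:R^-1).

Let yE k : yk k = k.+1%:R * (k.+1%:R * cabs (b k) ^+ 2 + 2 * re (b k)).
Proof.
rewrite /yk /h sqr_cabsD cabsM cabs_nat cabs1 exprMn.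
have -> : re (k.+1%:R * b k * (1 : R[i])^*%C) = k.+1%:R * re (b k).
  have -> : (1 : R[i])^*%C = 1 by rewrite /= oppr0.
  have -> : (k.+1%:R : R[i]) = (k.+1%:R)%:C%C by rewrite rmorph_nat.
  by rewrite mulr1 reZ.
move: (k.+1%:R : R) (cabs (b k)) (re (b k)) => x y z; ring.
Qed.

(** Cauchy-Schwarz applied to the recursion that expresses (n + 1) e_(n+1) as a convolution. *)
Let step n : n.+1%:R ^+ 2 * cabs (e n.+1) ^+ 2 <= (n.+1%:R + \sum_(k < n.+1) yk k) * S n.+1.
Proof.
have -> : n.+1%:R + \sum_(k < n.+1) yk k = \sum_(k < n.+1) cabs (h k) ^+ 2.
  by rewrite /yk sumrB sumr_const card_ord; move: (\sum_(i < _) _) => x; ring.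
have -> : S n.+1 = \sum_(k < n.+1) cabs (e (n - k)%N) ^+ 2.
  rewrite /S (reindex_inj rev_ord_inj) /=; apply: eq_bigr => k _; rewrite subSS //.
apply: le_trans (sum_cauchy_schwarz (fun k => cabs (h k)) (fun k => cabs (e (n - k)%N)) n.+1).
rewrite -exprMn -[n.+1%:R]cabs_nat -cabsM exp_seqS ler_pXn2r ?nnegrE //; last first.
  by apply: sumr_ge0 => i _; rewrite mulr_ge0.
by apply: le_trans (cabs_sum _ _ _) _; apply: ler_sum => k _; rewrite cabsM.
Qed.

Let S_ge0 n : 0 <= S n. Proof. by apply: sumr_ge0 => i _; exact: exprn_ge0. Qed.

(* [1 + X / N^2 = (N + 1) / N * (1 + (X - N) / (N (N + 1)))], which telescopes in products. *)
Let S_le n : S n.+1 <= n.+1%:R * expR (E n).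
Proof.
elim: n => [|n ih].
  by rewrite /S /E big_ord_recl !big_ord0 /e exp_seq0 cabs1 expr1n addr0 expR0 mulr1.
have N0 : 0 < n.+1%:R :> R by rewrite ltr0n.
have ES : E n.+1 = E n + (\sum_(k < n.+1) yk k) / (n.+1%:R * (n.+1%:R + 1)).
  rewrite /E mulr_suml !big_ord_recr /= addrA; congr (_ + _).
    rewrite -big_split; apply: eq_bigr => k _ /=; rewrite -[n.+2%:R]natr1.
    have K0 : 0 < k.+1%:R :> R by rewrite ltr0n.
    move: (k.+1%:R : R) (n.+1%:R : R) (yk k) K0 N0 => x N w x0 N0.
    by field; rewrite !gt_eqF // addr_gt0.
  rewrite -[n.+2%:R]natr1; move: (n.+1%:R : R) (yk n) N0 => N w N0.
  by field; rewrite !gt_eqF // addr_gt0.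
have SS : S n.+2 = S n.+1 + cabs (e n.+1) ^+ 2 by rewrite /S big_ord_recr.
rewrite SS ES expRD -[n.+2%:R]natr1.
have st := step n; have X0 : 0 <= n.+1%:R + \sum_(k < n.+1) yk k.
  rewrite /yk sumrB sumr_const card_ord.
  have h0 : 0 <= \sum_(i < n.+1) cabs (h i) ^+ 2 by apply: sumr_ge0 => i _; exact: exprn_ge0.
  by move: h0; move: (\sum_(i < _) _) => x; rewrite addrC subrK.
move: (S_ge0 n.+1) ih st X0; move: (S n.+1) (cabs _ ^+ 2) (\sum_(k < n.+1) _) (n.+1%:R : R) (expR (E n)) N0 (expR_gt0 (E n)) => s c w N X N0 X0 s0 ih st W0.
have exp1 := @expR_ge1Dx R (w / (N * (N + 1))).
have NN : 0 < N * (N + 1) by rewrite mulr_gt0 // addr_gt0.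
have c1 : c <= (N + w) * s / N ^+ 2 by rewrite ler_pdivlMr ?exprn_gt0 // mulrC.
apply: (@le_trans _ _ (s * (1 + (N + w) / N ^+ 2))).
  by rewrite mulrDr mulr1 lerD2l; apply: le_trans c1 _; rewrite le_eqVlt; apply/orP; left; apply/eqP; ring.
have -> : 1 + (N + w) / N ^+ 2 = (N + 1) / N * (1 + w / (N * (N + 1))).
  by field; rewrite !gt_eqF // addr_gt0.
have m0 : 0 <= (N + 1) / N * (1 + w / (N * (N + 1))).
  have -> : (N + 1) / N * (1 + w / (N * (N + 1))) = 1 + (N + w) / N ^+ 2 by field; rewrite !gt_eqF // addr_gt0.
  by rewrite addr_ge0 // divr_ge0 // exprn_ge0 // ltW.
apply: le_trans (ler_wpM2r m0 ih) _.
have -> : N * X * ((N + 1) / N * (1 + w / (N * (N + 1)))) = (N + 1) * X * (1 + w / (N * (N + 1))) by field; rewrite !gt_eqF // addr_gt0.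
by rewrite mulrA ler_wpM2l // mulr_ge0 ?(ltW X0) // addr_ge0 // ltW.
Qed.

Let bernoulli (x : R) k : 0 <= x <= 1 -> 1 - k%:R * x <= (1 - x) ^+ k.
Proof.
move=> /andP[x0 x1]; elim: k => [|k ih]; first by rewrite mul0r subr0 expr0.
have p : 0 <= 1 - x by lra.
rewrite exprS; apply: le_trans (ler_wpM2l p ih).
have k0 : 0 <= k%:R :> R := ler0n _ _; rewrite -natr1.
have -> : (1 - x) * (1 - k%:R * x) = 1 - (k%:R + 1) * x + k%:R * x ^+ 2 by ring.
by rewrite lerDl mulr_ge0 // sqr_ge0.
Qed.

(* The Fejer weights [1 - (k + 1) / (n + 1)] are compared with [rho n ^+ k.+1], whose weighted sum is controlled by [hb]. *)
Let E_bound n : E n <= 2 * D + 2.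
Proof.
case: n => [|n]; first by rewrite /E big_ord0; have := energy_ge0; lra.
set N := n.+1; pose x : R := N.+1%:R^-1; pose r : R := 1 - x.
have x0 : 0 < x by rewrite invr_gt0 ltr0n.
have x1 : x < 1 by rewrite invf_lt1 ?ltr0n // ltr1n.
have r0 : 0 < r by rewrite subr_gt0. have r1 : r < 1 by rewrite /r; lra.
pose v k : R := if (k < N)%N then 1 - k.+1%:R * x else 0.
pose w k : R := r ^+ k.+1 - v k.
have v01 k : 0 <= v k <= 1.
  rewrite /v; case: ifP => [kN|_]; last by rewrite lexx ler01.
  have : k.+1%:R * x <= 1 by rewrite ler_pdivrMr ?ltr0n // mul1r ler_nat; exact: leqW.
  by have : 0 <= k.+1%:R * x by [rewrite mulr_ge0 // ltW]; move: (k.+1%:R * x) => t; lra.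
have rk k : 0 <= r ^+ k <= 1 by rewrite exprn_ge0 ?exprn_ile1 ?ltW.
have w0 k : 0 <= w k.
  rewrite subr_ge0 /v; case: ifP => _; last by case/andP: (rk k.+1).
  by apply: bernoulli; rewrite !ltW.
(* Below [N], w_k is at most 1 and at most (k + 1) x; from [N] on, (k + 1) x >= 1 lets r^k
   dominate. *)
have w2 k : w k ^+ 2 <= k.+1%:R * (x * ((k < N)%:R + r ^+ k)).
  have k0 : 0 <= k.+1%:R * x by rewrite mulr_ge0 // ltW.
  have /andP[rk0 rk1] := rk k; have /andP[rS0 rS1] := rk k.+1.
  have := w0 k; rewrite /w /v; case: ifP => kN.
    have : 0 <= k.+1%:R * x * r ^+ k by rewrite mulr_ge0.
    rewrite mulrA mulrDr mulr1.
    have : k.+1%:R * x <= 1 by rewrite ler_pdivrMr ?ltr0n // mul1r ler_nat; exact: leqW.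
    move: (k.+1%:R * x * r ^+ k) (k.+1%:R * x) (r ^+ k.+1) k0 rS0 rS1 => a t q t0 q0 q1 t1 a0 qt.
    apply: (@le_trans _ _ ((q - (1 - t)) * 1)); first by rewrite expr2 ler_wpM2l //; lra.
    by lra.
  rewrite subr0 add0r => _; have kN' : 1 <= k.+1%:R * x.
    by rewrite ler_pdivlMr ?ltr0n // mul1r ler_nat ltnS leqNgt kN.
  apply: (@le_trans _ _ (r ^+ k)); last by rewrite mulrA ler_peMl.
  apply: (@le_trans _ _ (r ^+ k.+1)); first by rewrite expr2 ler_piMr.
  by rewrite exprS ler_piMl // ltW.
have key M : E N <= D + 2 * re (\sum_(k < N + M) b k * (r%:C%C ^+ k.+1)) + (D + 2).
  have -> : E N = \sum_(k < N) (k.+1%:R * cabs (b k) ^+ 2) * v k + \sum_(k < N + M) 2 * re (b k) * v k.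
    rewrite big_split_ord /= [X in _ + (_ + X)]big1 ?addr0.
      rewrite -big_split; apply: eq_bigr => k _ /=; rewrite yE /v ltn_ord /x.
      have K0 : 0 < k.+1%:R :> R by rewrite ltr0n.
      move: (k.+1%:R : R) (cabs (b k) ^+ 2) (re (b k)) K0 (N.+1%:R^-1 : R) => a c d K0 q.
      by field; rewrite gt_eqF.
    by move=> k _; rewrite /v ltnNge leq_addr mulr0.
  rewrite -addrA; apply: lerD.
    apply: le_trans (hD N); apply: ler_sum => k _.
    by have /andP[_ h1] := v01 k; rewrite ler_piMr // mulr_ge0 ?exprn_ge0.
  (* Replacing v_k by r^(k+1) costs 2 |b_k| w_k, split by the arithmetic-geometric mean inequality
     into (k + 1) |b_k|^2 and w_k^2 / (k + 1). *)
  have am k : 2 * re (b k) * v k <= 2 * re (b k * r%:C%C ^+ k.+1) + (k.+1%:R * cabs (b k) ^+ 2 + x * ((k < N)%:R + r ^+ k)).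
    have -> : re (b k * r%:C%C ^+ k.+1) = r ^+ k.+1 * re (b k) by rewrite -real_complexX mulrC reZ.
    have -> : r ^+ k.+1 = w k + v k by rewrite /w subrK.
    have := w2 k; have := w0 k; have := re_le_cabs (b k).
    have K0 : 0 < k.+1%:R :> R by rewrite ltr0n.
    have := cabs_ge0 (b k).
    move: (k.+1%:R : R) (w k) (v k) (x * _) (re (b k)) (cabs (b k)) K0 => K wk vk q a c K0 c0 ha wk0 wq.
    have : - (2 * a * wk) <= 2 * (c * wk).
      have : - a <= c by move: ha; rewrite ler_norml => /andP[ha _]; lra.
      by move/(ler_wpM2r wk0); lra.
    have : 2 * (c * wk) <= K * c ^+ 2 + q.
      have Ki : 0 < K^-1 by rewrite invr_gt0.
      have h1 : K^-1 * wk ^+ 2 <= q by rewrite mulrC ler_pdivrMr // mulrC.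
      apply: le_trans (lerD (lexx _) h1).
      have := mulr_ge0 (ltW Ki) (sqr_ge0 (K * c - wk)).
      have -> : K^-1 * (K * c - wk) ^+ 2 = K * c ^+ 2 - 2 * (c * wk) + K^-1 * wk ^+ 2 by field; rewrite gt_eqF.
      lra.
    lra.
  apply: (le_trans (ler_sum _ (fun (k : 'I_(N + M)) (_ : true) => am k))).
  rewrite !big_split /= -!mulr_sumr re_sum lerD2l; apply: lerD; first exact: hD.
  have -> : \sum_(i < N + M) ((i < N)%:R + r ^+ i) = N%:R + \sum_(i < N + M) r ^+ i.
    rewrite big_split /=; congr (_ + _); rewrite big_split_ord /= [X in _ + X]big1 ?addr0.
      by rewrite (eq_bigr (fun _ => 1)) ?sumr_const ?card_ord // => i _; rewrite ltn_ord.
    by move=> i _; rewrite ltnNge leq_addr.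
  have g : \sum_(i < N + M) r ^+ i <= N.+1%:R.
    have rr : 0 <= r < 1 by rewrite ltW.
    by apply: le_trans (geo_sum_le _ rr) _; rewrite /r opprB addrC subrK invrK.
  apply: (@le_trans _ _ (x * (N.+1%:R + N.+1%:R))).
    by rewrite ler_wpM2l ?(ltW x0) // lerD // ler_nat.
  by rewrite /x mulrDr mulVf ?pnatr_eq0.
have lim : (fun M => 2 * re (\sum_(k < M) b k * (r%:C%C ^+ k.+1))) @ \oo --> 2 * re (r%:C%C * psum b r%:C%C).
  have rc : cabs (r%:C%C : R[i]) < 1 by rewrite cabs_real gtr0_norm.
  have := rcvgMl 2 (ccvg_re (ccvgMl r%:C%C (psum_cvg unit_radius_energy rc))) => cv.
  apply: (cvg_ext cv) => M /=; congr (2 * re _); rewrite mulr_sumr; apply: eq_bigr => k _.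
  by rewrite exprS; ring.
have l0 : 2 * re (r%:C%C * psum b r%:C%C) <= 0.
  by rewrite reZ; apply: mulr_ge0_le0 => //; apply: mulr_ge0_le0; rewrite ?(ltW r0) // hb // r0.
have : E N - (D + (D + 2)) <= 2 * re (r%:C%C * psum b r%:C%C).
  apply: (rcvg_ge lim); exists N => M NM; have := key (M - N)%N; rewrite subnKC //.
  by move: (2 * re _) => t; lra.
by move: (2 * re _) l0 => t; lra.
Qed.

(** The energy alone does not control the averages of Re b_k in the exponent; the sign of Re b along
    the radius does. For schlicht functions that sign will come from (1 - r)^2 |f (r s)| <= r. *)
Lemma lebedev_milin n : \sum_(j < n.+1) cabs (exp_seq (fun k => k.+1%:R * b k + 1) j) ^+ 2 <= n.+1%:R * expR (2 * D + 2).
Proof. by apply: le_trans (S_le n) _; rewrite ler_wpM2l // ler_expR; exact: E_bound. Qed.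

End LebedevMilin.

(** Partial sums of the negative binomial series. By Pascal's rule, multiplication by 1 - r lowers
    [m] by one up to a nonnegative boundary term. *)
Lemma sum_binomial_le (R : realType) (r : R) m n : 0 < r < 1 ->
  (1 - r) ^+ m.+1 * \sum_(j < n) 'C(j + m, m)%:R * r ^+ j <= 1.
Proof.
move=> /andP[r0 r1]; have p : 0 <= 1 - r by lra.
elim: m => [|m ih].
  rewrite expr1 (eq_bigr (fun j : 'I_n => r ^+ j)) => [|j _]; last by rewrite bin0 mul1r.
  have rr : 0 <= r < 1 by rewrite ltW.
  apply: le_trans (ler_wpM2l p (geo_sum_le n rr)) _; rewrite mulfV // gt_eqF //; lra.
have E : (1 - r) * \sum_(j < n) 'C(j + m.+1, m.+1)%:R * r ^+ j + 'C(n + m, m.+1)%:R * r ^+ n =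
    \sum_(j < n) 'C(j + m, m)%:R * r ^+ j.
  elim: n {ih} => [|n ih].
    by rewrite !big_ord0 mulr0 add0r add0n bin_small // mul0r.
  rewrite [in LHS]big_ord_recr [in RHS]big_ord_recr /= -ih addSn addnS binS natrD exprS.
  by move: (\sum_(i < n) _) ('C(n + m, m.+1)%:R : R) ('C(n + m, m)%:R : R) => s a c; ring.
rewrite exprSr -mulrA; apply: le_trans ih; rewrite ler_wpM2l ?exprn_ge0 // -E lerDl.
by rewrite mulr_ge0 // exprn_ge0 // ltW.
Qed.

(** * Perturbations of the Koebe factor *)

Section KoebeProduct.
Variable R : realType.
Variable d : nat -> R[i].
Hypothesis hd : unit_radius d.

(** Coefficients of exp (sum d_k z^(k+1)) / (1 - z)^2; for d = 0 they are the Koebe coefficients n +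
    1. *)
Definition kexp := exp_seq (fun k => k.+1%:R * d k + 2).

Lemma unit_radius_kd : unit_radius (fun k => k.+1%:R * d k).
Proof.
by apply: (unit_radius_le (unit_radius_nat 1 hd)) => n; rewrite expr1.
Qed.

Lemma kexpE : kexp =1 conv (exp_seq (fun k => k.+1%:R * d k)) (conv (fun _ => 1) (fun _ => 1)).
Proof.
move=> n; rewrite /kexp.
transitivity (exp_seq (fun k => k.+1%:R * d k + (1 + 1)) n); first by [].
rewrite -(exp_seqD (fun k => k.+1%:R * d k) (fun _ => 1 + 1)); apply: eq_conv => // k.
rewrite -(exp_seqD (fun _ => 1) (fun _ => 1)); apply: eq_conv; exact: exp_seq_one.
Qed.

Lemma unit_radius_ones : unit_radius (fun _ => 1 : R[i]).
Proof. by apply: (@unit_radius_bounded _ _ 1) => n; rewrite cabs1. Qed.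

Lemma psum_ones z : cabs z < 1 -> psum (fun _ => 1 : R[i]) z * (1 - z) = 1.
Proof.
move=> z1; have c1 : cabs (1 : R[i]) <= 1 by rewrite cabs1.
have := psum_geo c1 z1; rewrite (eq_psum z (fun n => expr1n _ n)) mul1r.
exact.
Qed.

Lemma unit_radius_kexp : unit_radius kexp.
Proof.
apply: (@unit_radius_exp _ (fun k => k.+1%:R * d k + 2)) => [|n]; last exact: exp_seqS.
apply: unit_radiusD; first exact: unit_radius_kd.
by apply: (@unit_radius_bounded _ _ 2) => n; rewrite cabs_nat.
Qed.

Lemma psum_kexp r : 0 < r < 1 -> cabs (psum kexp r%:C%C) * (1 - r) ^+ 2 = expR (r * re (psum d r%:C%C)).
Proof.
move=> /andP[r0 r1]; have rc : cabs (r%:C%C : R[i]) < 1 by rewrite cabs_real gtr0_norm.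
set w := exp_seq (fun k => k.+1%:R * d k).
have hw : unit_radius w by apply: (unit_radius_exp unit_radius_kd) => n; exact: exp_seqS.
have h1 := unit_radius_ones.
rewrite (eq_psum _ kexpE) psumM //; last exact: unit_radius_conv.
rewrite psumM //.
have -> : (1 - r) ^+ 2 = cabs ((1 - r%:C%C) ^+ 2 : R[i]).
  by rewrite cabsX -(rmorph1 (real_complex R)) -rmorphB cabs_real gtr0_norm // subr_gt0.
rewrite -cabsM -mulrA.
have -> : psum (fun _ => 1) r%:C%C * psum (fun _ => 1) r%:C%C * (1 - r%:C%C) ^+ 2 = 1 :> R[i].
  transitivity ((psum (fun _ => 1) r%:C%C * (1 - r%:C%C)) * (psum (fun _ => 1) r%:C%C * (1 - r%:C%C)) : R[i]).
    by move: (psum _ _) => x; ring.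
  by rewrite psum_ones // mulr1.
rewrite mulr1 (@psum_exp _ (fun n => if n is m.+1 then d m else 0)) //.
- by rewrite cabs_cexp psum_delay // reZ.
- exact: unit_radius_delay.
- by move=> n; rewrite exp_seqS.
Qed.

Variable L : R.
Hypothesis hL : forall K, \sum_(k < K) k.+1%:R * cabs (d k) ^+ 2 <= L.
Hypothesis hneg : forall r, 0 < r < 1 -> re (psum d r%:C%C) <= 0.

(** With the exponent halved, [kexp] is a Cauchy square of a series of energy at most L / 4, and the
    Lebedev-Milin bound for its mean square applies. *)
Lemma kexp_growth n : cabs (kexp n) <= expR (L / 2 + 2) * n.+1%:R.
Proof.
pose b k := 2^-1 * d k; have hb : unit_radius b := unit_radiusZ _ hd.
have half : (2^-1 : R[i]) = (2^-1)%:C%C by rewrite fmorphV rmorph_nat.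
have hD K : \sum_(k < K) k.+1%:R * cabs (b k) ^+ 2 <= L / 4.
  have -> : \sum_(k < K) k.+1%:R * cabs (b k) ^+ 2 = (\sum_(k < K) k.+1%:R * cabs (d k) ^+ 2) / 4.
    rewrite mulr_suml; apply: eq_bigr => k _; by rewrite /b cabsM cabsV cabs_nat; field.
  by rewrite ler_pM2r // invr_gt0.
have hn r : 0 < r < 1 -> re (psum b r%:C%C) <= 0.
  move=> r01; have /andP[r0 r1] := r01; rewrite psumZ // ?cabs_real ?gtr0_norm // half reZ.
  by apply: mulr_ge0_le0; rewrite ?invr_ge0 // hneg.
set e := exp_seq (fun k => k.+1%:R * b k + 1).
have -> : kexp n = conv e e n.
  rewrite exp_seqD; apply: (@exp_rec_unique _ (fun k => k.+1%:R * d k + 2)) => [|k|k].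
  - by rewrite !exp_seq0.
  - exact: exp_seqS.
  - by rewrite exp_seqS; apply: eq_conv => // j; rewrite /b; field.
have S := lebedev_milin hD hn n; rewrite -/e in S.
have -> : L / 2 + 2 = 2 * (L / 4) + 2 by field.
rewrite mulrC; apply: le_trans S; apply: le_trans (cabs_sum _ _ _) _.
rewrite (eq_bigr (fun k : 'I_n.+1 => cabs (e k) * cabs (e (n - k)%N))) => [|k _]; last by rewrite cabsM.
apply: (@le_trans _ _ (\sum_(k < n.+1) (cabs (e k) ^+ 2 + cabs (e (n - k)%N) ^+ 2) / 2)).
  apply: ler_sum => k _; rewrite ler_pdivlMr //.
  move: (cabs _) (cabs _) => x y; by have := sqr_ge0 (x - y); lra.
rewrite -mulr_suml big_split /=.
have <- : \sum_(j < n.+1) cabs (e j) ^+ 2 = \sum_(j < n.+1) cabs (e (n - j)%N) ^+ 2.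
  by rewrite (reindex_inj rev_ord_inj) /=; apply: eq_bigr => k _; rewrite subSS.
by move: (\sum_(j < n.+1) _) => x; lra.
Qed.

Variables (K : nat) (th C : R).
Hypothesis th0 : 0 < th.
Hypothesis tail : forall M, \sum_(k < M) (K + k).+1%:R * cabs (d (K + k)%N) ^+ 2 <= th ^+ 2.
Hypothesis hC : forall n, cabs (kexp n) <= C * n.+1%:R.

(** The difference is the convolution of (k + 1) d_k with [kexp]. For k >= K the small tail energy
    gives a term of order th n; the first K terms give a constant. *)
Lemma kexp_defect n :
  cabs (n.+1%:R * kexp n.+1 - 2 * \sum_(k < n.+1) kexp k) <=
  C * n.+1%:R * (th * n.+1%:R + (th * K%:R + K%:R ^+ 2 * (L + 1))).
Proof.
have C0 : 0 <= C by have := le_trans (cabs_ge0 _) (hC 0); rewrite mulr1.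
have -> : n.+1%:R * kexp n.+1 - 2 * \sum_(k < n.+1) kexp k = \sum_(k < n.+1) (k.+1%:R * d k) * kexp (n - k)%N.
  rewrite exp_seqS convDl /conv -addrA -[RHS]addr0; congr (_ + _).
  rewrite (reindex_inj rev_ord_inj) mulr_sumr -sumrB big1 // => k _ /=.
  by rewrite subSS subKn ?subrr // -ltnS.
apply: le_trans (cabs_sum _ _ _) _.
apply: (@le_trans _ _ (\sum_(k < n.+1) C * n.+1%:R * (k.+1%:R * cabs (d k)))).
  apply: ler_sum => k _; rewrite !cabsM cabs_nat mulrC ler_wpM2r ?mulr_ge0 //.
  apply: le_trans (hC _) _; rewrite ler_wpM2l // ler_nat; lia.
rewrite -mulr_sumr ler_wpM2l ?mulr_ge0 //.
apply: (@le_trans _ _ (\sum_(k < K + n.+1) k.+1%:R * cabs (d k))).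
  by apply: (@sum_le_mono _ (fun k => k.+1%:R * cabs (d k))) => [i _|]; rewrite ?mulr_ge0 // leq_addl.
rewrite big_split_ord /= addrC addrA; apply: lerD; last first.
  apply: (@le_trans _ _ (\sum_(k < K) K%:R * (L + 1))); last by rewrite sumr_const card_ord expr2 -mulrA [X in _ <= X]mulr_natl.
  apply: ler_sum => k _; apply: ler_pM => //; first by rewrite ler_nat.
  exact: energy_coef_le hL k.
set N : R := n.+1%:R; have N0 : 0 < N by rewrite ltr0n.
(* The weight N / th balances the tail energy th^2 against the number N of terms, each part being of
   order th N. *)
apply: (@le_trans _ _ (\sum_(k < n.+1) (N / (2 * th) * ((K + k).+1%:R * cabs (d (K + k)%N) ^+ 2) + th * (N + K%:R) / (2 * N)))).
  apply: ler_sum => k _; set m : R := (K + k).+1%:R; set c := cabs _.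
  have m0 : 0 < m by rewrite ltr0n.
  have mN : m <= N + K%:R by rewrite -natrD ler_nat; have := ltn_ord k; lia.
  apply: (@le_trans _ _ (N / (2 * th) * (m * c ^+ 2) + th * m / (2 * N))); last first.
    by rewrite lerD2l ler_pM2r ?invr_gt0 ?mulr_gt0 // ler_wpM2l // ltW.
  have q0 : 0 < m / (2 * th * N) by rewrite divr_gt0 ?mulr_gt0.
  have := mulr_ge0 (ltW q0) (sqr_ge0 (N * c - th)).
  have -> : m / (2 * th * N) * (N * c - th) ^+ 2 = N / (2 * th) * (m * c ^+ 2) + th * m / (2 * N) - m * c.
    by field; rewrite !gt_eqF.
  by rewrite subr_ge0.
rewrite big_split /= -mulr_sumr sumr_const card_ord -[X in _ + X](mulr_natl _ n.+1) -/N.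
have q1 : 0 <= N / (2 * th) by rewrite divr_ge0 ?mulr_ge0 // ltW.
apply: le_trans (lerD (ler_wpM2l q1 (tail n.+1)) (lexx _)) _.
have -> : N / (2 * th) * th ^+ 2 + N * (th * (N + K%:R) / (2 * N)) = th * N + th * K%:R / 2.
  by field; rewrite !gt_eqF.
by rewrite lerD2l ler_piMr ?mulr_ge0 ?(ltW th0) // invf_le1 // ler1n.
Qed.

End KoebeProduct.

(** * The Tauberian argument *)

Section SlowVariation.
Variable R : realType.
Variables (p : nat -> R[i]) (C dl : R) (N1 : nat).
Hypothesis hC : forall n, cabs (p n) <= C * n.+1%:R.
Local Notation q n := (\sum_(k < n.+1) p k).
Hypothesis hq : forall n, (N1 <= n)%N -> cabs (n.+1%:R * p n.+1 - 2 * q n) <= dl * n.+1%:R ^+ 2.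

(** The partial sum of the Koebe coefficients 1, ..., n + 1, hence the natural normalisation of
    partial sums of [p]. *)
Let T n : R := n.+1%:R * n.+2%:R / 2.
Let T0 n : 0 < T n. Proof. by rewrite divr_gt0 ?mulr_gt0 ?ltr0n. Qed.
Let TS n : T n.+1 = T n + n.+2%:R.
Proof. by rewrite /T -[n.+3%:R]natr1 -[n.+2%:R]natr1; move: (n.+1%:R : R) => x; field. Qed.

Let TnC n : (T n)%:C%C != 0 :> R[i]. Proof. by rewrite -cabs_gt0 cabs_real normr_gt0 gt_eqF. Qed.

Definition cmean n : R[i] := q n / (T n)%:C%C.
Local Notation t := cmean.

Let tE n : q n = (T n)%:C%C * t n. Proof. by rewrite /t mulrC divfK ?TnC. Qed.

Let nz k : k.+1%:R != 0 :> R. Proof. by rewrite pnatr_eq0. Qed.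

Let C0 : 0 <= C. Proof. by have := le_trans (cabs_ge0 _) (hC 0); rewrite mulr1. Qed.

Let dl0 : 0 <= dl.
Proof.
have := le_trans (cabs_ge0 _) (hq (leqnn N1)).
by rewrite pmulr_lge0 // exprn_gt0 // ltr0n.
Qed.

Let t_le n : cabs (t n) <= C.
Proof.
rewrite /t cabsM cabsV cabs_real gtr0_norm // ler_pdivrMr //.
apply: le_trans (cabs_sum _ _ _) _; apply: (le_trans (ler_sum _ (fun (k : 'I_n.+1) _ => hC k))).
rewrite -mulr_sumr ler_wpM2l // le_eqVlt; apply/orP; left; apply/eqP.
elim: n => [|n ih]; first by rewrite big_ord_recl big_ord0 /T /=; field.
by rewrite big_ord_recr /= ih TS.
Qed.

Let natr2C n : (T n)%:C%C = n.+1%:R * n.+2%:R / 2 :> R[i].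
Proof. by rewrite /T rmorphM rmorphM fmorphV !rmorph_nat. Qed.

Lemma coef_cmean n : (N1 <= n)%N -> cabs (p n.+1 - n.+2%:R * t n) <= dl * n.+1%:R.
Proof.
move=> nN; have n0 : 0 < n.+1%:R :> R by rewrite ltr0n.
rewrite -(ler_pM2l n0).
have -> : n.+1%:R * (dl * n.+1%:R) = dl * n.+1%:R ^+ 2 by ring.
rewrite -{1}(cabs_nat R n.+1) -cabsM.
have -> : n.+1%:R * (p n.+1 - n.+2%:R * t n) = n.+1%:R * p n.+1 - 2 * q n; last exact: hq.
by rewrite tE natr2C; move: (t n) (n.+1%:R : R[i]) (n.+2%:R : R[i]) (p _) => a b c e; field.
Qed.

Lemma cmean_step n : (N1 <= n)%N -> cabs (t n.+1 - t n) <= 2 * dl / n.+3%:R.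
Proof.
move=> nN; rewrite -(ler_pM2l (T0 n.+1)) -{1}(gtr0_norm (T0 n.+1)) -cabs_real -cabsM.
have -> : (T n.+1)%:C%C * (t n.+1 - t n) = p n.+1 - n.+2%:R * t n.
  rewrite mulrBr -tE TS rmorphD rmorph_nat mulrDl -tE big_ord_recr /=.
  by move: (\sum_(i < _) _) (n.+2%:R * _) (p _) => a b c; ring.
apply: le_trans (coef_cmean nN) _; rewrite /T.
have -> : n.+2%:R * n.+3%:R / 2 * (2 * dl / n.+3%:R) = dl * n.+2%:R.
  by move: (n.+3%:R : R) (nz n.+2) => x x0; field.
by rewrite ler_wpM2l // ler_nat.
Qed.

(** Each step moves the mean by O(dl / n), so over a range comparable to n it moves by O(dl)
    only. *)
Lemma cmean_slow n k : (N1 <= n)%N -> cabs (t (n + k) - t n) <= 2 * dl * k%:R / n.+3%:R.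
Proof.
move=> nN; have n0 : 0 < n.+3%:R :> R by rewrite ltr0n.
elim: k => [|k ih]; first by rewrite addn0 subrr cabs0 mulr0 mul0r.
apply: le_trans (cabs_distD (t (n + k)) _ _) _; rewrite addnS.
apply: (@le_trans _ _ (2 * dl / n.+3%:R + 2 * dl * k%:R / n.+3%:R)); last first.
  by rewrite -natr1 le_eqVlt; apply/orP; left; apply/eqP; move: (n.+3%:R : R) (nz n.+2) => x x0; field.
apply: lerD ih; apply: le_trans (cmean_step (leq_trans nN (leq_addr _ _))) _.
by rewrite ler_wpM2l ?mulr_ge0 // lef_pV2 ?posrE ?ltr0n // ler_nat; lia.
Qed.

Let M := 2 * C * T N1.

(** Three ranges share the bound: for j < N1 boundedness gives the constant [M]; between N1 and n,
    and above n, slow variation is used from the smaller index. *)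
Lemma cmean_weighted n j : (N1 <= n)%N ->
  T j * cabs (t j - t n) <= dl * n.+1%:R * j.+1%:R + 2 * dl / n.+3%:R * (T j * j.+3%:R) + M.
Proof.
move=> nN; have M0 : 0 <= M by rewrite mulr_ge0 ?mulr_ge0 // ltW.
have a0 : 0 <= dl * n.+1%:R * j.+1%:R by rewrite !mulr_ge0.
have b0 : 0 <= 2 * dl / n.+3%:R * (T j * j.+3%:R) by rewrite !mulr_ge0 ?invr_ge0 // ltW.
have [jN|Nj] := ltnP j N1.
  apply: (@le_trans _ _ M); last by rewrite lerDr addr_ge0.
  rewrite /M mulrC; apply: ler_pM => //; first exact: ltW.
    by apply: le_trans (cabs_distD 0 _ _) _; rewrite subr0 sub0r cabsN; have := t_le j; have := t_le n; lra.
  by rewrite /T ler_pM2r ?invr_gt0 // ler_pM // ler_nat; lia.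
have [nj|jn] := leqP n j.
  apply: (@le_trans _ _ (2 * dl / n.+3%:R * (T j * j.+3%:R))); last by rewrite -addrA addrCA lerDl addr_ge0.
  have := cmean_slow (j - n) nN; rewrite subnKC // => h.
  rewrite mulrCA ler_wpM2l ?(ltW (T0 j)) //; apply: le_trans h _.
  rewrite mulrAC ler_wpM2l ?mulr_ge0 ?invr_ge0 // ler_nat; lia.
apply: (@le_trans _ _ (dl * n.+1%:R * j.+1%:R)); last by rewrite -addrA lerDl addr_ge0.
have := cmean_slow (n - j) Nj; rewrite subnKC ?(ltnW jn) // => h; rewrite cabsB.
apply: le_trans (ler_wpM2l (ltW (T0 j)) h) _; rewrite /T.
have -> : j.+1%:R * j.+2%:R / 2 * (2 * dl * (n - j)%:R / j.+3%:R) = (dl * j.+1%:R) * ((n - j)%:R * (j.+2%:R / j.+3%:R)) :> R.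
  by move: (j.+3%:R : R) (nz j.+2) => x x0; field.
rewrite [X in _ <= X]mulrAC ler_wpM2l ?mulr_ge0 //.
apply: (@le_trans _ _ ((n - j)%:R * 1)).
  by rewrite ler_wpM2l // ler_pdivrMr ?ltr0n // mul1r ler_nat.
by rewrite mulr1 ler_nat; lia.
Qed.

(** The Abel mean of [p] is an average of the means t_j with weights (1 - r)^3 T_j r^j of total mass
    1, and 1 - r = 1 / (n + 1) is the scale matching n. The constant 7 = 1 + 6 comes from the
    binomial sums of orders 1 and 3. *)
Lemma abel_cmean n : unit_radius p -> (0 < n)%N -> (N1 <= n)%N ->
  cabs ((1 - (rho R n)%:C%C) ^+ 2 * psum p (rho R n)%:C%C - t n) <= 7 * dl + M / n.+1%:R.
Proof.
move=> hp n0 nN; set r := rho R n; set z : R[i] := r%:C%C.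
have r1 : r < 1 by case/andP: (rho01 R n).
have r0 : 0 < r by rewrite subr_gt0 invf_lt1 ?ltr0n // ltr1n.
have r01 : 0 < r < 1 by rewrite r0.
have zr : cabs z = r by rewrite cabs_real gtr0_norm.
have z1 : cabs z < 1 by rewrite zr.
have h1 := @unit_radius_ones R; have h2 := unit_radius_conv h1 h1; have h3 := unit_radius_conv h2 h1.
have e1 : psum (fun _ => 1) z * (1 - z) = 1 := psum_ones z1.
have TE j : conv (conv (fun _ => 1) (fun _ => 1)) (fun _ => 1) j = (T j)%:C%C :> R[i].
  have i1 k : conv (fun _ => 1) (fun _ => 1) k = k.+1%:R :> R[i].
    by rewrite /conv (eq_bigr (fun _ => 1)) ?sumr_const ?card_ord // => i _; rewrite mulr1.
  transitivity (\sum_(k < j.+1) k.+1%:R : R[i]); first by apply: eq_bigr => k _; rewrite i1 mulr1.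
  elim: j => [|j ih]; first by rewrite big_ord_recl big_ord0 natr2C /=; field.
  by rewrite big_ord_recr /= ih TS rmorphD rmorph_nat.
pose a j : R[i] := conv p (fun _ => 1) j - t n * conv (conv (fun _ => 1) (fun _ => 1)) (fun _ => 1) j.
have hq1 : unit_radius (conv p (fun _ => 1)) by exact: unit_radius_conv.
have hT := unit_radiusZ (t n) h3.
have ha : unit_radius a by exact: unit_radiusB.
(* Abel summation: dividing by 1 - z passes to partial sums, and (1 - z)^(-3) has coefficients
   T_j. *)
have aE : psum a z * (1 - z) ^+ 3 = (1 - z) ^+ 2 * psum p z - t n.
  rewrite /a psumB // psumZ // !psumM //.
  move: e1; move: (psum (fun _ => 1) z) (psum p z) (t n) (1 - z) => o P c w e1.
  transitivity (w ^+ 2 * P * (o * w) - c * (o * w) ^+ 3); first by ring.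
  by rewrite e1 expr1n !mulr1.
rewrite -aE cabsM.
have w1 : cabs ((1 - z) ^+ 3) = (1 - r) ^+ 3.
  by rewrite cabsX -(rmorph1 (real_complex R)) -rmorphB cabs_real gtr0_norm // subr_gt0.
rewrite w1; have d0 : 0 < 1 - r by rewrite subr_gt0.
rewrite -ler_pdivlMr ?exprn_gt0 //.
have d1 : 1 - r = n.+1%:R^-1 by rewrite /r /rho opprB addrC subrK.
apply: (ccvg_le (psum_cvg ha z1)); exists 0%N => J _.
have s1 : \sum_(j < J) j.+1%:R * r ^+ j <= ((1 - r) ^+ 2)^-1.
  rewrite -[X in _ <= X]mul1r ler_pdivlMr ?exprn_gt0 // mulrC; have := @sum_binomial_le R r 1 J r01.
  by congr (_ * _ <= _); apply: eq_bigr => j _; rewrite addn1 bin1.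
have s0 : \sum_(j < J) r ^+ j <= (1 - r)^-1 by apply: geo_sum_le; rewrite ltW.
have s3 : \sum_(j < J) T j * j.+3%:R * r ^+ j <= 3 * ((1 - r) ^+ 4)^-1.
  rewrite ler_pdivlMr ?exprn_gt0 // mulrC; have := @sum_binomial_le R r 3 J r01.
  rewrite -(@ler_pM2l _ 3) // mulr1; congr (_ <= _); rewrite mulrCA; congr (_ * _).
  rewrite mulr_sumr; apply: eq_bigr => j _; rewrite mulrA; congr (_ * _).
  have b1 := mul_bin_diag (j + 3) 2; have b2 := mul_bin_diag (j + 2) 1.
  rewrite !addnS addn0 /= in b1 b2; rewrite bin1 in b2.
  have b3 : (3 * 'C(j + 3, 3) * 2 = j.+3 * (j.+2 * j.+1))%N by rewrite !addnS addn0 -b1 b2; lia.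
  have b4 : 3 * 'C(j + 3, 3)%:R * 2 = j.+3%:R * (j.+2%:R * j.+1%:R) :> R by rewrite -!natrM b3.
  by move: b4; rewrite /T; move: ('C(_, _)%:R : R) => c b4; apply: (mulIf (_ : 2 != 0 :> R)); rewrite ?b4 //; field.
apply: (@le_trans _ _ (dl * n.+1%:R * ((1 - r) ^+ 2)^-1 + 2 * dl / n.+3%:R * (3 * ((1 - r) ^+ 4)^-1) + M * (1 - r)^-1)); last first.
  rewrite ler_pdivlMr ?exprn_gt0 //.
  have -> : (dl * n.+1%:R * ((1 - r) ^+ 2)^-1 + 2 * dl / n.+3%:R * (3 * ((1 - r) ^+ 4)^-1) + M * (1 - r)^-1) * (1 - r) ^+ 3 =
    dl * (n.+1%:R * (1 - r)) + 6 * dl * (n.+3%:R^-1 * (1 - r)^-1) + M * (1 - r) * (1 - r).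
    by move: (1 - r) (n.+3%:R^-1 : R) d0 => w v w0; field; rewrite gt_eqF.
  rewrite {4}d1 d1 mulfV ?pnatr_eq0 // invrK mulr1.
  have q1 : n.+3%:R^-1 * n.+1%:R <= 1 :> R by rewrite mulrC ler_pdivrMr ?ltr0n // mul1r ler_nat; lia.
  have q2 : M / n.+1%:R / n.+1%:R <= M / n.+1%:R.
    by rewrite ler_piMr ?invf_le1 ?ltr0n ?ler1n // !mulr_ge0 ?invr_ge0 // ltW.
  apply: lerD q2; have := ler_wpM2l dl0 q1; rewrite mulr1.
  by move: (dl) (n.+3%:R^-1 * n.+1%:R) => x y; lra.
apply: le_trans (cabs_sum _ _ _) _.
apply: (@le_trans _ _ (\sum_(j < J) ((dl * n.+1%:R * j.+1%:R + 2 * dl / n.+3%:R * (T j * j.+3%:R) + M) * r ^+ j))).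
  apply: ler_sum => j _; rewrite cabsM cabsX zr ler_wpM2r ?exprn_ge0 ?(ltW r0) //.
  apply: le_trans (cmean_weighted j nN); rewrite -[T j](gtr0_norm (T0 j)) -cabs_real -cabsM mulrBr -tE /a TE.
  have -> : conv p (fun _ => 1) j = q j by apply: eq_bigr => k _; rewrite mulr1.
  by rewrite [t n * _]mulrC.
have M0 : 0 <= M by rewrite mulr_ge0 ?mulr_ge0 // ltW.
have c1 : 0 <= dl * n.+1%:R by rewrite mulr_ge0.
have c2 : 0 <= 2 * dl / n.+3%:R by rewrite !mulr_ge0 ?invr_ge0.
rewrite (eq_bigr (fun j : 'I_J => dl * n.+1%:R * (j.+1%:R * r ^+ j) + 2 * dl / n.+3%:R * (T j * j.+3%:R * r ^+ j) + M * r ^+ j)) => [|j _]; last first.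
  by rewrite !mulrDl -!mulrA.
rewrite !big_split /= -!mulr_sumr.
by apply: lerD; [apply: lerD|]; rewrite ler_wpM2l.
Qed.

Lemma abel_coef n : unit_radius p -> (0 < n)%N -> (N1 <= n)%N ->
  `|cabs (p n.+1) / n.+2%:R - (1 - rho R n) ^+ 2 * cabs (psum p (rho R n)%:C%C)| <= 8 * dl + M / n.+1%:R.
Proof.
move=> hp n0 nN; have h := abel_cmean hp n0 nN; have c := coef_cmean nN.
have r1 : rho R n < 1 by case/andP: (rho01 R n).
have -> : (1 - rho R n) ^+ 2 * cabs (psum p (rho R n)%:C%C) = cabs ((1 - (rho R n)%:C%C) ^+ 2 * psum p (rho R n)%:C%C).
  by rewrite cabsM cabsX -(rmorph1 (real_complex R)) -rmorphB cabs_real gtr0_norm // subr_gt0.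
have N0 : 0 < n.+2%:R :> R by rewrite ltr0n.
have c' : cabs (p n.+1 / n.+2%:R - t n) <= dl.
  have -> : p n.+1 / n.+2%:R - t n = (p n.+1 - n.+2%:R * t n) / n.+2%:R.
    by rewrite mulrBl [_ * t n]mulrC mulfK // pnatr_eq0.
  rewrite cabsM cabsV cabs_nat ler_pdivrMr //; apply: le_trans c _; by rewrite ler_wpM2l // ler_nat.
have -> : cabs (p n.+1) / n.+2%:R = cabs (p n.+1 / n.+2%:R) by rewrite cabsM cabsV cabs_nat.
apply: le_trans (cabs_distB _ _) _; apply: le_trans (cabs_distD (t n) _ _) _.
rewrite [X in _ + X]cabsB; move: c' h; move: (cabs _) (cabs _) (M / _) => x y m; lra.
Qed.

End SlowVariation.

Lemma psum_continuous (R : realType) (a : nat -> R[i]) (r : R) (v : nat -> R[i]) (l : R[i]) : unit_radius a ->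
  0 <= r < 1 -> (forall n, cabs (v n) <= r) -> cabs l <= r -> v @ \oo --> l ->
  (fun n => psum a (v n)) @ \oo --> psum a l.
Proof.
move=> ha r01 hv hl vl; have [L L0 hL] := tay_lip (tay_psum ha r01).
apply: (@ccvg_bound _ _ _ (fun n => L * cabs (v n - l))) => [n|]; first by apply: hL; split => //; exact: hv.
have hc : (fun _ : nat => l) @ \oo --> l by exact: cvg_cst.
by have := rcvgMl L (ccvg_cabs (ccvgB vl hc)); rewrite subrr cabs0 mulr0.
Qed.

Lemma circle_subsequence (R : realType) (Q : nat -> R[i] -> Prop) :
  (forall N, exists n s, [/\ (N <= n)%N, cabs s = 1 & Q n s]) ->
  exists s0 (nn : nat -> nat) (ss : nat -> R[i]),
    [/\ cabs s0 = 1, (forall j, [/\ (j <= nn j)%N, cabs (ss j) = 1 & Q (nn j) (ss j)]) & ss @ \oo --> s0].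
Proof.
move=> /circle_cluster[s0 [s01 h]].
have h' j : exists p : nat * R[i], [/\ (j <= p.1)%N, cabs p.2 = 1, Q p.1 p.2 & cabs (p.2 - s0) < j.+1%:R^-1].
  have e0 : 0 < (j.+1%:R^-1 : R) by rewrite invr_gt0 ltr0n.
  by have [n [s [h1 h2 h3 h4]]] := h _ e0 j; exists (n, s).
have [g hg] := choice h'; exists s0, (fun j => (g j).1), (fun j => (g j).2); split=> //.
  by move=> j; have [] := hg j.
apply: (@ccvg_bound _ _ _ (fun n => 1 - rho R n)) => [n|].
  have -> : 1 - rho R n = n.+1%:R^-1 by rewrite /rho opprB addrC subrK.
  by have [_ _ _ /ltW] := hg n.
have h1 : (fun _ : nat => (1 : R)) @ \oo --> (1 : R) by exact: cvg_cst.
by have := rcvgB h1 (@cvg_rho R); rewrite subrr.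
Qed.

Lemma rcvg_comp (R : realType) (v : nat -> R) (l : R) (nn : nat -> nat) : (forall j, (j <= nn j)%N) ->
  v @ \oo --> l -> (fun j => v (nn j)) @ \oo --> l.
Proof.
move=> hn /rcvgP h; apply/rcvgP => e e0; have [N hN] := h e e0; exists N => n Nn.
by apply: hN; exact: leq_trans Nn (hn n).
Qed.

(** * Schlicht functions, growth along rays and the Hayman index *)

Section Schlicht.
Variable R : realType.

Definition tl (a : nat -> R[i]) n : R[i] := a n.+1.
Definition recip (a : nat -> R[i]) : nat -> R[i] := inv_coef (tl a).
(** Equal to (1 - r)^2 |f (r s)| / r for r > 0. The division by r is what makes it nonincreasing
    with value 1 at the origin. *)
Definition tau (a : nat -> R[i]) (s : R[i]) (r : R) : R := (1 - r) ^+ 2 * cabs (psum (tl a) (r%:C%C * s)).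

Variables (f : R[i] -> R[i]) (a : nat -> R[i]).
Hypothesis hf : schlicht_coeffs f a.

(** From some index on, consecutive partial sums at r are within 1 of the limit, so the terms are at
    most 2; the finitely many others are added up. *)
Lemma schlicht_unit_radius : unit_radius a.
Proof.
have [_ _ hs _] := hf; move=> r /andP[r0 r1].
have rc : cabs (r%:C%C : R[i]) < 1 by rewrite cabs_real ger0_norm.
have [N hN] := hs _ rc 1 ltr01.
exists (2 + \sum_(k < N) cabs (a k) * r ^+ k) => n.
have s0 : 0 <= \sum_(k < N) cabs (a k) * r ^+ k by apply: sumr_ge0 => k _; rewrite mulr_ge0 ?exprn_ge0.
have [nN|Nn] := ltnP n N.
  rewrite (bigD1 (Ordinal nN)) //= addrCA lerDl addr_ge0 //.
  by apply: sumr_ge0 => k _; rewrite mulr_ge0 ?exprn_ge0.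
have := hN n.+1 (leqW Nn); have := hN n Nn; rewrite big_ord_recr /= => h1 h2.
have : cabs (a n * r%:C%C ^+ n) <= 2.
  apply: le_trans (_ : cabs (f r%:C%C - \sum_(k < n) a k * r%:C%C ^+ k) + cabs (\sum_(k < n) a k * r%:C%C ^+ k + a n * r%:C%C ^+ n - f r%:C%C) <= _).
    apply: le_trans (cabsD _ _); rewrite le_eqVlt; apply/orP; left; apply/eqP; congr cabs.
    by move: (f _) (\sum_(k < n) _) (a n * _) => x y z; ring.
  by rewrite cabsB; move: (cabs _) (cabs _) h1 h2 => x y; lra.
by rewrite cabsM cabsX cabs_real ger0_norm // => h; apply: le_trans h _; rewrite lerDl.
Qed.

Lemma schlicht_psum z : cabs z < 1 -> f z = psum a z.
Proof.
move=> z1; have [_ _ hs _] := hf; symmetry; apply: (psum_eq schlicht_unit_radius z1).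
exact: (series_toP _ _).1 (hs z z1).
Qed.

Lemma unit_radius_tl : unit_radius (tl a).
Proof. exact: unit_radius_shift schlicht_unit_radius. Qed.

Lemma tl0 : tl a 0%N = 1. Proof. by have [_ h _ _] := hf. Qed.

Lemma schlicht_tl z : cabs z < 1 -> f z = z * psum (tl a) z.
Proof.
move=> z1; have [a0 _ _ _] := hf.
by rewrite schlicht_psum // psum_shift ?a0 ?add0r //; exact: schlicht_unit_radius.
Qed.

(** A zero away from the origin would be a second zero of [f], against injectivity. *)
Lemma tl_neq0 z : cabs z < 1 -> psum (tl a) z != 0.
Proof.
move=> z1; have [->|zn] := eqVneq z 0; first by rewrite psum0 ?tl0 ?oner_neq0 //; exact: unit_radius_tl.
apply/eqP => h; have [_ _ _ inj] := hf; have c0 : cabs (0 : R[i]) < 1 by rewrite cabs0.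
case/eqP: zn; apply: inj => //; rewrite (schlicht_tl z1) (schlicht_tl c0) h.
by rewrite [LHS]mulr0 [RHS]mul0r.
Qed.

Lemma unit_radius_recip : unit_radius (recip a).
Proof. exact: unit_radius_inv unit_radius_tl tl0 tl_neq0. Qed.

Lemma recip0 : recip a 0%N = 1. Proof. by rewrite /recip inv_coefE. Qed.

Lemma conv_recip n : conv (tl a) (recip a) n = unitseq n.
Proof. by rewrite conv_inv ?tl0 //; case: n. Qed.

Lemma psum_recip z : cabs z < 1 -> psum (recip a) z = (psum (tl a) z)^-1.
Proof.
move=> z1; apply: (mulfI (tl_neq0 z1)); rewrite mulfV ?tl_neq0 //.
exact: psum_inv unit_radius_tl tl0 tl_neq0 z1.
Qed.

Lemma laurent_recip z : cabs z < 1 -> laurent (recip a) z = (f z)^-1.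
Proof. by move=> z1; rewrite /laurent psum_recip // schlicht_tl // invfM mulrC. Qed.

Lemma recip_inj z w : 0 < cabs z < 1 -> 0 < cabs w < 1 -> laurent (recip a) z = laurent (recip a) w -> z = w.
Proof.
move=> /andP[_ z1] /andP[_ w1]; rewrite !laurent_recip // => /invr_inj h.
by have [_ _ _ inj] := hf; exact: inj.
Qed.

Section Ray.
Variable s : R[i].
Hypothesis s1 : cabs s = 1.

Let ray r : 0 < r < 1 -> cabs (r%:C%C * s) < 1.
Proof. by move=> /andP[r0 r1]; rewrite cabsM s1 mulr1 cabs_real gtr0_norm. Qed.

Lemma phi_tau r : 0 < r < 1 -> phi (recip a) s r = (tau a s r ^+ 2)^-1.
Proof.
move=> r01; have p : 0 < 1 - r by case/andP: r01 => _; lra.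
have : psum (tl a) (r%:C%C * s) != 0 by apply/tl_neq0/ray.
rewrite -cabs_gt0 /phi psum_recip ?ray // cabsV /tau; move: (cabs _) p => x p x0.
by field; rewrite !gt_eqF.
Qed.

Lemma tau_gt0 r : 0 < r < 1 -> 0 < tau a s r.
Proof.
move=> r01; have p : 0 < 1 - r by case/andP: r01 => _; lra.
by rewrite mulr_gt0 ?exprn_gt0 // cabs_gt0; apply/tl_neq0/ray.
Qed.

Lemma tau_le1 r : 0 < r < 1 -> tau a s r <= 1.
Proof.
move=> r01; have t0 := tau_gt0 r01.
have := phi_ge1 unit_radius_recip unit_radius_tl recip0 conv_recip recip_inj s1 r01.
rewrite phi_tau // invf_ge1 ?exprn_gt0 // => h.
by rewrite -(@ler_pXn2r _ 2) ?nnegrE ?(ltW t0) // expr1n.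
Qed.

Lemma tau_nonincreasing r t : 0 < r -> r <= t -> t < 1 -> tau a s t <= tau a s r.
Proof.
move=> r0 rt t1; have r01 : 0 < r < 1 by rewrite r0 (le_lt_trans rt).
have t01 : 0 < t < 1 by rewrite t1 (lt_le_trans r0).
have := phi_nondecreasing unit_radius_recip unit_radius_tl recip0 conv_recip recip_inj s1 r0 rt t1.
rewrite (phi_tau r01) (phi_tau t01); move: (tau a s r) (tau a s t) (tau_gt0 r01) (tau_gt0 t01) => x y x0 y0.
by rewrite lef_pV2 ?posrE ?exprn_gt0 // ler_pXn2r ?nnegrE // ltW.
Qed.

Lemma tau_maxmod r : 0 < r < 1 -> r * tau a s r <= (1 - r) ^+ 2 * maxmod f r.
Proof.
move=> r01; have /andP[r0 r1] := r01; rewrite /tau mulrCA ler_wpM2l ?exprn_ge0 ?subr_ge0 ?(ltW r1) //.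
have rc : cabs (r%:C%C * s) = r by rewrite cabsM s1 mulr1 cabs_real gtr0_norm.
have -> : r * cabs (psum (tl a) (r%:C%C * s)) = cabs (f (r%:C%C * s)).
  by rewrite schlicht_tl ?ray // [in RHS]cabsM rc.
apply: ub_le_sup; last by exists (r%:C%C * s).
have rr : 0 <= r < 1 by rewrite ltW.
have [M M0 hM] := psum_bounded schlicht_unit_radius rr.
by exists M => _ [z /= zr <-]; rewrite schlicht_psum ?zr // hM ?zr.
Qed.

Lemma tau_continuous r (v : nat -> R[i]) : 0 < r < 1 -> (forall n, cabs (v n) = 1) -> v @ \oo --> s ->
  (fun n => tau a (v n) r) @ \oo --> tau a s r.
Proof.
move=> r01 hv vs; have /andP[r0 r1] := r01; have rr : 0 <= r < 1 by rewrite ltW.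
have rc z : cabs z = 1 -> cabs (r%:C%C * z) <= r by move=> h; rewrite cabsM h mulr1 cabs_real gtr0_norm.
have := psum_continuous unit_radius_tl rr (fun n => rc _ (hv n)) (rc _ s1) (ccvgMl r%:C%C vs).
by move/ccvg_cabs/(rcvgMl ((1 - r) ^+ 2)).
Qed.

End Ray.

Let rhoS n : 0 < rho R n.+1 < 1.
Proof.
have /andP[_ ->] := rho01 R n.+1; rewrite andbT /rho subr_gt0 invf_lt1 ?ltr0n // ltr1n //.
Qed.

Variable alpha : R.
Hypothesis hayman : hayman_index f alpha.

Let rhoS_cvg : (fun n => rho R n.+1) @ \oo --> (1 : R).
Proof. by rewrite (cvg_shiftS (rho R)); exact: cvg_rho. Qed.

Let hayman_seq : (fun n => (1 - rho R n.+1) ^+ 2 * maxmod f (rho R n.+1)) @ \oo --> alpha.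
Proof.
apply: ((cvg_at_leftP (fun r => (1 - r) ^+ 2 * maxmod f r) 1 alpha).1 hayman (fun n => rho R n.+1)).
by split; [move=> n; case/andP: (rhoS n)|exact: rhoS_cvg].
Qed.

Lemma hayman_upper e : 0 < e -> exists2 r, 0 < r < 1 & forall s, cabs s = 1 -> tau a s r <= alpha + e.
Proof.
move=> e0; have h1 : (1 : R) != 0 := oner_neq0 R.
have hV : (fun n => (rho R n.+1)^-1) @ \oo --> (1 : R) by rewrite -[X in _ --> X]invr1; exact: cvgV.
have := rcvgM hayman_seq hV; rewrite mulr1 => /rcvgP /(_ e e0)[N hN].
exists (rho R N.+1) => // s s1; have /andP[r0 _] := rhoS N.
have := tau_maxmod s1 (rhoS N); rewrite mulrC -ler_pdivlMr // => h; apply: le_trans h _.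
have := hN N (leqnn N); rewrite ltr_norml => /andP[_].
by move: (_ / _) => x; lra.
Qed.

(** Almost maximal directions at radii tending to 1 have a limit direction. Monotonicity carries
    their lower bounds back to any fixed radius, where [tau] is continuous in the direction. *)
Lemma hayman_direction : exists2 s, cabs s = 1 & forall r, 0 < r < 1 -> alpha <= tau a s r.
Proof.
(* The subtracted (1 - r)^2 is slack for choosing a point whose modulus is within 1 of the supremum;
   it vanishes in the limit. *)
pose H n := (1 - rho R n.+1) ^+ 2 * maxmod f (rho R n.+1) - (1 - rho R n.+1) ^+ 2.
have [|s0 [nn [ss [s01 hs cs]]]] := @circle_subsequence R (fun n s => H n <= tau a s (rho R n.+1)).
  move=> N; have r01 := rhoS N; have /andP[r0 r1] := r01; set r := rho R N.+1 in r01 r0 r1.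
  pose S := [set cabs (f z) | z in [set z : R[i] | cabs z = r]].
  have hS : has_sup S.
    split; first by exists (cabs (f r%:C%C)); exists r%:C%C => //=; rewrite cabs_real gtr0_norm.
    have rr : 0 <= r < 1 by rewrite ltW.
    have [M M0 hM] := psum_bounded schlicht_unit_radius rr.
    by exists M => _ [z /= zr <-]; rewrite schlicht_psum ?zr // hM ?zr.
  have [_ [z /= zr <-] hz] := sup_adherent ltr01 hS.
  have rn : (r%:C%C : R[i]) != 0 by rewrite -cabs_gt0 cabs_real normr_gt0 gt_eqF.
  exists N, (z / r%:C%C); split => //.
    by rewrite cabsM cabsV zr cabs_real gtr0_norm // mulfV // gt_eqF.
  rewrite /H -/r /tau mulrC [z / _]mulrC mulVKf // -[X in _ - X]mul1r -mulrBl mulrC ler_wpM2l ?sqr_ge0 //.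
  apply: le_trans (ltW hz) _; rewrite schlicht_tl ?zr // cabsM zr.
  by rewrite ler_piMl // ltW.
exists s0 => // r r01; have /andP[r0 r1] := r01.
have Hlim : (fun j => H (nn j)) @ \oo --> alpha.
  apply: (@rcvg_comp _ H alpha nn) => [j|]; first by have [] := hs j.
  have h1 : (fun _ : nat => (1 : R)) @ \oo --> (1 : R) by exact: cvg_cst.
  have d := rcvgB h1 rhoS_cvg; have := rcvgB hayman_seq (rcvgM d d); rewrite subrr mulr0 subr0 => h.
  by apply: (cvg_ext h) => n; rewrite /H expr2.
have ss1 j : cabs (ss j) = 1 by have [] := hs j.
have nnj j : (j <= nn j)%N by have [] := hs j.
have g0 : 0 < 1 - r by rewrite subr_gt0.
have [N hN] := (rcvgP _ _).1 (rcvg_comp nnj rhoS_cvg) _ g0.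
rewrite -subr_ge0; apply: (rcvg_ge (rcvgB (tau_continuous s01 r01 ss1 cs) Hlim)).
exists N => j Nj; rewrite subr_ge0; have [_ _ h] := hs j; apply: le_trans h _.
apply: tau_nonincreasing => //; last by case/andP: (rhoS (nn j)).
by have := hN j Nj; rewrite ltr_norml => /andP[h _]; lra.
Qed.

End Schlicht.

(** * Full mappings *)

Section FullMapping.
Variable R : realType.
Variables (f : R[i] -> R[i]) (a : nat -> R[i]).
Hypothesis hf : schlicht_coeffs f a.
Hypothesis full : full_mapping (fun z : R[i] => (f z^-1)^-1).

(** The omitted sets decrease as t grows to 1 and their intersection is contained in the null
    complement of the full mapping; continuity from above applies because they have finite
    measure. *)
Lemma omitted_small d : 0 < d -> exists2 t : R, 2^-1 <= t < 1 & fine (mu2 (omitted (recip a) t)) < d.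
Proof.
move=> d0; pose F n := omitted (recip a) (rho R n.+1).
have hr n : 2^-1 <= rho R n.+1 < 1.
  have /andP[_ ->] := rho01 R n.+1; rewrite andbT /rho.
  have : (n.+2%:R^-1 : R) <= 2^-1 by rewrite lef_pV2 ?posrE ?ltr0n // ler_nat.
  by move: (n.+2%:R^-1 : R) => x; lra.
(* The constant polynomial suffices here: the area theorem is called only for measurability and
   finiteness of the omitted sets. *)
have rel z : 0 < cabs z < 1 -> (1 : {poly R[i]}).[laurent (recip a) z] * z ^+ 0 = psum (@unitseq R) z.
  by move=> /andP[_ z1]; rewrite hornerC mulr1 psum_unitseq.
have [M0 _ area] := area_theorem (unit_radius_recip hf) (recip0 a) (recip_inj hf) (@unit_radius_unitseq R) rel.
have mF n : measurable (F n) by have [] := area _ (hr n).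
have fF n : (mu2 (F n) < +oo)%E by have [] := area _ (hr n).
have [_ _ [A [mA A0 sA]]] := full.
have F0 : mu2 (\bigcap_n F n) = 0%E.
  apply: (@subset_measure0 _ _ _ mu2 _ A) => //; first exact: bigcapT_measurable.
  move=> p Fp; apply: sA => -[z [z1 e]]; have zV : cabs z^-1 < 1 by rewrite cabsV invf_lt1 // (lt_trans ltr01).
  have zV0 : 0 < cabs z^-1 by rewrite cabsV invr_gt0 (lt_trans ltr01).
  have g0 : 0 < 1 - cabs z^-1 by rewrite subr_gt0.
  have [N hN] := (rcvgP _ _).1 (@cvg_rho R) _ g0.
  apply: (Fp N I); exists z^-1; last by rewrite (laurent_recip hf) // e.
  rewrite zV0 /=; have := hN N.+1 (leqnSn N); rewrite ltr_norml => /andP[h _].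
  by move: (cabs z^-1) h => x; lra.
have mono : nonincreasing_seq F.
  move=> m n mn; rewrite subsetEset => p np [z /andP[z0 zt] e]; apply: np; exists z => //.
  rewrite z0 /=; apply: lt_le_trans zt _; rewrite /rho lerD2l lerN2 lef_pV2 ?posrE ?ltr0n // ler_nat; lia.
have := nonincreasing_cvg_mu (fF 0%N) mF (bigcapT_measurable mF) mono; rewrite F0.
move/fine_cvgP => [_ /rcvgP /(_ d d0)[N hN]]; exists (rho R N.+1) => //.
by have := hN N (leqnn N); rewrite subr0 ltr_norml => /andP[_].
Qed.

End FullMapping.

(** * Faber polynomials at zero as logarithmic coefficients *)

Section FaberAtZero.
Variable R : realType.
Variables u Y : nat -> R[i].
Hypothesis Y0 : Y 0%N = 1.
Hypothesis uY : forall n, conv u Y n = unitseq n.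

Let F n : R[i] := (faber Y n).[0].

(** The generating function of the F_n(0) is 1 - z Y' / Y, and u = 1 / Y changes the sign of the
    logarithmic derivative. So F_k(0) / k are the coefficients of log u = log (f z / z). *)
Lemma faber_at0_recursion n : n.+1%:R * u n.+1 = conv (fun k => F k.+1) u n.
Proof.
have F0 : F 0 = 1 by rewrite /F faber0 hornerC.
have h1 : conv Y F =1 fun k => Y k - euler Y k.
  case=> [|m]; first by rewrite /conv big_ord_recl big_ord0 F0 Y0 /euler mul0r mulr1 addr0 subr0.
  rewrite /conv big_ord_recl Y0 mul1r subn0 {1}/F faberE /faber_step.
  rewrite !hornerE horner_sum (eq_bigr (fun i : 'I_m.+1 => Y i.+1 * F (m - i)%N)) => [|i _]; last by rewrite hornerZ.
  rewrite [X in _ + X](eq_bigr (fun i : 'I_m.+1 => Y i.+1 * F (m - i)%N)) => [|i _]; last by rewrite /= subSS.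
  by rewrite /euler -natr1; move: (\sum_(i < m.+1) _) => x; ring.
have h2 : F =1 fun n => unitseq n + conv (euler u) Y n.
  move=> k; rewrite -(conv1 F k) -(@eq_conv _ _ _ F _ _ uY (fun=> erefl)) -convA (@eq_conv _ u _ _ _ _ (fun=> erefl) h1) convBr uY.
  congr (_ + _); have := conv_euler u Y k; rewrite uY.
  have -> : k%:R * unitseq k = 0 :> R[i] by rewrite /unitseq; case: k => [|k]; rewrite ?mul0r ?mulr0.
  by move/eqP; rewrite eq_sym addr_eq0 => /eqP ->.
have h3 : conv F u n.+1 = u n.+1 + euler u n.+1.
  rewrite (@eq_conv _ _ _ u _ _ h2 (fun=> erefl)) convDl conv1 -convA; congr (_ + _).
  rewrite (@eq_conv _ (euler u) _ _ (@unitseq R) _ (fun=> erefl)) => [|k]; last by rewrite convC uY.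
  by rewrite convC conv1.
move: h3; rewrite /conv big_ord_recl F0 mul1r subn0 => /addrI; rewrite /euler => <-.
by apply: eq_bigr => k _; rewrite /= subSS.
Qed.

(** Replacing z by s z turns conj(s)^k into 1: the Koebe factor has its pole at 1 and [ck] becomes
    the perturbation. *)
Lemma twisted_coef (s : R[i]) : u 0%N = 1 -> cabs s = 1 ->
  (fun n => u n * s ^+ n) =1 kexp (fun k => ck Y s k * s ^+ k.+1).
Proof.
move=> u0 s1; apply: (@exp_rec_unique _ (fun k => F k.+1 * s ^+ k.+1)) => [|n|n].
- by rewrite u0 expr0 mulr1 /kexp exp_seq0.
- rewrite mulrA faber_at0_recursion /conv mulr_suml; apply: eq_bigr => k _ /=.
  have -> : s ^+ n.+1 = s ^+ k.+1 * s ^+ (n - k) by rewrite -exprD; congr (_ ^+ _); have := ltn_ord k; lia.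
  by move: (s ^+ _) (s ^+ _) (F _) (u _) => x y z t; ring.
- rewrite exp_seqS; apply: eq_conv => // k; rewrite /ck -/(F k.+1).
  have e1 : s^*%C ^+ k.+1 * s ^+ k.+1 = 1 by rewrite -exprMn mulrC mulcJ s1 expr1n rmorph1 expr1n.
  have k0 : k.+1%:R != 0 :> R[i] by rewrite pnatr_eq0.
  rewrite mulrA [k.+1%:R * _]mulrC divfK // mulrBl -mulrA e1 mulr1 subrK //.
Qed.

End FaberAtZero.

Lemma psum_twist (R : realType) (u : nat -> R[i]) s z : unit_radius u -> cabs s = 1 -> cabs z < 1 ->
  psum (fun n => u n * s ^+ n) z = psum u (z * s).
Proof.
move=> hu s1 z1; have zs : cabs (z * s) < 1 by rewrite cabsM s1 mulr1.
apply: (psum_eq _ z1).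
  by apply: (unit_radius_le hu) => n; rewrite cabsM cabsX s1 expr1n mulr1.
apply: (cvg_ext (psum_cvg hu zs)) => n; apply: eq_bigr => k _.
by rewrite exprMn -mulrA [s ^+ k * _]mulrC.
Qed.

(** The order of quantifiers is the point: [th] depends on L and e only, and [N] also on K, never on
    the sequence [d]. One choice thus serves all functions of the given family. *)
Lemma abel_coef_uniform (R : realType) (L e : R) : 0 < e -> exists2 th, 0 < th & forall K, exists N,
  forall d : nat -> R[i], unit_radius d -> (forall M, \sum_(k < M) k.+1%:R * cabs (d k) ^+ 2 <= L) ->
  (forall r, 0 < r < 1 -> re (psum d r%:C%C) <= 0) ->
  (forall M, \sum_(k < M) (K + k).+1%:R * cabs (d (K + k)%N) ^+ 2 <= th ^+ 2) ->
  forall n, (N <= n)%N ->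
  `|cabs (kexp d n.+1) / n.+2%:R - (1 - rho R n) ^+ 2 * cabs (psum (kexp d) (rho R n)%:C%C)| <= e.
Proof.
move=> e0; pose C : R := expR (L / 2 + 2); have C0 : 0 < C by exact: expR_gt0.
(* With dl = 2 C th this gives 8 dl = e / 2; the other half of [e] is left for the term M / (n +
   1). *)
pose th := e / (32 * C); have th0 : 0 < th by rewrite divr_gt0 // mulr_gt0.
exists th => // K; pose B := th * K%:R + K%:R ^+ 2 * (L + 1); pose dl := 2 * (C * th).
have [N1 hN1] := div_nat_small B th0.
pose M := 2 * C * (N1.+1%:R * N1.+2%:R / 2).
have e2 : 0 < e / 2 by rewrite divr_gt0.
have [N2 hN2] := div_nat_small M e2.
exists (N1 + N2).+1 => d hd hL hneg tail n nN.
have hC := kexp_growth hd hL hneg.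
have hq k : (N1 <= k)%N -> cabs (k.+1%:R * kexp d k.+1 - 2 * \sum_(j < k.+1) kexp d j) <= dl * k.+1%:R ^+ 2.
  move=> kN; apply: le_trans (kexp_defect hL th0 tail hC k) _; rewrite -/C -/B.
  have k0 : 0 < k.+1%:R :> R by rewrite ltr0n.
  have := hN1 k kN; rewrite ltr_pdivrMr // => hB.
  have c1 : 0 <= C * k.+1%:R by rewrite mulr_ge0 ?(ltW C0).
  have := ler_wpM2l c1 (ltW hB); rewrite /dl.
  by move: (k.+1%:R : R) (B) (C) (th) => x b c t; lra.
have n0 : (0 < n)%N by lia.
have nN1 : (N1 <= n)%N by lia.
apply: le_trans (abel_coef hC hq (unit_radius_kexp hd) n0 nN1) _; rewrite -/M.
have := hN2 n (_ : (N2 <= n)%N); rewrite (_ : (N2 <= n)%N); last by lia.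
move=> /(_ isT) h; have : 8 * dl = e / 2 by rewrite /dl /th; field; rewrite gt_eqF.
by move: (8 * dl) (M / _) h => x y h ->; lra.
Qed.

(** * Coefficients along a direction of maximal growth *)

Section RayCoefficients.
Variable R : realType.
Variables (f : R[i] -> R[i]) (a : nat -> R[i]).
Hypothesis hf : schlicht_coeffs f a.
Variables (s : R[i]) (alpha : R).
Hypothesis s1 : cabs s = 1.
Hypothesis alpha0 : 0 < alpha.
Hypothesis dir : forall r, 0 < r < 1 -> alpha <= tau a s r.

Let d k : R[i] := ck (recip a) s k * s ^+ k.+1.

Lemma phi_direction r : 0 < r < 1 -> phi (recip a) s r <= (alpha ^+ 2)^-1.
Proof.
move=> r01; rewrite (phi_tau hf s1 r01); have t0 := tau_gt0 hf s1 r01.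
rewrite lef_pV2 ?posrE ?exprn_gt0 // ler_pXn2r ?nnegrE ?(ltW t0) ?(ltW alpha0) //; exact: dir.
Qed.

Lemma ck_energy K : \sum_(k < K) k.+1%:R * cabs (ck (recip a) s k) ^+ 2 <= - 2 * ln alpha.
Proof.
have -> : - 2 * ln alpha = ln ((alpha ^+ 2)^-1).
  by rewrite lnV ?posrE ?exprn_gt0 // lnXn // mulNr mulr_natl.
exact: (energy_limit (unit_radius_recip hf) (unit_radius_tl hf) (recip0 a) (conv_recip hf) (recip_inj hf) s1 phi_direction).
Qed.

Let cabs_d k : cabs (d k) = cabs (ck (recip a) s k).
Proof. by rewrite cabsM cabsX s1 expr1n mulr1. Qed.

Lemma twisted_energy K : \sum_(k < K) k.+1%:R * cabs (d k) ^+ 2 <= - 2 * ln alpha.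
Proof. by rewrite (eq_bigr _ (fun (k : 'I_K) _ => congr1 (fun x => _ * x ^+ 2) (cabs_d k))); exact: ck_energy. Qed.

Lemma unit_radius_twisted : unit_radius d.
Proof. exact: unit_radius_energy twisted_energy. Qed.

Lemma psum_twisted r : 0 < r < 1 -> psum (kexp d) r%:C%C = psum (tl a) (r%:C%C * s).
Proof.
move=> /andP[r0 r1]; have rc : cabs (r%:C%C : R[i]) < 1 by rewrite cabs_real gtr0_norm.
rewrite -(psum_twist (unit_radius_tl hf) s1 rc).
by rewrite (eq_psum _ (twisted_coef (recip0 a) (conv_recip hf) (tl0 hf) s1)).
Qed.

(** Along the ray [tau] equals exp (r Re d(r)) and is at most 1. *)
Lemma twisted_neg r : 0 < r < 1 -> re (psum d r%:C%C) <= 0.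
Proof.
move=> r01; have := psum_kexp unit_radius_twisted r01; rewrite psum_twisted // mulrC -/(tau a s r) => h.
have := tau_le1 hf s1 r01; rewrite h -expR0 ler_expR pmulr_rle0 //; by case/andP: r01.
Qed.

Lemma cabs_twisted n : cabs (kexp d n) = cabs (a n.+1).
Proof.
by rewrite -(twisted_coef (recip0 a) (conv_recip hf) (tl0 hf) s1) cabsM cabsX s1 expr1n mulr1.
Qed.

Lemma twisted_tail K th : - 2 * ln alpha - th <= \sum_(k < K) k.+1%:R * cabs (ck (recip a) s k) ^+ 2 ->
  forall M, \sum_(k < M) (K + k).+1%:R * cabs (d (K + k)%N) ^+ 2 <= th.
Proof.
move=> h M; have := ck_energy (K + M); rewrite big_split_ord /=.
rewrite (eq_bigr _ (fun (k : 'I_M) _ => congr1 (fun x => _ * x ^+ 2) (cabs_d (K + k)%N))).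
by move: h; move: (\sum_(k < K) _) (\sum_(k < M) _) (- 2 * ln alpha) => x y z; lra.
Qed.

End RayCoefficients.

(** * Continuity of the coefficients under limits *)

Section CoefficientLimits.
Variable R : realType.

Lemma ccvg_sum n (v : nat -> nat -> R[i]) (l : nat -> R[i]) : (forall i, (i < n)%N -> v i @ \oo --> l i) ->
  (fun j => \sum_(i < n) v i j) @ \oo --> \sum_(i < n) l i.
Proof.
elim: n => [|n ih] h.
  by rewrite big_ord0; apply: (@cvg_ext _ (fun _ => 0)) => [|j]; [exact: cvg_cst|rewrite big_ord0].
rewrite big_ord_recr /=; have h1 := ih (fun i ni => h i (leqW ni)).
by apply: (cvg_ext (ccvgD h1 (h n (leqnn _)))) => j; rewrite big_ord_recr.
Qed.

Lemma ccvgN (v : nat -> R[i]) (l : R[i]) : v @ \oo --> l -> (fun n => - v n) @ \oo --> - l.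
Proof. by move=> h; have := ccvgMl (-1) h; rewrite mulN1r => h'; apply: (cvg_ext h') => n; rewrite mulN1r. Qed.

Variables (uj : nat -> nat -> R[i]) (u : nat -> R[i]).
Hypothesis hu : forall n, (fun j => uj j n) @ \oo --> u n.

Lemma inv_coef_cvg n : (fun j => inv_coef (uj j) n) @ \oo --> inv_coef u n.
Proof.
elim/ltn_ind: n => -[|m] ih.
  have h1 : (fun _ : nat => 1 : R[i]) @ \oo --> (1 : R[i]) by exact: cvg_cst.
  have -> : inv_coef u 0 = 1 by rewrite inv_coefE.
  by apply: (cvg_ext h1) => j; rewrite inv_coefE.
have -> : inv_coef u m.+1 = - \sum_(k < m.+1) u k.+1 * inv_coef u (m - k)%N by rewrite inv_coefE.
have h : (fun j => \sum_(k < m.+1) uj j k.+1 * inv_coef (uj j) (m - k)%N) @ \oo --> \sum_(k < m.+1) u k.+1 * inv_coef u (m - k)%N; last first.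
  by apply: (cvg_ext (ccvgN h)) => j; rewrite [RHS]inv_coefE.
apply: (@ccvg_sum _ (fun k j => uj j k.+1 * inv_coef (uj j) (m - k)%N) (fun k => u k.+1 * inv_coef u (m - k)%N)).
by move=> k km; apply: ccvgM (@hu _) (ih _ _); rewrite ltnS leq_subr.
Qed.

Lemma faber_at0_cvg n : (fun j => (faber (uj j) n).[0]) @ \oo --> (faber u n).[0].
Proof.
have E (Y : nat -> R[i]) m : (faber Y m.+1).[0] = - (\sum_(i < m.+1) Y i.+1 * (faber Y (m - i)).[0]) - m%:R * Y m.+1.
  rewrite faberE /faber_step !hornerE horner_sum; congr (- _ - _).
  by apply: eq_bigr => i _; rewrite hornerZ.
elim/ltn_ind: n => -[|m] ih.
  have h1 : (fun _ : nat => 1 : R[i]) @ \oo --> (1 : R[i]) by exact: cvg_cst.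
  have -> : (faber u 0).[0] = 1 by rewrite faber0 hornerC.
  exact: h1.
have h : (fun j => \sum_(i < m.+1) uj j i.+1 * (faber (uj j) (m - i)).[0]) @ \oo --> \sum_(i < m.+1) u i.+1 * (faber u (m - i)).[0]; last first.
  by rewrite E; apply: (cvg_ext (ccvgB (ccvgN h) (ccvgMl m%:R (@hu m.+1)))) => j; rewrite E.
apply: (@ccvg_sum _ (fun i j => uj j i.+1 * (faber (uj j) (m - i)).[0]) (fun i => u i.+1 * (faber u (m - i)).[0])).
by move=> k km; apply: ccvgM (@hu _) (ih _ _); rewrite ltnS leq_subr.
Qed.

End CoefficientLimits.

Lemma ck_cvg (R : realType) (uj : nat -> nat -> R[i]) (u : nat -> R[i]) (sj : nat -> R[i]) s k :
  (forall n, (fun j => uj j n) @ \oo --> u n) -> sj @ \oo --> s ->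
  (fun j => ck (inv_coef (uj j)) (sj j) k) @ \oo --> ck (inv_coef u) s k.
Proof.
move=> hu hs; have h1 := @faber_at0_cvg _ _ _ (inv_coef_cvg hu) k.+1.
have h2 := ccvgMl k.+1%:R^-1 (ccvgB h1 (ccvgMl 2 (@ccvgX _ _ _ k.+1 (ccvg_conj hs)))).
by rewrite /ck mulrC; apply: (cvg_ext h2) => j; rewrite mulrC.
Qed.

Lemma dist_half (R : realFieldType) (x y z e : R) : `|x - y| < e / 2 -> `|y - z| < e / 2 -> `|x - z| < e.
Proof. by move=> h1 h2; rewrite [e]splitr -(subrKA y); apply: le_lt_trans (ler_normD _ _) (ltrD h1 h2). Qed.

Lemma half_le_of_close (R : realFieldType) (x a : R) : `|x - a| < a / 2 -> a / 2 <= x.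
Proof. by rewrite ltr_norml => /andP[h _]; lra. Qed.

Lemma close_of_sandwich (R : realFieldType) (e al v w p q t : R) : 0 < e -> v <= p -> p <= q ->
  t <= al + e / 8 -> `|v - al| < e / 16 -> `|q - t| < e / 16 -> `|w - p| <= e / 4 -> `|w - v| < e.
Proof.
rewrite !ltr_norml ler_norml => e0 vp pq ht /andP[x1 x2] /andP[y1 y2] /andP[z1 z2].
by apply/andP; split; lra.
Qed.

(** The four losses behind a total of eta: truncation at K, choice of the radius r0, convergence of
    the partial energies, each eta / 4, and convergence of ln alpha_m, which enters twice with eta /
    8. *)
Lemma energy_budget (R : realFieldType) (p q t v w eta : R) : t - eta / 4 <= q -> - 2 * v - eta / 4 <= t ->
  `|w - v| < eta / 8 -> `|p - q| < eta / 4 -> - 2 * w - eta <= p.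
Proof. by rewrite !ltr_norml => h1 h2 /andP[x1 x2] /andP[y1 y2]; lra. Qed.

(** * Consequences of locally uniform convergence *)

Section LocallyUniformLimit.
Variable R : realType.
Variables (fm : nat -> R[i] -> R[i]) (am : nat -> nat -> R[i]) (f : R[i] -> R[i]) (a : nat -> R[i]).
Hypothesis hm : forall m, schlicht_coeffs (fm m) (am m).
Hypothesis hf : schlicht_coeffs f a.
Hypothesis cv : loc_unif_cvg fm f.

(** Cauchy's estimate on |z| = 1/2: the tolerance e 2^(-k-1) on the circle leaves e / 2 for the
    coefficient. *)
Lemma coef_cvg (mm : nat -> nat) k : (forall j, (j <= mm j)%N) -> (fun j => am (mm j) k) @ \oo --> a k.
Proof.
move=> hmm; apply/ccvgP => e e0; have h2 : 0 < (2^-1 : R) < 1 by lra.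
have d0 : 0 < e * (2^-1) ^+ k.+1 by rewrite mulr_gt0 // exprn_gt0 // invr_gt0.
have [N hN] := cv h2 d0; exists N => j Nj.
have ha := schlicht_unit_radius (hm (mm j)); have hb := schlicht_unit_radius hf.
have bnd z : cabs z = 2^-1 -> cabs (psum (fun n => am (mm j) n - a n) z) <= e * (2^-1) ^+ k.+1.
  move=> zr; have z1 : cabs z < 1 by rewrite zr; lra.
  rewrite psumB // -(schlicht_psum (hm _) z1) -(schlicht_psum hf z1).
  by apply/ltW/hN; rewrite ?zr //; exact: leq_trans Nj (hmm j).
have p0 : 0 < (2^-1 : R) ^+ k by rewrite exprn_gt0 // invr_gt0.
have := coef_bound k (unit_radiusB ha hb) h2 bnd; rewrite exprS mulrA ler_pM2r // => h.
apply: le_lt_trans h _; lra.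
Qed.

Lemma tau_cvg (mm : nat -> nat) (ss : nat -> R[i]) s r : (forall j, (j <= mm j)%N) ->
  (forall j, cabs (ss j) = 1) -> cabs s = 1 -> ss @ \oo --> s -> 0 < r < 1 ->
  (fun j => tau (am (mm j)) (ss j) r) @ \oo --> tau a s r.
Proof.
move=> hmm ss1 s1 cs r01; have /andP[r0 r1] := r01.
apply/rcvgP => e e0; have e2 : 0 < e / 2 by rewrite divr_gt0.
have d0 : 0 < r * (e / 2) by rewrite mulr_gt0.
have [N1 h1] := cv r01 d0; have [N2 h2] := (rcvgP _ _).1 (tau_continuous hf s1 r01 ss1 cs) _ e2.
exists (N1 + N2)%N => j jN.
have hj2 := h2 j (leq_trans (leq_addl _ _) jN).
have zr : cabs (r%:C%C * ss j) = r by rewrite cabsM ss1 mulr1 cabs_real gtr0_norm.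
have z1 : cabs (r%:C%C * ss j) < 1 by rewrite zr.
have := h1 (mm j) (leq_trans (leq_trans (leq_addr _ _) jN) (hmm j)) (r%:C%C * ss j).
rewrite zr => /(_ (lexx _)); rewrite (schlicht_tl (hm _) z1) (schlicht_tl hf z1) -mulrBr cabsM zr ltr_pM2l // => hj1.
have t1 : `|tau (am (mm j)) (ss j) r - tau a (ss j) r| < e / 2.
  rewrite /tau -mulrBr normrM; apply: le_lt_trans hj1.
  have w : `|(1 - r) ^+ 2| <= 1 by rewrite ger0_norm ?sqr_ge0 // exprn_ile1 //; lra.
  by rewrite -[X in _ <= X]mul1r; apply: ler_pM => //; exact: cabs_distB.
exact: dist_half t1 hj2.
Qed.

End LocallyUniformLimit.

Theorem theorem2 (R : realType)
  (fm : nat -> R[i] -> R[i]) (am : nat -> nat -> R[i])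
  (f : R[i] -> R[i]) (alpham : nat -> R) (alpha : R) :
  (forall m : nat, schlicht_coeffs (fm m) (am m)) ->
  in_S f ->
  loc_unif_cvg fm f ->
  (forall m : nat, hayman_index (fm m) (alpham m)) ->
  hayman_index f alpha ->
  0 < alpha ->
  full_mapping (fun z : R[i] => (f z^-1)^-1) ->
  alpham @ \oo --> alpha ->
  forall e : R, 0 < e ->
    exists N : nat, forall m n : nat, (N < m)%N -> (N < n)%N ->
      `| cabs (am m n) / n%:R - alpham m | < e.
Proof.
move=> hm [a hf] cv haym hay a0 full ca e e0; apply: contrapT => hn.
(* A failure for N is recorded together with a direction of maximal growth of the offending
   function, so that the directions can be made to converge. *)
pose Q N s := exists p : nat * nat, [/\ (N < p.1)%N, (N < p.2)%N, e <= `|cabs (am p.1 p.2) / p.2%:R - alpham p.1| &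
  forall r, 0 < r < 1 -> alpham p.1 <= tau (am p.1) s r].
have [|s0 [nn [ss [s01 hs cs]]]] := @circle_subsequence R Q.
  move=> N; apply: contrapT => h; apply: hn; exists N => m n Nm Nn; rewrite ltNge; apply/negP => he.
  have [s s1 ds] := hayman_direction (hm m) (haym m).
  by apply: h; exists N, s; split => //; exists (m, n).
have [g hg] := choice (fun j => let: And3 _ _ h := hs j in h).
pose mm j := (g j).1; pose n' j := (g j).2.
have ss1 j : cabs (ss j) = 1 by have [] := hs j.
have hnn j : (j <= nn j)%N by have [] := hs j.
have hmm j : (j <= mm j)%N by have [h _ _ _] := hg j; apply: leq_trans (hnn j) (ltnW h).
have hn' j : (j < n' j)%N by have [_ h _ _] := hg j; apply: leq_ltn_trans (hnn j) h.
have bad j : e <= `|cabs (am (mm j) (n' j)) / (n' j)%:R - alpham (mm j)| by have [] := hg j.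
have dir j r : 0 < r < 1 -> alpham (mm j) <= tau (am (mm j)) (ss j) r by have [_ _ _] := hg j; apply.
have caj : (fun j => alpham (mm j)) @ \oo --> alpha := rcvg_comp hmm ca.
have tcv r : 0 < r < 1 -> (fun j => tau (am (mm j)) (ss j) r) @ \oo --> tau a s0 r.
  exact: tau_cvg hm hf cv _ _ _ _ hmm ss1 s01 cs.
(* The lower bounds pass to the limit at each fixed radius, so [s0] is a direction of maximal growth
   of [f]. *)
have dir0 r : 0 < r < 1 -> alpha <= tau a s0 r.
  move=> r01; rewrite -subr_ge0; apply: (rcvg_ge (rcvgB (tcv r r01) caj)).
  by exists 0%N => j _; rewrite subr_ge0 dir.
have e4 : 0 < e / 4 by rewrite divr_gt0.
(* For large j the indexes are at least alpha / 2, which gives one energy bound common to all the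
   functions involved. *)
have [th th0 hth] := abel_coef_uniform (- 2 * ln (alpha / 2)) e4.
pose eta := th ^+ 2; have eta0 : 0 < eta by rewrite exprn_gt0.
(* Since [phi] is tau^(-2), the factor exp (eta / 8) costs exactly eta / 4 in ln [phi]. *)
have [r0 r001 hr0] : exists2 r, 0 < r < 1 & tau a s0 r <= alpha * expR (eta / 8).
  have ep : 0 < alpha * expR (eta / 8) - alpha.
    by rewrite -{2}[alpha]mulr1 -mulrBr mulr_gt0 // subr_gt0 -expR0 ltr_expR divr_gt0.
  have [r r01 hr] := hayman_upper hf hay ep; exists r => //.
  by apply: le_trans (hr _ s01) _; rewrite addrC subrK.
have X0 : 0 < alpha * expR (eta / 8) by rewrite mulr_gt0 // expR_gt0.
have lnphi : - 2 * ln alpha - eta / 4 <= ln (phi (recip a) s0 r0).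
  have t0 := tau_gt0 hf s01 r001.
  rewrite (phi_tau hf s01 r001) lnV ?posrE ?exprn_gt0 // lnXn //.
  have : ln (tau a s0 r0) <= ln (alpha * expR (eta / 8)) by rewrite ler_ln ?posrE.
  rewrite lnM ?posrE ?expR_gt0 // expRK -mulr_natl.
  by move: (ln (tau _ _ _)) (ln alpha) => x y; lra.
have eta4 : 0 < eta / 4 by rewrite divr_gt0.
have [K hK] := full_energy (unit_radius_recip hf) (unit_radius_tl hf) (recip0 a) (conv_recip hf) (recip_inj hf) s01
  (phi_direction hf s01 a0 dir0) (omitted_small hf full) r001 eta4.
have [N0 hN0] := hth K.
have tlcv n : (fun j => tl (am (mm j)) n) @ \oo --> tl a n by exact: coef_cvg hm hf cv _ _ hmm.
have ecv : (fun j => \sum_(k < K) k.+1%:R * cabs (ck (recip (am (mm j))) (ss j) k) ^+ 2) @ \oo -->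
    \sum_(k < K) k.+1%:R * cabs (ck (recip a) s0 k) ^+ 2.
  apply: (@rcvg_sum R K (fun k j => k.+1%:R * cabs (ck (recip (am (mm j))) (ss j) k) ^+ 2)
    (fun k => k.+1%:R * cabs (ck (recip a) s0 k) ^+ 2)) => k.
  exact: rcvgMl _ (rcvg_sqr_cabs (@ck_cvg R (fun j => tl (am (mm j))) (tl a) ss s0 k tlcv cs)).
have lcv := rcvg_ln a0 caj.
have eta8 : 0 < eta / 8 by rewrite divr_gt0.
have [N1 hN1] := (rcvgP _ _).1 ecv _ eta4.
have [N2 hN2] := (rcvgP _ _).1 lcv _ eta8.
have al2 : 0 < alpha / 2 by rewrite divr_gt0.
have [N3 hN3] := (rcvgP _ _).1 caj _ al2.
have e8 : 0 < e / 8 by rewrite divr_gt0.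
have e16 : 0 < e / 16 by rewrite divr_gt0.
have [r1 r101 hr1] := hayman_upper hf hay e8.
have [N4 hN4] := (rcvgP _ _).1 (tcv r1 r101) _ e16.
have [N5 hN5] := (rcvgP _ _).1 caj _ e16.
have g1 : 0 < 1 - r1 by case/andP: r101 => _; lra.
have [N6 hN6] := (rcvgP _ _).1 (@cvg_rho R) _ g1.
(* The shift by 2 is due to the coefficient estimate, which at n concerns a_(n+2); [.+3] keeps the
   truncated subtraction honest and n positive. *)
pose j := (N0 + N1 + N2 + N3 + N4 + N5 + N6).+3; pose n := (n' j).-2.
have jn := hn' j; have nE : n' j = n.+2 by rewrite /n; move: jn; rewrite /j; clear; case: (n' _) => [|[|k]] //; lia.
have aj0 : alpha / 2 <= alpham (mm j).
  by apply/half_le_of_close/hN3; rewrite /j; clear; lia.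
have ajp : 0 < alpham (mm j) by exact: lt_le_trans al2 aj0.
have nN0 : (N0 <= n)%N by move: jn; rewrite /n /j; clear; lia.
have nN6 : (N6 <= n)%N by move: jn; rewrite /n /j; clear; lia.
have n0 : (0 < n)%N by move: jn; rewrite /n /j; clear; lia.
have djd := dir j.
pose d k := ck (recip (am (mm j))) (ss j) k * ss j ^+ k.+1.
have hd := unit_radius_twisted (hm (mm j)) (ss1 j) ajp djd.
have hE M : \sum_(k < M) k.+1%:R * cabs (d k) ^+ 2 <= - 2 * ln (alpha / 2).
  apply: le_trans (twisted_energy (hm (mm j)) (ss1 j) ajp djd M) _.
  by rewrite !mulNr lerN2 ler_pM2l // ler_ln ?posrE.
have hng := twisted_neg (hm (mm j)) (ss1 j) ajp djd.
(* The first K indices carry nearly all the energy of the limit, hence of the approximating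
   function, whose total bound is nearly the same; nothing is left for high indices. *)
have htail : forall M, \sum_(k < M) (K + k).+1%:R * cabs (d (K + k)%N) ^+ 2 <= eta.
  apply: (twisted_tail (hm (mm j)) (ss1 j) ajp djd).
  have j1 : (N1 <= j)%N by rewrite /j; clear; lia.
  have j2 : (N2 <= j)%N by rewrite /j; clear; lia.
  exact: energy_budget hK lnphi (hN2 j j2) (hN1 j j1).
have near := hN0 d hd hE hng htail n nN0.
have rn01 : 0 < rho R n < 1.
  by have /andP[_ ->] := rho01 R n; rewrite andbT /rho subr_gt0 invf_lt1 ?ltr0n // ltr1n.
rewrite (cabs_twisted (hm (mm j)) (ss1 j)) (psum_twisted (hm (mm j)) (ss1 j) rn01) -nE -/(tau (am (mm j)) (ss j) (rho R n)) in near.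
have lo := djd _ rn01.
(* Monotonicity replaces the moving radius by the fixed r1, where [tau] converges; the lower bound
   comes from the direction of maximal growth. *)
have up : tau (am (mm j)) (ss j) (rho R n) <= tau (am (mm j)) (ss j) r1.
  apply: (tau_nonincreasing (hm (mm j)) (ss1 j)); [by case/andP: r101| |by case/andP: rn01].
  by have := hN6 n nN6; rewrite ltr_norml => /andP[]; rewrite opprB ltrD2r => /ltW.
have j4 : (N4 <= j)%N by rewrite /j; clear; lia.
have j5 : (N5 <= j)%N by rewrite /j; clear; lia.
have := bad j; rewrite leNgt => /negP; apply.
exact: (close_of_sandwich e0 lo up (hr1 _ s01) (hN5 j j5) (hN4 j j4) near).
Qed.
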